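(* Suppose that the finitely Ruelle-expanding semigroup $\mathcal S$ generated by $\{T_i\}_{i\in\mathcal W}$ is jointly topologically mixing and finitely aperiodic, and that every potential $\varphi_i$, $i\in\mathcal W$, is $\alpha$-Hölder and summable. Let $\omega\in\Sigma$ and $f\in\mathcal H_\alpha$. For $n\ge0$ let $f_n=f-\int f\circ T_{[\omega]_n}\,d\mu_\omega$, for $n\ge1$ let $s_n^2=\mathbb E_{\mu_\omega}\big(\sum_{k=0}^{n-1}f_k\circ T_{[\omega]_k}\big)^2$, and assume that $\sum_n s_n^{-4}<\infty$. Then, enlarging the probability space $(X,\mu_\omega)$ if necessary, there exists a sequence $(Z_n)_{n\ge0}$ of independent centred Gaussian random variables such that $$\sup_n\Big|\sqrt{\textstyle\sum_{k=0}^{n-1}\mathbb E_{\mu_\omega}Z_k^2}-s_n\Big|<\infty$$ and $$\sup_{0\le k\le n-1}\Big|\sum_{i=0}^k f_i\circ T_{[\omega]_i}-\sum_{i=0}^kZ_i\Big|=o\Big(\sqrt{s_n^2\log\log s_n^2}\Big)\quad\text{almost surely as } n\to\infty.$$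
   Context: Setting. $(X,d)$ is a complete separable metric space, $\mathcal W$ a finite alphabet, and for each $i\in\mathcal W$, $T_i:X\to X$ is continuous and surjective. For a finite word $v=i_1\cdots i_n$ put $|v|=n$ and $T_v=T_{i_n}\circ\cdots\circ T_{i_1}$ (with $T_\emptyset=\mathrm{id}$). $\mathcal S$ is the semigroup generated by $\{T_i\}$. Let $d_v(x,y)=\max\{d(x,y),\,d(T_{i_1\cdots i_j}(x),T_{i_1\cdots i_j}(y)):1\le j<n\}$. A map $T$ is $(a,\lambda)$-Ruelle-expanding ($a>0$, $\lambda\in(0,1)$) if for all $x,y,\tilde x\in X$ with $d(x,y)<a$ and $T(\tilde x)=x$ there is a unique $\tilde y\in X$ with $T(\tilde y)=y$ and $d(\tilde x,\tilde y)<a$, and this $\tilde y$ satisfies $d(\tilde x,\tilde y)\le\lambda d(x,y)$. It is finitely expanding if moreover $\sup\{d(T(x),T(y))/d(x,y):0<d(x,y)<a\}<\infty$. $\mathcal S$ is finitely Ruelle-expanding if, for common $a,\lambda$, every $T_i$ is $(a,\lambda)$-Ruelle-expanding and finitely expanding. $\mathcal S$ is jointly topologically mixing if for all nonempty open $U,V\subset X$ there is $m\in\mathbb N$ with $T_w^{-1}(U)\cap V\ne\emptyset$ for all finite words $w$ with $|w|\ge m$. $\mathcal S$ is finitely aperiodic if there are $n\in\mathbb N$, a finite set $K\subset X$ and $r>0$ such that for all $x\in X$ and $w\in\mathcal W^n$ there are $\xi,\eta\in K$ with: (i) there is $\xi^*\in T_w^{-1}(\xi)$ with $d_w(x,\xi^*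 )<a$; (ii) there is $x^*\in T_w^{-1}(x)$ with $d(x^*,\eta)<a$ and $d_w(x^*,\eta)<r$. Potentials and operators. Fix $\alpha\in(0,1]$, $D_\alpha(f)=\sup_{x\ne y}|f(x)-f(y)|/d(x,y)^\alpha$, and $\mathcal H_\alpha$ the space of bounded $f:X\to\mathbb R$ with $D_\alpha(f)<\infty$. Potentials are functions $\varphi_i:X\to\mathbb R$; $\varphi_i$ is $\alpha$-Hölder if $D_\alpha(\varphi_i)<\infty$. For $v=i_1\cdots i_n$, $\varphi_v=\varphi_{i_1}+\varphi_{i_2}\circ T_{i_1}+\cdots+\varphi_{i_n}\circ T_{i_1\cdots i_{n-1}}$ and $L_v(f)(x)=\sum_{T_v(y)=x}e^{\varphi_v(y)}f(y)$. $\varphi_i$ is summable if $\|L_i(\mathbf 1)\|_\infty<\infty$. $\Sigma=\mathcal W^{\mathbb N}$ is the set of infinite words and $[\omega]_n$ is the initial word of length $n$ of $\omega\in\Sigma$ ($[\omega]_0=\emptyset$). For $\omega\in\Sigma$, $\mu_\omega$ is the Borel probability measure on $X$ with $\int f\,d\mu_\omega=\lim_{l\to\infty}\int \frac{L_{[\omega]_l}(f)}{L_{[\omega]_l}(\mathbf 1)}\,d\nu$ for $f\in\mathcal H_\alpha$; under the hypotheses of the claim this limit exists and does not depend on the probability measure $\nu$. *)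

(* Defs.v *)
From HB Require Import structures.
From mathcomp Require Import all_boot all_order all_algebra finmap.
From mathcomp Require Import all_classical all_reals all_analysis.
Import Order.TTheory GRing.Theory Num.Theory.
Import numFieldNormedType.Exports.

Set Implicit Arguments.
Unset Strict Implicit.
Unset Printing Implicit Defensive.

Local Open Scope classical_set_scope.
Local Open Scope ring_scope.

(* Completeness is convergence of Cauchy filters, and the library's complete
   types carry a base point, so the space is nonempty. *)
#[short(type="completeMetricType")]
HB.structure Definition CompleteMetric (K : numDomainType) :=
  { M of Metric K M & Complete M }.

Definition separable_space (X : topologicalType) : Prop :=
  exists D : set X, countable D /\ dense D.

Definition borel (X : ptopologicalType) := g_sigma_algebraType (@open X).

Section semigroup.
Context {R : realType} {X : completeMetricType R} {W : finType}.
Implicit Types (T : W -> X -> X) (v w : seq W) (x y : X) (a lam r : R).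

(* The first letter of the word acts first. *)
Definition Tword T v x : X := foldl (fun z i => T i z) x v.

Definition dword T v x y : R :=
  \big[Num.max/mdist x y]_(1 <= j < size v)
    mdist (Tword T (take j v) x) (Tword T (take j v) y).

Definition ruelle_expanding a lam (S : X -> X) : Prop :=
  [/\ 0 < a, 0 < lam < 1 &
    forall x y x', mdist x y < a -> S x' = x ->
      exists y', unique (fun z => S z = y /\ mdist x' z < a) y' /\
        mdist x' y' <= lam * mdist x y].

Definition finitely_expanding a (S : X -> X) : Prop :=
  has_ubound [set q | exists x y,
    0 < mdist x y < a /\ q = mdist (S x) (S y) / mdist x y].

Definition finitely_ruelle_expanding a lam T : Prop :=
  forall i, ruelle_expanding a lam (T i) /\ finitely_expanding a (T i).

Definition jointly_mixing T : Prop :=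
  forall U V : set X, open U -> open V -> U !=set0 -> V !=set0 ->
  exists m : nat, forall w, (m <= size w)%N ->
    (Tword T w @^-1` U) `&` V !=set0.

(* [a] is the radius of the expanding condition. *)
Definition finitely_aperiodic a T : Prop :=
  exists (n : nat) (K : set X) (r : R), finite_set K /\ 0 < r /\
  forall x (w : n.-tuple W), exists xi eta, K xi /\ K eta /\
    (exists xi', Tword T w xi' = xi /\ dword T w x xi' < a) /\
    (exists x', [/\ Tword T w x' = x, mdist x' eta < a &
                    dword T w x' eta < r]).

(* In the extended reals, so that an infinite supremum is not collapsed. *)
Definition holder_seminorm (alpha : R) (f : X -> R) : \bar R :=
  ereal_sup [set q | exists x y, x <> y /\
    q = (`|f x - f y| / mdist x y `^ alpha)%:E].

Definition holder (alpha : R) (f : X -> R) : Prop :=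
  (holder_seminorm alpha f < +oo)%E.

Definition holder_space (alpha : R) : set (X -> R) :=
  [set f | bounded_fun f /\ holder alpha f].

Definition potential_word T (phi : W -> X -> R) v x : R :=
  \sum_(j < size v) phi (tnth (in_tuple v) j) (Tword T (take j v) x).

(* The sum over the fibre is unconditional: positive part minus negative part,
   with values in the extended reals. *)
Definition transfer T (phi : W -> X -> R) v (f : X -> R) x : \bar R :=
  let g y := (expR (potential_word T phi v y) * f y)%:E in
  (esum (Tword T v @^-1` [set x]) g^\+ -
   esum (Tword T v @^-1` [set x]) g^\-)%E.

Definition summable_potential T (phi : W -> X -> R) (i : W) : Prop :=
  (ereal_sup (range (fun x => `|transfer T phi [:: i] (cst 1%R) x|)) < +oo)%E.

Definition prefix_word (omega : nat -> W) (n : nat) : seq W := mkseq omega n.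

(* The bounded Hoelder functions determine a Borel probability measure, so at
   most one [mu] satisfies this. *)
Definition is_limit_measure (alpha : R) T (phi : W -> X -> R)
    (omega : nat -> W) (mu : probability (borel X) R) : Prop :=
  forall (nu : probability (borel X) R) (f : X -> R), holder_space alpha f ->
    (fun l => \int[nu]_x (fine (transfer T phi (prefix_word omega l) f x) /
                          fine (transfer T phi (prefix_word omega l) (cst 1) x)))
      @ \oo --> \int[mu]_x f x.

Definition centred T (omega : nat -> W) (mu : probability (borel X) R)
    (f : X -> R) (n : nat) x : R :=
  f x - \int[mu]_z f (Tword T (prefix_word omega n) z).

Definition centred_sum T (omega : nat -> W) (mu : probability (borel X) R)
    (f : X -> R) (n : nat) x : R :=
  \sum_(k < n) centred T omega mu f k (Tword T (prefix_word omega k) x).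

Definition std_dev T (omega : nat -> W) (mu : probability (borel X) R)
    (f : X -> R) (n : nat) : R :=
  Num.sqrt (fine ('E_mu[fun x => centred_sum T omega mu f n x ^+ 2])).

End semigroup.

Section gaussian.
Context {R : realType} {d : measure_display} {Y : measurableType d}.

(* [normal_prob 0 0] is a junk value; the degenerate Gaussian is a Dirac mass. *)
Definition centred_gaussian (P : probability Y R) (Z : {RV P >-> R}) : Prop :=
  exists2 sigma : R, 0 <= sigma & forall A : set R, measurable A ->
    distribution P Z A = if sigma == 0 then \d_(0 : R) A else normal_prob 0 sigma A.

Definition independent (P : probability Y R) (Z : nat -> {RV P >-> R}) : Prop :=
  forall (J : {fset nat}) (A : nat -> set R), (forall j, measurable (A j)) ->
    (P (\bigcap_(j in [set` J]) (Z j @^-1` A j)) =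
     \prod_(j <- J) P (Z j @^-1` A j))%E.

End gaussian.

Arguments centred_gaussian {R d Y} P Z.
Arguments independent {R d Y} P Z.

(* Main.v *)
(** Reversing time turns the transfer operators into a Markov chain: normalized by
    the densities [L_w 1], they are conditional expectations onto the future
    coordinates, and they contract a two-scale seminorm (small oscillation, local
    Hoelder constant) uniformly in the word.  Hence [f_k] splits into a bounded
    reverse martingale difference plus a bounded coboundary, and the sum of the
    conditional variances over [l] steps fluctuates by [O(sqrt l)].

    The time axis is cut into blocks along which the variance [A] grows by the
    factor [1 + 1/c], where [c] tends to infinity so slowly that [c ^ 7 / A ^ 2]
    stays summable.  Given the future, the martingale sum over one block has a
    distribution function close to the Gaussian one (Lindeberg replacement with
    the heat kernel, after truncating the conditional variance).  A grid of mesh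
    [o(sqrt A)] partitions both laws into cells of matching conditional mass, and
    rejection sampling inside the cell of the observed block sum yields exact
    Gaussian blocks that are independent of one another.  Exponential maximal
    inequalities control the partial sums within a block, Borel-Cantelli discards
    the bad blocks, and the mesh errors add up to [o(sqrt (A ln ln A))]. *)

Require Import Defs.
From HB Require Import structures.
From mathcomp Require Import all_boot all_order all_algebra finmap.
From mathcomp Require Import all_classical all_reals all_analysis.
From mathcomp Require Import measurable_realfun ring lra zify.
Import Order.TTheory GRing.Theory Num.Theory.
Import numFieldNormedType.Exports.

Set Implicit Arguments.
Unset Strict Implicit.
Unset Printing Implicit Defensive.

Local Open Scope classical_set_scope.
Local Open Scope ring_scope.

(** * Expanding semigroups *)

(** The sigma-algebras generated by the future shrink and the maps change with the letter, so
    everything is conditioned on the state at the end of a block, and exact independence of the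
    Gaussians has to survive this. It does because the cell into which a Gaussian is forced has,
    given the future, exactly the probability of the observed cell: averaged over the block, the
    accepted sample has its unconditional law whatever the future is. The exponent 7 is the price of
    a block of [l] steps. There are about [c] cells. The conditional variance must be known up to
    [del * v], with [del] of order [c ^- 2] and [v] at least [A / c], so Chebyshev's inequality
    costs [l / (del * v) ^ 2], at most of order [c ^ 6 * l / A ^ 2], for each cell. Summed over the
    blocks, [l / A ^ 2] is comparable with the sum of [A_n ^- 2], hence with that of [s_n ^- 4], and
    the Abel-Dini theorem leaves room for a factor tending to infinity. The mesh, about
    [sqrt v / c], is small against the growth of [sqrt A] over a block, which is why its errors may
    accumulate. *)

Section words.
Context {R : realType} {X : completeMetricType R} {W : finType}.
Implicit Types (T : W -> X -> X) (v w : seq W) (x y : X).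

Lemma Tword_cat T v w x : Tword T (v ++ w) x = Tword T w (Tword T v x).
Proof. by rewrite /Tword foldl_cat. Qed.

Lemma Tword_rcons T v i x : Tword T (rcons v i) x = T i (Tword T v x).
Proof. by rewrite -cats1 Tword_cat. Qed.

Lemma Tword_surj T : (forall i y, exists x, T i x = y) ->
  forall v y, exists x, Tword T v x = y.
Proof.
move=> hs; elim=> [|i v IH] y; first by exists y.
by have [z <-] := IH y; have [x <-] := hs i z; exists x.
Qed.

Lemma dword_ge T v x y : mdist x y <= dword T v x y.
Proof. exact: bigmax_ge_id. Qed.

Lemma dword_take T v x y j : (1 <= j < size v)%N ->
  mdist (Tword T (take j v) x) (Tword T (take j v) y) <= dword T v x y.
Proof.
move=> jv; rewrite /dword.
apply: (le_bigmax_seq _ _ predT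
  (fun k => mdist (Tword T (take k v) x) (Tword T (take k v) y))) => //.
by rewrite mem_index_iota.
Qed.

Lemma dword_take0 T v x y j : (j < size v)%N ->
  mdist (Tword T (take j v) x) (Tword T (take j v) y) <= dword T v x y.
Proof.
case: j => [_|j jv]; last exact: dword_take.
by rewrite take0; exact: dword_ge.
Qed.

End words.

(** * Lifting points along words, and boundedness of the space *)

Section expanding.
Context {R : realType} {X : completeMetricType R} {W : finType}.
Variables (T : W -> X -> X) (a lam : R).
Hypothesis hexp : finitely_ruelle_expanding a lam T.
Hypothesis hsurj : forall i y, exists x, T i x = y.
Variable i0 : W.
Implicit Types (i : W) (x y z : X) (v w : seq W).

Lemma expanding_radius_gt0 : 0 < a.
Proof. by have [[]] := hexp i0. Qed.

Lemma expanding_rate : 0 < lam < 1.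
Proof. by have [[]] := hexp i0. Qed.

Let a0 := expanding_radius_gt0.
Let lam0 : 0 < lam. Proof. by have /andP[] := expanding_rate. Qed.
Let lam1 : lam < 1. Proof. by have /andP[] := expanding_rate. Qed.

Lemma lift_point i x' y : mdist (T i x') y < a ->
  exists2 y', T i y' = y & mdist x' y' <= lam * mdist (T i x') y.
Proof.
move=> xya; have [[_ _ H] _] := hexp i.
have [y' [[[Ty' _] _] d]] := H _ _ x' xya erefl.
by exists y'.
Qed.

Lemma lift_unique i x' y1 y2 : T i y1 = T i y2 -> mdist (T i x') (T i y1) < a ->
  mdist x' y1 < a -> mdist x' y2 < a -> y1 = y2.
Proof.
move=> e xya d1 d2; have [[_ _ H] _] := hexp i.
have [y' [[_ u] _]] := H _ _ x' xya erefl.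
by rewrite -(u y1)// -(u y2)//.
Qed.

Lemma lam_dist_lt r : 0 <= r -> r < a -> lam * r < a.
Proof.
move=> r0 ra; apply: le_lt_trans ra.
by rewrite ler_piMl// ltW.
Qed.

Lemma lift_word v p x : mdist (Tword T v p) x < a ->
  exists2 x', Tword T v x' = x &
    mdist p x' <= lam ^+ size v * mdist (Tword T v p) x.
Proof.
elim/last_ind: v x => [|v i IH] x.
  by rewrite /= => d; exists x => //; rewrite expr0 mul1r.
rewrite Tword_rcons => d.
have [y' Ty' dy] := lift_point d.
have [|x' Tx' dx] := IH y'.
  exact: le_lt_trans dy (lam_dist_lt (mdist_ge0 _ _) d).
exists x'; first by rewrite Tword_rcons Tx'.
rewrite size_rcons exprSr; apply: (le_trans dx).
by rewrite -mulrA ler_wpM2l// exprn_ge0// ltW.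
Qed.

Lemma locally_lipschitz : exists2 Qm, 1 <= Qm &
  forall i x y, mdist x y < a -> mdist (T i x) (T i y) <= Qm * mdist x y.
Proof.
have /choice[q hq] : forall i, exists q : R,
    forall x y, mdist x y < a -> mdist (T i x) (T i y) <= q * mdist x y.
  move=> i; have [_ [q hq]] := hexp i.
  exists q => x y xya.
  have [->|xy] := eqVneq x y; first by rewrite !mdistxx mulr0.
  have d0 : 0 < mdist x y by rewrite mdist_gt0.
  rewrite -ler_pdivrMr//; apply: hq; exists x, y; split => //.
  by rewrite d0.
exists (\big[Num.max/1]_i (q i)); first exact: bigmax_ge_id.
move=> i x y xya; apply: (le_trans (hq i x y xya)).
by rewrite ler_wpM2r ?mdist_ge0//; exact: le_bigmax.
Qed.

(** Every point is some [T_w x], and clause (i) of finite aperiodicity follows its orbit to a point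
    of the finite set [K]. Since [dword] stops before the last letter, one application of the
    Lipschitz bound is needed at the end. *)
Lemma bounded_space : finitely_aperiodic a T ->
  exists2 Dm, 1 <= Dm & forall x y : X, mdist x y <= Dm.
Proof.
move=> [n [K [r [Kfin [r0 H]]]]].
have [Qm Qm1 HQ] := locally_lipschitz.
have Qm0 : 0 <= Qm by rewrite (le_trans _ Qm1).
pose w : n.-tuple W := nseq_tuple n i0.
have near_K z : exists2 xi, K xi & mdist z xi <= Qm * a.
  have [x xz] := Tword_surj hsurj w z.
  have [xi [eta [Kxi [Keta [[xi' [Txi' dx]] _]]]]] := H x w.
  exists xi => //.
  (* The empty word has no last letter to peel off; there [1 <= Qm] makes the same bound hold. *)
  have: size w = n by rewrite size_tuple.
  move: xz Txi' dx; case: (n) w => [|m] w xz Txi' dx sw.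
    move: xz Txi'; rewrite (size0nil sw) /Tword/= => <- <-.
    apply: (le_trans (dword_ge T w _ _)).
    by apply: (le_trans (ltW dx)); rewrite ler_peMl// ltW.
  have sw' : (m < size w)%N by rewrite sw.
  have E u : Tword T w u = T (nth i0 w m) (Tword T (take m w) u).
    by rewrite -Tword_rcons -take_nth// take_oversize// sw.
  rewrite -xz -Txi' !E.
  have da : mdist (Tword T (take m w) x) (Tword T (take m w) xi') < a.
    exact: le_lt_trans (dword_take0 _ _ _ sw') dx.
  by apply: (le_trans (HQ _ _ _ da)); rewrite ler_wpM2l// ltW.
have [s Ks] : exists s : seq X, K = [set` s] by exact/finite_seqP.
pose D0 := \big[Num.max/1]_(p <- [seq (k, l) | k <- s, l <- s]) mdist p.1 p.2.
exists (1 + (Qm * a + D0 + Qm * a)).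
  by rewrite lerDl !addr_ge0// ?mulr_ge0// ?(ltW a0)// (le_trans ler01)// bigmax_ge_id.
move=> x y; have [k Kk xk] := near_K x; have [l Kl yl] := near_K y.
have kl : mdist k l <= D0.
  apply: (le_bigmax_seq _ (k, l) predT (fun p => mdist p.1 p.2)) => //.
  by apply/allpairsP; exists (k, l); move: Kk Kl; rewrite Ks.
have := metric_triangle x k y; have := metric_triangle k l y.
rewrite (metric_sym l y); lra.
Qed.

End expanding.

Lemma geometric_small {R : realType} (q c eps : R) : 0 <= q < 1 -> 0 < eps ->
  exists m, forall n, (m <= n)%N -> q ^+ n * c < eps.
Proof.
move=> /andP[q0 q1] e0.
have cv : (fun n => q ^+ n * c) @ \oo --> (0 : R).
  rewrite -(mul0r c); apply: cvgM; last exact: cvg_cst.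
  by apply: cvg_expr; rewrite ger0_norm.
have /cvgr0Pnorm_lt/(_ _ e0)[m _ H] := cv.
exists m => n mn; have := H n mn => /=.
by apply: le_lt_trans; exact: ler_norm.
Qed.

Section exactness.
Context {R : realType} {X : completeMetricType R} {W : finType}.
Variables (T : W -> X -> X) (a lam : R).
Hypothesis hexp : finitely_ruelle_expanding a lam T.
Hypothesis hsurj : forall i y, exists x, T i x = y.
Hypothesis hmix : jointly_mixing T.
Hypothesis hap : finitely_aperiodic a T.
Variable i0 : W.

Let a0 : 0 < a := expanding_radius_gt0 hexp i0.
Let lam01 : 0 < lam < 1 := expanding_rate hexp i0.

(** Cut [w] into [w1], one letter [i] and [n] final letters. Aperiodicity pulls [x] back through the
    final letters to within [a] of some [eta] in [K]; an inverse branch of [T i] brings it close to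
    [pre i eta]; mixing supplies [p] near [z] whose image under [w1] is close to the same point;
    lifting along [w1] contracts towards [p]. Uniformity in [w] and [x] holds because [W] and [K]
    are finite, so that only finitely many targets [pre i eta] occur. *)
Lemma exactness (z : X) (eps : R) : 0 < eps ->
  exists N, forall w, (N <= size w)%N ->
    forall x, exists2 x', Tword T w x' = x & mdist z x' < eps.
Proof.
move=> e0; have /andP[lam0 lam1] := lam01.
have [n [K [r [Kfin [r0 H]]]]] := hap.
have [s Ks] : exists s : seq X, K = [set` s] by exact/finite_seqP.
have /choice[pre Hpre] : forall i : W, exists g : X -> X, forall y, T i (g y) = y.
  by move=> i; have [g Hg] := choice (hsurj i); exists g.
(* The inverse branch of [T i] turns a distance below [a] into one of at most [lam * a]; the rest of
   the radius, [(1 - lam) * a], is left for the mixing error. *)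
have la0 : 0 < (1 - lam) * a by rewrite mulr_gt0// subr_gt0.
have e20 : 0 < eps / 2 by rewrite divr_gt0.
have /choice[m Hm] : forall ik : W * X, exists m : nat, forall w, (m <= size w)%N ->
    exists2 p, mdist z p < eps / 2 &
      mdist (pre ik.1 ik.2) (Tword T w p) < (1 - lam) * a.
  move=> [i k].
  have [||||m hm] := hmix (U := (ball (pre i k) ((1 - lam) * a))^°)
      (V := (ball z (eps / 2))^°).
  - exact: open_interior.
  - exact: open_interior.
  - by exists (pre i k); exact: (nbhsx_ballx (pre i k) _ la0).
  - by exists z; exact: (nbhsx_ballx z _ e20).
  exists m => w mw.
  have [p [/= /interior_subset + /interior_subset]] := hm w mw.
  by rewrite !ballEmdist/= => h1 h2; exists p.
pose M := (\max_(i : W) \max_(k <- s) m (i, k))%N.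
have [m1 Hm1] : exists m, forall l, (m <= l)%N -> lam ^+ l * a < eps / 2.
  by apply: geometric_small => //; rewrite (ltW lam0).
exists (M + m1 + n.+1)%N => w Nw x.
pose l := (size w - n.+1)%N.
have lM : (M + m1 <= l)%N by rewrite /l; lia.
have lw : (l < size w)%N by rewrite /l; lia.
pose w1 := take l w; pose i := nth i0 w l.
have sw3 : size (drop l.+1 w) == n by rewrite size_drop /l; apply/eqP; lia.
pose w3 : n.-tuple W := Tuple sw3.
have wE : w = rcons w1 i ++ w3 by rewrite -take_nth// cat_take_drop.
have sw1 : size w1 = l by rewrite size_take lw.
have [xi [eta [Kxi [Keta [_ [xs [Txs dxs _]]]]]]] := H x w3.
have d1 : mdist (T i (pre i eta)) xs < a by rewrite Hpre metric_sym.
have [y' Ty' dy'] := lift_point hexp d1.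
have hmi : (m (i, eta) <= size w1)%N.
  rewrite sw1; apply: leq_trans lM; apply: leq_trans (leq_addr _ _).
  apply: leq_trans (leq_bigmax i).
  apply: (@leq_bigmax_seq _ _ predT (fun k => m (i, k))) => //.
  by move: Keta; rewrite Ks.
have [p zp dp] := Hm (i, eta) w1 hmi.
have d2 : mdist (Tword T w1 p) y' < a.
  apply: le_lt_trans (metric_triangle _ (pre i eta) _) _.
  rewrite metric_sym; move: dp dy' d1; rewrite /= Hpre.
  move=> h1 h2 h3; have : lam * mdist eta xs <= lam * a by rewrite ler_wpM2l// ltW.
  lra.
have [x'' Tx'' dx''] := lift_word hexp i0 d2.
exists x''; first by rewrite wE Tword_cat Tword_rcons Tx'' Ty'.
have : mdist p x'' < eps / 2.
  apply: le_lt_trans dx'' _; rewrite sw1.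
  apply: le_lt_trans (Hm1 l _); last by apply: leq_trans lM; exact: leq_addl.
  by rewrite ler_wpM2l ?exprn_ge0// ltW.
by have := metric_triangle z p x''; lra.
Qed.

End exactness.

Section holder.
Context {R : realType} {X : completeMetricType R}.

Lemma holder_bound (alpha : R) (f : X -> R) : 0 < alpha -> holder alpha f ->
  exists2 H, 0 <= H & forall x y, `|f x - f y| <= H * mdist x y `^ alpha.
Proof.
move=> al0; rewrite /holder /holder_seminorm => fin.
set S := (S in ereal_sup S) in fin.
pose H := Num.max 0 (fine (ereal_sup S)).
exists H; first by rewrite le_max lexx.
move=> x y; have [->|xy] := eqVneq x y.
  by rewrite subrr normr0 mdistxx powR0 ?gt_eqF// mulr0.
have d0 : 0 < mdist x y by rewrite mdist_gt0.
rewrite -ler_pdivrMr ?powR_gt0//.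
have Sxy : S (`|f x - f y| / mdist x y `^ alpha)%:E.
  by exists x, y; split => //; exact/eqP.
have := ereal_sup_ubound Sxy.
rewrite /H; move: fin; case: (ereal_sup S) => [q||]//= _.
by rewrite lee_fin le_max => ->; rewrite orbT.
Qed.

Lemma holder_of_bound (alpha H : R) (f : X -> R) : 0 < alpha ->
  (forall x y, `|f x - f y| <= H * mdist x y `^ alpha) -> holder alpha f.
Proof.
move=> al0 Hf; rewrite /holder /holder_seminorm.
apply: (@le_lt_trans _ _ H%:E); last exact: ltry.
apply: ge_ereal_sup => _ [x [y [xy ->]]].
rewrite lee_fin ler_pdivrMr// powR_gt0// mdist_gt0; exact/eqP.
Qed.

End holder.

(** * Normalized transfer operators *)

(** Empty when the fibre is infinite, a case that [finite_fibres] excludes below. *)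
Definition fib {R : realType} {X : completeMetricType R} {W : finType}
  (T : W -> X -> X) (i : W) (x : X) : seq X := fset_set (T i @^-1` [set x]).

Definition subword {W : finType} (om : nat -> W) (n l : nat) : seq W :=
  mkseq (fun k => om (n + k)%N) l.

Section operators.
Context {R : realType} {X : completeMetricType R} {W : finType}.
Variables (T : W -> X -> X) (a lam : R).
Hypothesis hexp : finitely_ruelle_expanding a lam T.
Hypothesis hsurj : forall i y, exists x, T i x = y.
Hypothesis hmix : jointly_mixing T.
Hypothesis hap : finitely_aperiodic a T.
Variables (alpha : R) (phi : W -> X -> R) (om : nat -> W).
Hypothesis alpha0 : 0 < alpha.
Variables (B Hp : R) (Mf : nat).
Hypothesis phiB : forall i x, `|phi i x| <= B.
Hypothesis phiH : forall i x y, `|phi i x - phi i y| <= Hp * mdist x y `^ alpha.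
Hypothesis finfib : forall i x, finite_set (T i @^-1` [set x]).
Hypothesis cardfib : forall i x, (size (fib T i x) <= Mf)%N.

Let i0 : W := om 0%N.
Let a0 : 0 < a := expanding_radius_gt0 hexp i0.
Let lam01 : 0 < lam < 1 := expanding_rate hexp i0.
Let lam0 : 0 < lam. Proof. by have /andP[] := lam01. Qed.
Let lam1 : lam < 1. Proof. by have /andP[] := lam01. Qed.
Local Notation rr x y := (mdist x y `^ alpha).
Local Notation fibo n x := (fib T (om n) x).

Lemma fib_uniq i x : uniq (fib T i x). Proof. exact: fset_uniq. Qed.

Lemma mem_fib i x y : (y \in fib T i x) = (T i y == x).
Proof.
apply/idP/eqP.
  by rewrite [_ \in _](in_fset_set (finfib i x)) inE.
by move=> e; rewrite [_ \in _](in_fset_set (finfib i x)) inE.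
Qed.

Lemma fib_self i y : y \in fib T i (T i y). Proof. by rewrite mem_fib. Qed.

Lemma B_ge0 : 0 <= B.
Proof. exact: le_trans (normr_ge0 _) (phiB i0 point). Qed.

Lemma Mf_gt0 : (0 < Mf)%N.
Proof.
apply: leq_trans (cardfib i0 (T i0 point)).
by rewrite lt0n size_eq0; apply/eqP => e; have := fib_self i0 point; rewrite e.
Qed.

(** Lifting [y] at each preimage of [x] gives [p]. Lifting back in the other direction shows that
    [p] is onto, and uniqueness of lifts within [a] shows that it is injective, so nearby fibres are
    matched one to one. *)
Lemma pairing i x y : mdist x y < a -> exists2 p : X -> X,
  perm_eq [seq p u | u <- fib T i x] (fib T i y) &
  forall u, u \in fib T i x -> mdist u (p u) <= lam * mdist x y.
Proof.
move=> xya.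
have /choice[p Hp'] : forall u, exists v, u \in fib T i x ->
    T i v = y /\ mdist u v <= lam * mdist x y.
  move=> u; case: (boolP (u \in fib T i x)) => [|_]; last by exists u.
  rewrite mem_fib => /eqP e.
  have [|v Tv dv] := lift_point hexp (i := i) (x' := u) (y := y); first by rewrite e.
  by rewrite e in dv; exists v.
have lda : lam * mdist x y < a by exact: (lam_dist_lt hexp i0 (mdist_ge0 _ _) xya).
exists p; last by move=> u /Hp'[].
apply: uniq_perm; last 2 first.
- exact: fib_uniq.
- move=> v; apply/mapP/idP => [[u ux ->]|].
    by rewrite mem_fib; apply/eqP; case: (Hp' u ux).
  rewrite mem_fib => /eqP e.
  have [|u Tu du] := lift_point hexp (i := i) (x' := v) (y := x).
    by rewrite e metric_sym.
  have ux : u \in fib T i x by rewrite mem_fib; apply/eqP.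
  exists u => //; have [Tp dp] := Hp' u ux.
  apply: (lift_unique hexp (i := i) (x' := u)); rewrite ?e ?Tu ?Tp//.
  - rewrite metric_sym; apply: le_lt_trans du _.
    by rewrite e metric_sym.
  - exact: le_lt_trans dp lda.
- rewrite map_inj_in_uniq ?fib_uniq// => u v ux vx puv.
  have [Tpu dpu] := Hp' u ux; have [Tpv dpv] := Hp' v vx.
  move: ux vx; rewrite !mem_fib => /eqP Tu /eqP Tv.
  apply: (lift_unique hexp (i := i) (x' := p u)); rewrite ?Tu ?Tv ?Tpu//.
  - by rewrite metric_sym.
  - by rewrite metric_sym; exact: le_lt_trans dpu lda.
  - by rewrite puv metric_sym; exact: le_lt_trans dpv lda.
Qed.

Lemma sum_pairing i x y (p : X -> X) (F : X -> R) :
  perm_eq [seq p u | u <- fib T i x] (fib T i y) ->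
  \sum_(v <- fib T i y) F v = \sum_(u <- fib T i x) F (p u).
Proof. by move=> pp; rewrite -(perm_big _ pp) big_map. Qed.

Let la := lam `^ alpha.

Lemma la_gt0 : 0 < la. Proof. exact: powR_gt0. Qed.

Lemma la_lt1 : la < 1.
Proof.
have -> : 1 = 1 `^ alpha :> R by rewrite powR1.
by apply: gt0_ltr_powR; rewrite ?nnegrE ?ler01 ?(ltW lam0).
Qed.

Lemma rr_contract (u v x y : X) : mdist u v <= lam * mdist x y -> rr u v <= la * rr x y.
Proof.
move=> d; rewrite -powRM ?mdist_ge0 ?(ltW lam0)//.
by apply: ge0_ler_powR; rewrite ?nnegrE ?mdist_ge0 ?mulr_ge0 ?mdist_ge0// ltW.
Qed.

Lemma rr_ge0 (x y : X) : 0 <= rr x y. Proof. exact: powR_ge0. Qed.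

Lemma rr_le (x y : X) r : mdist x y <= r -> rr x y <= r `^ alpha.
Proof.
move=> d; apply: ge0_ler_powR; rewrite ?nnegrE ?mdist_ge0 ?(ltW alpha0)//.
exact: le_trans (mdist_ge0 _ _) d.
Qed.

(** The density [L_w 1] for the initial word of length [n], computed letter by letter with the last
    letter outermost. *)
Fixpoint hdens n x : R := if n is m.+1 then
  \sum_(y <- fibo m x) expR (phi (om m) y) * hdens m y else 1.

Lemma hdens_gt0 n x : 0 < hdens n x.
Proof.
elim: n x => [|n IH] x; first exact: ltr01.
have [y Ty] := hsurj (om n) x.
rewrite /= (bigD1_seq y) ?fib_uniq ?mem_fib ?Ty//=.
apply: ltr_wpDr; last by rewrite mulr_gt0 ?expR_gt0.
by apply: sumr_ge0 => z _; rewrite mulr_ge0 ?expR_ge0// ltW.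
Qed.

Hypothesis Hp0 : 0 <= Hp.

(** The fixed point of the recursion [C0 = (Hp + C0) * la] for the distortion exponent ([C0E]), so
    the bound does not deteriorate with the length of the word. *)
Let C0 := Hp * la / (1 - la).

Lemma C0_ge0 : 0 <= C0.
Proof. by rewrite /C0 divr_ge0 ?mulr_ge0 ?subr_ge0 ?(ltW la_gt0) ?(ltW la_lt1). Qed.

Lemma C0E : (Hp + C0) * la = C0.
Proof. by rewrite /C0; field; rewrite gt_eqF// subr_gt0 la_lt1. Qed.

Lemma hdens_distortion n x y : mdist x y < a ->
  hdens n x <= expR (C0 * rr x y) * hdens n y.
Proof.
elim: n x y => [|n IH] x y xya.
  by rewrite /= mulr1 -[leLHS]expR0 ler_expR mulr_ge0 ?C0_ge0 ?rr_ge0.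
have [p pp dp] := pairing (om n) xya.
rewrite /= (sum_pairing _ pp) mulr_sumr big_seq [leRHS]big_seq.
apply: ler_sum => u ux; have dup := dp u ux.
have dua : mdist u (p u) < a.
  apply: le_lt_trans dup _.
  by exact: (lam_dist_lt hexp i0 (mdist_ge0 _ _) xya).
have h1 : expR (phi (om n) u) <= expR (Hp * rr u (p u)) * expR (phi (om n) (p u)).
  rewrite -expRD ler_expR -lerBlDr; apply: le_trans (phiH _ _ _).
  exact: ler_norm.
apply: (@le_trans _ _ ((expR (Hp * rr u (p u)) * expR (phi (om n) (p u))) *
    (expR (C0 * rr u (p u)) * hdens n (p u)))).
  by apply: ler_pM; rewrite ?expR_ge0 ?(ltW (hdens_gt0 _ _))// IH.
rewrite mulrACA -expRD -mulrDl; apply: ler_wpM2r.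
  by rewrite mulr_ge0 ?expR_ge0// ltW// hdens_gt0.
rewrite ler_expR -[in leRHS]C0E -mulrA.
by apply: ler_wpM2l; [rewrite addr_ge0 ?C0_ge0|exact: rr_contract].
Qed.

Let Ca := expR (C0 * a `^ alpha).

Lemma hdens_near n x y : mdist x y < a -> hdens n x <= Ca * hdens n y.
Proof.
move=> xya; apply: (le_trans (hdens_distortion n xya)).
rewrite ler_pM2r ?hdens_gt0// ler_expR ler_wpM2l ?C0_ge0// rr_le//.
exact: ltW.
Qed.

Lemma subwordS n l : subword om n l.+1 = rcons (subword om n l) (om (n + l)%N).
Proof. by rewrite /subword mkseqS. Qed.

Lemma size_subword n l : size (subword om n l) = l.
Proof. exact: size_mkseq. Qed.

Lemma hdens_lower n l x' :
  expR (- B) ^+ l * hdens n x' <= hdens (n + l) (Tword T (subword om n l) x').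
Proof.
elim: l => [|l IH]; first by rewrite addn0 expr0 mul1r.
rewrite subwordS Tword_rcons addnS /=.
set z := Tword _ _ _ in IH *.
rewrite (bigD1_seq z) ?fib_uniq ?fib_self//=.
apply: (@le_trans _ _ (expR (phi (om (n + l)) z) * hdens (n + l) z)); last first.
  rewrite lerDl; apply: sumr_ge0 => v _.
  by rewrite mulr_ge0 ?expR_ge0// ltW// hdens_gt0.
rewrite exprS -mulrA; apply: ler_pM => //; rewrite ?expR_ge0//.
  by rewrite mulr_ge0 ?exprn_ge0 ?expR_ge0// ltW// hdens_gt0.
by rewrite ler_expR; have := phiB (om (n + l)) z; rewrite ler_norml => /andP[].
Qed.

Let U1 := Mf%:R * expR B.

Lemma U1_ge1 : 1 <= U1.
Proof.
rewrite -[1]mulr1; apply: ler_pM => //; first by rewrite ler1n Mf_gt0.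
by rewrite -[leLHS]expR0 ler_expR B_ge0.
Qed.

Lemma hdens_upper n l U : (forall z, hdens n z <= U) ->
  forall x, hdens (n + l) x <= U1 ^+ l * U.
Proof.
move=> hU; elim: l => [|l IH] x; first by rewrite addn0 expr0 mul1r.
rewrite addnS /=; set V := _ ^+ l * U in IH.
have V0 : 0 <= V by exact: le_trans (ltW (hdens_gt0 _ _)) (IH point).
apply: (@le_trans _ _ (\sum_(y <- fibo (n + l) x) expR B * V)).
  apply: ler_sum => y _; apply: ler_pM => //; rewrite ?expR_ge0 ?(ltW (hdens_gt0 _ _))//.
  by rewrite ler_expR; have := phiB (om (n + l)) y; rewrite ler_norml => /andP[].
rewrite big_const_seq count_predT iter_addr_0 -mulr_natl exprS -mulrA -/V /U1 -!mulrA.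
by apply: ler_wpM2r; [rewrite mulr_ge0 ?expR_ge0|rewrite ler_nat cardfib].
Qed.

(** Distortion only compares points closer than [a]. To reach an arbitrary [x] from [z],
    aperiodicity leads from [z] to some [xi] in [K] in [n] letters, and exactness at [xi] leads to
    [x] in [N] more, with [N] uniform since [K] is finite. Each letter costs a factor [expR (- B)],
    each jump a factor [Ca]. *)
Lemma hdens_ratio : exists2 C2, 1 <= C2 & forall n x y, hdens n x <= C2 * hdens n y.
Proof.
have [n [K [r [Kfin [r0 H]]]]] := hap.
have [s Ks] : exists s : seq X, K = [set` s] by exact/finite_seqP.
have /choice[Nx HN] := fun z : X => exactness hexp hsurj hmix hap i0 z a0.
pose N := (\max_(k <- s) Nx k)%N.
pose e := expR (- B).
have e0 : 0 < e by exact: expR_gt0.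
have e1 : e <= 1 by rewrite -[leRHS]expR0 ler_expR oppr_le0 B_ge0.
pose A := Ca * e ^- n * (Ca * e ^- N).
have Ca0 : 0 < Ca by exact: expR_gt0.
have Ca1 : 1 <= Ca by rewrite -[leLHS]expR0 ler_expR mulr_ge0 ?C0_ge0 ?powR_ge0.
have enN k : 0 < e ^- k by rewrite invr_gt0 exprn_gt0.
have en1 k : 1 <= e ^- k by rewrite invf_ge1 ?exprn_gt0// exprn_ile1// ltW.
have A0 : 0 < A by rewrite !mulr_gt0.
have A1 : 1 <= A.
  by rewrite /A -[1]mulr1; apply: ler_pM => //; rewrite -[1]mulr1; apply: ler_pM.
have key m x z : hdens m z <= A * hdens (m + n + N) x.
  have ws : size (subword om m n) == n by rewrite size_subword.
  have [xi [eta [Kxi [_ [[xi' [Txi' dxi']] _]]]]] := H z (Tuple ws).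
  have h1 : hdens m z <= Ca * hdens m xi'.
    by apply: hdens_near; apply: le_lt_trans dxi'; exact: dword_ge.
  have h2 := hdens_lower m n xi'; rewrite [Tword _ _ _]Txi' in h2.
  have [|x'' Tx'' dx''] := HN xi (subword om (m + n) N) _ x.
    rewrite size_subword; apply: (@leq_bigmax_seq _ _ predT (fun k => Nx k)) => //.
    by move: Kxi; rewrite Ks.
  have h3 := hdens_lower (m + n) N x''; rewrite Tx'' in h3.
  have h4 := hdens_near (m + n) dx''.
  apply: (le_trans h1); rewrite /A -2!mulrA ler_pM2l// -ler_pdivrMl//.
  rewrite invrK; apply: (le_trans h2); apply: (le_trans h4).
  rewrite -mulrA ler_pM2l// -ler_pdivrMl// invrK//.
exists (U1 ^+ (n + N) * A).
  by rewrite -[1]mulr1; apply: ler_pM => //; rewrite exprn_ege1// U1_ge1.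
(* Words shorter than [n + N] leave no room for [key]; for them crude upper and lower bounds on the
   density suffice. *)
move=> l x y; have [lnN|nNl] := ltnP l (n + N).
  have hu : hdens l x <= U1 ^+ l.
    by rewrite -[l in hdens l]add0n -[leRHS]mulr1; apply: hdens_upper => z.
  have [y' Ty'] := Tword_surj hsurj (subword om 0 l) y.
  have hl := hdens_lower 0 l y'; rewrite Ty' add0n /= mulr1 in hl.
  apply: (le_trans hu); rewrite -mulrA -[leLHS]mulr1; apply: ler_pM => //.
  - by rewrite exprn_ge0// (le_trans ler01)// U1_ge1.
  - by apply: ler_weXn2l; [exact: U1_ge1|exact: ltnW].
  - have hA : e ^- (n + N) <= A.
      rewrite /A exprD invfM mulrACA -[leLHS]mul1r ler_pM//.
        by rewrite mulr_ge0// ltW.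
      by rewrite -[1]mulr1; apply: ler_pM.
    apply: (@le_trans _ _ (e ^- (n + N) * e ^+ l)).
      rewrite ler_pdivlMl ?exprn_gt0// mulr1.
      by apply: ler_wiXn2l; rewrite ?(ltW e0)//; exact: ltnW.
    by apply: ler_pM => //; rewrite ?exprn_ge0// ltW.
have -> : l = ((l - (n + N)) + (n + N))%N by rewrite subnK.
set m := (l - (n + N))%N; rewrite -mulrA.
by apply: hdens_upper => z; rewrite addnA; exact: key.
Qed.

(** The probability that the reversed chain, found at [T (om n) y] at time [n.+1], was at [y] at
    time [n]. *)
Definition weight n y := expR (phi (om n) y) * hdens n y / hdens n.+1 (T (om n) y).

Definition Qop n (F : X -> R) x := \sum_(y <- fibo n x) weight n y * F y.

Fixpoint Qit n l F := if l is k.+1 then Qop (n + k) (Qit n k F) else F.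

Lemma weight_gt0 n y : 0 < weight n y.
Proof. by rewrite /weight divr_gt0 ?mulr_gt0 ?expR_gt0 ?hdens_gt0. Qed.

Lemma weight_sum n x : \sum_(y <- fibo n x) weight n y = 1.
Proof.
transitivity (\sum_(y <- fibo n x) (expR (phi (om n) y) * hdens n y) / hdens n.+1 x).
  rewrite big_seq [RHS]big_seq; apply: eq_bigr => y.
  by rewrite mem_fib /weight => /eqP ->.
by rewrite -mulr_suml divff// gt_eqF// (hdens_gt0 n.+1).
Qed.

Lemma QopE n F x : Qop n F x =
  (\sum_(y <- fibo n x) expR (phi (om n) y) * (hdens n y * F y)) / hdens n.+1 x.
Proof.
rewrite /Qop mulr_suml big_seq [RHS]big_seq; apply: eq_bigr => y.
by rewrite mem_fib /weight => /eqP ->; rewrite mulrAC -!mulrA; congr (_ * _); ring.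
Qed.

Lemma QopD n F G x : Qop n (fun y => F y + G y) x = Qop n F x + Qop n G x.
Proof. by rewrite /Qop -big_split; apply: eq_bigr => y _; rewrite mulrDr. Qed.

Lemma QopZ n c F x : Qop n (fun y => c * F y) x = c * Qop n F x.
Proof. by rewrite /Qop mulr_sumr; apply: eq_bigr => y _; rewrite mulrCA. Qed.

Lemma Qop_cst n c x : Qop n (fun=> c) x = c.
Proof. by rewrite /Qop -mulr_suml weight_sum mul1r. Qed.

Lemma Qop_ge0 n F x : (forall y, 0 <= F y) -> 0 <= Qop n F x.
Proof. by move=> F0; apply: sumr_ge0 => y _; rewrite mulr_ge0// ltW// weight_gt0. Qed.

Lemma Qop_gt0 n F y : (forall y, 0 <= F y) -> 0 < F y -> 0 < Qop n F (T (om n) y).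
Proof.
move=> F0 Fy; rewrite /Qop (bigD1_seq y) ?fib_uniq ?fib_self//=.
apply: ltr_wpDr; last by rewrite mulr_gt0// weight_gt0.
by apply: sumr_ge0 => z _; rewrite mulr_ge0// ltW// weight_gt0.
Qed.

Lemma Qop_pull n F G x :
  Qop n (fun y => F y * G (T (om n) y)) x = G x * Qop n F x.
Proof.
rewrite /Qop mulr_sumr big_seq [RHS]big_seq; apply: eq_bigr => y.
by rewrite mem_fib => /eqP ->; ring.
Qed.

Lemma le_Qop n F G x : (forall y, F y <= G y) -> Qop n F x <= Qop n G x.
Proof. by move=> FG; apply: ler_sum => y _; rewrite ler_wpM2l// ltW// weight_gt0. Qed.

Lemma le_Qit n l F G x : (forall y, F y <= G y) -> Qit n l F x <= Qit n l G x.
Proof. by move=> FG; elim: l x => [|l IH] x //=; exact: le_Qop. Qed.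

Lemma QitD n l F G : Qit n l (fun y => F y + G y) =
  (fun y => Qit n l F y + Qit n l G y).
Proof.
by elim: l => [//|l IH]; apply/funext => x; rewrite /= IH QopD.
Qed.

Lemma QitZ n l c F : Qit n l (fun y => c * F y) = (fun y => c * Qit n l F y).
Proof. by elim: l => [//|l IH]; apply/funext => x; rewrite /= IH QopZ. Qed.

Lemma Qit_cst n l c : Qit n l (fun=> c) = fun=> c.
Proof. by elim: l => [//|l IH]; apply/funext => x; rewrite /= IH Qop_cst. Qed.

Lemma Qit_add n k l F : Qit n (k + l) F = Qit (n + k) l (Qit n k F).
Proof. by elim: l => [|l IH]; rewrite ?addn0// addnS /= IH addnA. Qed.

Lemma Qit_pull n l F G x :
  Qit n l (fun y => F y * G (Tword T (subword om n l) y)) x = G x * Qit n l F x.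
Proof.
elim: l F G x => [|l IH] F G x; first by rewrite /= mulrC.
change (Qop (n + l) (Qit n l (fun y => F y * G (Tword T (subword om n l.+1) y))) x =
  G x * Qop (n + l) (Qit n l F) x).
rewrite -Qop_pull; apply: eq_bigr => y _; congr (_ * _).
rewrite mulrC -(IH F (fun z => G (T (om (n + l)) z))).
by congr (Qit _ _ _ _); apply/funext => z; rewrite subwordS Tword_rcons.
Qed.

(** By [hdens_ratio] the density after one more letter is at most [U1 * C2] times its value at [y],
    so no branch of the reversed chain has vanishing probability. This is the minorization behind
    the contraction. *)
Lemma weight_lower : exists2 c, 0 < c <= 1 & forall n y, c <= weight n y.
Proof.
have [C2 C21 HC] := hdens_ratio.
have e0 : 0 < expR (- B) by exact: expR_gt0.
have U0 : 0 < U1 by exact: lt_le_trans ltr01 U1_ge1.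
have C20 : 0 < C2 by exact: lt_le_trans ltr01 C21.
have Mc : 1 <= U1 * C2 by rewrite -[1]mulr1; apply: ler_pM => //; exact: U1_ge1.
exists (expR (- B) / (U1 * C2)).
  have UC0 : 0 < U1 * C2 by exact: mulr_gt0.
  apply/andP; split; first exact: divr_gt0.
  rewrite ler_pdivrMr// mul1r.
  by apply: le_trans Mc; rewrite -[leRHS]expR0 ler_expR oppr_le0 B_ge0.
move=> n y; rewrite /weight ler_pdivlMr; last exact: (hdens_gt0 n.+1).
have UC0 : 0 < U1 * C2 by exact: mulr_gt0.
rewrite mulrAC ler_pdivrMr// -mulrA; apply: ler_pM.
- exact: ltW.
- exact/ltW/hdens_gt0.
- by rewrite ler_expR; have := phiB (om n) y; rewrite ler_norml => /andP[].
- have := @hdens_upper n 1 (C2 * hdens n y) (fun z => HC n z y) (T (om n) y).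
  by rewrite addn1 expr1 mulrA mulrC.
Qed.

(** Two separate numbers are needed: one step shrinks the local constant [D], up to a multiple of
    [t], whereas the oscillation [t] only shrinks after sufficiently many steps. *)
Definition reg2 (F : X -> R) (t D : R) := (forall x y, `|F x - F y| <= t) /\
  (forall x y, mdist x y < a -> `|F x - F y| <= D * rr x y).

(** A weight is a quotient of two densities, which doubles the distortion exponent; [C3] then
    linearizes the exponential on distances below [a]. *)
Let C1 := C0 + C0.
Let C3 := C1 * expR (C1 * a `^ alpha).

Lemma C3_ge0 : 0 <= C3.
Proof. by rewrite mulr_ge0 ?expR_ge0// addr_ge0 ?C0_ge0. Qed.

Lemma weight_le n u v :
  mdist (T (om n) u) (T (om n) v) < a -> mdist u v <= lam * mdist (T (om n) u) (T (om n) v) ->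
  weight n u <= expR (C1 * rr (T (om n) u) (T (om n) v)) * weight n v.
Proof.
set x := T _ u; set y := T _ v => xya uv.
have uva : mdist u v < a.
  apply: le_lt_trans uv _; exact: (lam_dist_lt hexp i0 (mdist_ge0 _ _) xya).
rewrite /weight -/x -/y ler_pdivrMr ?hdens_gt0//.
have h1 : expR (phi (om n) u) <= expR (Hp * rr u v) * expR (phi (om n) v).
  rewrite -expRD ler_expR -lerBlDr; apply: le_trans (phiH _ _ _).
  exact: ler_norm.
have h2 := hdens_distortion n uva.
have h3 : hdens n.+1 y <= expR (C0 * rr x y) * hdens n.+1 x.
  rewrite (metric_sym x); apply: hdens_distortion.
  by rewrite metric_sym.
have hy := hdens_gt0 n.+1 y; have hv := hdens_gt0 n v.
apply: (@le_trans _ _ ((expR (Hp * rr u v) * expR (phi (om n) v)) *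
  (expR (C0 * rr u v) * hdens n v))).
  by apply: ler_pM; rewrite ?expR_ge0// ltW// hdens_gt0.
have h4 : expR (Hp * rr u v) * expR (C0 * rr u v) <= expR (C0 * rr x y).
  rewrite -expRD -mulrDl ler_expR -[in leRHS]C0E -mulrA.
  by apply: ler_wpM2l; [rewrite addr_ge0 ?C0_ge0|exact: rr_contract].
rewrite mulrACA; apply: (@le_trans _ _ (expR (C0 * rr x y) * (expR (phi (om n) v) * hdens n v))).
  by apply: ler_wpM2r => //; rewrite mulr_ge0 ?expR_ge0// ltW.
rewrite /C1 mulrDl expRD.
move: h3; move: (expR (C0 * rr x y)) (expR_ge0 (C0 * rr x y)) => E E0 h3.
have p0 : 0 < expR (phi (om n) v) * hdens n v by rewrite mulr_gt0 ?expR_gt0.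
move: p0 h3 hy; move: (expR _ * _) (hdens n.+1 x) (hdens n.+1 y) => p hx hy' p0 h3 hy.
rewrite [leRHS](_ : _ = (E * p) * ((E * hx) / hy')); last by ring.
by rewrite -[leLHS]mulr1; apply: ler_wpM2l; rewrite ?mulr_ge0 ?(ltW p0)// ler_pdivlMr// mul1r.
Qed.

Lemma weight_dist n u v :
  mdist (T (om n) u) (T (om n) v) < a -> mdist u v <= lam * mdist (T (om n) u) (T (om n) v) ->
  `|weight n u - weight n v| <= weight n u * (C3 * rr (T (om n) u) (T (om n) v)).
Proof.
move=> xya uv; have h1 := weight_le xya uv.
have h2 : weight n v <= expR (C1 * rr (T (om n) u) (T (om n) v)) * weight n u.
  rewrite (metric_sym (T (om n) u)); apply: weight_le.
    by rewrite metric_sym.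
  by rewrite metric_sym (metric_sym (T (om n) v)).
move: h1 h2; set t := C1 * _; set p := weight n u; set q := weight n v => h1 h2.
have p0 : 0 < p by exact: weight_gt0.
have q0 : 0 < q by exact: weight_gt0.
have t0 : 0 <= t by rewrite mulr_ge0 ?rr_ge0// addr_ge0 ?C0_ge0.
have ta : t <= C1 * a `^ alpha.
  by apply: ler_wpM2l; [rewrite addr_ge0 ?C0_ge0|rewrite rr_le// ltW].
have et : expR t - 1 <= t * expR t.
  have := expR_ge1Dx (- t); rewrite expRN => h.
  have := ler_wpM2r (expR_ge0 t) h; rewrite mulVf ?gt_eqF ?expR_gt0//; lra.
have e3 : expR t - 1 <= C3 * rr (T (om n) u) (T (om n) v).
  have -> : C3 * rr (T (om n) u) (T (om n) v) = t * expR (C1 * a `^ alpha).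
    by rewrite /C3 /t mulrAC.
  by apply: (le_trans et); rewrite ler_wpM2l// ler_expR.
apply: (@le_trans _ _ (p * (expR t - 1))); last by rewrite ler_wpM2l// ltW.
have E1 : 1 <= expR t by rewrite -[leLHS]expR0 ler_expR.
rewrite ler_norml; apply/andP; split; first by nra.
have : p - q <= p * (1 - (expR t)^-1).
  rewrite mulrBr mulr1 lerD2l lerN2 ler_pdivrMr ?expR_gt0//.
  by rewrite mulrC.
move=> /le_trans; apply; rewrite ler_wpM2l ?(ltW p0)//.
rewrite lerBlDr -subr_ge0.
have -> : expR t - 1 + (expR t)^-1 - 1 = (expR t - 1) ^+ 2 / expR t.
  by field; rewrite gt_eqF// expR_gt0.
by rewrite divr_ge0 ?sqr_ge0 ?expR_ge0.
Qed.

Lemma Qop_osc n F t x y : (forall x y, `|F x - F y| <= t) ->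
  `|Qop n F x - Qop n F y| <= t.
Proof.
move=> Ft.
have key u v : Qop n F u - Qop n F v <= t.
  have h z : Qop n F u <= F z + t.
    rewrite -(Qop_cst n (F z + t) u); apply: le_Qop => w.
    by have := Ft w z; rewrite ler_norml; lra.
  have : Qop n F u - t <= Qop n F v.
    rewrite -[leLHS](Qop_cst n _ v); apply: le_Qop => w.
    by have := h w; lra.
  by lra.
rewrite ler_norml; have := key x y; have := key y x; lra.
Qed.

(** The Doeblin-Fortet inequality: matching the fibres of [x] and [y], the change of [F] along a
    pair contributes [la * D], and the change of the weights contributes [C3 * t]. *)
Lemma Qop_reg2 n F t D : 0 <= D -> reg2 F t D -> reg2 (Qop n F) t (la * D + C3 * t).
Proof.
move=> D0 [Ft FD]; split; first by move=> x y; exact: Qop_osc.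
move=> x y xya; have [p pp dp] := pairing (om n) xya.
have e : Qop n F y = \sum_(u <- fibo n x) weight n (p u) * F (p u).
  by rewrite /Qop (sum_pairing _ pp).
have sp : \sum_(u <- fibo n x) weight n (p u) = 1.
  by rewrite -(sum_pairing _ pp) weight_sum.
(* The weights over each fibre sum to 1, so a constant may be subtracted from [F]; the change of the
   weights is then multiplied by an oscillation instead of a sup norm. *)
pose c := F point.
have -> : Qop n F x - Qop n F y = \sum_(u <- fibo n x)
    (weight n u * (F u - F (p u)) + (weight n u - weight n (p u)) * (F (p u) - c)).
  rewrite e /Qop -sumrB.
  rewrite [RHS](eq_bigr (fun u => (weight n u * F u - weight n (p u) * F (p u))
     + (weight n (p u) * c - weight n u * c))); last by move=> u _; ring.
  by rewrite [RHS]big_split/= [X in _ = _ + X]sumrB -!mulr_suml sp weight_sum subrr addr0 sumrB.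
apply: le_trans (ler_norm_sum _ _ _) _.
rewrite -[leRHS]mul1r -(weight_sum n x) mulr_suml big_seq [leRHS]big_seq.
apply: ler_sum => u ux; have dup := dp u ux.
have Tu : T (om n) u = x by move: ux; rewrite mem_fib => /eqP.
have Tp : T (om n) (p u) = y.
  apply/eqP; rewrite -mem_fib -(perm_mem pp); exact: map_f.
have w0 := weight_gt0 n u.
apply: le_trans (ler_normD _ _) _; rewrite normrM (gtr0_norm w0) [X in _ + X]normrM.
have d1 : `|F u - F (p u)| <= D * (la * rr x y).
  apply: le_trans (FD _ _ _) _.
    by apply: le_lt_trans dup _; exact: (lam_dist_lt hexp i0 (mdist_ge0 _ _) xya).
  by rewrite ler_wpM2l// rr_contract.
have d2 : `|weight n u - weight n (p u)| <= weight n u * (C3 * rr x y).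
  by have := @weight_dist n u (p u); rewrite Tu Tp; apply.
have d3 : `|F (p u) - c| <= t by exact: Ft.
have t0 : 0 <= t by exact: le_trans (normr_ge0 _) d3.
apply: (@le_trans _ _ (weight n u * (D * (la * rr x y)) + weight n u * (C3 * rr x y) * t)).
  apply: lerD; first by rewrite ler_pM2l.
  by apply: ler_pM.
by rewrite le_eqVlt; apply/orP; left; apply/eqP; ring.
Qed.

(** Bounds the geometric accumulation of the terms [C3 * t] of [Qop_reg2] over all steps. *)
Let C4 := C3 / (1 - la) + 1.

Lemma C4_bound : la * C4 + C3 <= C4.
Proof.
have l1 : 0 < 1 - la by rewrite subr_gt0 la_lt1.
have : C3 = (C4 - 1) * (1 - la) by rewrite /C4; field; rewrite gt_eqF.
by move=> ->; nra.
Qed.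

Lemma C4_gt0 : 0 < C4.
Proof.
by rewrite ltr_wpDl// divr_ge0 ?C3_ge0// subr_ge0 ltW// la_lt1.
Qed.

Lemma Qit_reg2 n l F t D : 0 <= D -> 0 <= t -> reg2 F t D ->
  reg2 (Qit n l F) t (la ^+ l * D + C4 * t).
Proof.
move=> D0 t0 FtD; have la0 := la_gt0; have C40 := C4_gt0.
elim: l => [|l [IH1 IH2]] /=.
  case: FtD => h1 h2; split => // x y /h2 h.
  apply: (le_trans h); rewrite ler_wpM2r ?rr_ge0// expr0 mul1r lerDl.
  by rewrite mulr_ge0// ltW.
have [||h1 h2] := @Qop_reg2 (n + l) (Qit n l F) t (la ^+ l * D + C4 * t).
- by rewrite addr_ge0 ?mulr_ge0 ?exprn_ge0// ltW.
- by split.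
split => // x y /h2 h; apply: (le_trans h).
apply: ler_wpM2r; first exact: rr_ge0.
rewrite mulrDr mulrA -exprS -addrA lerD2l mulrA -mulrDl.
by apply: ler_wpM2r => //; exact: C4_bound.
Qed.

Lemma Qit_lower c n l F x' : 0 <= c -> (forall n y, c <= weight n y) ->
  (forall y, 0 <= F y) ->
  c ^+ l * F x' <= Qit n l F (Tword T (subword om n l) x').
Proof.
move=> c0 hc F0; elim: l => [|l IH]; first by rewrite expr0 mul1r.
rewrite subwordS Tword_rcons /=; set z := Tword _ _ _ in IH *.
have Q0 y : 0 <= Qit n l F y.
  rewrite -[leLHS](_ : Qit n l (fun=> 0) y = 0); last by rewrite Qit_cst.
  exact: le_Qit.
rewrite /Qop (bigD1_seq z) ?fib_uniq ?fib_self//=.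
apply: (@le_trans _ _ (weight (n + l) z * Qit n l F z)); last first.
  by rewrite lerDl; apply: sumr_ge0 => v _; rewrite mulr_ge0// ltW// weight_gt0.
rewrite exprS -mulrA; apply: ler_pM => //.
by rewrite mulr_ge0 ?exprn_ge0.
Qed.

Definition reg (Lam : R) F (t : R) := reg2 F t (Lam * t).

(** By [exactness] any [x] and [y] have [N]-fold preimages near the base point, where [F] differs by
    at most [t / 2]. Each of them carries weight at least [c ^ N], and the remaining mass
    contributes at most the range of [F]. Hence the oscillation drops by at least [c ^ N * t / 2];
    some further steps let the local Hoelder constant follow. *)
Lemma contraction : exists (Lam : R) N (theta : R), [/\ 0 < Lam, (0 < N)%N, 0 < theta < 1,
  (forall n F (t : R), 0 <= t -> reg Lam F t -> reg Lam (Qop n F) t) &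
  (forall n F (t : R), 0 <= t -> reg Lam F t -> reg Lam (Qit n N F) (theta * t))].
Proof.
have [c /andP[c0 c1] hc] := weight_lower.
have la0 := la_gt0; have la1 := la_lt1.
have C40 := C4_gt0; have C4b := C4_bound; have C30 := C3_ge0.
(* One half absorbs the constant [C4] that accumulates in [Qit_reg2], the other half what remains of
   the initial Hoelder constant. *)
pose Lam := C4 + C4; have Lam0 : 0 < Lam by rewrite addr_gt0.
(* Two points within [eps] of the base point are within [2 * eps] of each other, where the local
   constant [Lam * t] allows a variation of at most [t / 2]. *)
have [eps e0 [ea eL]] : exists2 eps, 0 < eps & 2 * eps <= a /\ Lam * (2 * eps) `^ alpha <= 2^-1.
  pose s := Num.min a ((2 * Lam)^-1 `^ alpha^-1).
  have s0 : 0 < s by rewrite lt_min a0 powR_gt0// invr_gt0 mulr_gt0.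
  exists (s / 2); first by rewrite divr_gt0.
  rewrite mulrCA divff// mulr1; split; first by rewrite ge_min lexx.
  apply: (@le_trans _ _ (Lam * ((2 * Lam)^-1 `^ alpha^-1) `^ alpha)).
    rewrite ler_wpM2l ?(ltW Lam0)//; apply: ge0_ler_powR.
    - exact: ltW.
    - by rewrite nnegrE ltW.
    - by rewrite nnegrE powR_ge0.
    - by rewrite ge_min lexx orbT.
  rewrite -powRrM mulVf ?gt_eqF// powRr1 ?invr_ge0 ?mulr_ge0 ?(ltW Lam0)//.
  by rewrite invfM mulrCA divff ?gt_eqF// mulr1.
have [N HN] := exactness hexp hsurj hmix hap i0 (point : X) e0.
pose th := 1 - c ^+ N / 2.
have cN0 : 0 < c ^+ N by rewrite exprn_gt0.
have cN1 : c ^+ N <= 1 by rewrite exprn_ile1// ltW.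
have th0 : 0 < th by rewrite /th; lra.
have th1 : th < 1 by rewrite /th; lra.
have osc n F t : 0 <= t -> reg Lam F t ->
    forall x y, `|Qit n N F x - Qit n N F y| <= th * t.
  move=> t0 [F1 F2].
  have key x y : Qit n N F x - Qit n N F y <= th * t.
    have sw := size_subword n N.
    have [|x' Tx dx] := HN (subword om n N) _ x; first by rewrite sw.
    have [|y' Ty dy] := HN (subword om n N) _ y; first by rewrite sw.
    have dxy : mdist x' y' <= 2 * eps.
      have := metric_triangle x' point y'; rewrite (metric_sym x' point); lra.
    have Fxy : F x' - F y' <= t / 2.
      apply: (le_trans (ler_norm _)); have [e|ne] := eqVneq x' y'.
        by rewrite e subrr normr0 divr_ge0.
      have h : mdist x' y' < a.
        apply: lt_le_trans ea; have := metric_triangle x' point y'.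
        by rewrite (metric_sym x' point); lra.
      apply: (le_trans (F2 _ _ h)); rewrite mulrAC.
      rewrite [leRHS]mulrC; apply: ler_wpM2r => //.
      by apply: le_trans eL; rewrite ler_wpM2l ?(ltW Lam0)// rr_le.
    have hub : has_ubound (range F).
      exists (F point + t) => _ [z _ <-].
      by have := F1 z point; rewrite ler_norml; lra.
    have hs : has_sup (range F) by split => //; exists (F point), point.
    pose M := sup (range F).
    have FM z : F z <= M by apply: ub_le_sup => //; exists z.
    have h1 : c ^+ N * (M - F x') <= M - Qit n N F x.
      have := @Qit_lower c n N (fun z => M - F z) x' (ltW c0) hc.
      rewrite Tx => /(_ _)/le_trans; apply; first by move=> z; rewrite subr_ge0.
      have -> : (fun z => M - F z) = (fun z => (fun=> M) z + (-1) * F z).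
        by apply/funext => z; ring.
      by rewrite QitD QitZ Qit_cst mulN1r.
    have Mt z : M - t <= F z.
      rewrite lerBlDr; apply: ge_sup; first by exists (F point), point.
      by move=> _ [u _ <-]; have := F1 u z; rewrite ler_norml; lra.
    have h2 : c ^+ N * (F y' - (M - t)) <= Qit n N F y - (M - t).
      have := @Qit_lower c n N (fun z => F z - (M - t)) y' (ltW c0) hc.
      rewrite Ty => /(_ _)/le_trans; apply; first by move=> z; rewrite subr_ge0.
      have -> : (fun z => F z - (M - t)) = (fun z => (fun=> - (M - t)) z + F z).
        by apply/funext => z; ring.
      by rewrite QitD Qit_cst addrC.
    have : c ^+ N * (F x' - F y') <= c ^+ N * (t / 2) by rewrite ler_pM2l.
    by move: h1 h2; rewrite /th; lra.
  move=> x y; rewrite ler_norml; have := key x y; have := key y x; lra.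
(* These extra steps come after the oscillation has shrunk to [th * t]; they reduce the old Hoelder
   constant [(Lam + C4) * t] below [C4 * th * t]. *)
have [m Hm] : exists m, forall k, (m <= k)%N -> la ^+ k * (Lam + C4) < C4 * th.
  by apply: geometric_small; [rewrite (ltW la0)|rewrite mulr_gt0].
exists Lam, (N + m).+1, th; split => //.
- by rewrite th0.
- move=> n F t t0 rF; have [h1 h2] := @Qop_reg2 n F t (Lam * t) (mulr_ge0 (ltW Lam0) t0) rF.
  split => // x y /h2 /le_trans; apply; apply: ler_wpM2r; first exact: rr_ge0.
  rewrite mulrA -mulrDl; apply: ler_wpM2r => //.
  by rewrite /Lam; nra.
- move=> n F t t0 rF; rewrite -addnS Qit_add.
  have L0 : 0 <= Lam * t by rewrite mulr_ge0// ltW.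
  have [G1 G2] := Qit_reg2 n N L0 t0 rF.
  have tt0 : 0 <= th * t by rewrite mulr_ge0// ltW.
  have rG : reg2 (Qit n N F) (th * t) ((Lam + C4) * t).
    split; first by apply: osc.
    move=> x y /G2 /le_trans; apply; apply: ler_wpM2r; first exact: rr_ge0.
    rewrite [leRHS]mulrDl lerD2r ler_piMl//; apply: exprn_ile1; exact: ltW.
  have D0 : 0 <= (Lam + C4) * t by rewrite mulr_ge0// addr_ge0// ltW.
  have [h1 h2] := Qit_reg2 (n + N) m.+1 D0 tt0 rG.
  split => // x y /h2 /le_trans; apply; apply: ler_wpM2r; first exact: rr_ge0.
  have := Hm m.+1 (leqnSn m); set q := la ^+ _ => hq.
  rewrite !mulrA -mulrDl; apply: ler_wpM2r => //.
  have -> : Lam * th = C4 * th + C4 * th by rewrite -mulrDl.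
  by rewrite lerD2r ltW.
Qed.

Lemma contraction_iter Lam N theta n l F t : 0 <= theta -> 0 <= t ->
  (forall n F (t : R), 0 <= t -> reg Lam F t -> reg Lam (Qop n F) t) ->
  (forall n F (t : R), 0 <= t -> reg Lam F t -> reg Lam (Qit n N F) (theta * t)) ->
  reg Lam F t -> reg Lam (Qit n l F) (theta ^+ (l %/ N) * t).
Proof.
move=> th0 t0 h1 h2 rF.
rewrite {1}(divn_eq l N) Qit_add.
have key k : reg Lam (Qit n (k * N) F) (theta ^+ k * t).
  elim: k => [|k IH]; first by rewrite mul0n expr0 mul1r.
  rewrite mulSn addnC Qit_add exprS -mulrA; apply: h2 => //.
  by rewrite mulr_ge0// exprn_ge0.
elim: (l %% N)%N => [|k IH] //=.
by apply: h1 => //; rewrite mulr_ge0// exprn_ge0.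
Qed.

End operators.

(** * Bounded potentials, finite fibres and iterated transfer operators *)

Section potentials.
Context {R : realType} {X : completeMetricType R} {W : finType}.
Variables (T : W -> X -> X) (phi : W -> X -> R).

Lemma potential_word_rcons v i x :
  potential_word T phi (rcons v i) x = potential_word T phi v x + phi i (Tword T v x).
Proof.
have E u : potential_word T phi u x =
    \sum_(0 <= j < size u) phi (nth i u j) (Tword T (take j u) x).
  rewrite /potential_word big_mkord; apply: eq_bigr => j _.
  by rewrite (tnth_nth i).
rewrite !E size_rcons big_nat_recr//= nth_rcons ltnn eqxx.
congr (_ + _); last by rewrite -cats1 take_cat ltnn subnn take0 cats0.
rewrite !big_nat; apply: eq_bigr => j /andP[_ jv].
by rewrite nth_rcons jv -cats1 take_cat jv.
Qed.

Lemma uniform_holder (alpha : R) : 0 < alpha -> (forall i, holder alpha (phi i)) ->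
  exists2 H, 0 <= H & forall i x y, `|phi i x - phi i y| <= H * mdist x y `^ alpha.
Proof.
move=> al0 hphi.
have /choice[H hH] : forall i, exists H : R, 0 <= H /\
    forall x y, `|phi i x - phi i y| <= H * mdist x y `^ alpha.
  by move=> i; have [H H0 hH] := holder_bound al0 (hphi i); exists H.
exists (\big[Num.max/0]_i H i); first exact: bigmax_ge_id.
move=> i x y; apply: (le_trans ((hH i).2 x y)).
by rewrite ler_wpM2r ?powR_ge0//; exact: le_bigmax.
Qed.

Lemma uniform_bound (alpha Dm H : R) : 0 < alpha -> 0 <= H ->
  (forall x y : X, mdist x y <= Dm) ->
  (forall i x y, `|phi i x - phi i y| <= H * mdist x y `^ alpha) ->
  exists B, forall i x, `|phi i x| <= B.
Proof.
move=> al0 H0 hD hH.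
exists (\big[Num.max/0]_i `|phi i point| + H * Dm `^ alpha) => i x.
have -> : phi i x = phi i point + (phi i x - phi i point) by ring.
apply: le_trans (ler_normD _ _) _; apply: lerD; first exact: le_bigmax.
apply: (le_trans (hH i x point)); rewrite ler_wpM2l//.
apply: ge0_ler_powR; rewrite ?nnegrE ?mdist_ge0 ?(ltW al0)//.
exact: le_trans (mdist_ge0 x x) (hD _ _).
Qed.

End potentials.

Lemma esum_seq {R : realType} {X : choiceType} (s : seq X) (F : X -> \bar R) : uniq s -> (forall x, 0 <= F x)%E ->
  (\esum_(x in [set` s]) F x = \sum_(x <- s) F x)%E.
Proof.
move=> us F0; rewrite esum_fset; last 2 first.
- exact: finite_seq.
- by move=> x _; exact: F0.
by rewrite -fsbig_seq.
Qed.

Section finite_fibres.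
Context {R : realType} {X : completeMetricType R} {W : finType}.
Variables (T : W -> X -> X) (phi : W -> X -> R).

(** A potential bounded by [B] gives every preimage a weight of at least [expR (- B)], so a bounded
    sum over the fibre bounds the number of preimages. *)
Lemma finite_fibres (B : R) : (forall i x, `|phi i x| <= B) ->
  (forall i, summable_potential T phi i) ->
  (forall i x, finite_set (T i @^-1` [set x])) /\
  exists M, forall i x, (size (fib T i x) <= M)%N.
Proof.
move=> hB hsum.
have /choice[C hC] : forall i, exists C : R, forall x (s : seq X), uniq s ->
    [set` s] `<=` T i @^-1` [set x] -> (size s)%:R <= C.
  move=> i; have := hsum i; rewrite /summable_potential.
  set S := (S in ereal_sup S) => Sfin.
  exists (fine (ereal_sup S) * expR B) => x s us sT.
  have : (`|transfer T phi [:: i] (cst 1%R) x| <= ereal_sup S)%E.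
    by apply: ereal_sup_ubound; exists x.
  rewrite /transfer; set g := fun y => _.
  have g0 y : (0 <= g y)%E by rewrite lee_fin mulr1 expR_ge0.
  have -> : (g^\- = fun=> 0)%E.
    by apply/funext => y; rewrite (ge0_funenegE (D := setT)) ?inE.
  have -> : (g^\+ = g)%E.
    by apply/funext => y; rewrite (ge0_funeposE (D := setT)) ?inE.
  rewrite [X in (_ - X)%E]esum1// sube0 gee0_abs; last by apply: esum_ge0 => y _; exact: g0.
  move=> h; have : ((\sum_(y <- s) g y)%E <= ereal_sup S)%E.
    apply: le_trans h; apply: esum_ge; exists [set` s]; last by rewrite fsbig_seq.
    by split => //; exact: finite_seq.
  have : (((size s)%:R * expR (- B))%:E <= \sum_(y <- s) g y)%E.
    rewrite sumEFin lee_fin mulrC mulr_natr.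
    rewrite -[leLHS](_ : \sum_(y <- s) expR (- B) = _); last first.
      by rewrite big_const_seq count_predT iter_addr_0.
    apply: ler_sum => y _; rewrite mulr1 ler_expR /potential_word.
    rewrite big_ord_recl big_ord0 addr0 (tnth_nth i)/=.
    by have := hB i y; rewrite ler_norml => /andP[].
  move=> /le_trans/[apply]; move: Sfin; case: (ereal_sup S) => [q| |]//= _.
  by rewrite lee_fin expRN ler_pdivrMr ?expR_gt0.
have fin i x : finite_set (T i @^-1` [set x]).
  apply: contrapT => inf.
  have [Bf sub cB] := infinite_set_fset (Num.bound (C i)) inf.
  have := hC i x Bf (fset_uniq _) sub.
  have C0 : 0 <= C i by apply: le_trans (hC i x [::] isT _).
  have := archi_boundP C0 => h1 h2; have := lt_le_trans h1 _ => /(_ (size Bf)%:R).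
  by rewrite ler_nat => /(_ cB); rewrite ltNge h2.
split => //; exists (\max_i Num.bound (C i))%N => i x.
apply: leq_trans (leq_bigmax i).
have h : (size (fib T i x))%:R <= C i.
  apply: (hC i x); first exact: fset_uniq.
  by move=> y /=; rewrite [_ \in _](in_fset_set (fin i x)) inE.
have C0 : 0 <= C i by apply: le_trans h.
by rewrite -(@ler_nat R) (le_trans h)// ltW// archi_boundP.
Qed.

End finite_fibres.

Section transfer_formula.
Context {R : realType} {X : completeMetricType R} {W : finType}.
Variables (T : W -> X -> X) (phi : W -> X -> R) (om : nat -> W).
Hypothesis finfib : forall i x, finite_set (T i @^-1` [set x]).

Fixpoint word_fib l x : seq X :=
  if l is k.+1 then flatten [seq word_fib k y | y <- fib T (om k) x] else [:: x].

Fixpoint transfer_iter l (f : X -> R) x : R := if l is k.+1 then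
  \sum_(y <- fib T (om k) x) expR (phi (om k) y) * transfer_iter k f y else f x.

Lemma prefix_wordS l : prefix_word om l.+1 = rcons (prefix_word om l) (om l).
Proof. by rewrite /prefix_word mkseqS. Qed.

Lemma mem_word_fib l x y : (y \in word_fib l x) = (Tword T (prefix_word om l) y == x).
Proof.
elim: l x => [|l IH] x; first by rewrite /= inE.
rewrite prefix_wordS Tword_rcons /=; apply/flatten_mapP/eqP => [[z zx]|e].
  by rewrite IH => /eqP ->; apply/eqP; rewrite -(mem_fib finfib).
exists (Tword T (prefix_word om l) y); last by rewrite IH.
by rewrite (mem_fib finfib) e.
Qed.

Lemma word_fib_uniq l x : uniq (word_fib l x).
Proof.
elim: l x => [//|l IH] x /=.
have : uniq (fib T (om l) x) by exact: fset_uniq.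
elim: (fib T (om l) x) => [//|z s IHs] /= /andP[zs us].
rewrite cat_uniq IH IHs// andbT; apply/hasPn => y /flatten_mapP[u us'].
rewrite !mem_word_fib => /eqP -> /=; apply: contra zs => /eqP <-; exact: us'.
Qed.

Lemma transfer_iterE l f x :
  transfer_iter l f x =
  \sum_(y <- word_fib l x) expR (potential_word T phi (prefix_word om l) y) * f y.
Proof.
elim: l x => [|l IH] x.
  by rewrite /= big_seq1 /potential_word big_ord0 expR0 mul1r.
rewrite /= big_flatten big_map; apply: eq_bigr => z _.
rewrite IH mulr_sumr !big_seq; apply: eq_bigr => y.
rewrite mem_word_fib => /eqP e.
by rewrite prefix_wordS potential_word_rcons expRD e; ring.
Qed.

Lemma transferE l f x :
  fine (transfer T phi (prefix_word om l) f x) = transfer_iter l f x.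
Proof.
rewrite transfer_iterE /transfer; set g := fun y => _.
have -> : Tword T (prefix_word om l) @^-1` [set x] = [set` word_fib l x].
  by apply/seteqP; split => y /=; rewrite mem_word_fib => /eqP.
have -> : g = EFin \o (fun y => expR (potential_word T phi (prefix_word om l) y) * f y).
  by [].
rewrite funerpos funerneg !esum_seq ?word_fib_uniq//; last 2 first.
- by move=> y; rewrite lee_fin; exact: funrneg_ge0.
- by move=> y; rewrite lee_fin; exact: funrpos_ge0.
rewrite !sumEFin -EFinB/= -sumrB; apply: eq_bigr => y _.
exact: (congr1 (fun h : X -> R => h y)
  (funrposBneg (fun y => expR (potential_word T phi (prefix_word om l) y) * f y))).
Qed.

End transfer_formula.

(** * Reversed Markov chains *)

Fixpoint iter_step {S : Type} (step : nat -> S -> S) n l x : S :=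
  if l is k.+1 then step (n + k)%N (iter_step step n k x) else x.

(** [back n F x] is the conditional expectation of [F] at time [n] given the state [x] at time
    [n.+1], as an operator defined at every point: identities hold pointwise, without null sets.
    Only [back_int] involves [mu]. Positivity [back_gt0] at reached states later guarantees that an
    observed cell has positive conditional mass. *)
Record reverse_chain {R : realType} {d} {S : measurableType d} (mu : probability S R) :=
  ReverseChain {
  chain_step : nat -> S -> S;
  back : nat -> (S -> R) -> S -> R;
  step_meas : forall n, measurable_fun setT (chain_step n);
  backD : forall n (F G : S -> R), back n (fun y => F y + G y) = fun x => back n F x + back n G x;
  backZ : forall n c (F : S -> R), back n (fun y => c * F y) = fun x => c * back n F x;
  back_cst : forall n c, back n (fun=> c) = fun=> c;
  back_ge0 : forall n (F : S -> R) x, (forall y, 0 <= F y) -> 0 <= back n F x;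
  back_gt0 : forall n (F : S -> R) y, (forall y, 0 <= F y) -> 0 < F y -> 0 < back n F (chain_step n y);
  back_pull : forall n (F G : S -> R), back n (fun y => F y * G (chain_step n y)) = fun x => G x * back n F x;
  back_meas : forall n (F : S -> R), measurable_fun setT F -> measurable_fun setT (back n F);
  back_int : forall n (F : S -> R), measurable_fun setT F -> (forall x, 0 <= F x) ->
    (\int[mu]_x (F (iter_step chain_step 0 n x))%:E =
     \int[mu]_x (back n F (iter_step chain_step 0 n.+1 x))%:E)%E }.

Lemma cvg_seq_sum {R : realType} (I : Type) (r : seq I) (f : nat -> I -> R) (l : I -> R) :
  (forall i, f n i @[n --> \oo] --> l i) ->
  \sum_(i <- r) f n i @[n --> \oo] --> \sum_(i <- r) l i.
Proof.
move=> fl; elim: r => [|i r IH].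
  by rewrite big_nil; under eq_cvg do rewrite big_nil; exact: cvg_cst.
rewrite big_cons; under eq_cvg do rewrite big_cons.
by apply: cvgD.
Qed.

(** * Extending a duality formula from a pi-system to Borel functions *)

Section dynkin_extension.
Context {R : realType} {d} {S : measurableType d} (mu : probability S R).
Variables (s : S -> seq S) (w : S -> R) (p p' : S -> S).
Hypothesis w0 : forall y, 0 <= w y.
Hypotheses (mp : measurable_fun setT p) (mp' : measurable_fun setT p').

Let Q (F : S -> R) x := \sum_(y <- s x) w y * F y.

Let ok (A : set S) := [/\ measurable A, measurable_fun setT (Q \1_A) &
  (\int[mu]_x (\1_A (p x))%:E = \int[mu]_x (Q \1_A (p' x))%:E)%E].

Let Q_ge0 A x : 0 <= Q \1_A x.
Proof. by apply: sumr_ge0 => y _; rewrite mulr_ge0// indicE. Qed.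

Let okm A : ok A -> measurable_fun setT (fun x => (Q \1_A (p' x))%:E).
Proof.
by case=> _ mQ _; apply/measurable_EFinP; exact: (measurableT_comp mQ mp').
Qed.

Let indm A : measurable A -> measurable_fun setT (fun x => (\1_A (p x) : R)%:E).
Proof.
by move=> mA; apply/measurable_EFinP; apply: (measurableT_comp _ mp); exact: measurable_indic.
Qed.

Let ok_int A : ok A -> mu.-integrable setT (fun x => (Q \1_A (p' x))%:E).
Proof.
move=> oA; apply/integrableP; split; first exact: okm.
have [mA _ e] := oA.
under eq_integral do rewrite gee0_abs ?lee_fin//.
rewrite -e; apply: (@le_lt_trans _ _ (\int[mu]_x (cst 1%E x))%E).
  apply: ge0_le_integral => //.
  - exact: indm.
  - by move=> x _; rewrite /= lee_fin indicE lern1 leq_b1.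
by rewrite integral_cst//= mul1e (le_lt_trans (probability_le1 mu measurableT))// ltry.
Qed.

Let ind_int A : measurable A -> mu.-integrable setT (fun x => (\1_A (p x) : R)%:E).
Proof.
move=> mA; apply/integrableP; split; first exact: indm.
under eq_integral do rewrite gee0_abs ?lee_fin ?indicE//.
apply: (@le_lt_trans _ _ (\int[mu]_x (cst 1%E x))%E).
  apply: ge0_le_integral => //.
  - exact: indm.
  - by move=> x _; rewrite /= lee_fin lern1 leq_b1.
by rewrite integral_cst//= mul1e (le_lt_trans (probability_le1 mu measurableT))// ltry.
Qed.

(** [Q] is a weighted sum over a finite list that depends on the point, so the measurability of
    [Q \1_A] is not given. It is therefore propagated through the lambda-system together with the
    integral identity. *)
Lemma dynkin_extension (G : set (set S)) : setI_closed G ->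
  @measurable _ S = <<s G>> ->
  measurable_fun setT (Q \1_setT) ->
  (\int[mu]_x (\1_setT (p x))%:E = \int[mu]_x (Q \1_setT (p' x))%:E)%E ->
  (forall A, G A -> measurable_fun setT (Q \1_A) /\
    (\int[mu]_x (\1_A (p x))%:E = \int[mu]_x (Q \1_A (p' x))%:E)%E) ->
  forall A, measurable A -> measurable_fun setT (Q \1_A) /\
    (\int[mu]_x (\1_A (p x))%:E = \int[mu]_x (Q \1_A (p' x))%:E)%E.
Proof.
move=> GI mG QT1 QT2 GQ A mA.
suff : ok A by case.
suff : <<s G>> `<=` ok by apply; rewrite -mG.
apply: lambda_system_subset => //; last first.
  move=> B GB; have [h1 h2] := GQ B GB; split => //.
  by rewrite mG; exact: sub_sigma_algebra.
split => //.
- move=> B C CB oB oC; have [mB mQB eB] := oB; have [mC mQC eC] := oC.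
  have i1 y : \1_(B `\` C) y = \1_B y - \1_C y :> R.
    rewrite !indicE in_setD; case: (boolP (y \in C)) => [yC|yC] /=.
      have -> : y \in B by rewrite inE; apply: CB; rewrite inE in yC.
      by rewrite subrr.
    by rewrite andbT subr0.
  have QE x : Q \1_(B `\` C) x = Q \1_B x - Q \1_C x.
    by rewrite /Q -sumrB; apply: eq_bigr => y _; rewrite i1 mulrBr.
  split; first exact: measurableD.
    rewrite (_ : Q _ = fun x => Q \1_B x - Q \1_C x); last by apply/funext.
    exact: measurable_funB.
  under eq_integral do rewrite i1 EFinB.
  under [in RHS]eq_integral do rewrite QE EFinB.
  rewrite integralB_EFin//; [|exact: ind_int|exact: ind_int].
  rewrite integralB_EFin//; [|exact: ok_int|exact: ok_int].
  by rewrite eB eC.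
- move=> F ndF oF.
  have mF n : measurable (F n) by case: (oF n).
  have nd y : nondecreasing_seq (fun n => \1_(F n) y : R).
    move=> m n mn; rewrite !indicE ler_nat.
    case: (boolP (y \in F m)) => // /set_mem yF.
    by rewrite (mem_set (_ : F n y))//; have /subsetPset := ndF _ _ mn; apply.
  have cv y : (\1_(F n) y : R) @[n --> \oo] --> (\1_(\bigcup_n F n) y : R).
    apply/cvg_ballP => e e0; rewrite indicE.
    case: (boolP (y \in \bigcup_n F n)) => [/set_mem[m _ Fm]|/negP yF].
      exists m => // n /= mn.
      rewrite indicE mem_set; first exact: ballxx.
      by have /subsetPset := ndF _ _ mn; apply.
    apply: nearW => n; rewrite indicE memNset; first exact: ballxx.
    by move=> yn; apply: yF; rewrite inE; exists n.
  have cvQ x : Q \1_(F n) x @[n --> \oo] --> Q \1_(\bigcup_n F n) x.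
    apply: (cvg_seq_sum (f := fun n y => w y * \1_(F n) y)
      (l := fun y => w y * \1_(\bigcup_n F n) y)) => y.
    by apply: cvgM; [exact: cvg_cst|exact: cv].
  have ndQ x : nondecreasing_seq (fun n => Q \1_(F n) x).
    by move=> m n mn; apply: ler_sum => y _; rewrite ler_wpM2l//; exact: nd.
  split.
  + exact: bigcupT_measurable.
  + apply: (measurable_fun_cvg (h := fun n => Q \1_(F n))) => //.
    by move=> n; case: (oF n).
  + have E1 : (\int[mu]_x (\1_(F n) (p x))%:E)%E @[n --> \oo] -->
        (\int[mu]_x (\1_(\bigcup_n F n) (p x))%:E)%E.
      have -> : (fun x => (\1_(\bigcup_n F n) (p x) : R)%:E) =
          (fun x => limn (fun n => (\1_(F n) (p x) : R)%:E)).
        by apply/funext => x; apply/esym/cvg_lim => //; apply: cvg_EFin; [exact: nearW|exact: cv].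
      apply: cvg_monotone_convergence => //.
      * by move=> n; exact: indm.
      * by move=> x _ m n mn; rewrite lee_fin; exact: nd.
    have E2 : (\int[mu]_x (Q \1_(F n) (p' x))%:E)%E @[n --> \oo] -->
        (\int[mu]_x (Q \1_(\bigcup_n F n) (p' x))%:E)%E.
      have -> : (fun x => (Q \1_(\bigcup_n F n) (p' x))%:E) =
          (fun x => limn (fun n => (Q \1_(F n) (p' x))%:E)).
        by apply/funext => x; apply/esym/cvg_lim => //; apply: cvg_EFin; [exact: nearW|exact: cvQ].
      apply: cvg_monotone_convergence => //.
      * by move=> n; exact: okm.
      * by move=> n x _; rewrite lee_fin.
      * by move=> x _ m n mn; rewrite lee_fin; exact: ndQ.
    rewrite -(cvg_lim _ E1)// -(cvg_lim _ E2)//; apply: congr_lim.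
    by apply/funext => n; case: (oF n).
Qed.

End dynkin_extension.

Section extension.
Import HBNNSimple.
Context {R : realType} {d} {S : measurableType d} (mu : probability S R).
Variables (s : S -> seq S) (w : S -> R) (p p' : S -> S).
Hypothesis w0 : forall y, 0 <= w y.
Hypotheses (mp : measurable_fun setT p) (mp' : measurable_fun setT p').

Let Q (F : S -> R) x := \sum_(y <- s x) w y * F y.

Hypothesis Qm : forall A, measurable A -> measurable_fun setT (Q \1_A).
Hypothesis Qi : forall A, measurable A ->
  (\int[mu]_x (\1_A (p x))%:E = \int[mu]_x (Q \1_A (p' x))%:E)%E.

Let Q_ge0 (F : S -> R) x : (forall y, 0 <= F y) -> 0 <= Q F x.
Proof. by move=> F0; apply: sumr_ge0 => y _; rewrite mulr_ge0. Qed.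

Let measp (F : S -> R) : measurable_fun setT F -> measurable_fun setT (fun x => F (p x) : R).
Proof. by move=> mF; exact: measurableT_comp. Qed.

Let measp' (F : S -> R) : measurable_fun setT F -> measurable_fun setT (fun x => F (p' x) : R).
Proof. by move=> mF; exact: measurableT_comp. Qed.

Let comb_eq (I : Type) (r : seq I) (c : I -> R) (A : I -> set S) :
  Q (fun x => \sum_(i <- r) c i * \1_(A i) x) = fun x => \sum_(i <- r) c i * Q \1_(A i) x.
Proof.
apply/funext => x; rewrite /Q.
under eq_bigr do rewrite mulr_sumr.
rewrite exchange_big; apply: eq_bigr => i _; rewrite mulr_sumr.
by apply: eq_bigr => y _; rewrite mulrCA.
Qed.

Let comb (I : Type) (r : seq I) (c : I -> R) (A : I -> set S) :
  (forall i, measurable (A i)) -> (forall i x, 0 <= c i * \1_(A i) x) ->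
  measurable_fun setT (Q (fun x => \sum_(i <- r) c i * \1_(A i) x)) /\
  (\int[mu]_x (\sum_(i <- r) c i * \1_(A i) (p x))%:E =
   \int[mu]_x (Q (fun x => \sum_(i <- r) c i * \1_(A i) x) (p' x))%:E)%E.
Proof.
move=> mA c0; have c0' i x : 0 <= c i * Q \1_(A i) x.
  rewrite /Q mulr_sumr; apply: sumr_ge0 => y _.
  by rewrite mulrCA mulr_ge0.
rewrite comb_eq; split.
  apply: measurable_sum => i; apply: measurable_funM => //.
  exact: Qm.
under eq_integral do rewrite -sumEFin.
under [in RHS]eq_integral do rewrite -sumEFin.
rewrite !ge0_integral_sum//; last 4 first.
- move=> i; apply/measurable_EFinP; apply: measurable_funM => //.
  exact/measp'/Qm.
- by move=> i x _; rewrite lee_fin.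
- move=> i; apply/measurable_EFinP; apply: measurable_funM => //.
  by apply: (measp (F := \1_(A i))); exact: measurable_indic.
- by move=> i x _; rewrite lee_fin.
apply: eq_bigr => i _.
have [ci|ci] := leP 0 (c i).
  under eq_integral do rewrite EFinM.
  under [in RHS]eq_integral do rewrite EFinM.
  rewrite !ge0_integralZl//; last 3 first.
  - exact/measurable_EFinP/measp'/Qm.
  - by move=> x _; rewrite lee_fin; apply: Q_ge0 => y; rewrite indicE.
  - apply/measurable_EFinP; apply: (measp (F := \1_(A i))); exact: measurable_indic.
  by congr (_ * _)%E; exact: Qi.
(* Here [c i < 0], so nonnegativity of the terms forces [A i] to be empty. *)
have A0 y : (\1_(A i) y : R) = 0.
  by apply/eqP; rewrite eq_le indicE ler0n andbT; have := c0 i y; rewrite indicE; nra.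
apply: eq_integral => x _; rewrite A0; congr (_%:E); congr (_ * _).
by rewrite /Q big1// => y _; rewrite A0 mulr0.
Qed.

Lemma extension (F : S -> R) : measurable_fun setT F -> (forall x, 0 <= F x) ->
  measurable_fun setT (Q F) /\
  (\int[mu]_x (F (p x))%:E = \int[mu]_x (Q F (p' x))%:E)%E.
Proof.
move=> mF F0.
have mEF : measurable_fun setT (fun x => (F x)%:E) by exact/measurable_EFinP.
have EF0 x : setT x -> (0 <= (F x)%:E)%E by move=> _; rewrite lee_fin.
pose g := nnsfun_approx measurableT mEF.
have gF x : (g n x) @[n --> \oo] --> F x.
  have h : (fun n => (g n x)%:E) @ \oo --> (F x)%:E.
    exact: (@cvg_nnsfun_approx _ _ _ _ measurableT _ mEF EF0 x I).
  exact: (fine_cvg h).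
have g_nd x : nondecreasing_seq (fun n => g n x).
  by move=> m n mn; have /lefP := nd_nnsfun_approx measurableT mEF mn; apply.
have gE n : exists (I : eqType) (r : seq I) (c : I -> R) (A : I -> set S),
    [/\ (forall i, measurable (A i)), (forall i x, 0 <= c i * \1_(A i) x) &
      g n = (fun x => \sum_(i <- r) c i * \1_(A i) x) :> (S -> R)].
  exists R, (fset_set (range (g n))), id, (fun y => g n @^-1` [set y]); split.
  - by move=> y; exact: measurable_sfunP.
  - by move=> y x; rewrite -lee_fin EFinM nnfun_muleindic_ge0.
  - by apply/funext => x; rewrite fimfunE fsbig_finite.
have gm n : measurable_fun setT (Q (g n)).
  have [I [r [c [A [mA cA ->]]]]] := gE n.
  by have [] := comb r mA cA.
have gi n : (\int[mu]_x (g n (p x))%:E = \int[mu]_x (Q (g n) (p' x))%:E)%E.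
  have [I [r [c [A [mA cA ->]]]]] := gE n.
  by have [] := comb r mA cA.
have QgF x : Q (g n) x @[n --> \oo] --> Q F x.
  apply: (cvg_seq_sum (f := fun n y => w y * g n y) (l := fun y => w y * F y)) => y.
  by apply: cvgM; [exact: cvg_cst|exact: gF].
have Qg_nd x : nondecreasing_seq (fun n => Q (g n) x).
  by move=> m n mn; apply: ler_sum => y _; rewrite ler_wpM2l// g_nd.
split; first by apply: (measurable_fun_cvg (h := fun n => Q (g n))).
have E1 : (\int[mu]_x (g n (p x))%:E)%E @[n --> \oo] --> (\int[mu]_x (F (p x))%:E)%E.
  have -> : (fun x => (F (p x))%:E) = (fun x => limn (fun n => (g n (p x))%:E)).
    by apply/funext => x; apply/esym/cvg_lim => //; apply: cvg_EFin; [exact: nearW|exact: gF].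
  apply: cvg_monotone_convergence => //.
  - by move=> n; apply/measurable_EFinP; apply: (measp (F := g n)).
  - by move=> n x _; rewrite lee_fin.
  - by move=> x _ m n mn; rewrite lee_fin g_nd.
have E2 : (\int[mu]_x (Q (g n) (p' x))%:E)%E @[n --> \oo] --> (\int[mu]_x (Q F (p' x))%:E)%E.
  have -> : (fun x => (Q F (p' x))%:E) = (fun x => limn (fun n => (Q (g n) (p' x))%:E)).
    by apply/funext => x; apply/esym/cvg_lim => //; apply: cvg_EFin; [exact: nearW|exact: QgF].
  apply: cvg_monotone_convergence => //.
  - by move=> n; apply/measurable_EFinP; apply: measp'; exact: gm.
  - by move=> n x _; rewrite lee_fin; apply: Q_ge0.
  - by move=> x _ m n mn; rewrite lee_fin Qg_nd.
by rewrite -(cvg_lim _ E1)// -(cvg_lim _ E2)//; apply: congr_lim; apply/funext.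
Qed.

End extension.

Section borel_continuous.
Context {R : realType} {X : completeMetricType R}.

Lemma continuous_borel_real (f : X -> R) : continuous f ->
  measurable_fun setT (f : borel X -> R).
Proof.
move=> cf; apply: (measurability _ (RGenOpens.measurableE R)).
move=> _ [_ [a [b ->]] <-]; rewrite setTI.
apply: sub_sigma_algebra; move/continuousP : cf; apply.
exact: interval_open.
Qed.

Lemma continuous_borel (g : X -> X) : continuous g ->
  measurable_fun setT (g : borel X -> borel X).
Proof.
move=> cg; apply: (@measurability _ _ (borel X) (borel X) setT g (@open X)) => //.
move=> _ [U oU <-]; rewrite setTI.
by apply: sub_sigma_algebra; move/continuousP : cg; apply.
Qed.

End borel_continuous.

Section bounded_expectation.
Context {R : realType} {d} {S : measurableType d} (mu : probability S R).

Lemma bounded_integrable (F : S -> R) (t : R) : measurable_fun setT F ->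
  (forall x, `|F x| <= t) -> mu.-integrable setT (EFin \o F).
Proof.
move=> mF Ft; apply/integrableP; split; first exact/measurable_EFinP.
apply: (@le_lt_trans _ _ (\int[mu]_x (cst t%:E x))%E).
  apply: ge0_le_integral => //.
  - by apply/measurable_EFinP; exact: measurableT_comp.
  - by move=> x _; rewrite /= lee_fin.
rewrite integral_cst//=; apply: (@le_lt_trans _ _ (t%:E * 1)%E).
  rewrite lee_wpmul2l ?probability_le1//.
  by rewrite lee_fin (le_trans (normr_ge0 _) (Ft point)).
by rewrite mule1 ltry.
Qed.

Lemma Rintegral_EFin (F : S -> R) (t : R) : measurable_fun setT F ->
  (forall x, `|F x| <= t) -> (\int[mu]_x (F x)%:E)%E = (\int[mu]_x F x)%:E.
Proof.
move=> mF Ft; rewrite /Rintegral fineK//.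
exact: integrable_fin_num (bounded_integrable mF Ft).
Qed.

Lemma le_Rint (F G : S -> R) (t : R) : measurable_fun setT F -> measurable_fun setT G ->
  (forall x, `|F x| <= t) -> (forall x, `|G x| <= t) -> (forall x, F x <= G x) ->
  \int[mu]_x F x <= \int[mu]_x G x.
Proof.
by move=> mF mG Ft Gt FG; apply: le_Rintegral => //; exact: bounded_integrable.
Qed.

Lemma Rint_cst (c : R) : \int[mu]_x c = c.
Proof.
have -> := Rintegral_cst mu measurableT c.
by rewrite [X in fine X](@probability_setT _ _ _ mu) mulr1.
Qed.

Lemma RintD (F G : S -> R) (t : R) : measurable_fun setT F -> measurable_fun setT G ->
  (forall x, `|F x| <= t) -> (forall x, `|G x| <= t) ->
  \int[mu]_x (F x + G x) = \int[mu]_x F x + \int[mu]_x G x.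
Proof.
by move=> mF mG Ft Gt; apply: RintegralD => //; exact: bounded_integrable.
Qed.

Lemma RintZ (F : S -> R) (c t : R) : measurable_fun setT F ->
  (forall x, `|F x| <= t) -> \int[mu]_x (c * F x) = c * \int[mu]_x F x.
Proof.
by move=> mF Ft; apply: RintegralZl => //; exact: bounded_integrable.
Qed.

End bounded_expectation.

Lemma dirac_Rint {R : realType} {d} {S : measurableType d} (x0 : S) (F : S -> R) :
  measurable_fun setT F -> \int[\d_x0]_x F x = F x0.
Proof.
move=> mF; rewrite /Rintegral integral_dirac//; last exact/measurable_EFinP.
by rewrite diracT mul1e.
Qed.

(** * The reversed chain of an expanding semigroup *)

Section construct_chain.
Context {R : realType} {X : completeMetricType R} {W : finType}.
Variables (T : W -> X -> X) (a lam : R).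
Hypothesis hcont : forall i, continuous (T i).
Hypothesis hexp : finitely_ruelle_expanding a lam T.
Hypothesis hsurj : forall i y, exists x, T i x = y.
Hypothesis hap : finitely_aperiodic a T.
Variables (alpha : R) (phi : W -> X -> R) (om : nat -> W).
Hypothesis halpha : 0 < alpha <= 1.
Variable Hp : R.
Hypothesis phiH : forall i x y, `|phi i x - phi i y| <= Hp * mdist x y `^ alpha.
Hypothesis finfib : forall i x, finite_set (T i @^-1` [set x]).
Hypothesis Hp0 : 0 <= Hp.
Variable mu : probability (borel X) R.
Hypothesis hmu : is_limit_measure alpha T phi om mu.

Let i0 : W := om 0%N.
Let a0 : 0 < a := expanding_radius_gt0 hexp i0.
Let alpha0 : 0 < alpha. Proof. by have /andP[] := halpha. Qed.
Let alpha1 : alpha <= 1. Proof. by have /andP[] := halpha. Qed.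
Local Notation rr x y := (mdist x y `^ alpha).
Local Notation Qn := (Qop T phi om).
Local Notation Qt := (Qit T phi om).
Local Notation hd := (hdens T phi om).
Local Notation Xs k := (Tword T (subword om 0 k)).

Let hdens_pos n x : 0 < hd n x := hdens_gt0 hsurj phi om finfib n x.

Lemma reg2_continuous (F : X -> R) (t D : R) : 0 <= D ->
  reg2 a alpha F t D -> continuous F.
Proof.
move=> D0 [_ FD] x; apply/cvgrPdist_lt => e e0.
pose r := Num.min a ((e / (D + 1)) `^ alpha^-1).
have D10 : 0 < D + 1 by rewrite ltr_wpDl.
have r0 : 0 < r by rewrite lt_min a0 powR_gt0// divr_gt0.
apply: filterS (nbhsx_ballx x _ r0) => y; rewrite ballEmdist/= => xy.
have xya : mdist x y < a by apply: lt_le_trans xy _; rewrite ge_min lexx.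
apply: le_lt_trans (FD _ _ xya) _.
have rle : rr x y <= e / (D + 1).
  rewrite -[leRHS]powRr1 ?divr_ge0 ?(ltW e0) ?(ltW D10)//.
  rewrite -[X in _ <= _ `^ X](mulVf (lt0r_neq0 alpha0)) powRrM.
  apply: ge0_ler_powR; rewrite ?nnegrE ?mdist_ge0 ?powR_ge0 ?(ltW alpha0)//.
  by rewrite ltW// (lt_le_trans xy)// ge_min lexx orbT.
apply: (@le_lt_trans _ _ (D * (e / (D + 1)))); first exact: ler_wpM2l.
by rewrite mulrA ltr_pdivrMr// mulrC ltr_pM2l// ltrDl.
Qed.

Definition hold (F : X -> R) := (exists t, forall x, `|F x| <= t) /\
  exists2 H, 0 <= H & forall x y, `|F x - F y| <= H * rr x y.

Lemma hold_space F : hold F -> holder_space alpha F.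
Proof.
move=> [[t Ft] [H H0 HF]]; split; last exact: holder_of_bound HF.
exists t; split; first exact: num_real.
by move=> M tM x _ /=; rewrite (le_trans (Ft x))// ltW.
Qed.

Lemma space_hold F : holder_space alpha F -> hold F.
Proof.
move=> [[M [_ hM]] hF]; split; last exact: holder_bound.
by exists (M + 1) => x; apply: (hM (M + 1)) => //; rewrite ltrDl.
Qed.

Lemma reg2_hold F (t D : R) : 0 <= D -> reg2 a alpha F t D -> hold F.
Proof.
move=> D0 [Ft FD].
have t0 : 0 <= t by exact: le_trans (normr_ge0 _) (Ft point point).
split.
  exists (`|F point| + t) => x; have -> : F x = F point + (F x - F point) by ring.
  by apply: le_trans (ler_normD _ _) _; rewrite lerD2l.
have aa : 0 < a `^ alpha by rewrite powR_gt0.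
exists (D + t / a `^ alpha); first by rewrite addr_ge0// divr_ge0// ltW.
move=> x y; have [xya|axy] := ltP (mdist x y) a.
  apply: (le_trans (FD _ _ xya)); rewrite ler_wpM2r ?powR_ge0// lerDl.
  by rewrite divr_ge0// ltW.
apply: (le_trans (Ft x y)); rewrite mulrDl; apply: (@le_trans _ _ (t / a `^ alpha * rr x y)).
  rewrite -mulrA ler_peMr// mulrC ler_pdivlMr// mul1r.
  by apply: ge0_ler_powR; rewrite ?nnegrE ?mdist_ge0 ?(ltW a0) ?(ltW alpha0).
by rewrite lerDr mulr_ge0 ?powR_ge0.
Qed.

Lemma hold_reg2 F : hold F -> exists t D, [/\ 0 <= D, 0 <= t & reg2 a alpha F t D].
Proof.
move=> [[t Ft] [H H0 HF]]; exists (t + t), H; split => //.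
  by have := le_trans (normr_ge0 _) (Ft point); lra.
split => [x y|x y _]; last exact: HF.
by apply: le_trans (ler_normB _ _) _; exact: lerD.
Qed.

Lemma hold_continuous F : hold F -> continuous F.
Proof. by move=> /hold_reg2[t [D [D0 _ /reg2_continuous]]]; exact. Qed.

Lemma hold_Qop n F : hold F -> hold (Qn n F).
Proof.
move=> /hold_reg2[t [D [D0 t0 r]]].
have h := Qop_reg2 hexp hsurj om alpha0 phiH finfib Hp0 n D0 r.
apply: reg2_hold h; apply: addr_ge0; apply: mulr_ge0 => //; first exact: powR_ge0.
exact: (C3_ge0 hexp om alpha0 Hp0).
Qed.

Lemma hold_Qit n l F : hold F -> hold (Qt n l F).
Proof. by move=> hF; elim: l => [//|l IH] /=; exact: hold_Qop. Qed.

Lemma holdD F G : hold F -> hold G -> hold (fun x => F x + G x).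
Proof.
move=> [[t Ft] [H H0 HF]] [[u Gu] [K K0 KG]]; split.
  by exists (t + u) => x; apply: le_trans (ler_normD _ _) _; exact: lerD.
exists (H + K); first exact: addr_ge0.
move=> x y; rewrite opprD addrACA mulrDl.
by apply: le_trans (ler_normD _ _) _; exact: lerD.
Qed.

Lemma hold_cst c : hold (fun=> c).
Proof.
split; first by exists `|c|.
by exists 0 => // x y; rewrite subrr normr0 mul0r.
Qed.

Lemma holdM F G : hold F -> hold G -> hold (fun x => F x * G x).
Proof.
move=> [[t Ft] [H H0 HF]] [[u Gu] [K K0 KG]]; split.
  by exists (t * u) => x; rewrite normrM ler_pM.
exists (t * K + u * H).
  by rewrite addr_ge0 ?mulr_ge0//; [apply: le_trans (Ft point)|apply: le_trans (Gu point)].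
move=> x y; have -> : F x * G x - F y * G y = F x * (G x - G y) + G y * (F x - F y) by ring.
apply: le_trans (ler_normD _ _) _; rewrite !normrM mulrDl -!mulrA.
by apply: lerD; apply: ler_pM.
Qed.

(** Beyond the distance [a] the bound is trivial: the diameter [Dm] is at most [Dm / a] times the
    distance. *)
Lemma locally_lipschitz_comp : exists2 Qm, 1 <= Qm &
  forall i x y, mdist (T i x) (T i y) <= Qm * mdist x y.
Proof.
have [Dm Dm1 hD] := bounded_space hexp hsurj i0 hap.
have [Q Q1 hQ] := locally_lipschitz hexp.
exists (Q + Dm / a).
  apply: (le_trans Q1); rewrite lerDl divr_ge0 ?(ltW a0)//; exact: le_trans Dm1.
move=> i x y; have Da : 0 <= Dm / a by rewrite divr_ge0 ?(ltW a0)//; exact: le_trans Dm1.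
have [xya|axy] := ltP (mdist x y) a.
  apply: (le_trans (hQ i _ _ xya)); rewrite ler_wpM2r ?mdist_ge0// lerDl//.
apply: (le_trans (hD _ _)); rewrite mulrDl.
apply: (@le_trans _ _ (Dm / a * mdist x y)).
  by rewrite -mulrA ler_peMr ?(le_trans ler01)// mulrC ler_pdivlMr// mul1r.
by rewrite lerDr mulr_ge0 ?mdist_ge0// (le_trans ler01).
Qed.

Lemma hold_comp1 i F : hold F -> hold (F \o T i).
Proof.
move=> [[t Ft] [H H0 HF]]; split; first by exists t => x; exact: Ft.
have [Q Q1 hQ] := locally_lipschitz_comp.
have Q0 : 0 <= Q by exact: le_trans Q1.
exists (H * Q `^ alpha); first by rewrite mulr_ge0 ?powR_ge0.
move=> x y; apply: (le_trans (HF _ _)); rewrite -mulrA ler_wpM2l//.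
rewrite -powRM ?mdist_ge0//; apply: ge0_ler_powR; rewrite ?nnegrE ?mdist_ge0 ?(ltW alpha0)//.
by rewrite mulr_ge0 ?mdist_ge0.
Qed.

Lemma hold_comp k F : hold F -> hold (F \o Xs k).
Proof.
move=> hF; elim: k F hF => [|k IH] F hF.
  by rewrite (_ : _ \o _ = F)//; apply/funext.
rewrite (_ : F \o _ = (F \o T (om k)) \o Xs k).
  by apply: IH; exact: hold_comp1.
by apply/funext => x; rewrite /comp subwordS Tword_rcons add0n.
Qed.

Lemma transfer_iterQ l F x : transfer_iter T phi om l F x = hd l x * Qt 0 l F x.
Proof.
elim: l x => [|l IH] x; first by rewrite /= mul1r.
rewrite [Qt _ _ _]/= add0n (QopE phi om finfib) mulrCA divff ?mulr1; last exact: lt0r_neq0 (hdens_pos l.+1 x).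
by rewrite [LHS]/=; apply: eq_bigr => y _; rewrite IH.
Qed.

Lemma transfer_ratio l F x :
  fine (transfer T phi (prefix_word om l) F x) /
  fine (transfer T phi (prefix_word om l) (cst 1) x) = Qt 0 l F x.
Proof.
rewrite !(transferE phi om finfib) !transfer_iterQ Qit_cst// mulr1 mulrAC divff ?mul1r//.
exact: lt0r_neq0 (hdens_pos l x).
Qed.

(** A Dirac mass taken for [nu] turns the defining limit of integrals into pointwise convergence at
    [point]. *)
Lemma limit_measureE F : hold F ->
  (fun l => Qt 0 l F point) @ \oo --> \int[mu]_x F x.
Proof.
move=> hF; have := hmu (@dirac _ (borel X) point R) (hold_space hF).
set u := fun l => _; suff -> : u = (fun l => Qt 0 l F point) by [].
apply/funext => l; rewrite /u; under eq_Rintegral do rewrite transfer_ratio.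
rewrite dirac_Rint//; apply: continuous_borel_real.
exact/hold_continuous/hold_Qit.
Qed.

Lemma Qit_comp k l F : Qt 0 (k + l) (F \o Xs k) = Qt k l F.
Proof.
rewrite (Qit_add T phi om) add0n; congr (Qit _ _ _ _ _ _).
apply/funext => x; have := Qit_pull phi om finfib 0 k (fun=> 1) F x.
rewrite (Qit_cst hsurj phi om finfib) mulr1 => <-.
by congr (Qit _ _ _ _ _ _); apply/funext => y; rewrite mul1r.
Qed.

(** Both sides are limits of the same sequence up to a shift. Composition with the state at time [k]
    cancels the first [k] steps ([Qit_comp]), and iterating from time [k] on [F] is the same as
    iterating from [k.+1] on [Qn k F]. *)
Lemma duality_hold k F : hold F ->
  \int[mu]_x F (Xs k x) = \int[mu]_x Qn k F (Xs k.+1 x).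
Proof.
move=> hF.
have h1 := limit_measureE (hold_comp k hF).
have h2 := limit_measureE (hold_comp k.+1 (hold_Qop k hF)).
rewrite -(cvg_shiftn k.+1) in h1; rewrite -(cvg_shiftn k.+1) in h2.
apply: (cvg_unique (@Rhausdorff R) h1); apply: cvg_trans h2; apply: near_eq_cvg.
apply: nearW => l /=; rewrite [(l + k.+1)%N]addnC Qit_comp addSnnS Qit_comp.
by rewrite -(add1n l) (Qit_add T phi om) addn1 /= addn0.
Qed.

Lemma Xs_continuous k : continuous (Xs k).
Proof.
elim: k => [|k IH] x; first exact: cvg_id.
have -> : Xs k.+1 = T (om k) \o Xs k.
  by apply/funext => y; rewrite /comp subwordS Tword_rcons add0n.
by apply: continuous_comp; [exact: IH|exact: hcont].
Qed.

Lemma Xs_measurable k : measurable_fun setT (Xs k : borel X -> borel X).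
Proof. by apply: continuous_borel; exact: Xs_continuous. Qed.

Lemma Xs_comp_measurable k (F : borel X -> R) : measurable_fun setT F ->
  measurable_fun setT (fun x : borel X => F (Xs k x)).
Proof. by move=> mF; apply: (measurableT_comp mF); exact: Xs_measurable. Qed.

Lemma hold_measurable F : hold F -> measurable_fun setT (F : borel X -> R).
Proof. by move=> hF; apply: continuous_borel_real; exact: hold_continuous. Qed.

Lemma duality_hold_ereal k F : hold F ->
  (\int[mu]_x (F (Xs k x))%:E = \int[mu]_x (Qn k F (Xs k.+1 x))%:E)%E.
Proof.
move=> hF; have hQ := hold_Qop k hF.
have [[t Ft] _] := hF; have [[u Qu] _] := hQ.
rewrite (@Rintegral_EFin _ _ (borel X) mu (fun x => F (Xs k x)) t); last 2 first.
- by apply: Xs_comp_measurable; exact: hold_measurable.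
- by move=> x; exact: Ft.
rewrite (@Rintegral_EFin _ _ (borel X) mu (fun x => Qn k F (Xs k.+1 x)) u); last 2 first.
- by apply: (@Xs_comp_measurable k.+1 (Qn k F)); exact: hold_measurable.
- by move=> x; exact: Qu.
by rewrite duality_hold.
Qed.

Section open_approximation.
Variables (U : set X) (c0 : X).
Hypotheses (oU : open U) (c0U : ~ U c0).

Let C := ~` U.
Let dC x := inf [set mdist x c | c in C].

Let dC_lb x : has_lbound [set mdist x c | c in C].
Proof. by exists 0 => _ [c _ <-]; exact: mdist_ge0. Qed.

Let dC_ne x : [set mdist x c | c in C] !=set0.
Proof. by exists (mdist x c0), c0. Qed.

Let dC_le x c : C c -> dC x <= mdist x c.
Proof. by move=> Cc; apply: ge_inf => //; exists c. Qed.

Let dC_ge0 x : 0 <= dC x.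
Proof. by apply: lb_le_inf => // _ [c _ <-]; exact: mdist_ge0. Qed.

Let dC_lip x y : dC x <= mdist x y + dC y.
Proof.
rewrite -lerBlDl; apply: lb_le_inf => // _ [c Cc <-].
rewrite lerBlDl; apply: le_trans (metric_triangle _ y _); exact: dC_le.
Qed.

Let dC_out x : ~ U x -> dC x = 0.
Proof. by move=> Ux; apply/eqP; rewrite eq_le dC_ge0 andbT -(mdistxx x) dC_le. Qed.

Let dC_in x : U x -> 0 < dC x.
Proof.
move=> Ux; have : nbhs x U by exact: open_nbhs_nbhs.
rewrite -nbhs_ballE => -[e /= e0 eU].
apply: lt_le_trans e0 _; apply: lb_le_inf => // _ [c Cc <-].
rewrite leNgt; apply/negP => xc; apply: Cc; apply: eU.
by rewrite ballEmdist.
Qed.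

(** Truncated multiples of the distance to the complement increase to the indicator of [U]. They are
    Lipschitz, hence Hoelder because the space is bounded, so the duality already applies to
    them. *)
Let F k x := Num.min 1 (k%:R * dC x).

Let F_ge0 k x : 0 <= F k x.
Proof. by rewrite le_min ler01 mulr_ge0. Qed.

Let F_le1 k x : F k x <= 1.
Proof. by rewrite ge_min lexx. Qed.

Let F_nd x : nondecreasing_seq (F^~ x).
Proof.
move=> m n mn; rewrite /F le_min ge_min lexx/= ge_min; apply/orP; right.
by rewrite ler_wpM2r// ler_nat.
Qed.

Let F_cvg x : F k x @[k --> \oo] --> (\1_U x : R).
Proof.
have [Ux|Ux] := pselect (U x); last first.
  rewrite indicE memNset//= -[_%:R]/(0 : R).
  have -> : F^~ x = fun=> 0.
    by apply/funext => k; rewrite /F dC_out// mulr0; apply/min_idPr.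
  exact: cvg_cst.
rewrite indicE mem_set//= -[_%:R]/(1 : R).
have d0 := dC_in Ux.
apply: cvg_near_cst; exists (Num.bound (dC x)^-1) => // k /= hk.
apply/min_idPl; rewrite -ler_pdivrMr// mul1r.
apply: ltW; apply: lt_le_trans (archi_boundP _) _; first by rewrite invr_ge0 ltW.
by rewrite ler_nat.
Qed.

Let F_hold k : hold (F k).
Proof.
split; first by exists 1 => x; rewrite ger0_norm ?F_ge0 ?F_le1.
have [Dm Dm1 hD] := bounded_space hexp hsurj i0 hap.
have Dm0 : 0 < Dm by exact: lt_le_trans Dm1.
exists (k%:R * Dm `^ (1 - alpha)); first by rewrite mulr_ge0 ?powR_ge0.
move=> x y.
have dd : mdist x y <= Dm `^ (1 - alpha) * rr x y.
  have [->|xy] := eqVneq x y; first by rewrite mdistxx mulr_ge0 ?powR_ge0.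
  have d0 : 0 < mdist x y by rewrite mdist_gt0.
  rewrite -{1}(powRr1 (ltW d0)) -[X in _ `^ X](subrK alpha) powRD; last by apply/implyP => _; rewrite gt_eqF.
  rewrite ler_wpM2r ?powR_ge0//; apply: ge0_ler_powR; rewrite ?nnegrE ?subr_ge0 ?(ltW d0) ?(ltW Dm0)//.
have key u v : F k u - F k v <= k%:R * mdist u v.
  have h : k%:R * dC u <= k%:R * (mdist u v + dC v) by rewrite ler_wpM2l.
  have h0 : 0 <= k%:R * mdist u v by rewrite mulr_ge0 ?mdist_ge0.
  move: h; rewrite mulrDr lerBlDr /F => h.
  rewrite /Num.min; do 2 case: ifP; lra.
apply: (@le_trans _ _ (k%:R * mdist x y)).
  by rewrite ler_norml key lerNl opprB metric_sym key.
by rewrite -mulrA ler_wpM2l.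
Qed.

Lemma open_duality k : measurable_fun setT (Qn k \1_U : borel X -> R) /\
  (\int[mu]_x (\1_U (Xs k x))%:E = \int[mu]_x (Qn k \1_U (Xs k.+1 x))%:E)%E.
Proof.
have cvQ x : Qn k (F n) x @[n --> \oo] --> Qn k \1_U x.
  apply: (cvg_seq_sum (f := fun n y => weight T phi om k y * F n y)
      (l := fun y => weight T phi om k y * \1_U y)) => y.
  by apply: cvgM; [exact: cvg_cst|exact: F_cvg].
have w0 y : 0 <= weight T phi om k y by apply: ltW; exact: weight_gt0.
have ndQ x : nondecreasing_seq (fun n => Qn k (F n) x).
  by move=> m n mn; apply: ler_sum => y _; rewrite ler_wpM2l//; exact: F_nd.
have mF n : measurable_fun setT (fun x : borel X => F n (Xs k x)).
  by apply: Xs_comp_measurable; apply: hold_measurable; exact: F_hold.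
have mQF n : measurable_fun setT (fun x : borel X => Qn k (F n) (Xs k.+1 x)).
  apply: (@Xs_comp_measurable k.+1 (Qn k (F n))).
  by apply: hold_measurable; apply: hold_Qop; exact: F_hold.
split.
  apply: (@measurable_fun_cvg _ (borel X) _ _ (fun n => Qn k (F n))) => //.
  by move=> n; apply: hold_measurable; apply: hold_Qop; exact: F_hold.
have E1 : (\int[mu]_x (F n (Xs k x))%:E)%E @[n --> \oo] --> (\int[mu]_x (\1_U (Xs k x))%:E)%E.
  have -> : (fun x => (\1_U (Xs k x) : R)%:E) = (fun x => limn (fun n => (F n (Xs k x))%:E)).
    by apply/funext => x; apply/esym/cvg_lim => //; apply: cvg_EFin; [exact: nearW|exact: F_cvg].
  apply: (@cvg_monotone_convergence _ (borel X)) => //.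
  - by move=> n; apply/measurable_EFinP.
  - by move=> n x _; rewrite lee_fin.
  - by move=> x _ m n mn; rewrite lee_fin; exact: F_nd.
have E2 : (\int[mu]_x (Qn k (F n) (Xs k.+1 x))%:E)%E @[n --> \oo] -->
    (\int[mu]_x (Qn k \1_U (Xs k.+1 x))%:E)%E.
  have -> : (fun x => (Qn k \1_U (Xs k.+1 x))%:E) =
      (fun x => limn (fun n => (Qn k (F n) (Xs k.+1 x))%:E)).
    by apply/funext => x; apply/esym/cvg_lim => //; apply: cvg_EFin; [exact: nearW|exact: cvQ].
  apply: (@cvg_monotone_convergence _ (borel X)) => //.
  - by move=> n; apply/measurable_EFinP.
  - by move=> n x _; rewrite lee_fin; apply: Qop_ge0.
  - by move=> x _ m n mn; rewrite lee_fin; exact: ndQ.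
rewrite -(cvg_lim _ E1)// -(cvg_lim _ E2)//; apply: congr_lim.
by apply/funext => n; exact: duality_hold_ereal.
Qed.

End open_approximation.

Lemma borel_duality k (F : borel X -> R) : measurable_fun setT F -> (forall x, 0 <= F x) ->
  measurable_fun setT (Qn k F : borel X -> R) /\
  (\int[mu]_x (F (Xs k x))%:E = \int[mu]_x (Qn k F (Xs k.+1 x))%:E)%E.
Proof.
have w0 y : 0 <= weight T phi om k y by apply: ltW; exact: weight_gt0.
have QT x : \sum_(y <- fib T (om k) x) weight T phi om k y * \1_[set: borel X] y = 1 :> R.
  rewrite -[RHS](Qop_cst hsurj phi om finfib k 1 x).
  by apply: eq_bigr => y _; rewrite indicE in_setT.
have H A : @measurable _ (borel X) A -> measurable_fun setT (Qn k \1_A : borel X -> R) /\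
    (\int[mu]_x (\1_A (Xs k x))%:E = \int[mu]_x (Qn k \1_A (Xs k.+1 x))%:E)%E.
  apply: (@dynkin_extension _ _ (borel X) mu (fun x => fib T (om k) x) (weight T phi om k)
    (Xs k) (Xs k.+1) w0 (Xs_measurable k) (Xs_measurable k.+1) (@open X)) => //.
  - by move=> U V oU oV; exact: openI.
  - rewrite (_ : (fun x => _) = cst 1); first exact: measurable_cst.
    by apply/funext => x; exact: QT.
  - by apply: eq_integral => x _; rewrite QT indicE in_setT.
  (* The distance to the complement needs a point outside [U]; for the whole space the identity is
     just the normalization of the weights. *)
  - move=> U oU; have [UT|/existsNP[c Uc]] := pselect (forall c, U c); last exact: (open_duality oU Uc).
    have -> : U = setT by apply/seteqP; split.
    split; last by apply: eq_integral => x _; rewrite QT indicE in_setT.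
    rewrite (_ : (fun x => _) = cst 1); first exact: measurable_cst.
    by apply/funext => x; exact: QT.
move=> mF F0.
exact: (@extension _ _ (borel X) mu (fun x => fib T (om k) x) (weight T phi om k)
    (Xs k) (Xs k.+1) w0 (Xs_measurable k) (Xs_measurable k.+1)
    (fun A mA => (H A mA).1) (fun A mA => (H A mA).2) F mF F0).
Qed.

Lemma iter_stepE k x : iter_step (fun n => T (om n)) 0 k x = Xs k x.
Proof.
elim: k => [//|k IH]; rewrite [LHS]/= IH subwordS Tword_rcons//.
Qed.

Lemma Qop_measurable k (F : borel X -> R) : measurable_fun setT F ->
  measurable_fun setT (Qn k F : borel X -> R).
Proof.
move=> mF.
have -> : Qn k F = fun x => Qn k F^\+ x + (-1) * Qn k F^\- x.
  apply/funext => x; rewrite -QopZ -QopD; apply: eq_bigr => y _; congr (_ * _).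
  by rewrite mulN1r; have := congr1 (fun h : X -> R => h y) (funrposBneg F) => <-.
apply: measurable_funD.
  by have [] := @borel_duality k (F^\+) (measurable_funrpos mF) (funrpos_ge0 F).
apply: measurable_funM => //.
by have [] := @borel_duality k (F^\-) (measurable_funrneg mF) (funrneg_ge0 F).
Qed.

Definition expanding_chain : reverse_chain mu.
Proof.
refine (@ReverseChain R _ (borel X) mu (fun n => T (om n)) (fun n => Qop T phi om n)
  _ _ _ _ _ _ _ _ _).
- by move=> n; exact: continuous_borel.
- by move=> n F G; apply/funext => x; exact: QopD.
- by move=> n c F; apply/funext => x; exact: QopZ.
- by move=> n c; apply/funext => x; exact: Qop_cst.
- by move=> n F x F0; exact: Qop_ge0.
- by move=> n F y F0; exact: Qop_gt0.
- by move=> n F G; apply/funext => x; exact: Qop_pull.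
- by move=> n F; exact: Qop_measurable.
- move=> n F mF F0.
  under eq_integral do rewrite iter_stepE.
  under [in RHS]eq_integral do rewrite iter_stepE.
  by have [_] := borel_duality n mF F0.
Defined.

End construct_chain.

(** * Martingale decomposition *)

Section bounded_sums.
Context {R : realType} {d} {S : measurableType d} (mu : probability S R).

Lemma Rint_sum (I : Type) (r : seq I) (F : I -> S -> R) (t : I -> R) :
  (forall i, measurable_fun setT (F i)) -> (forall i x, `|F i x| <= t i) ->
  \int[mu]_x (\sum_(i <- r) F i x) = \sum_(i <- r) \int[mu]_x F i x.
Proof.
move=> mF Ft; elim: r => [|i r IH].
  by rewrite big_nil; under eq_Rintegral do rewrite big_nil; exact: Rint_cst.
rewrite big_cons -IH; under eq_Rintegral do rewrite big_cons.
have t0 j : 0 <= t j by exact: le_trans (normr_ge0 _) (Ft j point).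
apply: (@RintD _ _ _ _ _ _ (t i + \sum_(j <- r) t j)).
- exact: mF.
- by apply: measurable_sum.
- by move=> x; apply: (le_trans (Ft i x)); rewrite lerDl sumr_ge0.
- move=> x; apply: le_trans (ler_norm_sum _ _ _) _.
  by rewrite -[leLHS]add0r; apply: lerD => //; apply: ler_sum => j _.
Qed.

Lemma chebyshev_bounded (F : S -> R) (t b : R) : measurable_fun setT F ->
  (forall x, `|F x| <= b) -> 0 < t ->
  (mu [set x | (t <= `|F x|)%R] <= ((\int[mu]_x (F x ^+ 2)) / t ^+ 2)%:E)%E.
Proof.
move=> mF Fb t0.
have mA : measurable [set x | t <= `|F x|].
  rewrite (_ : [set x | _] = (fun x => `|F x|) @^-1` `[t, +oo[%classic); last first.
    by apply/seteqP; split => x /=; rewrite in_itv/= andbT.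
  by rewrite -[X in measurable X]setTI; apply: measurableT_comp.
have F2 x : `|F x ^+ 2| <= b ^+ 2 by rewrite normrX lerXn2r ?nnegrE// (le_trans (normr_ge0 _) (Fb x)).
have mF2 : measurable_fun setT (fun x => F x ^+ 2) by exact: measurable_funX.
rewrite EFinM; have -> : mu [set x | t <= `|F x|] =
    (\int[mu]_x (\1_[set x | t <= `|F x|] x)%:E)%E by rewrite integral_indic// setIT.
rewrite -(Rintegral_EFin mu mF2 F2) muleC -ge0_integralZl//; last 3 first.
- by apply/measurable_EFinP.
- by move=> x _; rewrite lee_fin sqr_ge0.
- by rewrite lee_fin invr_ge0 sqr_ge0.
apply: ge0_le_integral => //.
- by apply/measurable_EFinP; exact: measurable_indic.
- by apply/measurable_EFinP; apply: measurable_funM.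
move=> x _; rewrite -EFinM lee_fin indicE.
case: (boolP (x \in _)) => [/set_mem/= tx|_]; last by rewrite mulr_ge0 ?sqr_ge0 ?invr_ge0 ?sqr_ge0.
rewrite mulrC ler_pdivlMr ?exprn_gt0// mul1r -(real_normK (num_real (F x))).
by rewrite lerXn2r ?nnegrE// ltW.
Qed.

(** Minkowski's inequality from Young's inequality with a parameter [q]: the choice [q = D / |F|],
    with the L2 norm of [F], makes the bound a perfect square. The factor 2 leaves room for [q = 1]
    when [F] has norm 0. *)
Lemma L2_perturb (F K : S -> R) (D b : R) : measurable_fun setT F -> measurable_fun setT K ->
  (forall x, `|F x| <= b) -> 0 < D -> (forall x, `|F x - K x| <= D) ->
  Num.sqrt (\int[mu]_x (K x ^+ 2)) <= Num.sqrt (\int[mu]_x (F x ^+ 2)) + 2 * D.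
Proof.
move=> mF mK Fb D0 FK.
have b0 : 0 <= b by exact: le_trans (normr_ge0 _) (Fb point).
have F2 x : `|F x ^+ 2| <= b ^+ 2 by rewrite normrX lerXn2r ?nnegrE.
have Kb x : `|K x| <= b + D.
  have -> : K x = F x - (F x - K x) by ring.
  by apply: le_trans (ler_normB _ _) _; exact: lerD.
have key q : 0 < q -> \int[mu]_x (K x ^+ 2) <= (1 + q) * \int[mu]_x (F x ^+ 2) + (1 + q^-1) * D ^+ 2.
  move=> q0; have iq : 0 < q^-1 by rewrite invr_gt0.
  rewrite -(RintZ mu (1 + q) (t := b ^+ 2))//; last exact: measurable_funX.
  rewrite -[X in _ + X](Rint_cst mu).
  have mqF : measurable_fun setT (fun x => (1 + q) * F x ^+ 2).
    by apply: measurable_funM => //; exact: measurable_funX.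
  have bqF x : `|(1 + q) * F x ^+ 2| <= (1 + q) * b ^+ 2 + (1 + q^-1) * D ^+ 2.
    rewrite normrM gtr0_norm ?addr_gt0//.
    apply: (@le_trans _ _ ((1 + q) * b ^+ 2)); first by rewrite ler_wpM2l// addr_ge0// ltW.
    by rewrite lerDl mulr_ge0 ?sqr_ge0// addr_ge0// ltW.
  rewrite -(@RintD _ _ _ mu (fun x => (1 + q) * F x ^+ 2) (fun=> (1 + q^-1) * D ^+ 2)
    ((1 + q) * b ^+ 2 + (1 + q^-1) * D ^+ 2))//; last first.
    move=> _; rewrite ger0_norm; last by rewrite mulr_ge0 ?sqr_ge0// addr_ge0// ltW.
    by rewrite lerDr mulr_ge0 ?sqr_ge0// addr_ge0// ltW.
  have le1 x : K x ^+ 2 <= (1 + q) * F x ^+ 2 + (1 + q^-1) * D ^+ 2.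
    have h : (F x - K x) ^+ 2 <= D ^+ 2.
      by rewrite -(real_normK (num_real (F x - K x))) lerXn2r ?nnegrE// ltW.
    have h2 : 0 <= q^-1 * (q * F x + (F x - K x)) ^+ 2 by rewrite mulr_ge0 ?sqr_ge0// ltW.
    have -> : K x ^+ 2 = (1 + q) * F x ^+ 2 + (1 + q^-1) * (F x - K x) ^+ 2
        - q^-1 * (q * F x + (F x - K x)) ^+ 2.
      by field; rewrite gt_eqF.
    have : (1 + q^-1) * (F x - K x) ^+ 2 <= (1 + q^-1) * D ^+ 2.
      by rewrite ler_wpM2l// addr_ge0// ltW.
    lra.
  apply: (@le_Rint _ _ _ mu _ _ ((b + D) ^+ 2 + ((1 + q) * b ^+ 2 + (1 + q^-1) * D ^+ 2))).
  - exact: measurable_funX.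
  - by apply: measurable_funD.
  - move=> x; rewrite normrX; apply: (@le_trans _ _ ((b + D) ^+ 2)).
      by rewrite lerXn2r ?nnegrE// addr_ge0// ltW.
    by rewrite lerDl addr_ge0// mulr_ge0 ?sqr_ge0// addr_ge0// ltW.
  - move=> x; rewrite ger0_norm; last by rewrite (le_trans _ (le1 x))// sqr_ge0.
    apply: (@le_trans _ _ ((1 + q) * b ^+ 2 + (1 + q^-1) * D ^+ 2)); last by rewrite lerDr sqr_ge0.
    rewrite lerD2r ler_wpM2l//; first by rewrite addr_ge0// ltW.
    by have := F2 x; rewrite ger0_norm ?sqr_ge0.
  - exact: le1.
set EF := \int[mu]_x (F x ^+ 2) in key *; set EK := \int[mu]_x (K x ^+ 2) in key *.
have EF0 : 0 <= EF by apply: Rintegral_ge0 => x _; exact: sqr_ge0.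
have rhs0 : 0 <= Num.sqrt EF + 2 * D by rewrite addr_ge0 ?sqrtr_ge0// mulr_ge0// ltW.
rewrite -(ger0_norm rhs0) -sqrtr_sqr; apply: ler_wsqrtr.
have [EF1|EF1] := ltP 0 EF; last first.
  have -> : EF = 0 by apply/eqP; rewrite eq_le EF1.
  have := key 1 ltr01; have -> : EF = 0 by apply/eqP; rewrite eq_le EF1.
  rewrite sqrtr0 invr1; nra.
have s0 : 0 < Num.sqrt EF by rewrite sqrtr_gt0.
have := key (D / Num.sqrt EF) (divr_gt0 D0 s0).
have e : EF = Num.sqrt EF ^+ 2 by rewrite sqr_sqrtr.
move: s0 e; move: (Num.sqrt EF) => s s0 e; rewrite e.
have -> : (1 + D / s) * s ^+ 2 + (1 + (D / s)^-1) * D ^+ 2 = (s + D) ^+ 2.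
  by field; rewrite !gt_eqF.
move=> /le_trans; apply; nra.
Qed.

End bounded_sums.

Section martingale.
Context {R : realType} {X : completeMetricType R} {W : finType}.
Variables (T : W -> X -> X) (a lam : R).
Hypothesis hcont : forall i, continuous (T i).
Hypothesis hexp : finitely_ruelle_expanding a lam T.
Hypothesis hsurj : forall i y, exists x, T i x = y.
Hypothesis hap : finitely_aperiodic a T.
Variables (alpha : R) (phi : W -> X -> R) (om : nat -> W).
Hypothesis halpha : 0 < alpha <= 1.
Variable Hp : R.
Hypothesis phiH : forall i x y, `|phi i x - phi i y| <= Hp * mdist x y `^ alpha.
Hypothesis finfib : forall i x, finite_set (T i @^-1` [set x]).
Hypothesis Hp0 : 0 <= Hp.
Variable mu : probability (borel X) R.
Hypothesis hmu : is_limit_measure alpha T phi om mu.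

Let i0 : W := om 0%N.
Let a0 : 0 < a := expanding_radius_gt0 hexp i0.
Let alpha0 : 0 < alpha. Proof. by have /andP[] := halpha. Qed.
Let alpha1 : alpha <= 1. Proof. by have /andP[] := halpha. Qed.
Local Notation rr x y := (mdist x y `^ alpha).
Local Notation Qn := (Qop T phi om).
Local Notation Qt := (Qit T phi om).
Local Notation hd := (hdens T phi om).
Local Notation Xs k := (Tword T (subword om 0 k)).

Local Notation hold := (hold alpha).
Implicit Types F K : X -> R.
Variables (Lam : R) (N : nat) (theta : R).
Hypotheses (Lam0 : 0 < Lam) (N0 : (0 < N)%N) (theta01 : 0 < theta < 1).
Local Notation reg := (reg a alpha Lam).
Hypothesis step_reg : forall n F (t : R), 0 <= t -> reg F t -> reg (Qn n F) t.
Hypothesis iter_reg : forall n F (t : R), 0 <= t -> reg F t -> reg (Qt n N F) (theta * t).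
Variable f : X -> R.
Hypothesis hf : hold f.

Let th0 : 0 < theta. Proof. by have /andP[] := theta01. Qed.
Let th1 : theta < 1. Proof. by have /andP[] := theta01. Qed.

Let G := N%:R / (1 - theta).

Lemma theta_sum (K : nat) : \sum_(0 <= j < K) theta ^+ (j %/ N) <= G.
Proof.
have t1 : 0 < 1 - theta by rewrite subr_gt0.
have key m : \sum_(0 <= j < m * N) theta ^+ (j %/ N) = N%:R * \sum_(0 <= i < m) theta ^+ i.
  elim: m => [|m IH]; first by rewrite mul0n !big_geq// mulr0.
  rewrite mulSn addnC (big_cat_nat (leq0n _) (leq_addr _ _))//= IH big_nat_recr//= mulrDr.
  congr (_ + _); rewrite -{1}[(m * N)%N]add0n big_addn addnC addnK.
  rewrite big_nat (eq_bigr (fun=> theta ^+ m)); last first.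
    by move=> i /andP[_ iN]; rewrite divnDMl// divn_small.
  by rewrite -big_nat big_const_nat subn0 iter_addr_0 mulr_natl.
apply: (@le_trans _ _ (\sum_(0 <= j < K * N) theta ^+ (j %/ N))).
  rewrite (big_cat_nat (leq0n _) (leq_pmulr K N0))//= lerDl.
  by apply: sumr_ge0 => i _; rewrite exprn_ge0// ltW.
rewrite key /G ler_wpM2l// -[(1 - theta)^-1]mul1r ler_pdivlMr//.
have -> : (\sum_(0 <= i < K) theta ^+ i) * (1 - theta) = 1 - theta ^+ K.
  rewrite big_mkord; elim: K => [|K IH]; first by rewrite big_ord0 mul0r expr0 subrr.
  by rewrite big_ord_recr/= mulrDl IH exprS; ring.
by rewrite gerBl exprn_ge0// ltW.
Qed.

Lemma G_ge0 : 0 <= G.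
Proof. by rewrite divr_ge0// subr_ge0 ltW. Qed.

Lemma regD F K (s t : R) : reg F s -> reg K t -> reg (fun x => F x + K x) (s + t).
Proof.
move=> [F1 F2] [K1 K2]; split => [x y|x y xy]; rewrite opprD addrACA.
  by apply: le_trans (ler_normD _ _) _; exact: lerD.
by apply: le_trans (ler_normD _ _) _; rewrite mulrDr mulrDl; apply: lerD; [exact: F2|exact: K2].
Qed.

Lemma reg_le F (s t : R) : s <= t -> reg F s -> reg F t.
Proof.
move=> st [F1 F2]; split => [x y|x y xy]; first exact: le_trans (F1 x y) st.
by apply: (le_trans (F2 _ _ xy)); rewrite ler_wpM2r ?powR_ge0// ler_wpM2l// ltW.
Qed.

Lemma regZ F (c t : R) : reg F t -> reg (fun x => c * F x) (`|c| * t).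
Proof.
move=> [F1 F2]; split => [x y|x y xy]; rewrite -mulrBr normrM.
  by rewrite ler_wpM2l.
by rewrite mulrCA -mulrA ler_wpM2l// F2.
Qed.

Lemma reg_shift F (c t : R) : reg F t -> reg (fun x => F x + c) t.
Proof. by move=> [F1 F2]; split => [x y|x y xy]; rewrite opprD addrACA subrr addr0; [exact: F1|exact: F2]. Qed.

Lemma reg_sqr F (b t : R) : 0 <= t -> (forall x, `|F x| <= b) -> reg F t ->
  reg (fun x => F x ^+ 2) (2 * b * t).
Proof.
move=> t0 Fb [F1 F2].
have key x y : `|F x ^+ 2 - F y ^+ 2| <= 2 * b * `|F x - F y|.
  have -> : F x ^+ 2 - F y ^+ 2 = (F x + F y) * (F x - F y) by ring.
  rewrite normrM ler_wpM2r//; apply: le_trans (ler_normD _ _) _.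
  by have := Fb x; have := Fb y; lra.
have b0 : 0 <= 2 * b by have := le_trans (normr_ge0 _) (Fb point); lra.
split => [x y|x y xy]; apply: (le_trans (key x y)); first by rewrite ler_wpM2l.
apply: (@le_trans _ _ (2 * b * (Lam * t * rr x y))); first by rewrite ler_wpM2l// F2.
by rewrite le_eqVlt; apply/orP; left; apply/eqP; ring.
Qed.

Lemma hold_reg F : hold F -> exists2 t, 0 <= t & reg F t.
Proof.
move=> [[t Ft] [H H0 HF]].
have t0 : 0 <= t by exact: le_trans (normr_ge0 _) (Ft point).
exists (t + t + H / Lam); first by rewrite !addr_ge0// divr_ge0// ltW.
split => [x y|x y xy].
  apply: le_trans (ler_normB _ _) _; rewrite -[leLHS]addr0.
  by apply: lerD; [exact: lerD|rewrite divr_ge0// ltW].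
apply: (le_trans (HF x y)); rewrite ler_wpM2r ?powR_ge0// mulrDr.
rewrite [X in _ + X]mulrCA divff ?mulr1; last exact: lt0r_neq0.
rewrite lerDr mulr_ge0 ?addr_ge0 ?(ltW Lam0)//.
Qed.

Lemma reg_hold F (t : R) : 0 <= t -> reg F t -> hold F.
Proof. by move=> t0; apply: (reg2_hold hexp om halpha); rewrite mulr_ge0// ltW. Qed.

Lemma duality_iter n l F : hold F ->
  \int[mu]_x F (Xs n x) = \int[mu]_x Qt n l F (Xs (n + l) x).
Proof.
move=> hF; elim: l => [|l IH]; first by rewrite addn0.
rewrite IH addnS (duality_hold hexp hsurj hap halpha phiH finfib Hp0 hmu)//.
exact: hold_Qit.
Qed.

Lemma hold_comp_sub n l F : hold F -> hold (fun x => F (Tword T (subword om n l) x)).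
Proof.
elim: l F => [//|l IH] F hF.
have -> : (fun x => F (Tword T (subword om n l.+1) x)) =
  fun x => (F \o T (om (n + l)%N)) (Tword T (subword om n l) x).
  by apply/funext => x; rewrite subwordS Tword_rcons.
by apply: IH; exact: (hold_comp1 hexp hsurj hap om halpha).
Qed.

Lemma Xs_add n l x : Xs (n + l) x = Tword T (subword om n l) (Xs n x).
Proof.
elim: l => [|l IH]; first by rewrite addn0.
by rewrite addnS !subwordS !Tword_rcons IH.
Qed.

Lemma duality_pair n l F K : hold F -> hold K ->
  \int[mu]_x (F (Xs n x) * K (Xs (n + l) x)) =
  \int[mu]_x (Qt n l F (Xs (n + l) x) * K (Xs (n + l) x)).
Proof.
move=> hF hK; have hFK := holdM hF (hold_comp_sub n l hK).
under eq_Rintegral do rewrite Xs_add.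
rewrite (duality_iter n l hFK); apply: eq_Rintegral => x _.
by rewrite (Qit_pull phi om finfib) mulrC.
Qed.

Lemma hold_Xs_measurable k F : hold F -> measurable_fun setT (fun x : borel X => F (Xs k x)).
Proof.
by move=> hF; apply: (Xs_comp_measurable hcont); apply: (hold_measurable hexp om halpha).
Qed.

Lemma hold_bounded F : hold F -> exists t, forall x, `|F x| <= t.
Proof. by case. Qed.

Lemma Rint_holdD k l F K : hold F -> hold K ->
  \int[mu]_x (F (Xs k x) + K (Xs l x)) = \int[mu]_x F (Xs k x) + \int[mu]_x K (Xs l x).
Proof.
move=> hF hK; have [[t Ft] _] := hF; have [[u Ku] _] := hK.
apply: (@RintD _ _ (borel X) mu _ _ (Num.max t u)).
- exact: hold_Xs_measurable.
- exact: hold_Xs_measurable.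
- by move=> x; rewrite le_max Ft.
- by move=> x; rewrite le_max Ku orbT.
Qed.

Lemma Rint_shift k F (c : R) : hold F ->
  \int[mu]_x (F (Xs k x) + c) = \int[mu]_x F (Xs k x) + c.
Proof.
move=> hF; rewrite -[in RHS](@Rint_cst _ _ (borel X) mu c).
have hc : hold (fun _ : X => c).
  split; first by exists `|c|.
  by exists 0 => // x y; rewrite subrr normr0 mul0r.
exact: (Rint_holdD k k hF hc).
Qed.

(** A function with mean zero lies within its oscillation of 0. This converts the contraction of
    oscillations into sup bounds. *)
Lemma zero_mean_bound k F (t : R) : hold F -> (forall x y, `|F x - F y| <= t) ->
  \int[mu]_x F (Xs k x) = 0 -> forall x, `|F x| <= t.
Proof.
move=> hF Ft F0 x.
have [b Fb] := hold_bounded hF.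
have b0 : 0 <= b by exact: le_trans (normr_ge0 _) (Fb point).
have t0 : 0 <= t by exact: le_trans (normr_ge0 _) (Ft point point).
have mF := hold_Xs_measurable k hF.
have Fs : forall z, `|F (Xs k z)| <= b + t + `|F x|.
  by move=> z; apply: (le_trans (Fb _)); rewrite -addrA lerDl addr_ge0.
have bnd c : `|c| <= t + `|F x| -> `|c| <= b + t + `|F x| by move=> h; lra.
have u : F x - t <= 0.
  rewrite -F0 -(@Rint_cst _ _ (borel X) mu (F x - t)).
  apply: (@le_Rint _ _ (borel X) mu _ _ (b + t + `|F x|)) => // [y|y].
    by apply: bnd; apply: le_trans (ler_normB _ _) _; rewrite (ger0_norm t0) addrC.
  by have := Ft x (Xs k y); rewrite ler_norml; lra.
have v : 0 <= F x + t.
  rewrite -F0 -(@Rint_cst _ _ (borel X) mu (F x + t)).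
  apply: (@le_Rint _ _ (borel X) mu _ _ (b + t + `|F x|)) => // [y|y].
    by apply: bnd; apply: le_trans (ler_normD _ _) _; rewrite (ger0_norm t0) addrC.
  by have := Ft x (Xs k y); rewrite ler_norml; lra.
by rewrite ler_norml; lra.
Qed.

Let m n := \int[mu]_x f (Xs n x).
Let ft n x := f x - m n.

(** The conditional expectation, given the state [x] at time [k], of the sum of the centred
    observables before time [k]. The terms decay geometrically, so it stays bounded. *)
Definition corrector k x := \sum_(i < k) Qt i (k - i) (ft i) x.

Lemma correctorS k x : corrector k.+1 x = Qn k (fun y => ft k y + corrector k y) x.
Proof.
rewrite /corrector QopD big_ord_recr/= subSnn/= addn0 addrC; congr (_ + _).
rewrite /Qop -[RHS](_ : \sum_(y <- fib T (om k) x) \sum_(i < k) weight T phi om k y * Qt i (k - i) (ft i) y = _);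
  last by apply: eq_bigr => y _; rewrite mulr_sumr.
rewrite exchange_big/=; apply: eq_bigr => i _.
by rewrite subSn ?(ltnW (ltn_ord i))//= subnKC// ltnW.
Qed.

Let ft_hold n : hold (ft n).
Proof. by apply: holdD => //; exact: hold_cst. Qed.

Let ft_mean n : \int[mu]_x ft n (Xs n x) = 0.
Proof. by rewrite /ft (Rint_shift n (- m n) hf) subrr. Qed.

Lemma corrector_reg : exists2 t, 0 <= t & forall k, reg (corrector k) t.
Proof.
have [t0 t00 rt] := hold_reg hf.
exists (G * t0); first by rewrite mulr_ge0 ?G_ge0.
move=> k.
have h : forall s : seq 'I_k, reg (fun x => \sum_(i <- s) Qt i (k - i) (ft i) x)
    (\sum_(i <- s) theta ^+ ((k - i) %/ N) * t0).
  elim=> [|i s IH].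
    split => [x y|x y xy]; rewrite !big_nil subrr normr0//.
    by rewrite mulr0 mul0r.
  rewrite big_cons (_ : (fun x => _) = fun x => Qt i (k - i) (ft i) x + \sum_(j <- s) Qt j (k - j) (ft j) x); last first.
    by apply/funext => x; rewrite big_cons.
  apply: regD => //; apply: contraction_iter => //.
  - exact: ltW.
  - exact: reg_shift.
apply: (reg_le _ (h (index_enum 'I_k))).
rewrite -mulr_suml ler_wpM2r//.
(* After reversal [k - i] runs from 1 to [k]; the missing index 0 is added to match [theta_sum]. *)
apply: le_trans (theta_sum k.+1).
rewrite -[leLHS](big_mkord xpredT (fun i => theta ^+ ((k - i) %/ N))).
rewrite big_nat_rev/= add0n [leRHS]big_nat_recl//=.
rewrite -[leLHS]add0r; apply: lerD; first by rewrite exprn_ge0// ltW.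
rewrite !big_nat; apply: ler_sum => i /andP[_ ik].
by rewrite subKn.
Qed.

Lemma corrector_hold k : hold (corrector k).
Proof. by have [t t0 rt] := corrector_reg; exact: reg_hold t0 (rt k). Qed.

Lemma corrector_mean k : \int[mu]_x corrector k (Xs k x) = 0.
Proof.
elim: k => [|k IH].
  under eq_Rintegral do rewrite /corrector big_ord0.
  exact: (@Rint_cst _ _ (borel X) mu).
under eq_Rintegral do rewrite correctorS.
rewrite -(duality_hold hexp hsurj hap halpha phiH finfib Hp0 hmu); last first.
  by apply: holdD => //; exact: corrector_hold.
by rewrite Rint_holdD// ?IH ?ft_mean ?addr0//; exact: corrector_hold.
Qed.

(** Gordin's decomposition in reverse time: by [correctorS], the subtracted term is the conditional
    expectation of the other two given the next state. *)
Definition mdiff k y := ft k y + corrector k y - corrector k.+1 (T (om k) y).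

Lemma mdiff_hold k : hold (mdiff k).
Proof.
apply: holdD; first by apply: holdD => //; exact: corrector_hold.
rewrite (_ : (fun x => _) = fun x => (fun=> -1) x * (corrector k.+1 \o T (om k)) x); last first.
  by apply/funext => x; rewrite mulN1r.
apply: holdM; first exact: hold_cst.
by apply: (hold_comp1 hexp hsurj hap om halpha); exact: corrector_hold.
Qed.

Lemma mdiff_back k x : Qn k (mdiff k) x = 0.
Proof.
have -> : mdiff k = fun y => (ft k y + corrector k y) +
    (-1) * ((fun=> 1) y * corrector k.+1 (T (om k) y)).
  by apply/funext => y; rewrite /mdiff mul1r mulN1r.
rewrite QopD QopZ (Qop_pull phi om finfib) (Qop_cst hsurj phi om finfib) -correctorS.
by rewrite mulr1 mulN1r subrr.
Qed.

Lemma uniform_bounds : exists2 D, 1 <= D & [/\ (forall k x, `|corrector k x| <= D),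
   (forall k x, `|mdiff k x| <= D) & (forall k x, `|ft k x + corrector k x| <= D)].
Proof.
have [t t0 rt] := corrector_reg.
have [t1 t10 [f1 f2]] := hold_reg hf.
have cb k x : `|corrector k x| <= t.
  by apply: (@zero_mean_bound k); [exact: corrector_hold|exact: (rt k).1|exact: corrector_mean].
have fb k x : `|ft k x| <= t1.
  apply: (@zero_mean_bound k); [exact: ft_hold| |exact: ft_mean].
  by move=> y z; rewrite /ft opprD addrACA subrr addr0.
exists (1 + t + t + t1); first by rewrite -!addrA lerDl !addr_ge0.
split => k x.
- by apply: (le_trans (cb k x)); lra.
- apply: le_trans (ler_normB _ _) _; have := cb k.+1 (T (om k) x).
  have := ler_normD (ft k x) (corrector k x); have := cb k x; have := fb k x; lra.
- have := ler_normD (ft k x) (corrector k x); have := cb k x; have := fb k x; lra.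
Qed.

Definition mvar k x := Qn k (fun y => mdiff k y ^+ 2) x.

Lemma mvar_reg : exists2 t, 0 <= t & forall k, reg (mvar k) t.
Proof.
have [t t0 rt] := corrector_reg.
have [t1 t10 rf] := hold_reg hf.
have [D D1 [cb db sb]] := uniform_bounds.
have D0 : 0 <= D by exact: le_trans D1.
pose r1 := 2 * D * (t1 + t); pose r2 := 2 * D * t.
have r10 : 0 <= r1 by rewrite !mulr_ge0// addr_ge0.
have r20 : 0 <= r2 by rewrite !mulr_ge0.
exists (r1 + r2); first exact: addr_ge0.
move=> k.
(* The conditional variance as conditional second moment minus squared conditional mean. In this
   form no composition with the expanding map remains, which would enlarge the local Hoelder
   constant. *)
have -> : mvar k = fun x => Qn k (fun y => (ft k y + corrector k y) ^+ 2) x +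
    (-1) * corrector k.+1 x ^+ 2.
  apply/funext => x; rewrite /mvar.
  have -> : (fun y => mdiff k y ^+ 2) = fun y => (ft k y + corrector k y) ^+ 2 +
      ((-2) * ((ft k y + corrector k y) * corrector k.+1 (T (om k) y)) +
       (fun=> 1) y * (corrector k.+1 (T (om k) y) ^+ 2)).
    by apply/funext => y; rewrite /mdiff; ring.
  rewrite !QopD [X in _ + (X + _)]QopZ.
  rewrite (Qop_pull phi om finfib k (fun y => ft k y + corrector k y) (corrector k.+1)).
  rewrite (Qop_pull phi om finfib k (fun=> 1) (fun z => corrector k.+1 z ^+ 2)).
  by rewrite (Qop_cst hsurj phi om finfib) -correctorS; ring.
apply: regD.
  apply: step_reg => //; apply: reg_sqr => //; first exact: addr_ge0.
  by apply: regD => //; exact: reg_shift.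
have := regZ (-1) (reg_sqr t0 (cb k.+1) (rt k.+1)).
by rewrite normrN1 mul1r.
Qed.

Lemma mvar_hold k : hold (mvar k).
Proof. by have [t t0 rt] := mvar_reg; exact: reg_hold t0 (rt k). Qed.

Definition sigma2 k := \int[mu]_x (mdiff k (Xs k x) ^+ 2).

Let sqr_hold F : hold F -> hold (fun x => F x ^+ 2).
Proof. by move=> hF; under eq_fun do rewrite expr2; exact: holdM. Qed.

Lemma sigma2E k : sigma2 k = \int[mu]_x mvar k (Xs k.+1 x).
Proof.
have hs : hold (fun y => mdiff k y ^+ 2) by apply: sqr_hold; exact: mdiff_hold.
exact: (duality_hold hexp hsurj hap halpha phiH finfib Hp0 hmu k hs).
Qed.

Let cvar k x := mvar k x - sigma2 k.

Let cvar_hold k : hold (cvar k).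
Proof. by apply: holdD; [exact: mvar_hold|exact: hold_cst]. Qed.

Let cvar_mean k : \int[mu]_x cvar k (Xs k.+1 x) = 0.
Proof.
by rewrite /cvar (Rint_shift k.+1 (- sigma2 k) (mvar_hold k)) -sigma2E subrr.
Qed.

(** Duality moves the earlier factor to the later time, where it has become an [l]-fold backward
    average of a function of mean zero; such averages decay geometrically. *)
Lemma cvar_cov : exists2 t, 0 <= t & forall i l,
  `|\int[mu]_x (cvar i (Xs i.+1 x) * cvar (i + l)%N (Xs (i + l).+1 x))| <= t * theta ^+ (l %/ N).
Proof.
have [t t0 rt] := mvar_reg.
exists (t * t); first exact: mulr_ge0.
move=> i l; rewrite -addSn (duality_pair i.+1 l)//.
have rc j : reg (cvar j) t by exact: reg_shift.
have rQ : reg (Qt i.+1 l (cvar i)) (theta ^+ (l %/ N) * t).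
  by apply: contraction_iter => //; exact: ltW.
have hQ : hold (Qt i.+1 l (cvar i)) by apply: hold_Qit.
have bQ x : `|Qt i.+1 l (cvar i) x| <= theta ^+ (l %/ N) * t.
  apply: (@zero_mean_bound (i.+1 + l)) => //; first exact: rQ.1.
  by rewrite -duality_iter.
have bc x : `|cvar (i + l)%N x| <= t.
  by apply: (@zero_mean_bound (i + l).+1); [exact: cvar_hold|exact: (rc _).1|exact: cvar_mean].
set F := fun x => _; have hF : hold (fun z => Qt i.+1 l (cvar i) z * cvar (i + l)%N z).
  exact: holdM.
have mF := hold_Xs_measurable (i.+1 + l) hF.
have th : 0 <= theta ^+ (l %/ N) by rewrite exprn_ge0// ltW.
have bF x : `|F x| <= t * t * theta ^+ (l %/ N).
  rewrite /F normrM [leRHS](_ : _ = (theta ^+ (l %/ N) * t) * t); last by ring.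
  by apply: ler_pM => //; rewrite -addSn.
have c0 : 0 <= t * t * theta ^+ (l %/ N) by rewrite !mulr_ge0.
rewrite ler_norml; apply/andP; split.
  rewrite -(@Rint_cst _ _ (borel X) mu (- _)).
  apply: (@le_Rint _ _ (borel X) mu _ _ (t * t * theta ^+ (l %/ N))) => //.
    by move=> x; rewrite normrN ger0_norm.
  by move=> x; have := bF x; rewrite ler_norml => /andP[].
rewrite -(@Rint_cst _ _ (borel X) mu (t * t * _)).
apply: (@le_Rint _ _ (borel X) mu _ _ (t * t * theta ^+ (l %/ N))) => //.
  by move=> x; rewrite ger0_norm.
by move=> x; have := bF x; rewrite ler_norml => /andP[].
Qed.

(** By the decay of covariances, each new term has covariance at most [t * G] with the whole sum
    before it, whence linear growth in [l]. *)
Lemma sum_cvar_second_moment : exists2 C, 0 <= C & forall n l,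
  \int[mu]_x ((\sum_(i < l) cvar (n + i)%N (Xs (n + i).+1 x)) ^+ 2) <= C * l%:R.
Proof.
have [t t0 cov] := cvar_cov.
have G0 := G_ge0.
exists (2 * (t * G) + t).
  by apply: addr_ge0 => //; apply: mulr_ge0 => //; exact: mulr_ge0.
move=> n l; elim: l => [|l IH].
  under eq_Rintegral do rewrite big_ord0 expr0n.
  by rewrite (@Rint_cst _ _ (borel X) mu) mulr0.
pose a' i x := cvar (n + i)%N (Xs (n + i).+1 x).
have ma i : measurable_fun setT (a' i : borel X -> R) by apply: hold_Xs_measurable.
have /choice[b ab] : forall i, exists b, forall x, `|a' i x| <= b.
  by move=> i; have [[b hb] _] := cvar_hold (n + i); exists b => x; exact: hb.
have b0 i : 0 <= b i by exact: le_trans (normr_ge0 _) (ab i point).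
pose Sl x := \sum_(i < l) a' i x.
have mS : measurable_fun setT (Sl : borel X -> R) by apply: measurable_sum.
have Sb x : `|Sl x| <= \sum_(i < l) b i.
  by apply: le_trans (ler_norm_sum _ _ _) _; apply: ler_sum.
have sb0 : 0 <= \sum_(i < l) b i by apply: sumr_ge0.
pose bb := \sum_(i < l) b i.
have m1 : measurable_fun setT (fun x : borel X => Sl x * a' l x) by apply: measurable_funM.
have m2 : measurable_fun setT (fun x : borel X => a' l x * a' l x) by apply: measurable_funM.
have m3 : measurable_fun setT (fun x : borel X => Sl x ^+ 2) by apply: measurable_funX.
have B1 x : `|Sl x * a' l x| <= bb * b l by rewrite normrM ler_pM.
have B2 x : `|a' l x * a' l x| <= b l * b l by rewrite normrM ler_pM.
have B3 x : `|Sl x ^+ 2| <= bb ^+ 2 by rewrite normrX lerXn2r ?nnegrE.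
have -> : \int[mu]_x ((\sum_(i < l.+1) a' i x) ^+ 2) =
    \int[mu]_x (Sl x ^+ 2) + (2 * \int[mu]_x (Sl x * a' l x) + \int[mu]_x (a' l x * a' l x)).
  rewrite -(@RintZ _ _ (borel X) mu _ 2 (bb * b l))//.
  rewrite -(@RintD _ _ (borel X) mu _ _ (2 * (bb * b l) + b l * b l))//; last 3 first.
  - by apply: measurable_funM.
  - by move=> x; rewrite normrM ger0_norm//; have := B1 x; have := mulr_ge0 (b0 l) (b0 l); lra.
  - by move=> x; have := B2 x; have := mulr_ge0 sb0 (b0 l); rewrite -/bb; lra.
  have h0 := mulr_ge0 (b0 l) (b0 l); have h1 := mulr_ge0 sb0 (b0 l); have h2 := sqr_ge0 bb.
  rewrite -(@RintD _ _ (borel X) mu _ _ (bb ^+ 2 + (2 * (bb * b l) + b l * b l)))//; last 3 first.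
  - by apply: measurable_funD => //; apply: measurable_funM.
  - by move=> x; have := B3 x; rewrite -/bb in h1 *; lra.
  - move=> x; apply: le_trans (ler_normD _ _) _; rewrite normrM (ger0_norm (ler0n R 2)).
    by have := B1 x; have := B2 x; lra.
  by apply: eq_Rintegral => x _; rewrite big_ord_recr/= -/(Sl x); ring.
have c1 : \int[mu]_x (Sl x * a' l x) <= t * G.
  have -> : \int[mu]_x (Sl x * a' l x) = \sum_(i < l) \int[mu]_x (a' i x * a' l x).
    under eq_Rintegral do rewrite /Sl mulr_suml.
    apply: (@Rint_sum _ _ (borel X) mu _ _ _ (fun i : 'I_l => b i * b l)).
      by move=> i; apply: measurable_funM.
    by move=> i x; rewrite normrM ler_pM.
  apply: (@le_trans _ _ (\sum_(i < l) t * theta ^+ ((l - i) %/ N))).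
    apply: ler_sum => i _; apply: le_trans (ler_norm _) _.
    have := cov (n + i)%N (l - i)%N.
    by rewrite -addnA subnKC// ltnW.
  rewrite -mulr_sumr ler_wpM2l//; apply: le_trans (theta_sum l.+1).
  rewrite -[leLHS](big_mkord xpredT (fun i => theta ^+ ((l - i) %/ N))).
  rewrite big_nat_rev/= add0n [leRHS]big_nat_recl//=.
  rewrite -[leLHS]add0r; apply: lerD; first by rewrite exprn_ge0// ltW.
  by rewrite !big_nat; apply: ler_sum => i /andP[_ ik]; rewrite subKn.
have c2 : \int[mu]_x (a' l x * a' l x) <= t.
  apply: le_trans (ler_norm _) _; have := cov (n + l)%N 0%N.
  by rewrite addn0 div0n expr0 mulr1.
have IH' : \int[mu]_x (Sl x ^+ 2) <= (2 * (t * G) + t) * l%:R by exact: IH.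
by rewrite -[l.+1%:R]natr1 mulrDr mulr1; lra.
Qed.

Lemma mvar_concentration : exists2 C, 0 <= C & forall n l (t : R), 0 < t ->
  (mu [set x | (t <= `|\sum_(i < l) (mvar (n + i) (Xs (n + i).+1 x) - sigma2 (n + i))|)%R]
   <= (C * l%:R / t ^+ 2)%:E)%E.
Proof.
have [C C0 HC] := sum_cvar_second_moment.
exists C => // n l t t0.
pose F (x : borel X) := \sum_(i < l) cvar (n + i)%N (Xs (n + i).+1 x).
have mF : measurable_fun setT F by apply: measurable_sum => i; apply: hold_Xs_measurable.
have /choice[b hb] : forall i, exists b, forall x, `|cvar i x| <= b.
  by move=> i; have [[b hb] _] := cvar_hold i; exists b => x; exact: hb.
have Fb x : `|F x| <= \sum_(i < l) b (n + i)%N.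
  by apply: le_trans (ler_norm_sum _ _ _) _; apply: ler_sum.
apply: le_trans (@chebyshev_bounded _ _ (borel X) mu F t _ mF Fb t0) _.
by rewrite lee_fin ler_wpM2r ?invr_ge0 ?sqr_ge0//; exact: HC.
Qed.

Definition msum n x := \sum_(i < n) mdiff i (Xs i x).

Lemma centred_sumE n x :
  centred_sum T om mu f n x = msum n x + corrector n (Xs n x).
Proof.
elim: n => [|n IH]; first by rewrite /centred_sum /msum /corrector !big_ord0 addr0.
have E : centred_sum T om mu f n.+1 x = centred_sum T om mu f n x + ft n (Xs n x).
  by rewrite /centred_sum big_ord_recr.
have EX : Xs n.+1 x = T (om n) (Xs n x) by rewrite subwordS Tword_rcons add0n.
rewrite E IH EX /msum big_ord_recr/= /mdiff.
by ring.
Qed.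

Lemma msum_measurable n : measurable_fun setT (msum n : borel X -> R).
Proof. by apply: measurable_sum => i; apply: hold_Xs_measurable; exact: mdiff_hold. Qed.

Lemma msum_second_moment n : \int[mu]_x (msum n x ^+ 2) = \sum_(i < n) sigma2 i.
Proof.
have [D D1 [_ dD _]] := uniform_bounds.
have D0 : 0 <= D by exact: le_trans D1.
have md i : measurable_fun setT (fun x : borel X => mdiff i (Xs i x)).
  by apply: hold_Xs_measurable; exact: mdiff_hold.
elim: n => [|n IH].
  rewrite big_ord0; under eq_Rintegral do rewrite /msum big_ord0 expr0n.
  exact: (@Rint_cst _ _ (borel X) mu).
have mb x : `|msum n x| <= n%:R * D.
  apply: le_trans (ler_norm_sum _ _ _) _.
  apply: (@le_trans _ _ (\sum_(i < n) D)); first by apply: ler_sum.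
  by rewrite sumr_const card_ord mulr_natl.
have mm := msum_measurable n.
have nD0 : 0 <= n%:R * D by rewrite mulr_ge0.
have m1 : measurable_fun setT (fun x : borel X => msum n x * mdiff n (Xs n x)) by apply: measurable_funM.
have m2 : measurable_fun setT (fun x : borel X => mdiff n (Xs n x) ^+ 2) by apply: measurable_funX.
have m3 : measurable_fun setT (fun x : borel X => msum n x ^+ 2) by apply: measurable_funX.
have B1 x : `|msum n x * mdiff n (Xs n x)| <= n%:R * D * D by rewrite normrM ler_pM.
have B2 x : `|mdiff n (Xs n x) ^+ 2| <= D ^+ 2 by rewrite normrX lerXn2r ?nnegrE.
have B3 x : `|msum n x ^+ 2| <= (n%:R * D) ^+ 2 by rewrite normrX lerXn2r ?nnegrE.
have -> : \int[mu]_x (msum n.+1 x ^+ 2) = \int[mu]_x (msum n x ^+ 2) +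
    (2 * \int[mu]_x (msum n x * mdiff n (Xs n x)) + sigma2 n).
  rewrite /sigma2 -(@RintZ _ _ (borel X) mu _ 2 (n%:R * D * D))//.
  have h0 := sqr_ge0 D; have h1 := mulr_ge0 nD0 D0; have h2 := sqr_ge0 (n%:R * D).
  rewrite -(@RintD _ _ (borel X) mu _ _ (2 * (n%:R * D * D) + D ^+ 2))//; last 3 first.
  - by apply: measurable_funM.
  - by move=> x; rewrite normrM ger0_norm//; have := B1 x; lra.
  - by move=> x; have := B2 x; lra.
  rewrite -(@RintD _ _ (borel X) mu _ _ ((n%:R * D) ^+ 2 + (2 * (n%:R * D * D) + D ^+ 2)))//; last 3 first.
  - by apply: measurable_funD => //; apply: measurable_funM.
  - by move=> x; have := B3 x; lra.
  - move=> x; apply: le_trans (ler_normD _ _) _; rewrite normrM (ger0_norm (ler0n R 2)).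
    by have := B1 x; have := B2 x; lra.
  by apply: eq_Rintegral => x _; rewrite /msum big_ord_recr/= -/(msum n x); ring.
have -> : \int[mu]_x (msum n x * mdiff n (Xs n x)) = 0.
  transitivity (\sum_(i < n) \int[mu]_x (mdiff i (Xs i x) * mdiff n (Xs n x))).
    under eq_Rintegral do rewrite /msum mulr_suml.
    apply: (@Rint_sum _ _ (borel X) mu _ _ _ (fun=> D * D)).
      by move=> i; apply: measurable_funM.
    by move=> i x; rewrite normrM ler_pM.
  apply: big1 => i _.
  have := duality_pair i (n - i) (mdiff_hold i) (mdiff_hold n).
  rewrite subnKC ?(ltnW (ltn_ord i))// => ->.
  (* The first backward step already annihilates [mdiff i]; this is the orthogonality of martingale
     differences. *)
  have -> : Qt i (n - i) (mdiff i) = fun=> 0.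
    rewrite -(subnSK (ltn_ord i)) -add1n (Qit_add T phi om)/= addn0.
    rewrite (_ : Qn i (mdiff i) = fun=> 0); last by apply/funext => x; exact: mdiff_back.
    exact: (Qit_cst hsurj phi om finfib).
  by under eq_Rintegral do rewrite mul0r; exact: (@Rint_cst _ _ (borel X) mu).
by rewrite IH mulr0 add0r big_ord_recr.
Qed.

Lemma std_devE n : std_dev T om mu f n = Num.sqrt (\int[mu]_x (centred_sum T om mu f n x ^+ 2)).
Proof. by rewrite /std_dev unlock. Qed.

Lemma std_dev_close : exists2 C, 0 < C & forall n,
  `|Num.sqrt (\sum_(i < n) sigma2 i) - std_dev T om mu f n| <= C.
Proof.
have [D D1 [cD dD _]] := uniform_bounds.
have D0 : 0 < D by exact: lt_le_trans D1.
exists (2 * D); first by rewrite mulr_gt0.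
move=> n; rewrite std_devE -msum_second_moment.
have mb x : `|msum n x| <= n%:R * D.
  apply: le_trans (ler_norm_sum _ _ _) _.
  apply: (@le_trans _ _ (\sum_(i < n) D)); first by apply: ler_sum.
  by rewrite sumr_const card_ord mulr_natl.
have mm := msum_measurable n.
have mc : measurable_fun setT (fun x : borel X => centred_sum T om mu f n x).
  under eq_fun do rewrite centred_sumE.
  by apply: measurable_funD => //; apply: hold_Xs_measurable; exact: corrector_hold.
have cb x : `|centred_sum T om mu f n x| <= n%:R * D + D.
  by rewrite centred_sumE; apply: le_trans (ler_normD _ _) _; apply: lerD.
have h1 := @L2_perturb _ _ (borel X) mu _ _ D (n%:R * D) mm mc mb D0.
have h2 := @L2_perturb _ _ (borel X) mu _ _ D (n%:R * D + D) mc mm cb D0.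
have {}h1 := h1 _; have {}h2 := h2 _.
have k1 : forall x, `|msum n x - centred_sum T om mu f n x| <= D.
  by move=> x; rewrite centred_sumE opprD addrA subrr sub0r normrN.
have k2 : forall x, `|centred_sum T om mu f n x - msum n x| <= D.
  by move=> x; rewrite distrC.
by have := h1 k1; have := h2 k2; rewrite ler_norml; lra.
Qed.

(** Summability forces [s n] to infinity, so eventually the bounded discrepancy [C] between [s n]
    and the martingale standard deviation is at most half of [s n]. The factor 16 is the fourth
    power of this 2. *)
Lemma variance_growth :
  (\sum_(1 <= n <oo) ((std_dev T om mu f n ^+ 4)%:E)^-1 < +oo)%E ->
  exists n0 (K : R), 0 < \sum_(i < n0) sigma2 i /\
    forall m, \sum_(n0 <= n < m) (\sum_(i < n) sigma2 i) ^- 2 <= K.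
Proof.
set s := std_dev T om mu f => hs.
have [C C0 hC] := std_dev_close.
pose e n := ((s n ^+ 4)%:E^-1)%E.
have s4 n : 0 <= s n ^+ 4 by rewrite exprn_ge0// sqrtr_ge0.
have e0 n : (0 <= e n)%E by rewrite inve_ge0 lee_fin.
pose Ks := fine (\sum_(1 <= n <oo) e n)%E.
have part p : ((\sum_(1 <= n < p) e n)%R <= Ks%:E)%E.
  rewrite /Ks fineK; first by apply: nneseries_lim_ge => k _ _.
  rewrite ge0_fin_numE//; exact: nneseries_ge0.
(* In the extended reals the inverse of 0 is [+oo], so a single vanishing [s n] would already
   contradict the finiteness of the series. *)
have efin n : (1 <= n)%N -> s n != 0.
  move=> n1; apply/eqP => sn0; have := part n.+1.
  rewrite big_nat_recr//= /e sn0 expr0n/= inve0 addey//; last first.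
    rewrite gt_eqF//; apply: (lt_le_trans (ltNyr 0)); apply: sume_ge0 => k _; exact: e0.
have eE n : (1 <= n)%N -> e n = ((s n ^+ 4)^-1)%:E.
  by move=> n1; rewrite /e inver expf_eq0/= (negbTE (efin n n1)).
have partR p : \sum_(1 <= n < p) (s n ^+ 4)^-1 <= Ks.
  rewrite -lee_fin -sumEFin big_nat; apply: le_trans (part p).
  by rewrite [leRHS]big_nat; apply: lee_sum => n /andP[n1 _]; rewrite eE.
pose u n := (s n.+1 ^+ 4)^-1.
have u0 n : 0 <= u n by rewrite invr_ge0.
have cu : cvgn (series u).
  apply: nondecreasing_is_cvgn.
    by apply/nondecreasing_seqP => n; rewrite /series/= big_nat_recr//= lerDl.
  exists Ks => _ [n _ <-]; rewrite /series/=.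
  by have := partR n.+1; rewrite big_add1.
have u_0 := cvg_series_cvg_0 cu.
have b0 : 0 < (2 * C + 1) ^- 4 by rewrite invr_gt0 exprn_gt0// addr_gt0// mulr_gt0.
have /cvgr0Pnorm_lt/(_ _ b0)[n1 _ H] := u_0.
have sbig n : (n1.+1 <= n)%N -> 2 * C + 1 < s n.
  case: n => // n; rewrite ltnS => nn; have := H n nn.
  rewrite /= ger0_norm// /u ltf_pV2 ?posrE ?exprn_gt0 ?addr_gt0 ?mulr_gt0//; last first.
    by rewrite lt0r efin// sqrtr_ge0.
  have c1 : 2 * C + 1 \is Num.nneg by rewrite nnegrE; lra.
  have c2 : s n.+1 \is Num.nneg by rewrite nnegrE sqrtr_ge0.
  by rewrite ltr_pXn2r.
have Abig n : (n1.+1 <= n)%N -> s n / 2 <= Num.sqrt (\sum_(i < n) sigma2 i).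
  by move=> nn; have := sbig n nn; have := hC n; rewrite -/s ler_norml; lra.
have Apos n : (n1.+1 <= n)%N -> 0 < \sum_(i < n) sigma2 i.
  move=> nn; rewrite -sqrtr_gt0; have := Abig n nn; have := sbig n nn; lra.
exists n1.+1, (16 * Ks); split; first exact: Apos.
move=> p; apply: (@le_trans _ _ (\sum_(n1.+1 <= n < p) 16 * (s n ^+ 4)^-1)).
  rewrite !big_nat; apply: ler_sum => n /andP[nn _].
  have sn := sbig n nn; have s0 : 0 < s n by lra.
  have A0 := Apos n nn.
  rewrite -[16]invrK -invfM lef_pV2 ?posrE ?exprn_gt0 ?mulr_gt0 ?invr_gt0 ?exprn_gt0//.
  have -> : 16^-1 * s n ^+ 4 = ((s n / 2) ^+ 2) ^+ 2 by field.
  have := Abig n nn; rewrite -(ler_pXn2r (n := 2))// ?nnegrE ?sqrtr_ge0 ?divr_ge0 ?(ltW s0)//.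
  rewrite sqr_sqrtr ?(ltW A0)// => h.
  by rewrite lerXn2r ?nnegrE ?sqr_ge0 ?(ltW A0).
rewrite -mulr_sumr ler_wpM2l//.
have [mn|nm] := leqP p n1.+1; first by rewrite big_geq//; apply: le_trans (partR 1%N); rewrite big_geq.
apply: le_trans (partR p); rewrite [leRHS](big_cat_nat (n := n1.+1))//=; last exact: ltnW.
by rewrite lerDr sumr_ge0// => n _; rewrite invr_ge0.
Qed.

End martingale.

(** * Gaussian distribution functions *)

Section density.
Import HBNNSimple.
Context {R : realType} {d} {T : measurableType d}.
Variables (nu mu : measure T R) (p : T -> R).
Hypotheses (mp : measurable_fun setT p) (p0 : forall x, 0 <= p x).
Hypothesis nuE : forall A, measurable A -> (nu A = \int[mu]_(x in A) (p x)%:E)%E.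

Let pE : measurable_fun setT (fun x => (p x)%:E).
Proof. exact/measurable_EFinP. Qed.

Lemma density_indic (A : set T) : measurable A ->
  (\int[nu]_x (\1_A x)%:E = \int[mu]_x ((\1_A x)%:E * (p x)%:E))%E.
Proof.
move=> mA; rewrite integral_indic// setIT nuE// integral_mkcond.
apply: eq_integral => x _; rewrite patchE indicE.
by case: ifPn => // _; rewrite ?mul1e ?mul0e.
Qed.

Lemma density_integral (G : T -> \bar R) : measurable_fun setT G -> (forall x, 0 <= G x)%E ->
  (\int[nu]_x G x = \int[mu]_x (G x * (p x)%:E))%E.
Proof.
move=> mG G0; pose g := nnsfun_approx measurableT mG.
have gG x : (g n x)%:E @[n --> \oo] --> G x by exact: cvg_nnsfun_approx.
have g_nd x : nondecreasing_seq (fun n => g n x).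
  by move=> m n mn; have /lefP := nd_nnsfun_approx measurableT mG mn; apply.
have mg n : measurable_fun setT (fun x => (g n x)%:E).
  exact/measurable_EFinP.
have mgp n : measurable_fun setT (fun x => (g n x)%:E * (p x)%:E)%E.
  exact: emeasurable_funM.
have E n : (\int[nu]_x (g n x)%:E = \int[mu]_x ((g n x)%:E * (p x)%:E))%E.
  pose h r x : \bar R := (r * \1_(g n @^-1` [set r]) x)%:E.
  have h0 r x : (0 <= h r x)%E by rewrite /h EFinM nnfun_muleindic_ge0.
  have mh r : measurable_fun setT (h r).
    apply/measurable_EFinP; apply: measurable_funM => //.
  have gE x : ((g n x)%:E = \sum_(r \in range (g n)) h r x)%E.
    by rewrite [in LHS]fimfunE -fsumEFin.
  under eq_integral do rewrite gE.
  rewrite ge0_integral_fsum//.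
  under [RHS]eq_integral => x _.
    rewrite gE ge0_mule_fsuml//; over.
  rewrite ge0_integral_fsum//; last 2 first.
    by move=> r; exact: emeasurable_funM.
    by move=> r x _; apply: mule_ge0 => //; rewrite lee_fin.
  apply: eq_fsbigr => r /set_mem[y _ yr].
  have r0 : 0 <= r by rewrite -yr.
  rewrite /h; under eq_integral do rewrite EFinM.
  under [RHS]eq_integral do rewrite EFinM -muleA.
  rewrite !ge0_integralZl ?lee_fin//.
  - by rewrite density_indic.
  - apply: emeasurable_funM => //; exact/measurable_EFinP.
  - by move=> x _; rewrite mule_ge0 ?lee_fin.
  - exact/measurable_EFinP.
have E1 : (\int[nu]_x (g n x)%:E)%E @[n --> \oo] --> (\int[nu]_x G x)%E.
  have -> : G = (fun x => limn (fun n => (g n x)%:E)).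
    by apply/funext => x; apply/esym/cvg_lim.
  apply: cvg_monotone_convergence => //.
  - by move=> n x _ /=; rewrite lee_fin.
  - by move=> x _ m n mn; rewrite lee_fin g_nd.
have E2 : (\int[mu]_x ((g n x)%:E * (p x)%:E))%E @[n --> \oo] -->
    (\int[mu]_x (G x * (p x)%:E))%E.
  have -> : (fun x => G x * (p x)%:E)%E = (fun x => limn (fun n => (g n x)%:E * (p x)%:E)%E).
    by apply/funext => x; apply/esym/cvg_lim => //; apply: cvgeZr.
  apply: cvg_monotone_convergence => //.
  - by move=> n x _; rewrite mule_ge0 ?lee_fin.
  - by move=> x _ m n mn; rewrite lee_pmul ?lee_fin// g_nd.
rewrite -(cvg_lim _ E1)// -(cvg_lim _ E2)//; apply: congr_lim.
by apply/funext.
Qed.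

End density.

(** * Normal densities and distribution functions *)

Section normal.
Context {R : realType}.
Implicit Types (m s t x y w : R).
Local Notation leb := (@lebesgue_measure R).
Local Notation phi := (normal_pdf (0:R) 1).

Lemma integral_normal (m s : R) (G : R -> \bar R) : measurable_fun setT G ->
  (forall x, 0 <= G x)%E ->
  (\int[normal_prob m s]_x G x = \int[leb]_x (G x * (normal_pdf m s x)%:E))%E.
Proof.
apply: (density_integral (nu := normal_prob m s) (mu := leb)) => //.
- exact: measurable_normal_pdf.
- exact: normal_pdf_ge0.
Qed.

Lemma integral_normalR (m s : R) (G : R -> R) : measurable_fun setT G ->
  (forall x, 0 <= G x) ->
  (\int[normal_prob m s]_x (G x)%:E = \int[leb]_x (G x * normal_pdf m s x)%:E)%E.
Proof.
by move=> mG G0; rewrite integral_normal//; exact/measurable_EFinP.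
Qed.

Lemma measurable_expRM t : measurable_fun setT (fun x : R => expR (t * x)).
Proof. by apply: measurableT_comp => //; exact: mulrl_measurable. Qed.

Lemma normal_peak_scale s : 0 < s -> normal_peak s = s^-1 * normal_peak 1.
Proof.
move=> s0; rewrite /normal_peak expr1n mul1r -mulrnAr sqrtrM ?sqr_ge0//.
by rewrite sqrtr_sqr gtr0_norm// invfM.
Qed.

Lemma normal_peak1_le : normal_peak (1 : R) <= 2^-1.
Proof.
rewrite /normal_peak expr1n mul1r lef_pV2 ?posrE//; last first.
  by rewrite sqrtr_gt0 pmulrn_lgt0// pi_gt0.
have -> : 2 = Num.sqrt (2 ^+ 2) :> R by rewrite sqrtr_sqr gtr0_norm.
by rewrite ler_wsqrtr// -mulr_natr; have := pi_ge2 R; lra.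
Qed.

Lemma pdfE m s x : s != 0 -> normal_pdf m s x =
  normal_peak s * expR (- (x - m) ^+ 2 / (s ^+ 2 *+ 2)).
Proof. by move=> s0; rewrite normal_pdfE. Qed.

Lemma phiE x : phi x = normal_peak 1 * expR (- (x ^+ 2 / 2)).
Proof. by rewrite pdfE ?oner_neq0// subr0 expr1n mulNr. Qed.

Lemma normal_tilt t x : expR (t * x) * phi x = expR (t ^+ 2 / 2) * normal_pdf t 1 x.
Proof.
rewrite phiE pdfE ?oner_neq0// expr1n mulrCA [RHS]mulrCA -!expRD.
by congr (_ * expR _); field.
Qed.

Lemma normal_pdf_scale m s x : 0 < s -> normal_pdf m s x = s^-1 * phi ((x - m) / s).
Proof.
move=> s0; rewrite phiE pdfE ?gt_eqF// (normal_peak_scale s0) mulrA.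
by congr (_ * expR _); field; rewrite gt_eqF.
Qed.

(** Completing the square in [x]: for a standard normal [x] and [y] normal around [t * x], the joint
    density is the marginal density of [y] times the conditional density of [x]. *)
Lemma normal_pdf_conv s t x y : 0 < s ->
  normal_pdf (t * x) s y * phi x =
  normal_pdf 0 (Num.sqrt (s ^+ 2 + t ^+ 2)) y *
  normal_pdf (y * t / (s ^+ 2 + t ^+ 2)) (s / Num.sqrt (s ^+ 2 + t ^+ 2)) x.
Proof.
move=> s0; have s20 : 0 < s ^+ 2 by rewrite exprn_gt0.
have q0 : 0 < s ^+ 2 + t ^+ 2 by rewrite ltr_wpDr ?sqr_ge0.
set S := Num.sqrt _; have S0 : 0 < S by rewrite sqrtr_gt0.
have S2 : S ^+ 2 = s ^+ 2 + t ^+ 2 by rewrite sqr_sqrtr// ltW.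
rewrite phiE !pdfE ?gt_eqF ?divr_gt0//.
rewrite (normal_peak_scale s0) (normal_peak_scale S0) (normal_peak_scale (divr_gt0 s0 S0)).
rewrite subr0 mulrACA [RHS]mulrACA -!expRD; congr (_ * expR _).
  by field; rewrite !gt_eqF.
rewrite expr_div_n S2; field; rewrite !gt_eqF//.
Qed.

Definition gcdf x : R := fine (normal_prob 0 1 `]-oo, x]%classic).

Lemma is_derive_normal_cdf m s y : s != 0 ->
  is_derive y 1 (fun y => fine (normal_prob m s `]-oo, y]%classic)) (normal_pdf m s y).
Proof.
move=> s0.
have y1 : y < y + 1 by rewrite ltrDl.
have intf : leb.-integrable [set` Interval -oo%O (BRight (y + 1))] (EFin \o normal_pdf m s).
  by apply: integrableS (integrable_normal_pdf m s).
have [] := @continuous_FTC1 R (normal_pdf m s) -oo%O y (y + 1) y1 intf _ _.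
- by rewrite ltNyr.
- exact: continuous_normal_pdf.
- move=> h1 h2; rewrite -[X in is_derive _ _ _ X]h2 derive1E.
  exact: DeriveDef.
Qed.

Lemma is_derive_gcdf x : is_derive x 1 gcdf (phi x).
Proof. exact/is_derive_normal_cdf/oner_neq0. Qed.

Lemma is_derive_phi x : is_derive x 1 phi (- (x * phi x)).
Proof.
have E : phi = normal_peak 1 *: (expR \o (fun x => - (x ^+ 2 / 2))).
  by apply/funext => z; rewrite phiE.
rewrite {1}E.
have d1 : is_derive x 1 (fun x => - (x ^+ 2 / 2)) (- x).
  rewrite (_ : (fun x => _) = - 2^-1 *: (@id R ^+ 2)); last first.
    by apply/funext => z; rewrite /= mulrC -mulNr.
  by apply: is_derive_eq; rewrite /GRing.scale/= mulr1 expr1; field.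
have d2 := is_derive1_comp (is_derive_expR _) d1.
by apply: is_derive_eq; rewrite /GRing.scale/= phiE; ring.
Qed.

Lemma phi_bound x : 0 <= phi x /\ (1 + x ^+ 2 / 2) * phi x <= 2^-1 /\ x ^+ 4 * phi x <= 8.
Proof.
have p0 : 0 < normal_peak (1:R) by rewrite normal_peak_gt0 ?oner_neq0.
have p1 := normal_peak1_le.
have x2 : 0 <= x ^+ 2 by exact: sqr_ge0.
split; first exact: normal_pdf_ge0.
rewrite phiE expRN.
set u := x ^+ 2 / 2; have u0 : 0 <= u by rewrite /u; lra.
have e0 : 0 < expR u by exact: expR_gt0.
have e1 : 1 + u <= expR u by exact: expR_ge1Dx.
(* The linear bound [e1] controls the quadratic weight; the squared one at [u / 2] is needed for the
   quartic weight, since [x ^ 4 = 4 * u ^ 2]. *)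
have e2 : (1 + u / 2) ^+ 2 <= expR u.
  have -> : expR u = expR (u / 2) ^+ 2 by rewrite expr2 -expRD; congr expR; lra.
  rewrite ler_pXn2r// ?nnegrE ?expR_ge0//; last by lra.
  exact: expR_ge1Dx.
split; rewrite mulrA ler_pdivrMr//; first nra.
have -> : x ^+ 4 = 4 * u ^+ 2 by rewrite /u; field.
nra.
Qed.

Lemma gcdf_ge0 x : 0 <= gcdf x.
Proof. exact: fine_ge0. Qed.

Lemma gcdfE x : (gcdf x)%:E = normal_prob 0 1 `]-oo, x]%classic.
Proof. by rewrite fineK// fin_num_measure. Qed.

Lemma gcdf_le1 x : gcdf x <= 1.
Proof. by rewrite -lee_fin gcdfE probability_le1. Qed.

Let idTR : measurableTypeR R -> R := idfun.

#[local] HB.instance Definition _ :=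
  @isMeasurableFun.Build _ _ _ _ idTR (@measurable_id _ _ setT).

Lemma normal_cdf_cvgNy m s : fine (normal_prob m s `]-oo, y]%classic) @[y --> -oo] --> (0 : R).
Proof. exact: (fine_cvg (cvg_cdfNy0 (idTR : {RV (normal_prob m s) >-> R}))). Qed.

Lemma gcdf_cvgNy : gcdf x @[x --> -oo] --> (0 : R).
Proof. exact: normal_cdf_cvgNy. Qed.

Lemma gcdf_cvgy : gcdf x @[x --> +oo] --> (1 : R).
Proof. exact: (fine_cvg (cvg_cdfy1 (idTR : {RV (normal_prob 0 1) >-> R}))). Qed.

(** Both sides have the same derivative in [y], so they differ by a constant, and both tend to 0 at
    minus infinity. *)
Lemma normal_cdf m s y : 0 < s ->
  normal_prob m s `]-oo, y]%classic = (gcdf ((y - m) / s))%:E.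
Proof.
move=> s0.
suff E : fine (normal_prob m s `]-oo, y]%classic) = gcdf ((y - m) / s).
  by rewrite -E fineK// fin_num_measure.
pose F y := fine (normal_prob m s `]-oo, y]%classic) - gcdf ((y - m) / s).
have dF (z : R) : is_derive z (1:R) F 0.
  have d1 : is_derive z 1 (fun y => (y - m) / s) s^-1.
    rewrite (_ : (fun y => _) = s^-1 *: (@id R - cst m)); last first.
      by apply/funext => x; rewrite /= mulrC.
    by apply: is_derive_eq; rewrite /GRing.scale/= subr0 mulr1.
  have d2 := is_derive1_comp (is_derive_gcdf _) d1.
  have d3 := @is_derive_normal_cdf m s z (lt0r_neq0 s0).
  rewrite (_ : F = (fun y => fine (normal_prob m s `]-oo, y]%classic)) -
     (gcdf \o fun y => (y - m) / s))//.
  apply: is_derive_eq; rewrite (normal_pdf_scale m z s0) mulrC subrr//.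
have Fc x z : F x = F z by exact: is_derive_0_is_cst.
apply/eqP; rewrite -subr_eq0 -/(F y); apply/eqP.
have h1 : F x @[x --> -oo] --> (0 - 0 : R).
  apply: cvgB; first exact: normal_cdf_cvgNy.
  apply: (cvg_comp (fun x => (x - m) / s) gcdf _ gcdf_cvgNy).
  apply/cvgrNyPle => A; exists (s * A + m); split; first exact: num_real.
  by move=> x xs; rewrite /= ler_pdivrMr// lerBlDr mulrC ltW.
have h2 : F x @[x --> -oo] --> F y.
  by under eq_cvg do rewrite (Fc _ y); exact: cvg_cst.
rewrite subr0 in h1.
have e1 := cvg_lim (@Rhausdorff R) h1.
have e2 := cvg_lim (@Rhausdorff R) h2.
by rewrite -e2 e1.
Qed.

Lemma gcdf_incr : {homo gcdf : x y / x < y}.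
Proof.
move=> x y xy.
have [] := @MVT R gcdf phi x y xy.
- by move=> z _; exact: is_derive_gcdf.
- apply: derivable_within_continuous => z _; exact: (@ex_derive _ _ _ _ _ _ _ (is_derive_gcdf z)).
- move=> c _ e; rewrite -subr_gt0 e mulr_gt0 ?subr_gt0// phiE.
  by rewrite mulr_gt0 ?expR_gt0// normal_peak_gt0// oner_neq0.
Qed.

Lemma gcdf_le : {homo gcdf : x y / x <= y}.
Proof. by move=> x y; rewrite le_eqVlt => /predU1P[->//|/gcdf_incr/ltW]. Qed.

Lemma gcdf_continuous : continuous gcdf.
Proof.
move=> x; apply: differentiable_continuous; apply/derivable1_diffP.
exact: (@ex_derive _ _ _ _ _ _ _ (is_derive_gcdf x)).
Qed.

End normal.

Section normal2.
Context {R : realType}.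
Implicit Types (m s t x y w : R).
Local Notation leb := (@lebesgue_measure R).
Local Notation phi := (normal_pdf (0:R) 1).

Lemma normal_mgf t : (\int[normal_prob 0 1]_x (expR (t * x))%:E = (expR (t ^+ 2 / 2))%:E)%E.
Proof.
rewrite integral_normalR; [|exact: measurable_expRM|by move=> x; exact: expR_ge0].
under eq_integral do rewrite normal_tilt EFinM.
rewrite ge0_integralZl ?lee_fin ?expR_ge0//; last 2 first.
- by apply/measurable_EFinP; exact: measurable_normal_pdf.
- by move=> x _; rewrite lee_fin normal_pdf_ge0.
by rewrite integral_normal_pdf mule1.
Qed.

(** Exponential tilting: on the half-line from [t] on, the standard density is at most
    [expR (- (t ^+ 2 / 2))] times the normal density centred at [t]. *)
Lemma normal_tail t : 0 <= t -> (normal_prob 0 1 `[t, +oo[%classic <= (expR (- (t ^+ 2 / 2)))%:E)%E.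
Proof.
move=> t0; rewrite /normal_prob integral_mkcond.
have mt : measurable_fun setT (fun x => (normal_pdf t 1 x)%:E).
  by apply/measurable_EFinP; exact: measurable_normal_pdf.
apply: (@le_trans _ _ (\int[leb]_x ((expR (- (t ^+ 2 / 2)))%:E * (normal_pdf t 1 x)%:E))%E).
  apply: ge0_le_integral => //.
  - by move=> x _; rewrite patchE; case: ifPn => // _; rewrite lee_fin normal_pdf_ge0.
  - apply/(measurable_restrictT _ _).1 => //; apply/measurable_funTS/measurable_EFinP.
    exact: measurable_normal_pdf.
  - by apply: emeasurable_funM.
  - move=> x _; rewrite patchE; case: ifPn => [|_]; last first.
      by rewrite lee_fin mulr_ge0 ?expR_ge0 ?normal_pdf_ge0.
    rewrite inE/= in_itv/= andbT => tx; rewrite lee_fin.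
    have -> : normal_pdf t 1 x = expR (- (t ^+ 2 / 2)) * (expR (t * x) * phi x).
      by rewrite normal_tilt mulrA -expRD addNr expR0 mul1r.
    rewrite !mulrA -!expRD ler_peMl ?normal_pdf_ge0// -[leLHS]expR0 ler_expR.
    by have := ler_wpM2l t0 tx; rewrite -expr2; lra.
rewrite ge0_integralZl ?lee_fin ?expR_ge0//; last first.
  by move=> x _; rewrite lee_fin normal_pdf_ge0.
by rewrite integral_normal_pdf mule1.
Qed.

Lemma gcdf_tail t : 0 <= t -> 1 - gcdf t <= expR (- (t ^+ 2 / 2)) /\ gcdf (- t) <= expR (- (t ^+ 2 / 2)).
Proof.
move=> t0; have h := normal_tail t0.
have e1 : (1 - gcdf t)%:E = normal_prob 0 1 `]t, +oo[%classic.
  have := probability_setC (normal_prob 0 1) (measurable_itv `]-oo, t]).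
  by rewrite setCitvl EFinB gcdfE => <-.
split.
  rewrite -lee_fin e1; apply: le_trans h; apply: le_measure; rewrite ?inE//.
  by move=> x /=; rewrite !in_itv/= !andbT => /ltW.
have e2 : gcdf (- t) = 1 - gcdf t.
  pose F y := gcdf (- y) + gcdf y.
  have dF (z : R) : is_derive z (1:R) F 0.
    have d1 : is_derive z 1 (-%R : R -> R) (-1) by exact: is_deriveNid.
    have d2 := is_derive1_comp (is_derive_gcdf _) d1.
    have d3 := is_derive_gcdf z.
    rewrite (_ : F = (gcdf \o -%R) + gcdf)//.
    by apply: is_derive_eq; rewrite !phiE sqrrN mulrN1 addNr.
  have Fc x z : F x = F z by exact: is_derive_0_is_cst.
  have y0 := @gcdf_cvgNy R; have y1 := @gcdf_cvgy R.
  have h1 : F x @[x --> +oo] --> (0 + 1 : R).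
    by apply: cvgD => //; exact: ((cvgNy_compNP _ _).1 y0).
  have h2 : F x @[x --> +oo] --> F t.
    by under eq_cvg do rewrite (Fc _ t); exact: cvg_cst.
  rewrite add0r in h1.
  have l1 := cvg_lim (@Rhausdorff R) h1.
  have l2 := cvg_lim (@Rhausdorff R) h2.
  have FE : F t = 1 by rewrite -l2 l1.
  by rewrite -FE /F addrK.
rewrite e2 -lee_fin e1; apply: le_trans h; apply: le_measure; rewrite ?inE//.
by move=> x /=; rewrite !in_itv/= !andbT => /ltW.
Qed.

(** The sum of independent centred normals with deviations [s] and [t] has variance [s ^ 2 + t ^ 2]:
    write the left side as a double integral, factor the joint density by [normal_pdf_conv] and
    integrate out [x] first. *)
Lemma gcdf_conv s t y : 0 < s ->
  (\int[normal_prob 0 1]_x (gcdf ((y - t * x) / s))%:E = (gcdf (y / Num.sqrt (s ^+ 2 + t ^+ 2)))%:E)%E.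
Proof.
move=> s0; set S := Num.sqrt _.
have S0 : 0 < S by rewrite sqrtr_gt0 ltr_wpDr ?sqr_ge0// exprn_gt0.
have mg : measurable_fun setT (fun x => gcdf ((y - t * x) / s)).
  apply: continuous_measurable_fun => x.
  apply: (@continuous_comp _ _ _ (fun x => (y - t * x) / s) gcdf); last exact: gcdf_continuous.
  by apply: cvgMl; apply: cvgB; [exact: cvg_cst|apply: cvgMr; exact: cvg_id].
rewrite integral_normalR//; last by move=> x; exact: gcdf_ge0.
pose I (z : R) : R := \1_(`]-oo, y]%classic) z.
have mI : measurable_fun setT I by exact: measurable_indic.
have I0 z : 0 <= I z by rewrite /I indicE.
pose h (xz : R * R) := (I xz.2 * (normal_pdf 0 S xz.2 *
   normal_pdf (xz.2 * t / (s ^+ 2 + t ^+ 2)) (s / S) xz.1))%:E.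
have h0 xz : (0 <= h xz)%E by rewrite lee_fin !mulr_ge0 ?normal_pdf_ge0.
have sS : s / S != 0 by rewrite mulf_neq0 ?invr_eq0 ?gt_eqF.
have mh : measurable_fun setT h.
  apply/measurable_EFinP; apply: measurable_funM.
    exact: (measurableT_comp mI measurable_snd).
  apply: measurable_funM.
    by apply: (measurableT_comp _ measurable_snd); exact: measurable_normal_pdf.
  have -> : (fun p : R * R => normal_pdf (p.2 * t / (s ^+ 2 + t ^+ 2)) (s / S) p.1) =
      (fun p : R * R => normal_peak (s / S) *
      expR (- (p.1 - p.2 * t / (s ^+ 2 + t ^+ 2)) ^+ 2 / ((s / S) ^+ 2 *+ 2))).
    by apply/funext => p; rewrite pdfE.
  apply: measurable_funM => //; apply: measurableT_comp => //.
  apply: measurable_funM => //; apply: measurableT_comp => //.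
  apply: measurable_funX; apply: measurable_funB; first exact: measurable_fst.
  by apply: measurable_funM => //; apply: measurable_funM => //; exact: measurable_snd.
transitivity (\int[leb]_x \int[leb]_z h (x, z))%E.
  apply: eq_integral => x _; rewrite EFinM -normal_cdf//.
  transitivity (\int[leb]_z ((I z * normal_pdf (t * x) s z)%:E * (phi x)%:E))%E.
    rewrite ge0_integralZr ?lee_fin ?normal_pdf_ge0//; last 2 first.
    - by apply/measurable_EFinP; apply: measurable_funM => //; exact: measurable_normal_pdf.
    - by move=> z _; rewrite lee_fin mulr_ge0 ?normal_pdf_ge0.
    congr (_ * _)%E; rewrite /normal_prob [LHS]integral_mkcond; apply: eq_integral => z _.
    by rewrite patchE /I indicE; case: (z \in _); rewrite ?mul1r ?mul0r.
  apply: eq_integral => z _; rewrite -EFinM -mulrA.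
  by congr (_%:E); congr (I z * _); exact: normal_pdf_conv.
have -> : (\int[leb]_x \int[leb]_z h (x, z) = \int[leb]_z \int[leb]_x h (x, z))%E.
  by rewrite -[LHS]fubini_tonelli1// fubini_tonelli2.
transitivity (\int[leb]_z ((I z * normal_pdf 0 S z)%:E))%E.
  apply: eq_integral => z _; rewrite /h/=.
  under eq_integral do rewrite mulrA EFinM.
  rewrite ge0_integralZl ?integral_normal_pdf ?mule1//.
  - by apply/measurable_EFinP; exact: measurable_normal_pdf.
  - by move=> x _; rewrite lee_fin normal_pdf_ge0.
  - by rewrite lee_fin mulr_ge0 ?normal_pdf_ge0.
rewrite -[y in RHS]subr0 -normal_cdf// /normal_prob [RHS]integral_mkcond.
apply: eq_integral => z _.
by rewrite patchE /I indicE; case: (z \in _); rewrite ?mul1r ?mul0r.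
Qed.

(** The integrand has the antiderivative [gcdf x - x * phi x], evaluated on growing symmetric
    intervals. *)
Lemma normal_second_moment : (\int[normal_prob (0:R) 1]_x (x ^+ 2)%:E = 1%:E)%E.
Proof.
rewrite integral_normalR; last 2 first.
- exact: exprn_measurable.
- exact: sqr_ge0.
pose B (n : nat) : set R := `[- n.+1%:R, n.+1%:R]%classic.
pose G x := gcdf x - x * phi x.
have m2 : measurable_fun setT (fun x => x ^+ 2 * phi x).
  by apply: measurable_funM; [exact: exprn_measurable|exact: measurable_normal_pdf].
have h1 : (\int[leb]_(x in B n) (x ^+ 2 * phi x)%:E)%E @[n --> \oo] -->
    (\int[leb]_x (x ^+ 2 * phi x)%:E)%E.
  have -> : (\int[leb]_x (x ^+ 2 * phi x)%:E =
      \int[leb]_(x in \bigcup_n B n) (x ^+ 2 * phi x)%:E)%E.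
    congr (integral _ _ _); apply/esym/seteqP; split => // x _.
    exists (Num.truncn `|x|) => //; rewrite /B/= in_itv/= -ler_norml.
    exact/ltW/truncnS_gt.
  apply: ge0_nondecreasing_set_cvg_integral.
  - move=> m n mn; apply/subsetPset => x; rewrite /B/= !in_itv/= => /andP[x1 x2].
    have : m.+1%:R <= n.+1%:R :> R by rewrite ler_nat.
    by move=> h; apply/andP; split; lra.
  - by move=> n; exact: measurable_itv.
  - by move=> n; apply/measurable_funTS/measurable_EFinP.
  - by move=> n x _; rewrite lee_fin mulr_ge0 ?sqr_ge0 ?normal_pdf_ge0.
have dG x : is_derive x (1:R) G (x ^+ 2 * phi x).
  have d1 := is_derive_gcdf x; have d2 := is_derive_phi x.
  rewrite (_ : G = gcdf - (@id R) * phi)//.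
  by apply: is_derive_eq; rewrite /GRing.scale/=; ring.
have cG x : {for x, continuous G}.
  by apply: differentiable_continuous; apply/derivable1_diffP; exact: (@ex_derive _ _ _ _ _ _ _ (dG x)).
have E n : (\int[leb]_(x in B n) (x ^+ 2 * phi x)%:E =
    (gcdf n.+1%:R - gcdf (- n.+1%:R) - 2 * (n.+1%:R * phi n.+1%:R))%:E)%E.
  have n0 : (- n.+1%:R : R) < n.+1%:R by rewrite gtrN.
  rewrite (continuous_FTC2 (F := G) n0).
  - have e : phi (- n.+1%:R) = phi n.+1%:R by rewrite !phiE sqrrN.
    by rewrite -EFinB /G e; congr (_%:E); ring.
  - apply: continuous_subspaceT => x; apply: cvgM; first exact: exprn_continuous.
    exact/continuous_normal_pdf/oner_neq0.
  - split.
    + by move=> x _; exact: (@ex_derive _ _ _ _ _ _ _ (dG x)).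
    + exact/cvg_at_right_filter/cG.
    + exact/cvg_at_left_filter/cG.
  - by move=> x _; rewrite derive1E; exact: (@derive_val _ _ _ _ _ _ _ (dG x)).
have nr : (n.+1%:R : R) @[n --> \oo] --> +oo.
  by apply/cvgryPge => A; near=> n; rewrite (le_trans (_ : _ <= n%:R))// ?ler_nat//; near: n; exact: nbhs_infty_ger.
have h2 : (gcdf n.+1%:R - gcdf (- n.+1%:R) - 2 * (n.+1%:R * phi n.+1%:R))%:E @[n --> \oo] --> (1 - 0 - 2 * 0)%:E.
  apply: cvg_EFin; first exact: nearW.
  apply: cvgB; first apply: cvgB.
  - exact: (cvg_comp _ gcdf nr (@gcdf_cvgy R)).
  - apply: (cvg_comp _ gcdf _ (@gcdf_cvgNy R)); apply/cvgNry.
    by rewrite (_ : - _ = (fun n => n.+1%:R))//; apply/funext => n /=; rewrite opprK.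
  - apply: cvgMr; apply: (@squeeze_cvgr _ _ _ _ (cst 0) (fun n => n.+1%:R^-1)).
    + apply: nearW => n /=; rewrite mulr_ge0 ?normal_pdf_ge0//=.
      have [_ [b _]] := phi_bound (n.+1%:R : R).
      have p0 := normal_pdf_ge0 0 1 (n.+1%:R : R).
      rewrite -div1r ler_pdivlMr//; nra.
    + exact: cvg_cst.
    + exact: cvg_harmonic.
rewrite -(cvg_lim _ h1)//; under eq_fun do rewrite E.
by rewrite (cvg_lim _ h2)// mulr0 !subr0.
Unshelve. all: by end_near. Qed.

(* Successive applications of the mean value theorem, with uniform signs. *)
Lemma mvt0 (f df : R -> R) d : (forall x, is_derive x (1:R) f (df x)) ->
  exists2 c, `|c| <= `|d| & f d - f 0 = df c * d.
Proof.
move=> fd; have fc (a b : R) : {within `[a, b], continuous f}.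
  by apply: derivable_within_continuous => z _; exact: (@ex_derive _ _ _ _ _ _ _ (fd z)).
have [d0|d0] := leP 0 d.
  have [c + e] := MVT_segment d0 (fun x _ => fd x) (fc 0 d).
  rewrite in_itv/= => /andP[c0 cd]; exists c; last by rewrite e subr0.
  by rewrite !ger0_norm.
have [c + e] := MVT_segment (ltW d0) (fun x _ => fd x) (fc d 0).
rewrite in_itv/= => /andP[c0 cd]; exists c; last by rewrite -opprB e; ring.
by rewrite !ler0_norm// ?lerN2// ltW.
Qed.

Lemma taylor3 (f f1 f2 f3 : R -> R) (M w d : R) :
  (forall x, is_derive x (1:R) f (f1 x)) -> (forall x, is_derive x (1:R) f1 (f2 x)) ->
  (forall x, is_derive x (1:R) f2 (f3 x)) -> (forall x, `|f3 x| <= M) ->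
  `|f (w + d) - f w - d * f1 w - d ^+ 2 / 2 * f2 w| <= M * `|d| ^+ 3.
Proof.
move=> h1 h2 h3 fM.
have sh (g g' : R -> R) : (forall x, is_derive x (1:R) g (g' x)) ->
    forall x, is_derive x (1:R) (fun t => g (w + t)) (g' (w + x)).
  move=> hg x; have d1 : is_derive x (1:R) (fun t => w + t) 1.
    rewrite (_ : (fun t => _) = cst w + @id R)//.
    by apply: is_derive_eq; rewrite add0r.
  by have := is_derive1_comp (hg (w + x)) d1; rewrite mulr1.
pose G := fun t => f (w + t) - t * f1 w - t ^+ 2 / 2 * f2 w.
pose G1 := fun t => f1 (w + t) - f1 w - t * f2 w.
have dG (x : R) : is_derive x (1:R) G (G1 x).
  have d1 := sh _ _ h1 x.
  rewrite (_ : G = (fun t => f (w + t)) - f1 w *: @id R - (f2 w / 2) *: (@id R ^+ 2)).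
    by apply: is_derive_eq; rewrite /GRing.scale/= expr1 /G1; field.
  apply/funext => t; rewrite /G.
  by transitivity (f (w + t) - f1 w * t - (f2 w / 2) * (t ^+ 2)); [field|].
have dG1 (x : R) : is_derive x (1:R) G1 (f2 (w + x) - f2 w).
  have d1 := sh _ _ h2 x.
  rewrite (_ : G1 = (fun t => f1 (w + t)) - cst (f1 w) - f2 w *: @id R).
    by apply: is_derive_eq; rewrite /GRing.scale/=; ring.
  apply/funext => t; rewrite /G1.
  by transitivity (f1 (w + t) - f1 w - f2 w * t); [ring|].
have [c cd e] := mvt0 d dG.
have [c1 c1c e1] := mvt0 c dG1.
have [c2 c2c e2] := mvt0 c1 (sh _ _ h3).
have -> : f (w + d) - f w - d * f1 w - d ^+ 2 / 2 * f2 w = G d - G 0.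
  by rewrite /G addr0; ring.
have G10 : G1 0 = 0 by rewrite /G1 addr0; ring.
rewrite e; move: e1; rewrite G10 subr0 => ->; move: e2; rewrite addr0 => ->.
have -> : M * `|d| ^+ 3 = M * `|d| * `|d| * `|d| by ring.
rewrite !normrM; apply: ler_pM; rewrite ?mulr_ge0//.
apply: ler_pM; rewrite ?mulr_ge0//.
by apply: ler_pM => //; exact: le_trans c1c cd.
Qed.

Lemma taylor2 (f f1 f2 : R -> R) (M w d : R) : 0 <= d ->
  (forall x, w <= x -> is_derive x (1:R) f (f1 x)) ->
  (forall x, w <= x -> is_derive x (1:R) f1 (f2 x)) ->
  (forall x, w <= x -> `|f2 x| <= M) ->
  `|f (w + d) - f w - d * f1 w| <= M * d ^+ 2.
Proof.
move=> d0 h1 h2 fM.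
have cont (g g' : R -> R) b : (forall x, w <= x -> is_derive x (1:R) g (g' x)) ->
    {within `[w, b], continuous g}.
  move=> hg; apply: derivable_within_continuous => z.
  rewrite in_itv/= => /andP[wz _]; exact: (@ex_derive _ _ _ _ _ _ _ (hg z wz)).
have mv (g g' : R -> R) b : w <= b -> (forall x, w <= x -> is_derive x (1:R) g (g' x)) ->
    exists2 c, w <= c <= b & g b - g w = g' c * (b - w).
  move=> wb hg; have h x : x \in `]w, b[ -> is_derive x (1:R) g (g' x).
    by rewrite in_itv/= => /andP[/ltW wx _]; exact: hg.
  have [c + e] := MVT_segment wb h (cont _ _ b hg).
  by rewrite in_itv/= => cc; exists c.
have wd : w <= w + d by rewrite lerDl.
have [c /andP[wc cd] e] := mv _ _ _ wd h1.
have [c' /andP[wc' cc'] e'] := mv _ _ _ wc h2.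
have -> : f (w + d) - f w - d * f1 w = (f1 c - f1 w) * d by rewrite e; ring.
rewrite e' !normrM expr2 mulrA (ger0_norm d0) ler_wpM2r//.
have M0 : 0 <= M := le_trans (normr_ge0 _) (fM c' wc').
by apply: ler_pM => //; [exact: fM|rewrite ger0_norm; lra].
Qed.

End normal2.

(** * The heat equation for Gaussian distribution functions *)

Section heat.
Context {R : realType}.
Implicit Types (s t x y w z q g d D : R).
Local Notation phi := (normal_pdf (0:R) 1).

Lemma is_derive_comp_mull (f f1 : R -> R) q x : is_derive (x * q) (1:R) f (f1 (x * q)) ->
  is_derive x (1:R) (fun x => f (x * q)) (q * f1 (x * q)).
Proof.
move=> h; have d1 : is_derive x (1:R) (fun x => x * q) q.
  rewrite (_ : (fun x => _) = q *: @id R); last by apply/funext => z; rewrite mulrC.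
  by apply: is_derive_eq; rewrite /GRing.scale/= mulr1.
by have := @is_derive1_comp R f (fun x => x * q) x _ _ h d1; rewrite mulrC.
Qed.

Let psi z := z * phi z.

Let dpsi z : is_derive z (1:R) psi ((1 - z ^+ 2) * phi z).
Proof.
have d2 := is_derive_phi z.
rewrite (_ : psi = @id R * phi)//.
by apply: is_derive_eq; rewrite /GRing.scale/=; ring.
Qed.

(** The distribution function of a centred Gaussian of variance [s]. Below, [heat_w] and [heat_s]
    are its partial derivatives, and the heat equation says that [heat_s] is half the second
    derivative in [w]. *)
Definition heat s w := gcdf (w / Num.sqrt s).

Definition heat_w s w := (Num.sqrt s)^-1 * phi (w / Num.sqrt s).
Definition heat_s s w := - 2^-1 * (Num.sqrt s)^-1 ^+ 2 * ((w / Num.sqrt s) * phi (w / Num.sqrt s)).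

(** Up to sign and powers of [sqrt s], these are the third derivative of [heat] in [w] and the
    second derivative in [s]. *)
Let bounds z : `|(1 - z ^+ 2) * phi z| <= 1 /\
  `|2^-1 * psi z + 4^-1 * (z * ((1 - z ^+ 2) * phi z))| <= 2.
Proof.
have [p0 [p1 p2]] := phi_bound z; rewrite /psi; set p := phi z in p0 p1 p2 *.
have z2 := sqr_ge0 z.
split; first by rewrite normrM (ger0_norm p0); have : `|1 - z ^+ 2| <= 1 + z ^+ 2;
  [rewrite ler_norml; apply/andP; split; lra|nra].
have -> : 2^-1 * (z * p) + 4^-1 * (z * ((1 - z ^+ 2) * p)) = (3 / 4 * z - 4^-1 * z ^+ 3) * p by field.
rewrite normrM (ger0_norm p0).
have z4 : z ^+ 4 = (z ^+ 2) ^+ 2 by ring.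
(* Odd powers are bounded by even ones through [2 * |z| <= 1 + z ^ 2] and
   [2 * |z| ^ 3 <= z ^ 2 + z ^ 4], so that [phi_bound] applies. *)
have : `|3 / 4 * z - 4^-1 * z ^+ 3| <= 3 / 8 * (1 + z ^+ 2) + 8^-1 * (z ^+ 2 + z ^+ 4).
  have a1 : 0 <= (1 - z) ^+ 2 by exact: sqr_ge0.
  have a2 : 0 <= (1 + z) ^+ 2 by exact: sqr_ge0.
  have a3 : 0 <= (z - z ^+ 2) ^+ 2 by exact: sqr_ge0.
  have a4 : 0 <= (z + z ^+ 2) ^+ 2 by exact: sqr_ge0.
  rewrite ler_norml; apply/andP; split; nra.
nra.
Qed.

(** The second order term [d ^ 2 / 2 * heat_ww] is written [d ^ 2 * heat_s] by the heat equation, to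
    be compared with the first order term in the variance. *)
Lemma heat_taylor_w s w d : 0 < s ->
  `|heat s (w + d) - heat s w - d * heat_w s w - d ^+ 2 * heat_s s w| <=
  (Num.sqrt s)^-1 ^+ 3 * `|d| ^+ 3.
Proof.
move=> s0; set q := (Num.sqrt s)^-1; have q0 : 0 < q by rewrite invr_gt0 sqrtr_gt0.
have e : heat_s s w = 2^-1 * (- q ^+ 2 * psi (w * q)).
  by rewrite /heat_s /psi -/q; ring.
have := @taylor3 R (heat s) (heat_w s) (fun w => - q ^+ 2 * psi (w * q))
  (fun w => - q ^+ 3 * ((1 - (w * q) ^+ 2) * phi (w * q))) (q ^+ 3) w d.
have -> : d ^+ 2 * heat_s s w = d ^+ 2 / 2 * (- q ^+ 2 * psi (w * q)) by rewrite e mulrA.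
apply.
- by move=> x; apply: is_derive_comp_mull; exact: is_derive_gcdf.
- move=> x; have h : is_derive x (1:R) (fun x => phi (x * q)) (q * - psi (x * q)).
    by apply: (is_derive_comp_mull (f1 := fun z => - psi z)); exact: is_derive_phi.
  rewrite (_ : heat_w s = q *: (fun x => phi (x * q)))//.
  by apply: is_derive_eq; rewrite /GRing.scale/=; ring.
- move=> x; have h : is_derive x (1:R) (fun x => psi (x * q)) (q * ((1 - (x * q) ^+ 2) * phi (x * q))).
    by apply: (is_derive_comp_mull (f1 := fun z => (1 - z ^+ 2) * phi z)); exact: dpsi.
  rewrite (_ : (fun w => _) = (- q ^+ 2) *: (fun x => psi (x * q)))//.
  by apply: is_derive_eq; rewrite /GRing.scale/=; ring.
- move=> x; rewrite normrM normrN (ger0_norm (exprn_ge0 3 (ltW q0))).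
  by apply: ler_piMr; [rewrite exprn_ge0// ltW|have [] := bounds (x * q)].
Qed.

Lemma heat_taylor_s s w g : 0 < s -> 0 <= g ->
  `|heat (s + g) w - heat s w - g * heat_s s w| <= 2 * (Num.sqrt s)^-1 ^+ 4 * g ^+ 2.
Proof.
move=> s0 g0; set q := (Num.sqrt s)^-1.
pose Q t := (Num.sqrt t)^-1.
have q0 : 0 < q by rewrite invr_gt0 sqrtr_gt0.
have dQ x : 0 < x -> is_derive x (1:R) Q (- 2^-1 * Q x ^+ 3).
  move=> x0; have d1 := is_derive1_sqrt x0.
  have sx : Num.sqrt x != 0 by rewrite gt_eqF// sqrtr_gt0.
  have d2 := is_deriveV sx d1.
  by apply: is_derive_eq; rewrite /GRing.scale/= /Q; field.
have dwQ x : 0 < x -> is_derive x (1:R) (fun t => w * Q t) (- 2^-1 * Q x ^+ 2 * (w * Q x)).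
  move=> x0; have d1 := dQ x x0.
  rewrite (_ : (fun t => _) = w *: Q)//.
  by apply: is_derive_eq; rewrite /GRing.scale/=; ring.
have := @taylor2 R (fun t => heat t w) (fun t => heat_s t w)
  (fun t => Q t ^+ 4 * (2^-1 * psi (w * Q t) + 4^-1 * ((w * Q t) * ((1 - (w * Q t) ^+ 2) * phi (w * Q t)))))
  (2 * q ^+ 4) s g g0.
apply.
- move=> x sx; have x0 : 0 < x by exact: lt_le_trans sx.
  have := @is_derive1_comp R gcdf (fun t => w * Q t) x _ _ (is_derive_gcdf (w * Q x)) (dwQ x x0).
  by move=> h; apply: (is_derive_eq h); rewrite /heat_s -/(Q x); ring.
- move=> x sx; have x0 : 0 < x by exact: lt_le_trans sx.
  have h := @is_derive1_comp R psi (fun t => w * Q t) x _ _ (dpsi (w * Q x)) (dwQ x x0).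
  have d1 := dQ x x0.
  rewrite (_ : (fun t => heat_s t w) = - 2^-1 *: (Q ^+ 2 * (psi \o (fun t => w * Q t)))).
    apply: is_derive_eq; rewrite /GRing.scale/= expr1 /psi.
    by rewrite -[(Q ^+ 2) x]/(Q x ^+ 2); field.
  by apply/funext => t; rewrite /heat_s -mulrA.
- move=> x sx; have x0 : 0 < x by exact: lt_le_trans sx.
  have Q0 : 0 < Q x by rewrite invr_gt0 sqrtr_gt0.
  have Qq : Q x <= q by rewrite lef_pV2 ?posrE ?sqrtr_gt0// ler_wsqrtr.
  rewrite normrM (ger0_norm (exprn_ge0 4 (ltW Q0))) mulrC.
  apply: ler_pM; rewrite ?exprn_ge0//; [exact: ltW|by have [] := bounds (w * Q x)|].
  by rewrite ler_pXn2r// nnegrE ltW.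
Qed.

(** One Lindeberg replacement: a random step [d] is traded for Gaussian variance [g]. If [d] has
    conditional mean 0 and conditional variance [g], the two explicit correction terms average to 0
    and only the right side remains. *)
Lemma heat_step s w d g D : 0 < D -> D ^+ 2 <= s -> `|d| <= D -> 0 <= g <= D ^+ 2 ->
  `|heat s (w + d) - heat (s + g) w - d * heat_w s w - (d ^+ 2 - g) * heat_s s w| <=
  D * (Num.sqrt s)^-1 ^+ 3 * (d ^+ 2 + 2 * g).
Proof.
move=> D0 Ds dD /andP[g0 gD].
have s0 : 0 < s by apply: lt_le_trans Ds; rewrite exprn_gt0.
have h1 := heat_taylor_w w d s0; have h2 := heat_taylor_s w s0 g0.
set q := (Num.sqrt s)^-1 in h1 h2 *; have q0 : 0 < q by rewrite invr_gt0 sqrtr_gt0.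
have qD : q * D <= 1.
  rewrite mulrC ler_pdivrMr ?sqrtr_gt0// mul1r -(ger0_norm (ltW D0)) -sqrtr_sqr.
  exact: ler_wsqrtr.
have -> : heat s (w + d) - heat (s + g) w - d * heat_w s w - (d ^+ 2 - g) * heat_s s w =
  (heat s (w + d) - heat s w - d * heat_w s w - d ^+ 2 * heat_s s w) -
  (heat (s + g) w - heat s w - g * heat_s s w).
  by move: (heat _ (w + d)) (heat (s + g) w) (heat s w) (heat_w s w) (heat_s s w) => *; ring.
apply: le_trans (ler_normB _ _) _; rewrite mulrDr; apply: lerD.
  apply: le_trans h1 _; have -> : `|d| ^+ 3 = `|d| * d ^+ 2 by rewrite exprS real_normK ?num_real.
  have -> : D * q ^+ 3 * d ^+ 2 = q ^+ 3 * (D * d ^+ 2) by ring.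
  by apply: ler_wpM2l; [rewrite exprn_ge0// ltW|rewrite ler_wpM2r ?sqr_ge0].
apply: le_trans h2 _.
have -> : 2 * q ^+ 4 * g ^+ 2 = (q ^+ 3 * (2 * g)) * (q * g) by ring.
have -> : D * q ^+ 3 * (2 * g) = (q ^+ 3 * (2 * g)) * D by ring.
apply: ler_wpM2l; first by apply: mulr_ge0; [rewrite exprn_ge0// ltW|rewrite mulr_ge0].
apply: (@le_trans _ _ (q * D ^+ 2)); first by rewrite ler_wpM2l// ltW.
by rewrite expr2 mulrA ler_piMl// ltW.
Qed.

Lemma heat_ge0 s w : 0 <= heat s w. Proof. exact: gcdf_ge0. Qed.

Lemma heat_le1 s w : heat s w <= 1. Proof. exact: gcdf_le1. Qed.

Lemma heat_le s : {homo heat s : w z / w <= z}.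
Proof. by move=> w z wz; apply: gcdf_le; rewrite ler_wpM2r// invr_ge0 sqrtr_ge0. Qed.

Lemma heat_tail s w e : 0 < s -> 0 <= e ->
  (e <= w -> 1 - heat s w <= expR (- (e ^+ 2 / (2 * s)))) /\
  (w <= - e -> heat s w <= expR (- (e ^+ 2 / (2 * s)))).
Proof.
move=> s0 e0; have r0 : 0 < Num.sqrt s by rewrite sqrtr_gt0.
have t0 : 0 <= e / Num.sqrt s by rewrite divr_ge0// ltW.
have [h1 h2] := gcdf_tail t0.
have E : (e / Num.sqrt s) ^+ 2 / 2 = e ^+ 2 / (2 * s).
  by rewrite expr_div_n sqr_sqrtr ?ltW//; field; rewrite gt_eqF.
rewrite E in h1 h2; split => [ew|ew].
  by apply: le_trans h1; rewrite lerB// heat_le.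
by apply: le_trans h2; rewrite -mulNr heat_le.
Qed.

Lemma heat_conv s t w : 0 < s ->
  (\int[normal_prob 0 1]_x (heat s (w - t * x))%:E = (heat (s + t ^+ 2) w)%:E)%E.
Proof.
move=> s0; have r0 : 0 < Num.sqrt s by rewrite sqrtr_gt0.
by have := gcdf_conv t w r0; rewrite sqr_sqrtr ?ltW.
Qed.

Lemma heat_continuous s : continuous (heat s).
Proof.
move=> x; apply: (@continuous_comp _ _ _ (fun x => x / Num.sqrt s) gcdf); last exact: gcdf_continuous.
by apply: cvgMl; exact: cvg_id.
Qed.

Lemma heat_measurable s : measurable_fun setT (heat s).
Proof. by apply: continuous_measurable_fun; exact: heat_continuous. Qed.

End heat.

Section law.
Context {R : realType}.

Lemma cdf_unique (P Q : probability (measurableTypeR R) R) :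
  (forall x : R, P `]-oo, x]%classic = Q `]-oo, x]%classic) ->
  forall A, measurable A -> P A = Q A.
Proof.
move=> PQ A mA.
pose G : set (set R) := [set B | exists x, B = `]-oo, x]%classic].
have G_sigma : @measurable _ (measurableTypeR R) = <<s G>>.
  apply/seteqP; split => [B|B]; last first.
    apply: smallest_sub; first exact: sigma_algebra_measurable.
    by move=> _ [x ->]; exact: measurable_itv.
  rewrite (RGenOInfty.measurableE R); apply: smallest_sub; first exact: smallest_sigma_algebra.
  move=> _ [x ->]; rewrite -setCitvl; apply: sigma_algebraC; apply: sub_sigma_algebra.
  by exists x.
apply: (@g_sigma_algebra_measure_unique _ R (measurableTypeR R) G _ (fun n => `]-oo, n%:R]%classic)).
- by rewrite G_sigma; exact: sub_sigma_algebra.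
- by move=> n; exists n%:R.
- apply/seteqP; split => // x _; exists (Num.truncn `|x|).+1 => //=.
  by rewrite in_itv/=; apply: le_trans (ler_norm x) _; exact/ltW/truncnS_gt.
- move=> _ _ [x ->] [y ->]; exists (Num.min x y).
  by apply/seteqP; split => z /=; rewrite !in_itv/= le_min => /andP.
- by move=> _ [x ->]; exact: PQ.
- by move=> n; exact: (le_lt_trans (probability_le1 P _) (ltry 1)).
- by rewrite -G_sigma.
Qed.

End law.

(** * Coin tosses and Gaussian sequences *)

Definition cylinder (n : nat) (s : nat -> bool) : set (nat -> bool) :=
  [set w | forall i, (i < n)%N -> w i = s i].

(** The empty set is included to make the family closed under intersection. *)
Definition cylinders : set (set (nat -> bool)) :=
  [set A | A = set0 \/ exists n s, A = cylinder n s].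

Definition coins := g_sigma_algebraType cylinders.

Lemma cylinder_measurable n s : measurable (cylinder n s : set coins).
Proof. by apply: sub_sigma_algebra; right; exists n, s. Qed.

Lemma cylinder0 s : cylinder 0 s = setT.
Proof. by apply/seteqP; split. Qed.

Lemma cylinderI_closed : setI_closed cylinders.
Proof.
move=> _ _ [->|[n [s ->]]] [->|[m [t ->]]]; rewrite ?set0I ?setI0; try by left.
have [[w [ws wt]]|no] := pselect (cylinder n s `&` cylinder m t !=set0); last first.
  by left; apply/nonemptyPn.
right; exists (maxn n m), w; apply/seteqP; split => z.
  by move=> [zs zt] i; rewrite leq_max => /orP[] h; [rewrite zs// ws|rewrite zt// wt].
by move=> zw; split => i h; rewrite zw ?leq_max ?h ?orbT//; [exact: ws|exact: wt].
Qed.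

Lemma coins_measurableP d (T : measurableType d) (f : T -> coins) :
  (forall i, measurable (f @^-1` [set w | w i])) -> measurable_fun setT f.
Proof.
move=> mf; have mi i b : measurable (f @^-1` [set w | w i = b]).
  case: b; first exact: mf.
  rewrite (_ : _ @^-1` _ = ~` (f @^-1` [set w | w i])); first exact/measurableC/mf.
  by apply/seteqP; split => x /=; [move=> ->|move/negP/negbTE].
apply: (@measurability _ _ T coins setT f cylinders erefl).
move=> _ [_ [->|[n [s ->]]] <-]; rewrite setTI ?preimage_set0//.
rewrite (_ : _ @^-1` _ = \bigcap_(i < n) (f @^-1` [set w | w i = s i])).
  exact: bigcap_measurableType.
by apply/seteqP; split => x h i /=; exact: h.
Qed.

Section fair_coins.
Context {R : realType}.
Implicit Types (x t : R) (w s : nat -> bool).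

Let hp n : R := 2^-1 ^+ n.

Let hp0 n : 0 < hp n. Proof. by rewrite exprn_gt0. Qed.

Let hpS n : hp n = hp n.+1 + hp n.+1.
Proof. by rewrite /hp exprS; field. Qed.

Definition bsum w n : R := \sum_(i < n) (w i)%:R * 2^-1 ^+ i.+1.

Let bsumS w n : bsum w n.+1 = bsum w n + (w n)%:R * hp n.+1.
Proof. by rewrite /bsum big_ord_recr. Qed.

(** Greedy binary expansion. The test with [<=] gives dyadic numbers their terminating expansion, in
    accordance with the half-open dyadic intervals of [digit_cylinder]. *)
Fixpoint dsum x n : R :=
  if n is k.+1 then
    if dsum x k + 2^-1 ^+ k.+1 <= x then dsum x k + 2^-1 ^+ k.+1 else dsum x k
  else 0.

Definition digit x n : bool := dsum x n + 2^-1 ^+ n.+1 <= x.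

Let dsumE x n : dsum x n = bsum (digit x) n.
Proof. by elim: n => [|n IH]; [rewrite /bsum big_ord0|rewrite bsumS -IH /= /digit; case: ifP; rewrite ?mul1r ?mul0r ?addr0]. Qed.

Let dsum_bounds x n : 0 <= x < 1 -> 0 <= x - dsum x n < hp n.
Proof.
move=> x01; elim: n => [|n IH]; first by rewrite /= subr0 /hp expr0.
have := hpS n; have := hp0 n.+1; move: IH => /andP[h1 h2] h3 h4 /=.
rewrite -/(hp n.+1); case: (leP _ x) => h /=; apply/andP; split; lra.
Qed.

Let digit_cylinder x n s : 0 <= x < 1 ->
  cylinder n s (digit x) <-> bsum s n <= x < bsum s n + hp n.
Proof.
move=> x01; split.
  move=> c; have -> : bsum s n = dsum x n.
    by rewrite dsumE; apply: eq_bigr => i _; rewrite c.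
  by have /andP[h1 h2] := dsum_bounds n x01; apply/andP; split; lra.
elim: n => [|n IH] h //.
have hS := hpS n; have h0 := hp0 n.+1.
have c : cylinder n s (digit x).
  by apply: IH; move: h; rewrite bsumS; case: (s n) => /=; rewrite ?mul1r ?mul0r => /andP[h1 h2]; apply/andP; split; lra.
move=> i; rewrite ltnS leq_eqVlt => /predU1P[->|]; last exact: c.
have e : dsum x n = bsum s n by rewrite dsumE; apply: eq_bigr => j _; rewrite c.
move: h; rewrite bsumS /digit e -/(hp n.+1); case: (s n) => /=; rewrite ?mul1r ?mul0r => /andP[h1 h2].
  by [].
by apply/negbTE; rewrite -ltNge; lra.
Qed.

Let bsum_bounds s n : 0 <= bsum s n /\ bsum s n + hp n <= 1.
Proof.
elim: n => [|n [h1 h2]]; first by rewrite /bsum big_ord0 add0r /hp expr0.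
have := hpS n; have := hp0 n.+1; rewrite bsumS; case: (s n) => /=; rewrite ?mul1r ?mul0r; split; lra.
Qed.

Let measurable_dsum n : measurable_fun setT (fun x => dsum x n).
Proof.
elim: n => [|n IH] //=.
have mD : measurable_fun setT (fun x => dsum x n + 2^-1 ^+ n.+1) by exact: measurable_funD.
apply: measurable_fun_ifT => //.
exact: measurable_fun_ler.
Qed.

Let measurable_digit : measurable_fun setT (digit : R -> coins).
Proof.
apply: coins_measurableP => i; rewrite -[X in measurable X]setTI.
by apply: measurable_fun_le => //; apply: measurable_funD => //; exact: measurable_dsum.
Qed.

Let unif : probability (measurableTypeR R) R := uniform_prob (@ltr01 R).

Let unifE (p q : R) : 0 <= p -> p <= q -> q <= 1 -> unif `[p, q[%classic = (q - p)%:E.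
Proof.
move=> p0 pq q1; rewrite -[LHS]/(\int[lebesgue_measure]_(x in `[p, q[) (uniform_pdf 0 1 x)%:E)%E.
rewrite (eq_integral (cst 1%E)); last first.
  move=> x; rewrite inE/= in_itv/= => /andP[px xq]; rewrite /uniform_pdf.
  by rewrite (le_trans p0 px) (le_trans (ltW xq) q1) subr0 invr1.
rewrite integral_cst//= mul1e lebesgue_measure_itv/= lte_fin.
by move: pq; rewrite le_eqVlt => /predU1P[->|->]//; rewrite ltxx subrr.
Qed.

Let unif_restrict (A : set R) : measurable A -> unif A = unif (A `&` `[0, 1[%classic).
Proof.
move=> mA; rewrite [LHS](measureDI unif mA (measurable_itv `[0, 1[)).
rewrite [X in (X + _)%E](_ : _ = 0%E) ?add0e//.
apply/eqP; rewrite eq_le measure_ge0 andbT.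
pose I01 : set R := `[0, 1[%classic.
have : (unif (A `\` I01) <= unif (~` I01))%E.
  have mI : measurable (I01 : set (measurableTypeR R)) by exact: measurable_itv.
  by apply: le_measure; rewrite ?inE; [exact: measurableD|exact: measurableC|move=> x []].
move=> /le_trans; apply.
have e1 : unif I01 = 1%E by rewrite /I01 unifE// subr0.
by rewrite probability_setC ?e1 ?subee//; exact: measurable_itv.
Qed.

Definition digits (x : measurableTypeR R) : coins := digit x.

HB.instance Definition _ := @isMeasurableFun.Build _ _ _ _ digits measurable_digit.

(** The law of the binary digits of a uniform variable; no infinite product of measures has to be
    constructed. *)
Definition fair : probability coins R := distribution unif digits.

Lemma fair_cylinder n s : fair (cylinder n s) = (2^-1 ^+ n)%:E.
Proof.
have mc : measurable (digit @^-1` cylinder n s).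
  rewrite -[X in measurable X]setTI; exact: measurable_digit (cylinder_measurable n s).
rewrite /fair /distribution /pushforward/= unif_restrict//.
have [b1 b2] := bsum_bounds s n; have h0 := hp0 n.
rewrite (_ : _ `&` _ = `[bsum s n, bsum s n + hp n[%classic).
  by rewrite unifE ?lerDl ?(ltW h0)//; congr (_%:E); rewrite addrAC subrr add0r.
apply/seteqP; split => x /=; rewrite !in_itv/=.
  by move=> [h x01]; apply/digit_cylinder.
move=> /andP[h1 h2]; have x01 : 0 <= x < 1 by apply/andP; split; lra.
by split => //; apply/digit_cylinder => //; apply/andP.
Qed.

Lemma measurable_bit i : measurable [set w : coins | w i].
Proof.
rewrite (_ : [set w | _] = \bigcup_(t in [set: i.-tuple bool]) cylinder i.+1 (nth true t)).
  by apply: fin_bigcup_measurable => // t _; exact: cylinder_measurable.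
apply/seteqP; split => w /=.
  move=> wi; exists [tuple w j | j < i] => // j; rewrite ltnS leq_eqVlt => /predU1P[->|ji].
    by rewrite nth_default ?size_tuple.
  by rewrite -(tnth_nth true _ (Ordinal ji)) tnth_mktuple.
by move=> [t _ /(_ i (ltnSn i))->]; rewrite nth_default ?size_tuple.
Qed.

Lemma measurable_bsum n : measurable_fun setT (fun w : coins => bsum w n).
Proof.
apply: measurable_sum => i; apply: measurable_funM => //.
rewrite (_ : (fun w => _) = \1_[set w : coins | w i] :> (coins -> R)); last first.
  apply/funext => x; rewrite indicE; congr (nat_of_bool _)%:R.
  by apply/idP/idP => [h|/set_mem//]; rewrite inE.
by apply: measurable_indic; exact: measurable_bit.
Qed.

Lemma bsum_cvg w : cvgn (bsum w).
Proof.
apply: nondecreasing_is_cvgn.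
  by apply/nondecreasing_seqP => n; rewrite bsumS lerDl mulr_ge0// ltW.
by exists 1 => _ [n _ <-]; have [_] := bsum_bounds w n; have := hp0 n; lra.
Qed.

Definition coin_val w : R := limn (bsum w).

Lemma measurable_coin_val : measurable_fun setT (coin_val : coins -> R).
Proof.
apply: (measurable_fun_cvg (h := fun n (w : coins) => bsum w n)).
  by move=> n; exact: measurable_bsum.
by move=> w _; exact: bsum_cvg.
Qed.

Let coin_val_digit x : 0 <= x < 1 -> coin_val (digit x) = x.
Proof.
move=> x01; apply/cvg_lim => //.
apply: (@squeeze_cvgr _ _ _ _ (fun n => x - hp n) (cst x)).
- apply: nearW => n; have := dsum_bounds n x01; rewrite dsumE => /andP[h1 h2] /=.
  by apply/andP; split; lra.
- rewrite -[X in _ --> X]subr0; apply: cvgB; first exact: cvg_cst.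
  by apply: cvg_expr; rewrite ger0_norm; lra.
- exact: cvg_cst.
Qed.

Lemma fair_coin_val t : 0 <= t <= 1 -> fair [set w | coin_val w <= t] = t%:E.
Proof.
move=> /andP[t0 t1].
have mt : measurable [set w : coins | coin_val w <= t].
  rewrite -[X in measurable X]setTI; apply: measurable_fun_le => //.
  exact: measurable_coin_val.
have mc : measurable (digit @^-1` [set w : coins | coin_val w <= t]).
  by rewrite -[X in measurable X]setTI; exact: measurable_digit.
have le0 : (unif [set t] = 0)%E.
  by rewrite -[LHS]/(\int[lebesgue_measure]_(x in [set t]) (uniform_pdf 0 1 x)%:E)%E integral_set1.
rewrite /fair /distribution /pushforward/= unif_restrict//.
apply/eqP; rewrite eq_le; apply/andP; split.
  apply: (@le_trans _ _ (unif (`[0, t[%classic `|` [set t]))).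
    apply: le_measure; rewrite ?inE//; [exact: measurableI|exact: measurableU|].
    move=> x /=; rewrite !in_itv/= => -[h x01]; move: h; rewrite coin_val_digit// => xt.
    case: (ltgtP x t) xt => // [xt|->] _; [left|by right].
    by move: x01 => /andP[-> _].
  apply: le_trans (measureU2 _ _ _) _ => //.
  have h0 : (unif [set t] <= 0)%E by rewrite le0.
  have h1 : (unif `[0%R, t[%classic <= t%:E)%E by rewrite unifE// subr0.
  by apply: (le_trans (leeD h1 h0)); rewrite adde0.
rewrite -{1}[t]subr0 -unifE//; apply: le_measure; rewrite ?inE//; first exact: measurableI.
move=> x /=; rewrite !in_itv/= => /andP[x0 xt].
have x01 : 0 <= x < 1 by rewrite x0 (lt_le_trans xt).
by split => //; rewrite coin_val_digit// ltW.
Qed.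

Lemma gcdf_surj u : 0 < u < 1 -> exists y, gcdf y = u :> R.
Proof.
move=> /andP[u0 u1].
have [a au] : exists a, gcdf a <= u.
  have /cvgrPdist_lt/(_ _ u0) := @gcdf_cvgNy R; move=> [M [_ h]].
  exists (M - 1); have := h (M - 1); rewrite sub0r normrN => /(_ _)/ltW.
  by rewrite ger0_norm ?gcdf_ge0//; apply; rewrite gtrBl.
have [b bu] : exists b, u <= gcdf b.
  have u1' : 0 < 1 - u by rewrite subr_gt0.
  have /cvgrPdist_lt/(_ _ u1') := @gcdf_cvgy R; move=> [M [_ h]].
  exists (M + 1); have := h (M + 1); rewrite ger0_norm ?subr_ge0 ?gcdf_le1//.
  by rewrite ltrDl => /(_ ltr01); lra.
have ab : a <= b.
  rewrite leNgt; apply/negP => ba; have := gcdf_incr ba.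
  by rewrite ltNge (le_trans au).
have mM : Num.min (gcdf a) (gcdf b) <= u <= Num.max (gcdf a) (gcdf b).
  by rewrite ge_min au le_max bu orbT.
have [c _ cu] := IVT ab (continuous_subspaceT (@gcdf_continuous R)) mM.
by exists c.
Qed.

Lemma gcdf_gt0 x : 0 < gcdf x.
Proof. by apply: le_lt_trans (gcdf_ge0 (x - 1)) _; apply: gcdf_incr; rewrite gtrBl. Qed.

Lemma gcdf_lt1 x : gcdf x < 1.
Proof. by apply: lt_le_trans (gcdf_le1 (x + 1)); apply: gcdf_incr; rewrite ltrDl. Qed.

Lemma gcdf_leE : {mono @gcdf R : x y / x <= y}.
Proof. exact/le_mono/gcdf_incr. Qed.

(** The quantile transform of the uniform variable [coin_val]. Where that variable is 0 or 1, a null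
    event, no quantile exists and the default value 0 is taken. *)
Definition std_normal w : R := xget 0 [set y | gcdf y = coin_val w].

Let std_normalE w y : (std_normal w <= y) =
  if 0 < coin_val w < 1 then coin_val w <= gcdf y else 0 <= y.
Proof.
rewrite /std_normal; case: ifPn => [/gcdf_surj[z zE]|no].
  have := xgetPex 0 (ex_intro [set y | gcdf y = coin_val w] z zE) => /=.
  by set v := xget _ _ => h; rewrite -h gcdf_leE.
case: xgetP => [z _ /= zE|//]; move: no; rewrite -zE gcdf_gt0 gcdf_lt1//.
Qed.

Lemma measurable_std_normal_le y : measurable [set w : coins | std_normal w <= y].
Proof.
have mle (c : R) : measurable [set w : coins | coin_val w <= c].
  rewrite -[X in measurable X]setTI; apply: measurable_fun_le => //.
  exact: measurable_coin_val.
have mlt (c : R) : measurable [set w : coins | coin_val w < c].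
  rewrite (_ : [set w : coins | _] = ~` [set w : coins | c <= coin_val w]); last first.
    by apply/seteqP; split => w /=; rewrite ltNge => /negP.
  apply: measurableC; rewrite -[X in measurable X]setTI; apply: measurable_fun_le => //.
  exact: measurable_coin_val.
pose I := [set w : coins | 0 < coin_val w < 1].
have mI : measurable I.
  rewrite (_ : I = [set w : coins | coin_val w < 1] `\` [set w : coins | coin_val w <= 0]).
    exact: measurableD.
  apply/seteqP; split => w; rewrite /I/=.
    by move=> /andP[w0 w1]; split => //; apply/negP; rewrite -ltNge.
  by move=> [w1 /negP]; rewrite -ltNge w1 => ->.
rewrite (_ : [set w | _] = (I `&` [set w : coins | coin_val w <= gcdf y]) `|`
    (~` I `&` [set w | 0 <= y])).
  apply: measurableU; first exact: measurableI.
  apply: measurableI; first exact: measurableC.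
  case: (leP 0 y) => y0; [rewrite (_ : [set w | _] = setT)//|rewrite (_ : [set w | _] = set0)//].
    by apply/seteqP; split.
  by apply/seteqP; split.
apply/seteqP; split => w /=; rewrite std_normalE /I/=.
  by case: ifP => h h'; [left|right; split => //; exact/negP/negbT].
by case=> [[-> ]//|[/negP/negbTE-> ]].
Qed.

Lemma measurable_std_normal : measurable_fun setT (std_normal : coins -> R).
Proof.
apply: (measurability _ (RGenOInfty.measurableE R)) => //.
move=> _ [_ [y ->] <-]; rewrite setTI -setCitvl preimage_setC; apply: measurableC.
rewrite [X in measurable X](_ : _ = [set w : coins | std_normal w <= y]).
  exact: measurable_std_normal_le.
by apply/seteqP; split => w /=; rewrite in_itv.
Qed.

Lemma std_normal_cdf y : fair [set w | std_normal w <= y] = (gcdf y)%:E.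
Proof.
have g01 : 0 <= gcdf y <= 1 by rewrite gcdf_ge0 gcdf_le1.
have mN := measurable_std_normal_le y.
have mle (c : R) : measurable [set w : coins | coin_val w <= c].
  rewrite -[X in measurable X]setTI; apply: measurable_fun_le => //.
  exact: measurable_coin_val.
pose Z0 : set coins := [set w | coin_val w <= 0].
pose Z1 : set coins := [set w | 1 <= coin_val w].
have c0 : fair Z0 = 0%E by rewrite fair_coin_val ?lexx ?ler01.
have c1 : fair Z1 = 0%E.
  have m1 : measurable Z1.
    rewrite -[X in measurable X]setTI; apply: measurable_fun_le => //.
    exact: measurable_coin_val.
  suff h (e : R) : 0 < e -> e < 1 -> (fair Z1 <= e%:E)%E.
    apply/eqP; rewrite eq_le measure_ge0 andbT; apply/lee_addgt0Pr => e e0; rewrite add0e.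
    have [e1|e1] := leP 1 e; last exact: h.
    by apply: (le_trans (probability_le1 fair m1)); rewrite lee_fin.
  move=> e0 e1.
  have h01 : 0 <= 1 - e <= 1 by apply/andP; split; lra.
  have -> : e%:E = fair (~` [set w | coin_val w <= 1 - e]).
    by rewrite probability_setC// fair_coin_val// -EFinB; congr (_%:E); lra.
  apply: le_measure; rewrite ?inE//; first exact: measurableC.
  by move=> w; rewrite /Z1/= => h; apply/negP; rewrite -ltNge; lra.
have m0 : measurable Z0 := mle 0; have mg := mle (gcdf y).
have m1 : measurable Z1.
  rewrite -[X in measurable X]setTI; apply: measurable_fun_le => //.
  exact: measurable_coin_val.
have null (A B : set coins) : measurable A -> measurable B ->
    (A `<=` B `|` (Z0 `|` Z1)) -> (fair A <= fair B)%E.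
  move=> mA mB AB; apply: (@le_trans _ _ (fair (B `|` (Z0 `|` Z1)))).
    by apply: le_measure; rewrite ?inE//; apply: measurableU => //; exact: measurableU.
  apply: le_trans (measureU2 _ _ _) _ => //; first exact: measurableU.
  rewrite -[leRHS]adde0 leeD2l//.
  apply: le_trans (measureU2 _ _ _) _ => //.
  have h0 : (fair Z0 <= 0)%E by rewrite c0.
  have h1 : (fair Z1 <= 0)%E by rewrite c1.
  by apply: (le_trans (leeD h0 h1)); rewrite adde0.
pose A0 : set coins := [set w | std_normal w <= y].
pose B0 : set coins := [set w | coin_val w <= gcdf y].
suff e : fair A0 = fair B0 by rewrite -(fair_coin_val g01); exact: e.
have h w : ~ (0 < coin_val w < 1) -> (Z0 `|` Z1) w.
  have [w0|w0] := leP (coin_val w) 0; first by left.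
  by move=> h; right; rewrite /Z1/= leNgt; apply/negP => w1; apply: h; rewrite w1.
have e1 : (fair A0 <= fair B0)%E.
  apply: null => // w; rewrite /A0/= std_normalE; case: ifPn => [_ ?|/negP /h ? _]; [by left|by right].
have e2 : (fair B0 <= fair A0)%E.
  apply: null => // w; rewrite /B0 /A0/= std_normalE; case: ifPn => [_ ?|/negP /h ? _]; [by left|by right].
by apply/eqP; rewrite eq_le e1 e2.
Qed.

Definition partial_cylinder (n k : nat) (J : pred nat) (s u : nat -> bool) : set coins :=
  [set w | (forall i, (i < n)%N -> w i = s i) /\
           (forall i, (n <= i < n + k)%N -> J i -> w i = u i)].

Lemma partial_cylinder_measurable n k J s u : measurable (partial_cylinder n k J s u).
Proof.
have mb i b : measurable [set w : coins | w i = b].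
  case: b; first exact: measurable_bit.
  rewrite (_ : [set w | _] = ~` [set w : coins | w i]); first by apply: measurableC; exact: measurable_bit.
  by apply/seteqP; split => x /=; [move=> ->|move/negP/negbTE].
rewrite (_ : partial_cylinder _ _ _ _ _ = cylinder n s `&`
    \bigcap_(i in [set i | (n <= i < n + k)%N && J i]) [set w : coins | w i = u i]).
  apply: measurableI; first exact: cylinder_measurable.
  by apply: bigcap_measurableType => i _; exact: mb.
apply/seteqP; split => w [h1 h2]; split => // i /=; first by move=> /andP[]; exact: h2.
by move=> hi Ji; apply: h2; rewrite /= hi.
Qed.

(** By induction on the number of bits beyond the prescribed prefix: a constrained bit lengthens the
    prefix, a free bit splits the event into two disjoint events of equal mass. *)
Lemma fair_partial_cylinder k n J s u :
  fair (partial_cylinder n k J s u) =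
  (2^-1 ^+ n * \prod_(n <= i < n + k) (if J i then 2^-1 else 1))%:E.
Proof.
elim: k n s => [|k IH] n s.
  rewrite addn0 big_geq// mulr1 -(fair_cylinder n s); congr (fair _).
  by apply/seteqP; split => w; [case|move=> h; split => // i; rewrite addn0 => /andP[h1 /(leq_ltn_trans h1)]; rewrite ltnn].
pose s' b i := if (i < n)%N then s i else b.
have sn b : cylinder n.+1 (s' b) = [set w | cylinder n s w /\ w n = b].
  apply/seteqP; split => w h.
    split; first by move=> i ni; rewrite h ?ltnS ?(ltnW ni)// /s' ni.
    by rewrite h// /s' ltnn.
  move=> i; rewrite ltnS leq_eqVlt /s' => /predU1P[->|ni]; first by rewrite ltnn; case: h.
  by rewrite ni; case: h => + _; apply.
have split_n b w : partial_cylinder n.+1 k J (s' b) u w <->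
    [/\ (forall i, (i < n)%N -> w i = s i), w n = b &
     forall i, (n.+1 <= i < n + k.+1)%N -> J i -> w i = u i].
  rewrite /partial_cylinder/= -addSnnS; split.
    move=> [h1 h2]; have : cylinder n.+1 (s' b) w by [].
    by rewrite sn => -[h3 h4]; split.
  move=> [h1 h2 h3]; split => //.
  have : cylinder n.+1 (s' b) w by rewrite sn.
  exact.
rewrite big_ltn ?addnS ?ltnS ?leq_addr//.
case: (boolP (J n)) => Jn.
  rewrite (_ : partial_cylinder n k.+1 J s u = partial_cylinder n.+1 k J (s' (u n)) u).
    by rewrite IH addSn exprS; congr (_%:E); ring.
  apply/seteqP; split => w.
    move=> [h1 h2]; apply/split_n; split => //; first by rewrite h2// leqnn addnS ltnS leq_addr.
    by move=> i /andP[h3 h4] Ji; rewrite h2// (ltnW h3).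
  move=> /split_n[h1 h2 h3]; split => // i /andP[]; rewrite leq_eqVlt => /predU1P[<-//|ni] ik Ji.
  by rewrite h3// ni.
rewrite (_ : partial_cylinder n k.+1 J s u = partial_cylinder n.+1 k J (s' true) u `|`
    partial_cylinder n.+1 k J (s' false) u).
  pose A b : set coins := partial_cylinder n.+1 k J (s' b) u.
  have mA b : measurable (A b) by exact: partial_cylinder_measurable.
  have -> : (fair (A true `|` A false) = fair (A true) + fair (A false))%E.
    apply: measureU => //; apply/seteqP; split => w //= [/split_n[_ h1 _] /split_n[_ h2 _]].
    by move: h1; rewrite h2.
  by rewrite /A !IH addSn -EFinD exprS; congr (_%:E); field.
apply/seteqP; split => w.
  move=> [h1 h2]; have h3 i : (n < i < n + k.+1)%N -> J i -> w i = u i.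
    by move=> /andP[h3 h4] Ji; rewrite h2// (ltnW h3).
  by case E : (w n); [left|right]; apply/split_n.
have key b : partial_cylinder n.+1 k J (s' b) u w -> partial_cylinder n k.+1 J s u w.
  move=> /split_n[h1 h2 h3]; split => // i /andP[]; rewrite leq_eqVlt => /predU1P[<-|ni] ik Ji.
    by rewrite Ji in Jn.
  by rewrite h3// ni.
by move=> [/key|/key].
Qed.

Definition evens (w : coins) : coins := fun i => w i.*2.
Definition odds (w : coins) : coins := fun i => w i.*2.+1.

Lemma measurable_evens : measurable_fun setT evens.
Proof. by apply: coins_measurableP => i; exact: measurable_bit. Qed.

Lemma measurable_odds : measurable_fun setT odds.
Proof. by apply: coins_measurableP => i; exact: measurable_bit. Qed.

Lemma prod_even_odd (F : nat -> R) K :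
  \prod_(0 <= i < K.*2) F i = \prod_(0 <= j < K) (F j.*2 * F j.*2.+1).
Proof.
elim: K => [|K IH]; first by rewrite !big_geq.
by rewrite doubleS !big_nat_recr//= IH mulrA.
Qed.

Lemma prod_half n K : (n <= K)%N ->
  \prod_(0 <= j < K) (if (j < n)%N then 2^-1 else 1) = 2^-1 ^+ n :> R.
Proof.
move=> nK; rewrite (big_cat_nat (leq0n n) nK)/=.
have -> : \prod_(0 <= j < n) (if (j < n)%N then 2^-1 else 1) = 2^-1 ^+ n :> R.
  by rewrite (eq_big_nat _ _ (F2 := fun=> 2^-1)) ?prodr_const_nat ?subn0// => i /andP[_ ->].
have -> : \prod_(n <= j < K) (if (j < n)%N then 2^-1 else 1) = 1 :> R.
  by rewrite big_nat_cond big1// => i /andP[/andP[ni _] _]; rewrite ltnNge ni.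
by rewrite mulr1.
Qed.

Lemma fair_split_cylinder n m s (t : nat -> bool) :
  fair (evens @^-1` cylinder n s `&` odds @^-1` cylinder m t) = (2^-1 ^+ n * 2^-1 ^+ m)%:E.
Proof.
pose K := maxn n m.
pose J i := if odd i then (i./2 < m)%N else (i./2 < n)%N.
pose u i := if odd i then t i./2 else s i./2.
transitivity (fair (partial_cylinder 0 K.*2 J u u)).
  congr (fair _); apply/seteqP; split => w.
    move=> [h1 h2]; split => // i _; rewrite /J /u.
    case: ifPn => oi h; have := odd_double_half i; rewrite ?oi ?(negbTE oi) ?add0n ?add1n => iE.
      by rewrite -[in LHS]iE; exact: h2.
    by rewrite -[in LHS]iE; exact: h1.
  move=> [_ h]; split => i hi.
    rewrite -[evens w i]/(w i.*2); have := h i.*2; rewrite /J /u odd_double doubleK add0n /= => -> //.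
    by rewrite ltn_double (leq_trans hi)// leq_maxl.
  rewrite -[odds w i]/(w i.*2.+1); have := h i.*2.+1; rewrite /J /u /= odd_double/= uphalf_double add0n => -> //.
  by rewrite -doubleS leq_double (leq_trans hi)// leq_maxr.
rewrite fair_partial_cylinder expr0 mul1r add0n prod_even_odd big_split/=.
congr (_ * _)%:E.
  rewrite -(prod_half (leq_maxl n m)); apply: eq_bigr => j _.
  by rewrite /J odd_double doubleK.
rewrite -(prod_half (leq_maxr n m)); apply: eq_bigr => j _.
by rewrite /J /= odd_double/= uphalf_double.
Qed.

Definition unshuffle (w : coins) : coins * coins := (evens w, odds w).

Lemma measurable_unshuffle : measurable_fun setT unshuffle.
Proof. exact: (measurable_fun_pair measurable_evens measurable_odds). Qed.

HB.instance Definition _ := @isMeasurableFun.Build _ _ _ _ unshuffle measurable_unshuffle.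

(** The even and the odd bits are independent fair sequences: both measures agree on products of
    cylinders, which form a generating pi-system. One coin sequence thus serves as a source of as
    many independent ones as needed. *)
Lemma fair_unshuffle (A : set (coins * coins)) : measurable A ->
  distribution fair unshuffle A = (fair \x fair)%E A.
Proof.
move=> mA.
pose G : set (set (coins * coins)) := [set A `*` B | A in cylinders & B in cylinders].
have cT : cylinders setT by right; exists 0%N, xpredT; rewrite cylinder0.
have cm B : cylinders B -> measurable (B : set coins) by exact: sub_sigma_algebra.
pose T' := g_sigma_algebraType G.
have m1 : measurable_fun setT ((fun p => p.1) : T' -> coins).
  apply: (@measurability _ _ T' coins setT _ cylinders erefl) => _ [B cB <-].
  apply: sub_sigma_algebra; exists B => //; exists setT => //.
  by apply/seteqP; split => -[u v] //= [].
have m2 : measurable_fun setT ((fun p => p.2) : T' -> coins).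
  apply: (@measurability _ _ T' coins setT _ cylinders erefl) => _ [B cB <-].
  apply: sub_sigma_algebra; exists setT => //; exists B => //.
have GE : @measurable _ (coins * coins)%type = <<s G>>.
  rewrite measurable_prod_measurableType; apply/seteqP; split.
    apply: smallest_sub; first exact: smallest_sigma_algebra.
    move=> _ [B1 mB1 [B2 mB2 <-]].
    have -> : B1 `*` B2 = (setT `&` (fun p : T' => p.1) @^-1` B1) `&` (setT `&` (fun p : T' => p.2) @^-1` B2).
      by rewrite !setTI.
    by apply: (@measurableI _ T'); [exact: m1|exact: m2].
  apply: smallest_sub; first exact: smallest_sigma_algebra.
  move=> _ [B1 cB1 [B2 cB2 <-]]; apply: sub_sigma_algebra.
  by exists B1; [exact: cm|exists B2 => //; exact: cm].
apply: (@g_sigma_algebra_measure_unique _ R (coins * coins)%type G _ (fun=> setT)).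
- by rewrite GE; exact: sub_sigma_algebra.
- by move=> _; exists setT => //; exists setT => //; rewrite setXTT.
- by apply/seteqP; split => // x _; exists 0%N.
- move=> _ _ [A1 cA1 [B1 cB1 <-]] [A2 cA2 [B2 cB2 <-]]; rewrite -setXI.
  by exists (A1 `&` A2); [exact: cylinderI_closed|exists (B1 `&` B2) => //; exact: cylinderI_closed].
- move=> _ [A1 cA1 [B1 cB1 <-]].
  rewrite [RHS](product_measure1E fair fair (cm _ cA1) (cm _ cB1)).
  case: cA1 => [->|[n [s ->]]].
    by rewrite set0X !measure0 mul0e.
  case: cB1 => [->|[m [t ->]]].
    by rewrite setX0 !measure0 mule0.
  rewrite [RHS](_ : _ = (2^-1 ^+ n * 2^-1 ^+ m)%:E); first exact: fair_split_cylinder.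
  by rewrite EFinM -(fair_cylinder n s) -(fair_cylinder m t).
- by move=> _; apply: le_lt_trans (ltry 1); exact: probability_le1.
- by rewrite -GE.
Qed.

Lemma fair_fubini (F : coins * coins -> \bar R) : measurable_fun setT F ->
  (forall p, (0 <= F p)%E) ->
  (\int[fair]_w F (evens w, odds w) = \int[fair]_a \int[fair]_b F (a, b))%E.
Proof.
move=> mF F0; transitivity (\int[fair \x fair]_z F z)%E; last first.
  by rewrite (@fubini_tonelli1 _ _ _ _ _ fair fair F mF F0).
rewrite -[LHS](ge0_integral_pushforward measurable_unshuffle fair measurableT)//.
apply: eq_measure_integral => A mA _; exact: fair_unshuffle.
Qed.

Lemma fair_dominate (F : coins -> \bar R) : measurable_fun setT F -> (forall w, (0 <= F w)%E) ->
  (\int[fair]_w F (evens w) = \int[fair]_w F w)%E /\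
  (\int[fair]_w F (odds w) = \int[fair]_w F w)%E.
Proof.
move=> mF F0; split.
  rewrite (fair_fubini (F := fun p : coins * coins => F p.1))//; last exact: measurableT_comp.
  apply: eq_integral => x _; rewrite (integral_cst fair measurableT (F x)).
  by rewrite -[RHS]mule1; congr (_ * _)%E; exact: probability_setT.
rewrite (fair_fubini (F := fun p : coins * coins => F p.2))//; last exact: measurableT_comp.
rewrite (integral_cst fair measurableT (\int[fair]_w F w)%E) -[RHS]mule1.
by congr (_ * _)%E; exact: probability_setT.
Qed.

Definition coin_normal (w : coins) : measurableTypeR R := std_normal w.

Lemma measurable_coin_normal : measurable_fun setT coin_normal.
Proof. exact: measurable_std_normal. Qed.

HB.instance Definition _ := @isMeasurableFun.Build _ _ _ _ coin_normal measurable_coin_normal.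

Lemma law_coin_normal (A : set (measurableTypeR R)) : measurable A ->
  distribution fair coin_normal A = normal_prob 0 1 A.
Proof.
apply: cdf_unique => x.
transitivity (gcdf x)%:E; last exact: gcdfE.
by rewrite -std_normal_cdf; congr (fair _).
Qed.

Lemma integral_coin_normal (F : measurableTypeR R -> \bar R) : measurable_fun setT F ->
  (forall x, (0 <= F x)%E) ->
  (\int[fair]_w F (coin_normal w) = \int[normal_prob (0 : R) 1]_x F x)%E.
Proof.
move=> mF F0.
rewrite -[LHS](ge0_integral_pushforward measurable_coin_normal fair measurableT)//.
apply: (eq_measure_integral (normal_prob 0 1)) => A mA _; exact: law_coin_normal.
Qed.

End fair_coins.

Global Opaque fair.

(** * Gaussian walks driven by coin tosses *)

Section gsum.
Context {R : realType}.
Implicit Types (sg : nat -> R) (y t u a : R) (w : coins).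
Local Notation fair := (@fair R).

(** Repeated splitting into even and odd bits extracts infinitely many independent fair sequences
    from a single one. *)
Definition coin_at (i : nat) w : coins := evens (iter i odds w).

Definition nth_normal (i : nat) w : R := coin_normal (coin_at i w).

Lemma coin_atS i w : coin_at i.+1 w = coin_at i (odds w).
Proof. by rewrite /coin_at iterSr. Qed.

Lemma measurable_iter_odds i : measurable_fun setT (iter i odds).
Proof.
elim: i => [|i IH]; first exact: measurable_id.
exact: (measurableT_comp measurable_odds IH).
Qed.

Lemma measurable_coin_at i : measurable_fun setT (coin_at i).
Proof. exact: (measurableT_comp measurable_evens (measurable_iter_odds i)). Qed.

Lemma measurable_nth_normal i : measurable_fun setT (nth_normal i).
Proof. exact: (measurableT_comp (@measurable_coin_normal R) (measurable_coin_at i)). Qed.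

(** The normals are numbered from 0 and the scales from [n], because a block starting at time [n]
    reads its own coin sequence. *)
Definition gsum sg (n l : nat) w : R := \sum_(i < l) sg (n + i)%N * nth_normal i w.

Definition gvar sg (n l : nat) : R := \sum_(i < l) sg (n + i)%N ^+ 2.

Lemma gsum0 sg n w : gsum sg n 0 w = 0.
Proof. by rewrite /gsum big_ord0. Qed.

Lemma gsumS sg n l w :
  gsum sg n l.+1 w = sg n * coin_normal (evens w) + gsum sg n.+1 l (odds w).
Proof.
rewrite /gsum big_ord_recl addn0; congr (_ + _); apply: eq_bigr => i _.
by rewrite /nth_normal coin_atS addSnnS.
Qed.

Lemma gvarS sg n l : gvar sg n l.+1 = sg n ^+ 2 + gvar sg n.+1 l.
Proof.
rewrite /gvar big_ord_recl addn0; congr (_ + _); apply: eq_bigr => i _.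
by rewrite addSnnS.
Qed.

Lemma gvar_ge0 sg n l : 0 <= gvar sg n l.
Proof. by apply: sumr_ge0 => i _; exact: sqr_ge0. Qed.

Lemma measurable_gsum sg n l : measurable_fun setT (gsum sg n l).
Proof.
by apply: measurable_sum => i; apply: measurable_funM => //; exact: measurable_nth_normal.
Qed.

Let measurable_gsum_le sg n l y : measurable [set w | gsum sg n l w <= y].
Proof.
rewrite -[X in measurable X]setTI; apply: measurable_fun_le => //.
exact: measurable_gsum.
Qed.

Let indic_le (A : set coins) : measurable A -> (\int[fair]_w (\1_A w)%:E = fair A)%E.
Proof. by move=> mA; rewrite integral_indic// setIT. Qed.

(** Induction on [l]: condition on all normals but the first to expose the shift, then integrate the
    first one with [heat_conv], which requires positive remaining variance. *)
Lemma gsum_cdf sg n l y : (forall i, 0 <= sg i) -> 0 < gvar sg n l ->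
  fair [set w | gsum sg n l w <= y] = (heat (gvar sg n l) y)%:E.
Proof.
move=> sg0; elim: l n y => [|l IH] n y; first by rewrite /gvar big_ord0 ltxx.
rewrite gvarS => v0.
pose F (p : coins * coins) : \bar R :=
  (\1_[set p : coins * coins | sg n * coin_normal p.1 + gsum sg n.+1 l p.2 <= y] p)%:E.
have mA : measurable [set p : coins * coins | sg n * coin_normal p.1 + gsum sg n.+1 l p.2 <= y].
  rewrite -[X in measurable X]setTI; apply: measurable_fun_le => //.
  apply: measurable_funD.
    by apply: measurable_funM => //; exact: (measurableT_comp (@measurable_coin_normal R)).
  exact: (measurableT_comp (measurable_gsum _ _ _)).
have mF : measurable_fun setT F by apply/measurable_EFinP; exact: measurable_indic.
have F0 p : (0 <= F p)%E by rewrite lee_fin indicE.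
rewrite -indic_le; last exact: measurable_gsum_le.
transitivity (\int[fair]_w F (evens w, odds w))%E.
  apply: eq_integral => w _; rewrite /F !indicE; congr (nat_of_bool _)%:R%:E.
  by apply/idP/idP; rewrite !inE/= gsumS.
rewrite fair_fubini//.
transitivity (\int[fair]_a fair [set b | (gsum sg n.+1 l b <= y - sg n * coin_normal a)%R])%E.
  apply: eq_integral => a _; rewrite -indic_le; last exact: measurable_gsum_le.
  apply: eq_integral => b _; rewrite /F !indicE; congr (nat_of_bool _)%:R%:E.
  by apply/idP/idP; rewrite !inE/= lerBrDl.
have [v1|v1] := ltP 0 (gvar sg n.+1 l).
  under eq_integral do rewrite IH//.
  rewrite (integral_coin_normal (F := fun x => (heat (gvar sg n.+1 l) (y - sg n * x))%:E)).
  - by rewrite (heat_conv _ _ v1) addrC.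
  - apply/measurable_EFinP; apply: (measurableT_comp (heat_measurable _)).
    by apply: measurable_funB => //; exact: mulrl_measurable.
  - by move=> x; rewrite lee_fin heat_ge0.
(* Without remaining variance the remaining sum is identically 0 and the first normal alone
   decides. *)
have v2 : gvar sg n.+1 l = 0 by apply/eqP; rewrite eq_le v1 gvar_ge0.
have g0 b : gsum sg n.+1 l b = 0.
  rewrite /gsum big1// => i _; apply/eqP; rewrite mulf_eq0; apply/orP; left.
  rewrite -sqrf_eq0; have := v2; rewrite /gvar.
  by move=> /eqP; rewrite psumr_eq0 => [/allP/(_ i (mem_index_enum i))//|k _]; exact: sqr_ge0.
have s0 : 0 < sg n.
  rewrite lt0r sg0 andbT; apply/eqP => e; move: v0; rewrite v2 e expr0n addr0 ltxx.
  by [].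
rewrite v2 addr0 /heat sqrtr_sqr gtr0_norm// -std_normal_cdf -indic_le; last first.
  exact: measurable_std_normal_le.
apply: eq_integral => a _; under eq_set do rewrite g0.
case: (boolP (0 <= y - sg n * coin_normal a)) => h.
  rewrite (_ : [set _ | _] = setT); last by apply/seteqP; split.
  rewrite indicE mem_set ?[LHS](@probability_setT _ _ _ fair)//=.
  by rewrite ler_pdivlMr// mulrC -subr_ge0.
rewrite (_ : [set _ | _] = set0); last by apply/seteqP; split => //= ? ; rewrite (negbTE h).
rewrite measure0 indicE memNset//= => h'; move/negP: h; apply.
by rewrite subr_ge0 mulrC -ler_pdivlMr.
Qed.

Lemma law_nth_normals (l : nat) (B : nat -> set (measurableTypeR R)) : (forall i, measurable (B i)) ->
  fair [set w | forall i, (i < l)%N -> B i (nth_normal i w)] =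
  (\prod_(i < l) normal_prob (0 : R) 1 (B i))%E.
Proof.
elim: l B => [|l IH] B mB.
  by rewrite big_ord0 (_ : [set _ | _] = setT) ?[LHS](@probability_setT _ _ _ fair)//; apply/seteqP; split.
have mA k (B' : nat -> set (measurableTypeR R)) : (forall i, measurable (B' i)) ->
    measurable [set w : coins | forall i, (i < k)%N -> B' i (nth_normal i w)].
  move=> mB'; rewrite (_ : [set _ | _] = \bigcap_(i < k) ((nth_normal i) @^-1` B' i)).
    apply: bigcap_measurableType => i _; rewrite -[X in measurable X]setTI.
    exact: (measurable_nth_normal i measurableT (mB' i)).
  by apply/seteqP; split => w h i /h.
pose F (p : coins * coins) : \bar R :=
  (\1_(coin_normal @^-1` B 0%N) p.1 * \1_[set w : coins | forall i, (i < l)%N -> B i.+1 (nth_normal i w)] p.2)%:E.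
have mN : measurable (coin_normal @^-1` B 0%N : set coins).
  by rewrite -[X in measurable X]setTI; exact: measurable_coin_normal.
have m2 := mA l (fun i => B i.+1) (fun i => mB i.+1).
have mF : measurable_fun setT F.
  apply/measurable_EFinP; apply: measurable_funM.
    by apply: (measurableT_comp (measurable_indic mN)); exact: measurable_fst.
  by apply: (measurableT_comp (measurable_indic m2)); exact: measurable_snd.
have F0 p : (0 <= F p)%E by rewrite lee_fin !indicE mulr_ge0.
rewrite -indic_le; last exact: mA.
transitivity (\int[fair]_w F (evens w, odds w))%E.
  apply: eq_integral => w _; rewrite /F !indicE -natrM mulnb; congr (nat_of_bool _)%:R%:E.
  apply/idP/andP; rewrite !inE/=.
    by move=> h; split; [exact: (h 0%N)|move=> i il; rewrite /nth_normal -coin_atS; exact: (h i.+1)].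
  move=> [h0 h] [|i] il //; rewrite /nth_normal coin_atS; exact: h.
rewrite fair_fubini// big_ord_recl.
transitivity (\int[fair]_a ((\1_(coin_normal @^-1` B 0%N) a)%:E *
   fair [set w : coins | forall i, (i < l)%N -> B i.+1 (nth_normal i w)]))%E.
  apply: eq_integral => a _; rewrite /F/=; under eq_integral do rewrite EFinM.
  rewrite ge0_integralZl ?lee_fin ?indicE//.
  - by congr (_ * _)%E; exact: indic_le.
  - exact/measurable_EFinP/measurable_indic.
have mI : measurable_fun setT (fun x : coins => (\1_(coin_normal @^-1` B 0%N) x : R)%:E).
  exact/measurable_EFinP/measurable_indic.
rewrite ge0_integralZr//.
rewrite (IH (fun i => B i.+1)) => [|i]; last exact: mB.
congr (_ * _)%E; rewrite indic_le//; exact: law_coin_normal.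
Qed.

Definition exceeds sg n l a u : set coins :=
  [set w | exists2 m, (m <= l)%N & u <= a + gsum sg n m w].

Lemma measurable_exceeds sg n l a u : measurable (exceeds sg n l a u).
Proof.
rewrite (_ : exceeds _ _ _ _ _ = \bigcup_(m in [set m | (m <= l)%N]) [set w : coins | u <= a + gsum sg n m w]).
  apply: bigcup_measurable => m _; rewrite -[X in measurable X]setTI; apply: measurable_fun_le => //.
  by apply: measurable_funD => //; exact: measurable_gsum.
by apply/seteqP; split => w [m ml h]; exists m.
Qed.

(* Ville's inequality for the exponential martingale of the Gaussian walk. *)
Lemma gsum_ville sg n l t u a : 0 <= t ->
  (fair (exceeds sg n l a u) <= (expR (t * (a - u) + t ^+ 2 * gvar sg n l / 2))%:E)%E.
Proof.
move=> t0.
have triv n' l' a' : u <= a' -> (fair (exceeds sg n' l' a' u) <=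
  (expR (t * (a' - u) + t ^+ 2 * gvar sg n' l' / 2))%:E)%E.
  move=> ua; apply: (le_trans (probability_le1 fair (measurable_exceeds _ _ _ _ _))).
  rewrite lee_fin -[leLHS]expR0 ler_expR addr_ge0 ?mulr_ge0 ?subr_ge0 ?gvar_ge0 ?sqr_ge0//.
elim: l n a => [|l IH] n a; have [ua|ua] := leP u a; try exact: triv.
  rewrite (_ : exceeds _ _ _ _ _ = set0) ?measure0 ?lee_fin ?expR_ge0//.
  by apply/seteqP; split => // w [m]; rewrite leqn0 => /eqP ->; rewrite gsum0 addr0 leNgt ua.
pose F (p : coins * coins) : \bar R :=
  (\1_[set p : coins * coins | exists2 m, (m <= l)%N & u <= (a + sg n * coin_normal p.1) + gsum sg n.+1 m p.2] p)%:E.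
have mA : measurable [set p : coins * coins | exists2 m, (m <= l)%N & u <= (a + sg n * coin_normal p.1) + gsum sg n.+1 m p.2].
  rewrite (_ : [set _ | _] = \bigcup_(m in [set m | (m <= l)%N]) [set p : coins * coins | u <= (a + sg n * coin_normal p.1) + gsum sg n.+1 m p.2]).
    apply: bigcup_measurable => m _; rewrite -[X in measurable X]setTI; apply: measurable_fun_le => //.
    apply: measurable_funD; last exact: (measurableT_comp (measurable_gsum _ _ _)).
    apply: measurable_funD => //.
    by apply: measurable_funM => //; exact: (measurableT_comp (@measurable_coin_normal R)).
  by apply/seteqP; split => w [m ml h]; exists m.
have mF : measurable_fun setT F by apply/measurable_EFinP; exact: measurable_indic.
have F0 p : (0 <= F p)%E by rewrite lee_fin indicE.
rewrite -indic_le; last exact: measurable_exceeds.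
apply: (@le_trans _ _ (\int[fair]_w F (evens w, odds w))%E).
  rewrite le_eqVlt; apply/orP; left; apply/eqP.
  apply: eq_integral => w _; rewrite /F !indicE; congr (nat_of_bool _)%:R%:E.
  apply/idP/idP; rewrite !inE/=.
    move=> [[|m] ml]; first by rewrite gsum0 addr0 leNgt ua.
    by rewrite gsumS addrA; exists m.
  by move=> [m ml h]; exists m.+1 => //; rewrite gsumS addrA.
rewrite fair_fubini//.
have mE : measurable_fun setT (fun x : coins => (expR ((t * sg n) * coin_normal x))%:E).
  apply/measurable_EFinP; apply: (measurableT_comp (measurable_expRM _)).
  exact: measurable_coin_normal.
apply: (@le_trans _ _ (\int[fair]_x ((expR (t * (a - u) + t ^+ 2 * gvar sg n.+1 l / 2))%:E *
   (expR ((t * sg n) * coin_normal x))%:E))%E).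
  apply: ge0_le_integral => //.
  - by move=> x _; apply: integral_ge0 => y _; exact: F0.
  - exact: measurable_fun_fubini_tonelli_F.
  - exact: emeasurable_funM.
  move=> x _; rewrite -EFinM -expRD.
  apply: (@le_trans _ _ (fair (exceeds sg n.+1 l (a + sg n * coin_normal x) u))).
    rewrite -indic_le; last exact: measurable_exceeds.
    rewrite le_eqVlt; apply/orP; left; apply/eqP; apply: eq_integral => b _.
    by rewrite /F !indicE; congr (nat_of_bool _)%:R%:E; apply/idP/idP; rewrite !inE.
  by apply: le_trans (IH _ _) _; rewrite lee_fin ler_expR; lra.
rewrite ge0_integralZl ?lee_fin ?expR_ge0//.
rewrite (integral_coin_normal (F := fun x => (expR ((t * sg n) * x))%:E)).
- by rewrite normal_mgf -EFinM -expRD lee_fin ler_expR gvarS; lra.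
- by apply/measurable_EFinP; exact: measurable_expRM.
- by move=> x; rewrite lee_fin expR_ge0.
Qed.

End gsum.

(** * Lindeberg method and maximal inequalities *)

Lemma iter_stepSl {S : Type} (step : nat -> S -> S) n l x :
  iter_step step n l.+1 x = iter_step step n.+1 l (step n x).
Proof.
elim: l => [|l IH]; first by rewrite /= addn0.
by rewrite -[LHS]/(step (n + l.+1)%N (iter_step step n l.+1 x)) IH addnS.
Qed.

Lemma iter_step_add {S : Type} (step : nat -> S -> S) n m l x :
  iter_step step n (m + l) x = iter_step step (n + m) l (iter_step step n m x).
Proof. by elim: l => [|l IH]; rewrite ?addn0// addnS /= IH addnA. Qed.

Lemma lower_step {R : realFieldType} (P2 P1 k g hw hs z K t : R) :
  - (k * (z ^+ 2 + 2 * g)) <= P2 - P1 - - z * hw - (z ^+ 2 - g) * hs ->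
  P1 + K * t - g * hs - k * (2 * g) + - hw * z + (hs - k) * z ^+ 2 <= P2 + K * t.
Proof. by move: (K * t) => Kt; lra. Qed.

Lemma upper_step {R : realFieldType} (P2 P1 k g hw hs z K t : R) :
  P2 - P1 - - z * hw - (z ^+ 2 - g) * hs <= k * (z ^+ 2 + 2 * g) ->
  P2 - K * t <= P1 - K * t - g * hs + k * (2 * g) + - hw * z + (hs + k) * z ^+ 2.
Proof. by move: (K * t) => Kt; lra. Qed.

Section backward.
Context {R : realType} {d} {S : measurableType d} (mu : probability S R).
Variable (c : reverse_chain mu).
Local Notation step := (chain_step c).
Local Notation back := (back c).
Implicit Types (F G : S -> R) (x y z : S).

(** Pulling out the indicator of the point [x], as a function of the next state, shows that only the
    values over [x] matter. *)
Lemma back_local n F G x : (forall y, step n y = x -> F y = G y) -> back n F x = back n G x.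
Proof.
move=> FG; have key K : back n K x = back n (fun y => K y * (step n y == x)%:R) x.
  by rewrite (back_pull c n K (fun y => (y == x)%:R)) eqxx mul1r.
rewrite key [RHS]key; congr (back n _ x); apply/funext => y.
by case: eqP => [/FG->//|_]; rewrite !mulr0.
Qed.

Lemma backN n F : back n (fun y => - F y) = fun x => - back n F x.
Proof.
rewrite (_ : (fun y => - F y) = fun y => -1 * F y); last by apply/funext => y; rewrite mulN1r.
by rewrite backZ; apply/funext => x; rewrite mulN1r.
Qed.

Lemma back_le n F G x : (forall y, step n y = x -> F y <= G y) -> back n F x <= back n G x.
Proof.
move=> FG; rewrite -subr_ge0.
have -> : back n G x - back n F x = back n (fun y => G y + - F y) x.
  by rewrite backD backN.
rewrite (@back_local n _ (fun y => if step n y == x then G y - F y else 0)); last first.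
  by move=> y ->; rewrite eqxx.
by apply: back_ge0 => y; case: eqP => // /FG; rewrite subr_ge0.
Qed.

Lemma back_eq_cst n F x a : (forall y, step n y = x -> F y = a) -> back n F x = a.
Proof. by move=> Fa; rewrite (back_local Fa) back_cst. Qed.

Fixpoint backs n l F : S -> R := if l is k.+1 then backs n.+1 k (back n F) else F.

Lemma backsD n l F G : backs n l (fun y => F y + G y) = fun x => backs n l F x + backs n l G x.
Proof. by elim: l n F G => [//|l IH] n F G /=; rewrite backD IH. Qed.

Lemma backsZ n l a F : backs n l (fun y => a * F y) = fun x => a * backs n l F x.
Proof. by elim: l n F => [//|l IH] n F /=; rewrite backZ IH. Qed.

Lemma backs_cst n l a : backs n l (fun=> a) = fun=> a.
Proof. by elim: l n => [//|l IH] n /=; rewrite back_cst IH. Qed.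

Lemma backs_ge0 n l F x : (forall y, 0 <= F y) -> 0 <= backs n l F x.
Proof.
elim: l n F x => [|l IH] n F x F0 /=; first exact: F0.
by apply: IH => y; exact: back_ge0.
Qed.

Lemma backs_gt0 n l F y : (forall y, 0 <= F y) -> 0 < F y ->
  0 < backs n l F (iter_step step n l y).
Proof.
elim: l n F y => [//|l IH] n F y F0 Fy; rewrite iter_stepSl /=.
by apply: IH => [z|]; [exact: back_ge0|exact: back_gt0].
Qed.

Lemma backs_pull n l F G : backs n l (fun y => F y * G (iter_step step n l y)) =
  fun x => G x * backs n l F x.
Proof.
elim: l n F => [|l IH] n F; first by apply/funext => x /=; rewrite mulrC.
rewrite -[LHS]/(backs n.+1 l (back n (fun y => F y * G (iter_step step n l.+1 y)))).
rewrite (_ : (fun y => F y * _) = fun y => F y * (G \o iter_step step n.+1 l) (step n y)).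
  rewrite (back_pull c n F (G \o iter_step step n.+1 l)) -IH; congr backs.
  by apply/funext => y; rewrite mulrC.
by apply/funext => y; rewrite iter_stepSl.
Qed.

Lemma backs_meas n l F : measurable_fun setT F -> measurable_fun setT (backs n l F).
Proof. by elim: l n F => [//|l IH] n F mF /=; apply: IH; exact: back_meas. Qed.

Lemma backs_int n l F : measurable_fun setT F -> (forall x, 0 <= F x) ->
  (\int[mu]_x (F (iter_step step 0 n x))%:E =
   \int[mu]_x (backs n l F (iter_step step 0 (n + l) x))%:E)%E.
Proof.
elim: l n F => [|l IH] n F mF F0; first by rewrite addn0.
rewrite back_int// addnS -addSn IH//; first exact: back_meas.
by move=> x; exact: back_ge0.
Qed.

Lemma iter_step_meas n l : measurable_fun setT (iter_step step n l).
Proof.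
elim: l => [|l IH]; first exact: measurable_id.
exact: (measurableT_comp (step_meas c _) IH).
Qed.

Lemma backs_le n l F G x : (forall y, F y <= G y) -> backs n l F x <= backs n l G x.
Proof.
elim: l n F G x => [|l IH] n F G x FG /=; first exact: FG.
by apply: IH => y; apply: back_le.
Qed.

Section blocks.
Variables (nn ll : nat -> nat).
Hypotheses (nn0 : nn 0%N = 0%N) (nnS : forall j, nn j.+1 = (nn j + ll j)%N).

Let bstep j := iter_step step (nn j) (ll j).

Lemma block_iter j x : iter_step bstep 0 j x = iter_step step 0 (nn j) x.
Proof.
elim: j => [|j IH]; first by rewrite nn0.
by rewrite -[LHS]/(bstep j (iter_step bstep 0 j x)) IH nnS iter_step_add.
Qed.

Lemma block_int j (F : S -> R) : measurable_fun setT F -> (forall x, 0 <= F x) ->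
    (\int[mu]_x (F (iter_step bstep 0 j x))%:E =
     \int[mu]_x (backs (nn j) (ll j) F (iter_step bstep 0 j.+1 x))%:E)%E.
Proof.
move=> mF F0; under eq_integral do rewrite block_iter.
under [RHS]eq_integral do rewrite block_iter nnS.
exact: backs_int.
Qed.

(** Observing the chain at the block ends gives a reverse chain again, so the coupling can treat a
    block as a single step. *)
Definition block_chain : reverse_chain mu :=
  @ReverseChain _ _ _ mu bstep (fun j => backs (nn j) (ll j))
    (fun j => iter_step_meas (nn j) (ll j))
    (fun j => backsD (nn j) (ll j)) (fun j => backsZ (nn j) (ll j))
    (fun j => backs_cst (nn j) (ll j)) (fun j => @backs_ge0 (nn j) (ll j))
    (fun j => @backs_gt0 (nn j) (ll j)) (fun j => backs_pull (nn j) (ll j))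
    (fun j => @backs_meas (nn j) (ll j)) block_int.

End blocks.

Section sums.
Variables (dd : nat -> S -> R) (D : R).
Hypothesis D0 : 0 < D.
Hypothesis ddD : forall n z, `|dd n z| <= D.
Hypothesis dd_meas : forall n, measurable_fun setT (dd n).
Hypothesis dd_back : forall n x, back n (dd n) x = 0.

Definition cvar n : S -> R := back n (fun z => dd n z ^+ 2).

Lemma cvar_bounds n x : 0 <= cvar n x <= D ^+ 2.
Proof.
apply/andP; split; first by apply: back_ge0 => z; exact: sqr_ge0.
rewrite -[leRHS](congr1 (fun f => f x) (back_cst c n (D ^+ 2))).
apply: back_le => z _; rewrite -real_normK ?num_real// ler_pXn2r ?nnegrE//.
by rewrite ltW.
Qed.

Lemma cvar_meas n : measurable_fun setT (cvar n).
Proof. by apply: back_meas; exact: measurable_funX. Qed.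

Lemma back_quad n (c0 c1 c2 : R) x :
  back n (fun z => c0 + c1 * dd n z + c2 * dd n z ^+ 2) x = c0 + c2 * cvar n x.
Proof.
have := backD c n (fun z => c0 + c1 * dd n z) (fun z => c2 * dd n z ^+ 2).
rewrite /= => ->; rewrite (backD c n (fun=> c0) (fun z => c1 * dd n z)) back_cst !backZ.
by rewrite dd_back mulr0 addr0.
Qed.

Fixpoint dsums n l z : R := if l is k.+1 then dd n z + dsums n.+1 k (step n z) else 0.

(** The conditional variance of step [n] is evaluated at the state of time [n.+1], because the
    conditioning is on the future. *)
Fixpoint vsums n l z : R :=
  if l is k.+1 then cvar n (step n z) + vsums n.+1 k (step n z) else 0.

Lemma dsumsE n l z : dsums n l z = \sum_(i < l) dd (n + i)%N (iter_step step n i z).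
Proof.
elim: l n z => [|l IH] n z; first by rewrite big_ord0.
rewrite big_ord_recl /= addn0 IH; congr (_ + _); apply: eq_bigr => i _.
by rewrite -iter_stepSl addSnnS.
Qed.

Lemma vsumsE n l z : vsums n l z = \sum_(i < l) cvar (n + i)%N (iter_step step n i.+1 z).
Proof.
elim: l n z => [|l IH] n z; first by rewrite big_ord0.
rewrite big_ord_recl /= !addn0 IH; congr (_ + _); apply: eq_bigr => i _.
have -> : iter_step step n.+1 i.+1 (step n z) = iter_step step n i.+2 z by rewrite [RHS]iter_stepSl.
by rewrite addSnnS.
Qed.

Lemma dsums_meas n l : measurable_fun setT (dsums n l).
Proof.
elim: l n => [|l IH] n /=; first exact: measurable_cst.
apply: measurable_funD => //; exact: (measurableT_comp (IH _) (step_meas c n)).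
Qed.

Lemma vsums_meas n l : measurable_fun setT (vsums n l).
Proof.
elim: l n => [|l IH] n /=; first exact: measurable_cst.
apply: measurable_funD; first exact: (measurableT_comp (cvar_meas n) (step_meas c n)).
exact: (measurableT_comp (IH _) (step_meas c n)).
Qed.

Variable tau : R.
Hypothesis tau0 : 0 <= tau.

(* Steps that would push the running conditional variance above [tau] are skipped. *)
Fixpoint tvsums n l z : R :=
  if l is k.+1 then
    let p := step n z in
    if tvsums n.+1 k p + cvar n p <= tau then tvsums n.+1 k p + cvar n p
    else tvsums n.+1 k p
  else 0.

(** Whether step [n] is kept depends on [z] only through [step n z]: the truncation is predictable
    in reverse time and preserves the martingale property. *)
Fixpoint tdsums n l z : R :=
  if l is k.+1 then
    let p := step n z in
    if tvsums n.+1 k p + cvar n p <= tau then tdsums n.+1 k p + dd n z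
    else tdsums n.+1 k p
  else 0.

Lemma tvsums_bounds n l z : 0 <= tvsums n l z <= tau.
Proof.
elim: l n z => [|l IH] n z /=; first by rewrite lexx.
have /andP[h1 h2] := IH n.+1 (step n z); have /andP[h3 h4] := cvar_bounds n (step n z).
by case: ifP => h; rewrite ?h ?h1 ?h2// addr_ge0.
Qed.

(** Conditional variances are nonnegative, so if the full sum stays below [tau], so does every
    partial one, and no step is ever skipped. *)
Lemma tsums_eq n l z : vsums n l z <= tau ->
  tvsums n l z = vsums n l z /\ tdsums n l z = dsums n l z.
Proof.
elim: l n z => [//|l IH] n z /= h.
have /andP[h3 _] := cvar_bounds n (step n z).
have [h1 h2] : tvsums n.+1 l (step n z) = vsums n.+1 l (step n z) /\
    tdsums n.+1 l (step n z) = dsums n.+1 l (step n z) by apply: IH; lra.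
by rewrite h1 h2 addrC h; split => //; rewrite addrC.
Qed.

Section lindeberg.
Variables (s0 : R) (y : R).
Hypothesis s0D : D ^+ 2 <= s0.

Let s00 : 0 < s0. Proof. by apply: lt_le_trans s0D; rewrite exprn_gt0. Qed.

(** By [heat_step] a step with increment [d] and variance [g] errs by at most
    [K / 3 * (d ^ 2 + 2 * g)], whose conditional mean is [K * g]. The total error is then [K] times
    the variance spent. *)
Let K := 3 * D * (Num.sqrt s0)^-1 ^+ 3.

Let K0 : 0 <= K.
Proof. by rewrite /K !mulr_ge0 ?exprn_ge0 ?invr_ge0 ?sqrtr_ge0 ?ltW. Qed.

(** The heat functional with the variance not yet spent. The reserve [s0] keeps the smoothing
    variance away from 0, where the derivatives would blow up. *)
Let psi n l z := heat (s0 + tau - tvsums n l z) (y - tdsums n l z).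

Let step_bound n l p z w s : step n z = p -> tvsums n.+1 l p + cvar n p <= tau ->
  w = y - tdsums n.+1 l p -> s = s0 + tau - tvsums n.+1 l p - cvar n p ->
  `|psi n l.+1 z - psi n.+1 l p - (- dd n z) * heat_w s w - (dd n z ^+ 2 - cvar n p) * heat_s s w| <=
  K / 3 * (dd n z ^+ 2 + 2 * cvar n p).
Proof.
move=> zp h wE sE; have /andP[v0 vt] := tvsums_bounds n.+1 l p.
have g01 := cvar_bounds n p.
have ss : s0 <= s by lra.
have := heat_step w D0 (le_trans s0D ss) _ g01 (d := - dd n z).
rewrite normrN => /(_ (ddD n z)); rewrite sqrrN.
have -> : psi n l.+1 z = heat s (w + - dd n z).
  have e : s0 + tau - (tvsums n.+1 l p + cvar n p) = s by rewrite sE; ring.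
  have e' : y - (tdsums n.+1 l p + dd n z) = w + - dd n z by rewrite wE; ring.
  by rewrite /psi /= zp h e e'.
have -> : psi n.+1 l p = heat (s + cvar n p) w.
  have e : s + cvar n p = s0 + tau - tvsums n.+1 l p by rewrite sE; ring.
  by rewrite e /psi wE.
move=> /le_trans; apply; rewrite ler_wpM2r//.
  by move: g01 => /andP[g0 _]; rewrite addr_ge0 ?sqr_ge0// mulr_ge0.
have -> : K / 3 = D * (Num.sqrt s0)^-1 ^+ 3 by rewrite /K; field; rewrite gt_eqF// sqrtr_gt0.
apply: ler_wpM2l; first exact: ltW.
rewrite ler_pXn2r ?nnegrE ?invr_ge0 ?sqrtr_ge0//.
by rewrite lef_pV2 ?posrE ?sqrtr_gt0 ?(lt_le_trans s00)// ler_wsqrtr.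
Qed.

(* Adding [K] times the running variance turns the heat functional into a
   submartingale, and subtracting it into a supermartingale. *)
Lemma lindeberg n l x : `|backs n l (psi n l) x - heat (s0 + tau) y| <= K * tau.
Proof.
have Kt z : 0 <= K * tvsums n l z <= K * tau.
  by have /andP[h1 h2] := tvsums_bounds n l z; rewrite mulr_ge0// ler_wpM2l.
have lo : forall l n x, heat (s0 + tau) y <= backs n l (fun z => psi n l z + K * tvsums n l z) x.
  elim => [|k IH] n1 x1; first by rewrite /= /psi /= !subr0 mulr0 addr0.
  apply: le_trans (IH n1.+1 x1) _ => /=.
  apply: backs_le => p.
  have [h|h] := leP (tvsums n1.+1 k p + cvar n1 p) tau; last first.
    rewrite (@back_eq_cst n1 _ p (psi n1.+1 k p + K * tvsums n1.+1 k p))// => z zp.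
    by rewrite /psi /= zp (lt_geF h).
  (* Given the next state [p], the functional is bounded below by a quadratic polynomial in
     [dd n1 z] with coefficients [c0], [- heat_w s w] and [c2]; [back_quad] averages it exactly. *)
  pose w := y - tdsums n1.+1 k p; pose s := s0 + tau - tvsums n1.+1 k p - cvar n1 p.
  pose c2 := heat_s s w - K / 3.
  pose c0 := psi n1.+1 k p + K * (tvsums n1.+1 k p + cvar n1 p) - cvar n1 p * heat_s s w
    - K / 3 * (2 * cvar n1 p).
  have -> : psi n1.+1 k p + K * tvsums n1.+1 k p = c0 + c2 * cvar n1 p.
    by rewrite /c0 /c2; field.
  rewrite -(back_quad n1 c0 (- heat_w s w) c2); apply: back_le => z zp.
  have := step_bound zp h erefl erefl; rewrite -/w -/s ler_norml => /andP[h1 _].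
  have tvE : tvsums n1 k.+1 z = tvsums n1.+1 k p + cvar n1 p by rewrite /= zp h.
  rewrite -[X in _ <= _ + K * X]/(tvsums n1 k.+1 z) tvE; exact: (lower_step _ _ h1).
have hi : forall l n x, backs n l (fun z => psi n l z - K * tvsums n l z) x <= heat (s0 + tau) y.
  elim => [|k IH] n1 x1; first by rewrite /= /psi /= !subr0 mulr0 subr0.
  apply: le_trans _ (IH n1.+1 x1) => /=.
  apply: backs_le => p.
  have [h|h] := leP (tvsums n1.+1 k p + cvar n1 p) tau; last first.
    rewrite (@back_eq_cst n1 _ p (psi n1.+1 k p - K * tvsums n1.+1 k p))// => z zp.
    by rewrite /psi /= zp (lt_geF h).
  pose w := y - tdsums n1.+1 k p; pose s := s0 + tau - tvsums n1.+1 k p - cvar n1 p.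
  pose c2 := heat_s s w + K / 3.
  pose c0 := psi n1.+1 k p - K * (tvsums n1.+1 k p + cvar n1 p) - cvar n1 p * heat_s s w
    + K / 3 * (2 * cvar n1 p).
  have -> : psi n1.+1 k p - K * tvsums n1.+1 k p = c0 + c2 * cvar n1 p.
    by rewrite /c0 /c2; field.
  rewrite -(back_quad n1 c0 (- heat_w s w) c2); apply: back_le => z zp.
  have := step_bound zp h erefl erefl; rewrite -/w -/s ler_norml => /andP[_ h1].
  have tvE : tvsums n1 k.+1 z = tvsums n1.+1 k p + cvar n1 p by rewrite /= zp h.
  rewrite -[X in _ - K * X <= _]/(tvsums n1 k.+1 z) tvE; exact: (upper_step _ _ h1).
have cst a : backs n l (fun=> a) x = a by rewrite backs_cst.
have add a : backs n l (psi n l) x + a = backs n l (fun z => psi n l z + a) x.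
  by rewrite (backsD n l (psi n l) (fun=> a)) cst.
have h1 : heat (s0 + tau) y <= backs n l (psi n l) x + K * tau.
  rewrite add; apply: le_trans (lo l n x) _; apply: backs_le => z; rewrite lerD2l.
  by have /andP[] := Kt z.
have h2 : backs n l (psi n l) x - K * tau <= heat (s0 + tau) y.
  rewrite add; apply: le_trans _ (hi l n x); apply: backs_le => z; rewrite lerD2l lerN2.
  by have /andP[] := Kt z.
by rewrite ler_norml; apply/andP; split; lra.
Qed.

End lindeberg.

(* The stopped exponential supermartingale, evaluated at the current state. *)
Section ville.
Variables (t u : R).
Hypotheses (t0 : 0 <= t) (u0 : 0 < u) (tD : 3 * (t * D) <= 1).

Fixpoint reaches n l z : bool :=
  if l is k.+1 then (u <= tdsums n l z) || reaches n.+1 k (step n z) else false.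

Let W n l z : R := if reaches n l z then 1
  else expR (t * (tdsums n l z - u) + t ^+ 2 * (tau - tvsums n l z)).

(** Since [expR (- a)] is at least [(1 - a / 2) ^ 2], it suffices that
    [(1 - a / 2) ^ 2 * (1 + a + a ^ 2)] be at least 1, which holds when [1 - 3 * a + a ^ 2] is
    nonnegative. *)
Let expR_le_quad (a : R) : 3 * `|a| <= 1 -> expR a <= 1 + a + a ^+ 2.
Proof.
move=> a3; have : `|a| <= 1 / 3 by lra.
rewrite ler_norml => /andP[a1 a2].
have e1 : 1 - a / 2 <= expR (- (a / 2)) by apply: expR_ge1Dx.
have e2 : (1 - a / 2) ^+ 2 <= expR (- a).
  have -> : expR (- a) = expR (- (a / 2)) ^+ 2 by rewrite expr2 -expRD; congr expR; lra.
  by rewrite ler_pXn2r// ?nnegrE ?expR_ge0//; lra.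
have e0 : 0 < expR (- a) by exact: expR_gt0.
have Q : 1 <= (1 - a / 2) ^+ 2 * (1 + a + a ^+ 2).
  have -> : (1 - a / 2) ^+ 2 * (1 + a + a ^+ 2) = 1 + a ^+ 2 / 4 * (1 - 3 * a + a ^+ 2) by field.
  by rewrite lerDl mulr_ge0 ?divr_ge0 ?sqr_ge0//; have := sqr_ge0 a; lra.
have q0 : 0 <= 1 + a + a ^+ 2 by have := sqr_ge0 a; lra.
rewrite -[expR a]invrK -expRN -div1r ler_pdivrMr// mulrC.
by apply: le_trans Q _; rewrite ler_wpM2r.
Qed.

Let W_step n l p : back n (W n l.+1) p <= W n.+1 l p.
Proof.
have /andP[v0 vt] := tvsums_bounds n.+1 l p; have /andP[g0 _] := cvar_bounds n p.
case: (boolP (reaches n.+1 l p)) => rp.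
  rewrite {2}/W rp (@back_eq_cst n _ p 1)// => z zp.
  by rewrite /W /= zp rp orbT.
pose e0 := expR (t * (tdsums n.+1 l p - u) + t ^+ 2 * (tau - tvsums n.+1 l p)).
have -> : W n.+1 l p = e0 by rewrite /W (negbTE rp).
have Wz z : step n z = p -> W n l.+1 z <=
    expR (t * (tdsums n l.+1 z - u) + t ^+ 2 * (tau - tvsums n l.+1 z)).
  move=> zp; rewrite /W; case: ifP => //; rewrite [reaches _ _ _]/= zp (negbTE rp) orbF => h.
  have /andP[_ vz] := tvsums_bounds n l.+1 z.
  have h' : u <= tdsums n l.+1 z by rewrite /= zp.
  rewrite -[leLHS]expR0 ler_expR addr_ge0// mulr_ge0 ?sqr_ge0// subr_ge0//.
have [h|h] := leP (tvsums n.+1 l p + cvar n p) tau; last first.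
  apply: (@le_trans _ _ (back n (fun=> e0) p)); last by rewrite back_cst.
  apply: back_le => z zp; apply: le_trans (Wz z zp) _.
  by rewrite /= zp (lt_geF h).
pose a := expR (t * (tdsums n.+1 l p - u) + t ^+ 2 * (tau - tvsums n.+1 l p - cvar n p)).
apply: (@le_trans _ _ (back n (fun z => a + (a * t) * dd n z + (a * t ^+ 2) * dd n z ^+ 2) p)).
  apply: back_le => z zp; apply: le_trans (Wz z zp) _.
  have -> : tdsums n l.+1 z = tdsums n.+1 l p + dd n z by rewrite /= zp h.
  have -> : tvsums n l.+1 z = tvsums n.+1 l p + cvar n p by rewrite /= zp h.
  have -> : t * (tdsums n.+1 l p + dd n z - u) + t ^+ 2 * (tau - (tvsums n.+1 l p + cvar n p)) =
    (t * (tdsums n.+1 l p - u) + t ^+ 2 * (tau - tvsums n.+1 l p - cvar n p)) + t * dd n z by ring.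
  rewrite expRD -/a.
  have -> : a + (a * t) * dd n z + (a * t ^+ 2) * dd n z ^+ 2 = a * (1 + t * dd n z + (t * dd n z) ^+ 2) by ring.
  apply: ler_wpM2l; first exact: expR_ge0.
  apply: expR_le_quad; rewrite normrM (ger0_norm t0); apply: le_trans tD.
  by rewrite ler_wpM2l// ler_wpM2l.
rewrite back_quad; have -> : e0 = a * expR (t ^+ 2 * cvar n p).
  by rewrite /e0 /a -expRD; congr expR; ring.
have -> : a + a * t ^+ 2 * cvar n p = a * (1 + t ^+ 2 * cvar n p) by ring.
apply: ler_wpM2l; first exact: expR_ge0.
exact: expR_ge1Dx.
Qed.

Lemma ville n l x : backs n l (fun z => (reaches n l z)%:R) x <= expR (- (t * u) + t ^+ 2 * tau).
Proof.
apply: (@le_trans _ _ (backs n l (W n l) x)).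
  by apply: backs_le => z; rewrite /W; case: ifP => //= _; rewrite expR_ge0.
elim: l n x => [|l IH] n x.
  by rewrite /W /= ler_expR; lra.
apply: le_trans (IH n.+1 x) => /=.
by apply: backs_le => p; exact: W_step.
Qed.

Lemma reachesP n l m z : vsums n l z <= tau -> (m <= l)%N ->
  u <= dsums (n + m) (l - m) (iter_step step n m z) -> reaches n l z.
Proof.
elim: l n m z => [|l IH] n m z.
  by move=> _; rewrite leqn0 => /eqP-> /=; rewrite leNgt u0.
move=> vt; case: m => [_|m ml].
  by rewrite addn0 subn0 => h; apply/orP; left; have [_ ->] := tsums_eq vt.
move=> h; apply/orP; right; apply: (IH n.+1 m) => //.
  by move: vt => /=; have /andP[g0 _] := cvar_bounds n (step n z); lra.
by rewrite -iter_stepSl addSnnS -subSS.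
Qed.

End ville.

End sums.

Lemma dsumsN dd n l z : dsums (fun n z => - dd n z) n l z = - dsums dd n l z.
Proof. by rewrite !dsumsE -sumrN. Qed.

Lemma vsumsN dd n l z : vsums (fun n z => - dd n z) n l z = vsums dd n l z.
Proof.
rewrite !vsumsE; apply: eq_bigr => i _; congr (back _ _ _).
by apply/funext => y; rewrite sqrrN.
Qed.

End backward.

Lemma shrink_bounds {R : realFieldType} (u B del r : R) : 0 <= del -> 1 <= r -> r <= 1 + del ->
  `|u| <= B -> u - del * B <= u / r <= u + del * B.
Proof.
move=> d0 r1 rd uB; have r0 : 0 < r by lra.
have B0 : 0 <= B := le_trans (normr_ge0 u) uB.
have q : `|u - u / r| <= del * B.
  have -> : u - u / r = u * ((r - 1) / r) by field; rewrite gt_eqF.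
  have t0 : 0 <= (r - 1) / r by rewrite divr_ge0//; lra.
  have t1 : (r - 1) / r <= del by rewrite ler_pdivrMr//; nra.
  by rewrite normrM (ger0_norm t0) mulrC; apply: ler_pM.
by move: q; rewrite ler_norml => /andP[q1 q2]; apply/andP; split; lra.
Qed.

(** Enlarging the variance by the factor [1 + 2 * del] divides the argument by at most [1 + del],
    which moves an argument of size at most [B] by at most [del * B]. *)
Lemma heat_scale {R : realType} (v del B u : R) : 0 < v -> 0 <= del -> `|u| <= B ->
  heat v (u - del * B) <= heat ((1 + 2 * del) * v) u <= heat v (u + del * B).
Proof.
move=> v0 d0 uB.
have r1 : 1 <= Num.sqrt (1 + 2 * del) by rewrite -{1}sqrtr1 ler_wsqrtr//; lra.
have rd : Num.sqrt (1 + 2 * del) <= 1 + del.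
  have d1 : 0 <= 1 + del by lra.
  rewrite -[leRHS](ger0_norm d1) -sqrtr_sqr ler_wsqrtr//.
  by have := sqr_ge0 del; lra.
have -> : heat ((1 + 2 * del) * v) u = heat v (u / Num.sqrt (1 + 2 * del)).
  by rewrite /heat sqrtrM ?invfM ?mulrA//; lra.
by have /andP[h1 h2] := shrink_bounds d0 r1 rd uB; rewrite !heat_le.
Qed.

Lemma block_cdf_lower {R : realFieldType} (H0 H1 H2 bp bb bd k : R) :
  H0 <= H1 -> H1 <= H2 -> - k <= bp - H2 -> bp - bb <= bd -> H0 - (bb + k) <= bd.
Proof. by lra. Qed.

Lemma block_cdf_upper {R : realFieldType} (H0 H1 H2 bp bb bd k : R) :
  H1 <= H0 -> H2 <= H1 -> bp - H2 <= k -> bd <= bp + bb -> bd <= H0 + (bb + k).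
Proof. by lra. Qed.

Lemma shift_lower {R : realFieldType} (u e t : R) : t <= e -> u - 2 * e <= u - e - t.
Proof. by lra. Qed.

Lemma shift_upper {R : realFieldType} (u e t : R) : t <= e -> u + e + t <= u + 2 * e.
Proof. by lra. Qed.

(** * Conditional distribution and maximum of a block sum *)

Section block_law.
Context {R : realType} {d} {S : measurableType d} (mu : probability S R).
Variable (c : reverse_chain mu).
Local Notation step := (chain_step c).
Local Notation back := (back c).
Local Notation backs := (backs c).
Implicit Types (F G : S -> R) (x y z : S).
Variables (dd : nat -> S -> R) (D : R).
Hypothesis D0 : 0 < D.
Hypothesis ddD : forall n z, `|dd n z| <= D.
Hypothesis dd_meas : forall n, measurable_fun setT (dd n).
Hypothesis dd_back : forall n x, back n (dd n) x = 0.
Local Notation cvar := (cvar c dd).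
Local Notation dsums := (dsums c dd).
Local Notation vsums := (vsums c dd).

Definition vbad v del n l z : bool := del * v < `|vsums n l z - v|.

(** Three sources of error: a conditional variance off by more than [del * v], the Lindeberg error
    [K * tau] with [tau = (1 + del) * v], and the tail beyond [e] of the smoothing Gaussian, whose
    variance is at most [3 * del * v]. *)
Definition block_err v del e n l x : R := backs n l (fun z => (vbad v del n l z)%:R) x +
  (3 * D * (Num.sqrt (del * v))^-1 ^+ 3 * ((1 + del) * v) + expR (- (e ^+ 2 / (6 * (del * v))))).

(** Smoothed indicators at [u + e] and [u - e] sandwich the indicator up to a Gaussian tail.
    [lindeberg] evaluates them with variance [(1 + 2 * del) * v], and returning to the variance [v]
    costs a second shift by at most [e]. *)
Lemma block_cdf (v del e B u : R) n l x : 0 < v -> 0 < del -> D ^+ 2 <= del * v -> 0 <= e ->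
  del * B <= e -> `|u| + e <= B ->
  heat v (u - 2 * e) - block_err v del e n l x <=
    backs n l (fun z => (dsums n l z < u)%R%:R) x <=
  heat v (u + 2 * e) + block_err v del e n l x.
Proof.
move=> v0 d0 Ds e0 dB uB.
pose tau := (1 + del) * v; pose s0 := del * v.
have tau0 : 0 <= tau by rewrite mulr_ge0 ?ltW//; lra.
have s00 : 0 < s0 by rewrite mulr_gt0.
have stE : s0 + tau = (1 + 2 * del) * v by rewrite /s0 /tau; ring.
set T := expR (- (e ^+ 2 / (6 * (del * v)))).
have T0 : 0 <= T by exact: expR_ge0.
pose psi w z := heat (s0 + tau - tvsums c dd tau n l z) (w - tdsums c dd tau n l z).
have cst a : backs n l (fun=> a) x = a by rewrite backs_cst.
(* The variance spent lies between [(1 - del) * v] and [tau], so nothing was skipped, and between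
   [s0] and [3 * s0] of variance is left for smoothing. *)
have good z : ~~ vbad v del n l z -> [/\ tdsums c dd tau n l z = dsums n l z,
    s0 <= s0 + tau - tvsums c dd tau n l z & s0 + tau - tvsums c dd tau n l z <= 3 * s0].
  rewrite /vbad -leNgt ler_norml => /andP[h1 h2].
  have vt : vsums n l z <= tau by rewrite /tau; lra.
  have [-> ->] := tsums_eq D0 ddD vt.
  by split => //; rewrite /s0 /tau; lra.
have tail s : s0 <= s -> s <= 3 * s0 -> expR (- (e ^+ 2 / (2 * s))) <= T.
  move=> h1 h2; rewrite /T ler_expR lerN2 ler_wpM2l ?sqr_ge0//.
  rewrite lef_pV2 ?posrE; [rewrite -/s0; lra|rewrite -/s0; lra|lra].
have up z : (dsums n l z < u)%R%:R <= psi (u + e) z + ((vbad v del n l z)%:R + T) :> R.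
  case: (boolP (vbad v del n l z)) => hb /=.
    have : (dsums n l z < u)%R%:R <= 1 :> R by rewrite lern1 leq_b1.
    by have := heat_ge0 (s0 + tau - tvsums c dd tau n l z) (u + e - tdsums c dd tau n l z); rewrite /psi; lra.
  have [h1 h2 h3] := good z hb; rewrite add0r.
  case: ltP => /= h; last by rewrite addr_ge0// heat_ge0.
  have s1 : 0 < s0 + tau - tvsums c dd tau n l z by lra.
  have [ht _] := heat_tail (u + e - tdsums c dd tau n l z) s1 e0.
  have := ht _; rewrite h1 => /(_ ltac:(lra)).
  by have := tail _ h2 h3; rewrite /psi h1; lra.
have lo z : psi (u - e) z - ((vbad v del n l z)%:R + T) <= (dsums n l z < u)%R%:R :> R.
  case: (boolP (vbad v del n l z)) => hb /=.
    have : 0 <= (dsums n l z < u)%R%:R :> R by [].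
    by have := heat_le1 (s0 + tau - tvsums c dd tau n l z) (u - e - tdsums c dd tau n l z); rewrite /psi; lra.
  have [h1 h2 h3] := good z hb; rewrite add0r.
  case: ltP => /= h.
    by have := heat_le1 (s0 + tau - tvsums c dd tau n l z) (u - e - tdsums c dd tau n l z); rewrite /psi; lra.
  have s1 : 0 < s0 + tau - tvsums c dd tau n l z by lra.
  have [_ ht] := heat_tail (u - e - tdsums c dd tau n l z) s1 e0.
  have := ht _; rewrite h1 => /(_ ltac:(lra)).
  by have := tail _ h2 h3; rewrite /psi h1; lra.
have errE : block_err v del e n l x = backs n l (fun z => (vbad v del n l z)%:R + T) x +
    3 * D * (Num.sqrt s0)^-1 ^+ 3 * tau.
  rewrite (backsD c n l (fun z => (vbad v del n l z)%:R) (fun=> T)) cst /block_err -/T -/s0 -/tau.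
  ring.
have b1 : `|u + e| <= B by apply: le_trans (ler_normD _ _) _; rewrite (ger0_norm e0).
have b2 : `|u - e| <= B by apply: le_trans (ler_normB _ _) _; rewrite (ger0_norm e0).
have /andP[_ su] := heat_scale v0 (ltW d0) b1.
have /andP[sl _] := heat_scale v0 (ltW d0) b2.
apply/andP; split.
- have := lindeberg D0 ddD dd_back tau0 (u - e) Ds n l x; rewrite -/(psi (u - e)) stE ler_norml => /andP[h1 _].
  have h2 : backs n l (psi (u - e)) x - backs n l (fun z => (vbad v del n l z)%:R + T) x <=
     backs n l (fun z => (dsums n l z < u)%R%:R) x.
    apply: le_trans (backs_le c n l x lo).
    rewrite (backsD c n l (psi (u - e)) (fun z => - ((vbad v del n l z)%:R + T))).
    rewrite (_ : (fun z => - _) = fun z => -1 * ((vbad v del n l z)%:R + T)); last by apply/funext => z; rewrite mulN1r.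
    by rewrite backsZ mulN1r.
  rewrite errE; apply: (block_cdf_lower _ sl h1 h2).
  by apply: heat_le; exact: shift_lower.
- have := lindeberg D0 ddD dd_back tau0 (u + e) Ds n l x; rewrite -/(psi (u + e)) stE ler_norml => /andP[_ h1].
  have h2 := backs_le c n l x up.
  rewrite (backsD c n l (psi (u + e)) (fun z => (vbad v del n l z)%:R + T)) in h2.
  rewrite errE; apply: (block_cdf_upper _ su h1 h2).
  by apply: heat_le; exact: shift_upper.
Qed.

Lemma vbad_meas v del n l : measurable [set z | vbad v del n l z].
Proof.
have m1 : measurable_fun setT (fun z => del * v < `|vsums n l z - v|).
  apply: measurable_fun_ltr => //; apply: measurableT_comp => //.
  by apply: measurable_funB => //; exact: vsums_meas.
by rewrite -[X in measurable X]setTI; exact: (m1 measurableT [set true]).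
Qed.

(** The sums run from an intermediate time to the end of the block: these, not the initial segments,
    form a martingale when time is reversed. *)
Definition peak u n l z : bool :=
  has (fun m => u <= `|dsums (n + m) (l - m) (iter_step step n m z)|) (iota 0 l.+1).

Lemma peak_meas u n l : measurable [set z | peak u n l z].
Proof.
rewrite (_ : [set _ | _] = \bigcup_(m in [set m | (m <= l)%N])
    [set z | u <= `|dsums (n + m) (l - m) (iter_step step n m z)|]).
  apply: bigcup_measurable => m _; rewrite -[X in measurable X]setTI; apply: measurable_fun_le => //.
  apply: measurableT_comp => //; apply: (measurableT_comp _ (iter_step_meas c n m)).
  exact: dsums_meas.
apply/seteqP; split => z /=.
  by move=> /hasP[m]; rewrite mem_iota add0n ltnS => /andP[_ ml] h; exists m.
by move=> [m ml h]; apply/hasP; exists m => //; rewrite mem_iota add0n ltnS.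
Qed.

(** Off the event of a bad variance the truncated sums are the true ones, so [ville] applies; using
    it for [dd] and for [- dd] gives the factor 2. *)
Lemma block_peak (v del t u : R) n l : 0 < v -> 0 < del -> 0 < u -> 0 <= t -> 3 * (t * D) <= 1 ->
  (mu [set x | peak u n l (iter_step step 0 n x)] <=
   mu [set x | vbad v del n l (iter_step step 0 n x)] +
   (2 * expR (- (t * u) + t ^+ 2 * ((1 + del) * v)))%:E)%E.
Proof.
move=> v0 d0 u0 t0 tD; set tau := (1 + del) * v.
have tau0 : 0 <= tau by rewrite mulr_ge0 ?ltW//; lra.
pose N n z := - dd n z.
have ND n' z : `|N n' z| <= D by rewrite normrN.
have N_back n' x : back n' (N n') x = 0 by rewrite backN dd_back oppr0.
pose Q := [set z | peak u n l z] `\` [set z | vbad v del n l z].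
have mQ : measurable Q by apply: measurableD; [exact: peak_meas|exact: vbad_meas].
have mX := iter_step_meas c 0 n.
have pre (A : set S) : measurable A -> measurable [set x | A (iter_step step 0 n x)].
  by move=> mA; rewrite -[X in measurable X]setTI; exact: mX.
have sub : [set x | peak u n l (iter_step step 0 n x)] `<=`
    [set x | vbad v del n l (iter_step step 0 n x)] `|` [set x | Q (iter_step step 0 n x)].
  move=> x /= h; case: (boolP (vbad v del n l (iter_step step 0 n x))) => hb; [by left|right].
  by split => //; exact/negP.
apply: (@le_trans _ _ (mu ([set x | vbad v del n l (iter_step step 0 n x)] `|` [set x | Q (iter_step step 0 n x)]))).
  apply: le_measure; rewrite ?inE//; first exact: (pre _ (peak_meas u n l)).
  by apply: measurableU; [exact: (pre _ (vbad_meas v del n l))|exact: pre].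
apply: le_trans (measureU2 _ _ _) _; [exact: (pre _ (vbad_meas v del n l))|exact: pre|].
rewrite leeD2l//.
have hQ : (mu [set x | Q (iter_step step 0 n x)] <= \int[mu]_x (\1_Q (iter_step step 0 n x))%:E)%E.
  by rewrite -[X in mu X]setIT -integral_indic//; exact: pre.
apply: le_trans hQ _; rewrite (backs_int c n l (measurable_indic mQ)) => [|x]; last by rewrite indicE.
pose b := 2 * expR (- (t * u) + t ^+ 2 * tau).
have b0 : 0 <= b by rewrite mulr_ge0 ?expR_ge0.
apply: (@le_trans _ _ (\int[mu]_x (cst b%:E x))%E); last first.
  by rewrite integral_cst//= -[leRHS]mule1 lee_wpmul2l ?lee_fin//; exact: probability_le1.
apply: ge0_le_integral => //.
- by move=> x _; rewrite lee_fin; apply: backs_ge0 => z; rewrite indicE.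
- apply/measurable_EFinP; apply: (measurableT_comp (backs_meas c n l (measurable_indic mQ))).
  exact: iter_step_meas.
move=> x _; rewrite lee_fin.
set y := iter_step step 0 _ x.
apply: (@le_trans _ _ (backs n l (fun z => (reaches c dd tau u n l z)%:R + (reaches c N tau u n l z)%:R) y)).
  apply: backs_le => z; rewrite indicE; case: (boolP (z \in Q)) => [/set_mem[hp hv]|_]; last by rewrite addr_ge0.
  have vt : vsums n l z <= tau.
    by move/negP: hv; rewrite /vbad -leNgt ler_norml => /andP[_]; rewrite /tau; lra.
  move: hp => /hasP[m]; rewrite mem_iota add0n ltnS => /andP[_ ml].
  rewrite ler_normr => /orP[] hu.
    by rewrite (reachesP D0 ddD u0 vt ml hu) lerDl.
  have vt' := vt; rewrite -(vsumsN c dd) in vt'.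
  by rewrite (reachesP D0 ND u0 vt' ml _) ?lerDr// dsumsN.
rewrite (backsD c n l (fun z => (reaches c dd tau u n l z)%:R) (fun z => (reaches c N tau u n l z)%:R)).
rewrite /b mulr_natl mulr2n; apply: lerD.
  exact: (ville D0 ddD dd_back tau0 u t0 tD n l y).
exact: (ville D0 ND N_back tau0 u t0 tD n l y).
Qed.

End block_law.

(** * Coupling by rejection sampling *)

Section rejection.
Context {R : realType}.
Implicit Types (E C : set coins) (w v : coins).
Local Notation fair := (@fair R).
Local Notation fr A := (fine (fair A)).

Lemma frE (A : set coins) : measurable A -> (fr A)%:E = fair A.
Proof. by move=> mA; rewrite fineK// fin_num_measure. Qed.

Lemma integral_fair_indic (A : set coins) : measurable A -> (\int[fair]_w (\1_A w)%:E = fair A)%E.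
Proof. by move=> mA; rewrite integral_indic// setIT. Qed.

Lemma law_coin_at (l : nat) (B : nat -> set coins) : (forall i, measurable (B i)) ->
  fair [set w | forall i, (i < l)%N -> B i (coin_at i w)] = (\prod_(i < l) fr (B i))%:E.
Proof.
elim: l B => [|l IH] B mB.
  by rewrite big_ord0 (_ : [set _ | _] = setT) ?[LHS](@probability_setT _ _ _ fair)//; apply/seteqP; split.
have mA k (B' : nat -> set coins) : (forall i, measurable (B' i)) ->
    measurable [set w : coins | forall i, (i < k)%N -> B' i (coin_at i w)].
  move=> mB'; rewrite (_ : [set _ | _] = \bigcap_(i < k) ((coin_at i) @^-1` B' i)).
    apply: bigcap_measurableType => i _; rewrite -[X in measurable X]setTI.
    exact: (measurable_coin_at i measurableT (mB' i)).
  by apply/seteqP; split => w h i /h.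
pose A2 := [set w : coins | forall i, (i < l)%N -> B i.+1 (coin_at i w)].
pose F (p : coins * coins) : \bar R := (\1_(B 0%N) p.1 * \1_A2 p.2)%:E.
have m2 : measurable A2 := mA l (fun i => B i.+1) (fun i => mB i.+1).
have mF : measurable_fun setT F.
  apply/measurable_EFinP; apply: measurable_funM.
    by apply: (measurableT_comp (measurable_indic (mB 0%N))); exact: measurable_fst.
  by apply: (measurableT_comp (measurable_indic m2)); exact: measurable_snd.
have F0 p : (0 <= F p)%E by rewrite lee_fin !indicE mulr_ge0.
rewrite -integral_fair_indic; last exact: mA.
transitivity (\int[fair]_w F (evens w, odds w))%E.
  apply: eq_integral => w _; rewrite /F !indicE -natrM mulnb; congr (nat_of_bool _)%:R%:E.
  apply/idP/andP; rewrite !inE/=.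
    by move=> h; split; [exact: (h 0%N)|move=> i il; rewrite -coin_atS; exact: (h i.+1)].
  move=> [h0 h] [|i] il //; rewrite coin_atS; exact: h.
rewrite fair_fubini// big_ord_recl EFinM frE//.
transitivity (\int[fair]_a ((\1_(B 0%N) a)%:E * fair A2))%E.
  apply: eq_integral => a _; rewrite /F/=; under eq_integral do rewrite EFinM.
  rewrite ge0_integralZl ?lee_fin ?indicE//.
  - by congr (_ * _)%E; exact: integral_fair_indic.
  - exact/measurable_EFinP/measurable_indic.
have mI : measurable_fun setT (fun x : coins => (\1_(B 0%N) x : R)%:E).
  exact/measurable_EFinP/measurable_indic.
rewrite ge0_integralZr//.
rewrite [X in (_ * X)%E](IH (fun i => B i.+1)) => [|i]; last exact: mB.
by congr (_ * _)%E; rewrite integral_fair_indic.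
Qed.

(* The first term of an i.i.d. sequence that falls in [E]: von Neumann's rejection sampling. *)
Definition sel E w : coins :=
  if pselect (exists k, `[< E (coin_at k w) >]) is left h then coin_at (ex_minn h) w else point.

Lemma selP E C w : C (sel E w) <->
  (exists k, [/\ E (coin_at k w), forall i, (i < k)%N -> ~ E (coin_at i w) & C (coin_at k w)]) \/
  ((forall k, ~ E (coin_at k w)) /\ C point).
Proof.
rewrite /sel; case: pselect => [h|no].
  case: ex_minnP => m /asboolP Em mmin; split => [Cm|[[k [Ek kmin Ck]]|[none]]]; last by case: (none m).
    left; exists m; split => // i im Ei.
    by have := mmin i (introT (asboolP _) Ei); rewrite leqNgt im.
  have mk : (m <= k)%N by apply: mmin; exact/asboolP.
  have km : (k <= m)%N by rewrite leqNgt; apply/negP => h'; exact: (kmin m h' Em).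
  by have <- : k = m by apply/eqP; rewrite eqn_leq mk km.
have none k : ~ E (coin_at k w) by move=> Ek; apply: no; exists k; exact/asboolP.
split => [Cp|[[k [Ek _ _]]|[]//]]; last by case: (none k).
by right.
Qed.

(** The search renews itself: if the first candidate is rejected, it starts afresh on the
    independent sequence [odds w]. *)
Lemma sel_rec E C w : C (sel E w) <->
  (E (evens w) /\ C (evens w)) \/ (~ E (evens w) /\ C (sel E (odds w))).
Proof.
split.
  move=> /selP[[[|k] [Ek kmin Ck]]|[none Cp]].
  - by left.
  - right; split; first exact: (kmin 0%N).
    apply/selP; left; exists k; rewrite -!coin_atS; split => // i ik.
    by rewrite -coin_atS; exact: kmin.
  - right; split; first exact: (none 0%N).
    by apply/selP; right; split => // k; rewrite -coin_atS; exact: none.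
move=> [[E0 C0]|[E0 /selP[[k [Ek kmin Ck]]|[none Cp]]]]; apply/selP.
- by left; exists 0%N.
- left; exists k.+1; rewrite !coin_atS; split => // -[|i] ik; first exact: E0.
  by rewrite coin_atS; exact: kmin.
- right; split => // -[|k]; first exact: E0.
  by rewrite coin_atS; exact: none.
Qed.

Lemma measurable_sel d (T : measurableType d) (E : T -> set coins) (g : T -> coins) C :
  (forall k, measurable [set x | E x (coin_at k (g x))]) ->
  measurable_fun setT g -> measurable C ->
  measurable [set x | C (sel (E x) (g x))].
Proof.
move=> mE mg mC.
have mCk k : measurable [set x | C (coin_at k (g x))].
  rewrite -[X in measurable X]setTI.
  exact: (measurableT_comp (measurable_coin_at k) mg measurableT mC).
rewrite (_ : [set _ | _] =
   \bigcup_k ([set x | E x (coin_at k (g x))] `&`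
      (\bigcap_(i < k) (~` [set x | E x (coin_at i (g x))])) `&` [set x | C (coin_at k (g x))]) `|`
   ((\bigcap_k (~` [set x | E x (coin_at k (g x))])) `&` [set x | C point])).
  apply: measurableU.
    apply: bigcupT_measurable => k; apply: measurableI => //; apply: measurableI => //.
    by apply: bigcap_measurableType => i _; exact: measurableC.
  apply: measurableI; first by apply: bigcapT_measurable => k; exact: measurableC.
  have [Cp|Cp] := pselect (C point).
    by rewrite (_ : [set x : T | _] = setT)//; apply/seteqP; split.
  by rewrite (_ : [set x : T | _] = set0)//; apply/seteqP; split.
apply/seteqP; split => x /=.
  move=> /selP[[k [h1 h2 h3]]|[h1 h2]]; first by left; exists k.
  by right; split => // k _; exact: h1.
move=> [[k _ [[h1 h2] h3]]|[h1 h2]]; apply/selP; first by left; exists k.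
by right; split => // k; exact: h1.
Qed.

Lemma measurable_sel_cst E C : measurable E -> measurable C -> measurable [set w | C (sel E w)].
Proof.
move=> mE mC; apply: (measurable_sel (E := fun=> E) (g := id)) => //.
by move=> k; rewrite -[X in measurable X]setTI; exact: measurable_coin_at.
Qed.

(** By [sel_rec] the unknown probability equals that of [C] and [E] together plus the probability of
    rejection times itself; solving this linear equation gives the conditional law. *)
Lemma law_sel E C : measurable E -> measurable C -> 0 < fr E ->
  fr [set w | C (sel E w)] = fr (C `&` E) / fr E.
Proof.
move=> mE mC E0; pose A := [set w | C (sel E w)].
have mA : measurable A := measurable_sel_cst mE mC.
have mCE : measurable (C `&` E) by exact: measurableI.
have mE' : measurable (~` E) by exact: measurableC.
suff h : fair A = (fair (C `&` E) + fair (~` E) * fair A)%E.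
  have h' : fr A = fr (C `&` E) + (1 - fr E) * fr A.
    have e : fr (~` E) = 1 - fr E.
      have := probability_setC fair mE; rewrite -[X in X = _](frE mE') -[X in (_ - X)%E](frE mE) -EFinB.
      by case.
    by rewrite -e; apply: EFin_inj; rewrite EFinD EFinM !frE.
  by apply: (mulIf (lt0r_neq0 E0)); rewrite divfK ?lt0r_neq0//; move: h'; rewrite /A; lra.
pose F (p : coins * coins) : \bar R := ((\1_(C `&` E) p.1)%:E + (\1_(~` E) p.1)%:E * (\1_A p.2)%:E)%E.
have mi1 (B : set coins) : measurable B -> measurable_fun setT (fun p : coins * coins => (\1_B p.1 : R)%:E).
  by move=> mB; apply/measurable_EFinP; apply: (measurableT_comp (measurable_indic mB)); exact: measurable_fst.
have mi2 (B : set coins) : measurable B -> measurable_fun setT (fun p : coins * coins => (\1_B p.2 : R)%:E).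
  by move=> mB; apply/measurable_EFinP; apply: (measurableT_comp (measurable_indic mB)); exact: measurable_snd.
have mF : measurable_fun setT F.
  apply: emeasurable_funD; first exact: mi1.
  by apply: emeasurable_funM; [exact: mi1|exact: mi2].
have F0 p : (0 <= F p)%E by rewrite adde_ge0 ?mule_ge0 ?lee_fin ?indicE.
have mi (B : set coins) : measurable B -> measurable_fun setT (fun p : coins => (\1_B p : R)%:E).
  by move=> mB; apply/measurable_EFinP; exact: measurable_indic.
rewrite -[LHS]integral_fair_indic//.
transitivity (\int[fair]_w F (evens w, odds w))%E.
  apply: eq_integral => w _; rewrite /F/= !indicE.
  have [Ew|Ew] := pselect (E (evens w)).
    rewrite [evens w \in ~` E]memNset// mul0e adde0; congr (nat_of_bool _)%:R%:E.
    apply/idP/idP; rewrite !inE/=; first by move=> /sel_rec[[]|[]].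
    by move=> [Cw _]; apply/sel_rec; left.
  rewrite [evens w \in ~` E]mem_set// mul1e [_ \in C `&` E]memNset ?add0e; last by case.
  congr (nat_of_bool _)%:R%:E; apply/idP/idP; rewrite !inE/=; first by move=> /sel_rec[[]|[]].
  by move=> h; apply/sel_rec; right.
rewrite fair_fubini//.
transitivity (\int[fair]_a ((\1_(C `&` E) a)%:E + (\1_(~` E) a)%:E * fair A))%E.
  apply: eq_integral => a _; rewrite /F/= ge0_integralD//.
  - rewrite integral_cst// [X in (_ * X)%E](@probability_setT _ _ _ fair) mule1; congr (_ + _)%E.
    have miA := mi A mA.
    rewrite ge0_integralZl//.
    by congr (_ * _)%E; exact: integral_fair_indic.
  - by apply: emeasurable_funM => //; exact: mi.
have m1 : measurable_fun setT (fun a : coins => (\1_(C `&` E) a : R)%:E) := mi _ mCE.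
have m2 : measurable_fun setT (fun a : coins => (\1_(~` E) a : R)%:E * fair A)%E.
  by apply: emeasurable_funM => //; exact: mi.
have n2 (a : coins) : setT a -> (0 <= (\1_(~` E) a : R)%:E * fair A)%E.
  by move=> _; rewrite mule_ge0 ?lee_fin ?indicE.
have m3 : measurable_fun setT (fun a : coins => (\1_(~` E) a : R)%:E) := mi _ mE'.
rewrite ge0_integralD//.
rewrite [X in (X + _)%E]integral_fair_indic//; congr (_ + _)%E.
rewrite ge0_integralZr//.
by congr (_ * _)%E; exact: integral_fair_indic.
Qed.

End rejection.

Section coupling.
Context {R : realType} {d} {S : measurableType d} (mu : probability S R).
Variable (c : reverse_chain mu).
Local Notation step := (chain_step c).
Local Notation back := (back c).
Local Notation fair := (@fair R).
Local Notation fr A := (fine (fair A)).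
Local Notation Xs j := (iter_step step 0 j).
Implicit Types (x z : S) (w v : coins) (k : nat).

Variables (kap : nat -> S -> nat) (K : nat -> nat) (U : nat -> coins -> R).
Hypothesis kapK : forall j z, (kap j z <= K j)%N.
Hypothesis kap_meas : forall j k, measurable [set z | kap j z = k].
Hypothesis U_meas : forall j, measurable_fun setT (U j).
Hypothesis U01 : forall j w, 0 <= U j w < 1.
Hypothesis U_unif : forall j (t : R), 0 <= t <= 1 -> fr [set w | U j w < t] = t.

Lemma kap_indic_meas j (P : nat -> bool) : measurable_fun setT (fun z => (P (kap j z))%:R : R).
Proof.
rewrite (_ : (fun z => _) = \1_[set z | P (kap j z)]); last first.
  apply/funext => z; rewrite indicE; congr (nat_of_bool _)%:R.
  by apply/idP/idP => [h|/set_mem//]; rewrite inE.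
apply: measurable_indic.
rewrite (_ : [set z | _] = \bigcup_(k in [set k | P k]) [set z | kap j z = k]).
  by apply: bigcup_measurable.
by apply/seteqP; split => z /=; [move=> h; exists (kap j z)|move=> [k /= Pk e]; rewrite e].
Qed.

(** The conditional distribution function of [kap], given the next state [x]. *)
Definition cellp j k x : R := back j (fun z => (kap j z < k)%N%:R) x.

(** An event about the uniform variable [U j] whose probability is exactly the conditional
    probability of [kap = k] given [x]; the order of the cells is that of the values of [U]. *)
Definition cell j k x : set coins := [set w | cellp j k x <= U j w < cellp j k.+1 x].

Lemma cellp0 j x : cellp j 0 x = 0.
Proof. exact: back_eq_cst. Qed.

Lemma cellpK j x : cellp j (K j).+1 x = 1.
Proof. by apply: back_eq_cst => z _; rewrite ltnS kapK. Qed.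

Lemma cellp_le j k l x : (k <= l)%N -> cellp j k x <= cellp j l x.
Proof.
move=> kl; apply: back_le => z _; rewrite ler_nat.
by case: (ltnP (kap j z) k) => //= h; rewrite (leq_trans h kl).
Qed.

Lemma cellp01 j k x : 0 <= cellp j k x <= 1.
Proof.
apply/andP; split; first by apply: back_ge0.
apply: (@le_trans _ _ (back j (fun=> 1) x)); last by rewrite back_cst.
by apply: back_le => z _; rewrite lern1 leq_b1.
Qed.

Lemma cellpB j k x : cellp j k.+1 x - cellp j k x = back j (fun z => (kap j z == k)%:R) x.
Proof.
have e : back j (fun z => (kap j z == k)%:R + (kap j z < k)%N%:R) x = cellp j k.+1 x.
  apply: back_local => z _; rewrite ltnS [in RHS]leq_eqVlt.
  by have [->|_] := eqVneq (kap j z) k; rewrite ?ltnn ?addr0 ?add0r.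
by rewrite -e (backD c j (fun z => (kap j z == k)%:R) (fun z => (kap j z < k)%N%:R)) addrK.
Qed.

Lemma cellp_meas j k : measurable_fun setT (cellp j k).
Proof. exact/back_meas/(kap_indic_meas j (fun i => (i < k)%N)). Qed.

Lemma U_lt_meas j t : measurable [set w | U j w < t].
Proof.
rewrite (_ : [set w | _] = ~` [set w | t <= U j w]); last first.
  by apply/seteqP; split => w /=; rewrite ltNge => /negP.
by apply: measurableC; rewrite -[X in measurable X]setTI; exact: measurable_fun_le.
Qed.

Lemma cellE j k x : cell j k x = [set w | U j w < cellp j k.+1 x] `\` [set w | U j w < cellp j k x].
Proof.
apply/seteqP; split => w; rewrite /cell/=.
  by move=> /andP[h1 h2]; split => //; apply/negP; rewrite -leNgt.
by move=> [h1 /negP]; rewrite -leNgt h1 andbT.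
Qed.

Lemma cell_meas j k x : measurable (cell j k x).
Proof. by rewrite cellE; apply: measurableD; exact: U_lt_meas. Qed.

Lemma fr_le (A B : set coins) : measurable A -> measurable B -> A `<=` B -> fr A <= fr B.
Proof.
move=> mA mB AB; apply: fine_le; rewrite ?fin_num_measure//.
by apply: le_measure; rewrite ?inE.
Qed.

Lemma fr_ge0 (A : set coins) : 0 <= fr A.
Proof. by apply: fine_ge0; exact: measure_ge0. Qed.

Definition mass_below j (C : set coins) t : R := fr (C `&` [set w | U j w < t]).

Lemma mass_below_le j C : measurable C -> {homo mass_below j C : s t / s <= t}.
Proof.
move=> mC s t st; apply: fr_le; try by apply: measurableI => //; exact: U_lt_meas.
by move=> w [Cw /= h]; split => //=; exact: lt_le_trans st.
Qed.

Lemma mass_below_meas j C : measurable C -> measurable_fun setT (mass_below j C).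
Proof. by move=> mC; apply: nondecreasing_measurable => //; exact: mass_below_le. Qed.

Lemma cell_mass_below j C k x : measurable C ->
  fr (C `&` cell j k x) = mass_below j C (cellp j k.+1 x) - mass_below j C (cellp j k x).
Proof.
move=> mC; apply/eqP; rewrite eq_sym subr_eq; apply/eqP.
have m1 : measurable (C `&` [set w | U j w < cellp j k x]) by apply: measurableI => //; exact: U_lt_meas.
have m2 : measurable (C `&` cell j k x) by apply: measurableI => //; exact: cell_meas.
have h : fair ((C `&` cell j k x) `|` (C `&` [set w | U j w < cellp j k x])) =
    (fair (C `&` cell j k x) + fair (C `&` [set w | (U j w < cellp j k x)%R]))%E.
  apply: measureU => //; apply/seteqP; split => // w [[_ /andP[h1 _]] [_ /= h2]].
  by move: h2; rewrite ltNge h1.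
rewrite /mass_below -fineD ?fin_num_measure// -h; congr (fine (fair _)).
apply/seteqP; split => w /=.
  move=> [Cw h1]; have [h2|h2] := ltP (U j w) (cellp j k x); [by right|left].
  by split => //; apply/andP.
by move=> [[Cw /andP[_ h1]]|[Cw h1]]; split => //; apply: lt_le_trans h1 _; exact: cellp_le.
Qed.

Lemma fr_cell_meas j C k : measurable C -> measurable_fun setT (fun x => fr (C `&` cell j k x)).
Proof.
move=> mC; under eq_fun do rewrite cell_mass_below//.
by apply: measurable_funB; apply: (measurableT_comp (mass_below_meas j mC)); exact: cellp_meas.
Qed.

Lemma fr_cell j k x : fr (cell j k x) = cellp j k.+1 x - cellp j k x.
Proof.
rewrite -[cell j k x]setTI cell_mass_below// /mass_below !setTI !U_unif//; exact: cellp01.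
Qed.

Lemma sum_cells j C x : measurable C -> \sum_(k < (K j).+1) fr (C `&` cell j k x) = fr C.
Proof.
move=> mC; under eq_bigr do rewrite cell_mass_below//.
rewrite -(big_mkord xpredT (fun k => mass_below j C (cellp j k.+1 x) - mass_below j C (cellp j k x))).
rewrite telescope_sumr// cellpK cellp0 /mass_below.
rewrite (_ : C `&` [set w | U j w < 1] = C); last first.
  by apply/seteqP; split => w; [case|move=> Cw; split => //=; have /andP[] := U01 j w].
rewrite (_ : C `&` [set w | U j w < 0] = set0) ?measure0 ?subr0//.
by apply/seteqP; split => // w [_ /=]; have /andP[h _] := U01 j w; rewrite ltNge h.
Qed.

Definition cellz j z : set coins := cell j (kap j z) (step j z).

(** The cell actually observed has positive conditional mass at every point, not merely almost
    everywhere, thanks to [back_gt0]; rejection sampling is thus never conditioned on a null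
    event. *)
Lemma fr_cellz_gt0 j z : 0 < fr (cellz j z).
Proof.
by rewrite fr_cell cellpB; apply: (back_gt0 c j (F := fun y => (kap j y == kap j z)%:R)); rewrite ?eqxx.
Qed.

Lemma kap_split j (a : nat -> R) z : a (kap j z) = \sum_(k < (K j).+1) (kap j z == k)%:R * a k.
Proof.
have kz : (kap j z < (K j).+1)%N by rewrite ltnS.
rewrite (bigD1 (Ordinal kz))//= eqxx mul1r big1 ?addr0// => k /negP h.
by case: eqP => [e|_]; rewrite ?mul0r//; case: h; apply/eqP/val_inj.
Qed.

Lemma back_kap j (a : nat -> R) x :
  back j (fun z => a (kap j z)) x = \sum_(k < (K j).+1) a k * fr (cell j k x).
Proof.
have sum_back (r : seq nat) : back j (fun z => \sum_(k <- r) a k * (kap j z == k)%:R) x =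
    \sum_(k <- r) a k * fr (cell j k x).
  elim: r => [|k r IH]; first by rewrite big_nil; apply: back_eq_cst => z _; rewrite big_nil.
  rewrite big_cons -IH fr_cell cellpB.
  rewrite -(congr1 (fun f => f x) (backZ c j (a k) (fun z => (kap j z == k)%:R))).
  rewrite -(congr1 (fun f => f x) (backD c j (fun z => a k * (kap j z == k)%:R) _)).
  by apply: back_local => z _; rewrite big_cons.
rewrite -(big_mkord xpredT (fun k => a k * fr (cell j k x))) -sum_back.
apply: back_local => z _; rewrite (kap_split j a z) -(big_mkord xpredT (fun k => (kap j z == k)%:R * a k)).
by apply: eq_bigr => k _; rewrite mulrC.
Qed.

Definition pick_prob j (D : nat -> set coins) z : R := fr [set w | D (kap j z) (sel (cellz j z) w)].

Lemma pick_probE j D z : (forall k, measurable (D k)) ->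
  pick_prob j D z = fr (D (kap j z) `&` cellz j z) / fr (cellz j z).
Proof. by move=> mD; apply: law_sel => //; [exact: cell_meas|exact: fr_cellz_gt0]. Qed.

(** Given the next state, [kap = k] has probability [fr (cell j k x)], and this factor cancels the
    denominator of the conditional law. For a constant [D] the cells recombine to the fair law,
    whatever [x] is. *)
Lemma back_pick_prob j D x : (forall k, measurable (D k)) ->
  back j (pick_prob j D) x = \sum_(k < (K j).+1) fr (D k `&` cell j k x).
Proof.
move=> mD.
transitivity (back j (fun z => fr (D (kap j z) `&` cell j (kap j z) x) / fr (cell j (kap j z) x)) x).
  by apply: back_local => z zx; rewrite pick_probE// /cellz zx.
rewrite (back_kap j (fun k => fr (D k `&` cell j k x) / fr (cell j k x))).
(* In a null cell the quotient is 0 by convention, and so is the mass on the other side. *)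
apply: eq_bigr => k _; have [e|ne] := eqVneq (fr (cell j k x)) 0; last by rewrite divfK.
rewrite e mulr0; apply/eqP; rewrite eq_le fr_ge0 /= -e; apply: fr_le.
- by apply: measurableI => //; exact: cell_meas.
- exact: cell_meas.
- by move=> w [].
Qed.

Lemma pick_prob_meas j D : (forall k, measurable (D k)) -> measurable_fun setT (pick_prob j D).
Proof.
move=> mD; rewrite (_ : pick_prob j D = fun z => \sum_(k < (K j).+1) (kap j z == k)%:R *
   ((mass_below j (D k) (cellp j k.+1 (step j z)) - mass_below j (D k) (cellp j k (step j z))) /
    (cellp j k.+1 (step j z) - cellp j k (step j z)))); last first.
  by apply/funext => z; rewrite pick_probE// -(kap_split j (fun k => (mass_below j (D k) (cellp j k.+1 (step j z)) - mass_below j (D k) (cellp j k (step j z))) /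
    (cellp j k.+1 (step j z) - cellp j k (step j z)))) /cellz cell_mass_below// fr_cell.
have mc k : measurable_fun setT (fun z => cellp j k (step j z)).
  exact: (measurableT_comp (cellp_meas j k) (step_meas c j)).
apply: measurable_sum => k; apply: measurable_funM; first exact: (kap_indic_meas j (fun i => i == k)).
apply: measurable_funM.
  by apply: measurable_funB; apply: (measurableT_comp (mass_below_meas j (mD k))).
(* The difference is nonnegative, so its inverse is the real power with exponent -1, a measurable
   function. *)
rewrite (_ : (fun z => _) = fun z => (cellp j k.+1 (step j z) - cellp j k (step j z)) `^ (-1)).
  by apply: (measurableT_comp (measurable_powR _)); exact: measurable_funB.
by apply/funext => z; rewrite powR_inv1// subr_ge0 cellp_le.
Qed.

Lemma pick_prob_ge0 j D z : 0 <= pick_prob j D z.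
Proof. exact: fr_ge0. Qed.

(** Block [j] reads its own sequence [coin_at j], which in turn supplies the independent candidates
    of the search. *)
Definition pick j (p : S * coins) : coins := sel (cellz j (Xs j p.1)) (coin_at j p.2).

Lemma cellz_meas j k : measurable [set p : S * coins | cellz j (Xs j p.1) (coin_at k (coin_at j p.2))].
Proof.
have mXp : measurable_fun setT (fun p : S * coins => Xs j p.1).
  by apply: (measurableT_comp (iter_step_meas c 0 j)); exact: measurable_fst.
have mUp : measurable_fun setT (fun p : S * coins => U j (coin_at k (coin_at j p.2))).
  apply: (measurableT_comp (U_meas j)); apply: (measurableT_comp (measurable_coin_at k)).
  by apply: (measurableT_comp (measurable_coin_at j)); exact: measurable_snd.
have mz i : measurable_fun setT (fun z => cellp j (kap j z + i) (step j z)).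
  rewrite (_ : (fun z => _) = fun z => \sum_(k < (K j).+1) (kap j z == k)%:R * cellp j (k + i) (step j z)); last first.
    by apply/funext => z; rewrite -(kap_split j (fun k => cellp j (k + i) (step j z))).
  apply: measurable_sum => l; apply: measurable_funM; first exact: (kap_indic_meas j (fun i => i == l)).
  exact: (measurableT_comp (cellp_meas j _) (step_meas c j)).
rewrite (_ : [set p | _] =
  [set p | cellp j (kap j (Xs j p.1) + 0) (step j (Xs j p.1)) <= U j (coin_at k (coin_at j p.2))] `\`
  [set p | cellp j (kap j (Xs j p.1) + 1) (step j (Xs j p.1)) <= U j (coin_at k (coin_at j p.2))]).
  apply: measurableD; rewrite -[X in measurable X]setTI; apply: measurable_fun_le => //.
    exact: (measurableT_comp (mz 0%N) mXp).
  exact: (measurableT_comp (mz 1%N) mXp).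
apply/seteqP; split => p; rewrite /cellz /cell/= addn0 addn1.
  by move=> /andP[h1 h2]; split => //; apply/negP; rewrite -ltNge.
by move=> [-> /negP]; rewrite -ltNge.
Qed.

Lemma pick_meas j C : measurable C -> measurable [set p | C (pick j p)].
Proof.
move=> mC; apply: (measurable_sel (E := fun p : S * coins => cellz j (Xs j p.1)) (g := fun p => coin_at j p.2)) => //.
  exact: cellz_meas.
by apply: (measurableT_comp (measurable_coin_at j)); exact: measurable_snd.
Qed.

Fixpoint prodq (C : nat -> set coins) l m z : R :=
  if l is k.+1 then prodq C k m.+1 (step m z) * pick_prob m (fun=> C m) z else 1.

Lemma prodqE C l m z : prodq C l m z = \prod_(i < l) pick_prob (m + i) (fun=> C (m + i)%N) (iter_step step m i z).
Proof.
elim: l m z => [|l IH] m z; first by rewrite big_ord0.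
rewrite big_ord_recl /= addn0 IH mulrC; congr (_ * _); apply: eq_bigr => i _.
by rewrite -iter_stepSl addSnnS.
Qed.

Lemma prodq_meas C l m : (forall j, measurable (C j)) -> measurable_fun setT (prodq C l m).
Proof.
move=> mC; elim: l m => [|l IH] m /=; first exact: measurable_cst.
apply: measurable_funM; last exact: pick_prob_meas.
exact: (measurableT_comp (IH _) (step_meas c m)).
Qed.

Lemma prodq_ge0 C l m z : 0 <= prodq C l m z.
Proof. by rewrite prodqE; apply: prodr_ge0 => i _; exact: pick_prob_ge0. Qed.

(** The earliest block is integrated first: the later factors depend on the next state only and pull
    out, and what remains is the unconditional probability by [back_pick_prob]. This is where
    independence of the blocks comes from. *)
Lemma integral_prodq C l m : (forall j, measurable (C j)) ->
  (\int[mu]_x (prodq C l m (Xs m x))%:E = (\prod_(i < l) fr (C (m + i)%N))%:E)%E.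
Proof.
move=> mC; elim: l m => [|l IH] m.
  by rewrite big_ord0 /= integral_cst//= mul1e; exact: probability_setT.
rewrite (back_int c m (prodq_meas l.+1 m mC)) => [|x]; last exact: prodq_ge0.
rewrite big_ord_recl addn0 EFinM.
have -> : \prod_(i < l) fr (C (m + lift ord0 i)%N) = \prod_(i < l) fr (C (m.+1 + i)%N).
  by apply: eq_bigr => i _; rewrite /= /bump add1n addnS -addSn.
rewrite -(IH m.+1) -ge0_integralZl ?lee_fin ?fr_ge0//; last 2 first.
- apply/measurable_EFinP; apply: (measurableT_comp (prodq_meas l m.+1 mC)).
  exact: iter_step_meas.
- by move=> x _; rewrite lee_fin prodq_ge0.
apply: eq_integral => x _; rewrite -EFinM; congr (_%:E).
rewrite /prodq -/prodq.
rewrite (_ : (fun z => _) = fun z => pick_prob m (fun=> C m) z * prodq C l m.+1 (step m z)); last first.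
  by apply/funext => z; rewrite mulrC.
rewrite (back_pull c m (pick_prob m (fun=> C m)) (prodq C l m.+1)) mulrC back_pick_prob//.
by rewrite sum_cells.
Qed.

Lemma fair_coin_at j (B : set coins) : measurable B -> fair [set w | B (coin_at j w)] = fair B.
Proof.
have mB' i (A : set coins) : measurable A -> measurable [set w | A (coin_at i w)].
  by move=> mA; rewrite -[X in measurable X]setTI; exact: measurable_coin_at.
move=> mB; elim: j => [|j IH].
  rewrite -integral_fair_indic; last exact: mB'.
  rewrite -[RHS]integral_fair_indic//.
  have mi : measurable_fun setT (fun w : coins => (\1_B w : R)%:E).
    exact/measurable_EFinP/measurable_indic.
  have n w : (0 <= (\1_B w : R)%:E)%E by rewrite lee_fin indicE.
  have [<- _] := fair_dominate mi n.
  by apply: eq_integral => w _; rewrite !indicE.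
rewrite -IH -integral_fair_indic; last exact: mB'.
rewrite -[RHS]integral_fair_indic; last exact: mB'.
have mi : measurable_fun setT (fun w : coins => (\1_[set w | B (coin_at j w)] w : R)%:E).
  by apply/measurable_EFinP; apply: measurable_indic; exact: mB'.
have n w : (0 <= (\1_[set w | B (coin_at j w)] w : R)%:E)%E by rewrite lee_fin indicE.
have [_ <-] := fair_dominate mi n.
apply: eq_integral => w _; rewrite !indicE; congr (nat_of_bool _)%:R%:E.
by apply/idP/idP; rewrite !inE/= coin_atS.
Qed.

Lemma law_pick M (C : nat -> set coins) : (forall j, measurable (C j)) ->
  (mu \x fair)%E [set p | forall j, (j < M)%N -> C j (pick j p)] = (\prod_(j < M) fr (C j))%:E.
Proof.
move=> mC.
have -> : \prod_(j < M) fr (C j) = \prod_(i < M) fr (C (0 + i)%N) by [].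
rewrite -(integral_prodq M 0 mC); apply: eq_integral => x _.
rewrite prodqE /=.
pose B j := [set v | C j (sel (cellz j (Xs j x)) v)].
have mB j : measurable (B j) by apply: measurable_sel_cst => //; exact: cell_meas.
transitivity (fair [set w | forall i, (i < M)%N -> B i (coin_at i w)]).
  congr (fair _); apply/seteqP; split => w; rewrite /xsection/=.
    by move=> /set_mem h i iM; exact: (h i iM).
  by move=> h; apply/mem_set => i iM; exact: (h i iM).
by rewrite law_coin_at.
Qed.

Lemma law_pick_kap j (D : nat -> set coins) : (forall k, measurable (D k)) ->
  (mu \x fair)%E [set p | D (kap j (Xs j p.1)) (pick j p)] =
  (\int[mu]_x (\sum_(k < (K j).+1) fr (D k `&` cell j k (Xs j.+1 x)))%:E)%E.
Proof.
move=> mD.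
transitivity (\int[mu]_x (pick_prob j D (Xs j x))%:E)%E.
  apply: eq_integral => x _.
  pose B := [set v | D (kap j (Xs j x)) (sel (cellz j (Xs j x)) v)].
  have mB : measurable B by apply: measurable_sel_cst => //; exact: cell_meas.
  transitivity (fair [set w | B (coin_at j w)]).
    congr (fair _); apply/seteqP; split => w; rewrite /xsection/=; first by move=> /set_mem.
    by move=> h; apply/mem_set.
  by rewrite fair_coin_at// -[LHS]frE.
rewrite (back_int c j (pick_prob_meas j mD)) => [|x]; last exact: pick_prob_ge0.
by apply: eq_integral => x _; rewrite back_pick_prob.
Qed.

Lemma kap_pick_meas j (D : nat -> set coins) : (forall k, measurable (D k)) ->
  measurable [set p : S * coins | D (kap j (Xs j p.1)) (pick j p)].
Proof.
move=> mD; rewrite (_ : [set p | _] = \bigcup_k ([set p : S * coins | kap j (Xs j p.1) = k] `&` [set p | D k (pick j p)])).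
  apply: bigcupT_measurable => k; apply: measurableI; last exact: pick_meas.
  have mXp : measurable_fun setT (fun p : S * coins => Xs j p.1).
    by apply: (measurableT_comp (iter_step_meas c 0 j)); exact: measurable_fst.
  by rewrite -[X in measurable X]setTI; exact: (mXp measurableT _ (kap_meas j k)).
apply/seteqP; split => p /=; first by move=> h; exists (kap j (Xs j p.1)).
by move=> [k _ [/= <-]].
Qed.

End coupling.

(** * Choice of the blocks *)

Definition bounded_sums {R : realType} (p : nat -> R) := exists K, forall m, \sum_(j < m) p j <= K.

Section bounded_sums.
Context {R : realType}.
Implicit Types p q : nat -> R.

Lemma bounded_sums_le p q : (\forall j \near \oo, p j <= q j) -> (forall j, 0 <= q j) -> bounded_sums q -> bounded_sums p.
Proof.
move=> [J _ hJ] q0 [K hK]; exists (\sum_(j < J) `|p j| + K) => m.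
apply: (@le_trans _ _ (\sum_(j < m) ((if (j < J)%N then `|p j| else 0) + q j))).
  apply: ler_sum => j _; case: ifP => jJ; first by rewrite (le_trans (ler_norm _))// lerDl.
  by rewrite add0r; apply: hJ => /=; rewrite leqNgt jJ.
rewrite big_split/= lerD//.
rewrite -(big_mkord xpredT (fun j => if (j < J)%N then `|p j| else 0)).
rewrite -(big_mkord xpredT (fun j => `|p j|)) -big_mkcond/=.
have [mJ|/ltnW Jm] := leqP m J.
  rewrite (big_cat_nat _ mJ)//= -[leLHS]addr0 lerD//; last by apply: sumr_ge0.
  by rewrite big_mkcond; apply: ler_sum => j _; case: ifP.
rewrite (big_cat_nat _ Jm)//= [X in _ + X]big_nat_cond [X in _ + X]big1 ?addr0 => [|j /andP[/andP[h _]]]; last by rewrite ltnNge h.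
  by rewrite big_mkcond; apply: ler_sum => j _; case: ifP.
exact: hK.
Qed.

Lemma bounded_sumsD p q : bounded_sums p -> bounded_sums q -> bounded_sums (fun j => p j + q j).
Proof. by move=> [K hK] [L hL]; exists (K + L) => m; rewrite big_split lerD. Qed.

Lemma bounded_sumsZ p k : 0 <= k -> bounded_sums p -> bounded_sums (fun j => k * p j).
Proof. by move=> k0 [K hK]; exists (k * K) => m; rewrite -mulr_sumr ler_wpM2l. Qed.

(** From some index on [p] grows at least linearly, so its inverse squares are dominated by a
    convergent series. *)
Lemma bounded_sums_inv_sq p : (\forall j \near \oo, p j.+1 >= p j + 1) -> (forall j, 0 <= p j) ->
  bounded_sums (fun j => (p j)^-2).
Proof.
move=> [J _ hJ] p0.
have gr i : i%:R <= p (J + i)%N.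
  elim: i => [|i IH]; first exact: p0.
  by rewrite addnS -natr1; apply: le_trans (hJ _ _); rewrite ?lerD2r//= leq_addr.
(* With [i = j - J] this is [1 / ((i - 1) * i)], which telescopes and dominates [i ^- 2]. *)
pose q j : R := if (J + 1 < j)%N then (j - J - 1)%:R^-1 - (j - J)%:R^-1 else 0.
have q0 j : 0 <= q j.
  rewrite /q; case: ifP => // hj; rewrite subr_ge0 lef_pV2 ?posrE ?ltr0n ?ler_nat; lia.
apply: (@bounded_sums_le _ q) => //.
- exists (J + 2)%N => // j /= hj; rewrite /q ifT; last by lia.
  have -> : (j - J)%:R = (j - J - 1)%:R + 1 :> R by rewrite natr1; congr (_%:R); lia.
  have := gr (j - J)%N; rewrite (_ : (J + (j - J) = j)%N); last by lia.
  have -> : (j - J)%:R = (j - J - 1)%:R + 1 :> R by rewrite natr1; congr (_%:R); lia.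
  have : (1 : R) <= (j - J - 1)%:R by rewrite ler1n; lia.
  set x := (j - J - 1)%:R; move: (p j) => P x1 hP.
  have -> : x^-1 - (x + 1)^-1 = (x * (x + 1))^-1 by field; rewrite ?gt_eqF//; lra.
  rewrite lef_pV2 ?posrE; [|nra|nra]; nra.
- exists 1 => m; suff : \sum_(j < m) q j <= 1 - (if (J + 1 < m)%N then (m - J - 1)%:R^-1 else 1).
    move=> h; apply: le_trans h _; rewrite gerBl; case: ifP => // _.
  elim: m => [|m IH]; first by rewrite big_ord0 /= subrr.
  rewrite big_ord_recr/=; apply: le_trans (lerD IH (lexx _)) _; rewrite /q.
  case: ifP => h1; first rewrite ifT; try lia.
    rewrite (_ : (m.+1 - J - 1 = m - J)%N); last by lia.
    by move: ((m - J - 1)%:R^-1) ((m - J)%:R^-1) => x y; lra.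
  case: ifP => h2; last lra.
  rewrite (_ : (m.+1 - J - 1 = 1)%N); last by lia.
  by rewrite invr1; lra.
Qed.

End bounded_sums.

(** * Block ends and the slowly growing parameter *)

Section schedule.
Context {R : realType}.
Variables (A : nat -> R) (D : R) (n0 : nat) (K : R).
Hypothesis A0 : A 0%N = 0.
Hypothesis A_le : forall n, A n <= A n.+1.
Hypothesis A_inc : forall n, A n.+1 <= A n + D ^+ 2.
Hypothesis An0 : 0 < A n0.
Hypothesis AK : forall m, \sum_(n0 <= n < m) (A n)^-2 <= K.

Lemma A_mono : {homo A : m n / (m <= n)%N >-> m <= n}.
Proof. by apply: homo_leq => // x y z; exact: le_trans. Qed.

Lemma A_ge0 n : 0 <= A n.
Proof. by rewrite -A0; exact: A_mono. Qed.

Lemma A_unbounded (t : R) : exists n, t <= A n.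
Proof.
apply: contrapT => /forallNP h.
have At n : A n < t by rewrite ltNge; apply/negP.
have t0 : 0 < t by apply: lt_trans (At n0).
have [m hm] : exists m : nat, K * t ^+ 2 < m%:R.
  exists (Num.truncn `|K * t ^+ 2|).+1; apply: le_lt_trans (ler_norm _) _.
  by rewrite Num.Theory.truncnS_gt.
have := AK (n0 + m); rewrite leNgt => /negP; apply.
apply: (@lt_le_trans _ _ (m%:R * t ^-2)); first by rewrite ltr_pdivlMr// exprn_gt0.
have -> : m%:R * t^-2 = \sum_(n0 <= n < n0 + m) t^-2 by rewrite sumr_const_nat addKn mulr_natl.
apply: ler_sum_nat => n /andP[h1 h2].
have An : 0 < A n by apply: lt_le_trans An0 _; exact: A_mono.
by rewrite lef_pV2 ?posrE ?exprn_gt0// ler_pXn2r ?nnegrE ?ltW.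
Qed.

Let a n : R := if (n0 <= n)%N then (A n)^-2 else 0.
Let sa n := \sum_(i < n) a i.
Let lim_sa := sup (range sa).
Let r n := lim_sa - sa n.

Lemma increment_ge0 n : 0 <= a n.
Proof. by rewrite /a; case: ifP => // _; rewrite invr_ge0 sqr_ge0. Qed.

Lemma sa_has_sup : has_sup (range sa).
Proof.
split; first by exists (sa 0%N), 0%N.
exists K => _ [m _ <-]; apply: le_trans (AK m).
rewrite /sa -(big_mkord xpredT a).
have [mn|nm] := leqP m n0.
  rewrite big_nat_cond big1 => [|i /andP[/andP[_ h] _]]; last by rewrite /a leqNgt (leq_trans h mn).
  by rewrite big_geq.
rewrite (big_cat_nat _ (ltnW nm))//= big_nat_cond big1 ?add0r => [|i /andP[/andP[_ h] _]]; last by rewrite /a leqNgt h.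
by apply: ler_sum_nat => i /andP[h _]; rewrite /a h.
Qed.

Lemma remainderS n : r n = a n + r n.+1.
Proof. by rewrite /r /sa big_ord_recr/=; ring. Qed.

Lemma remainder_ge0 n : 0 <= r n.
Proof. by rewrite subr_ge0; apply: (sup_upper_bound sa_has_sup); exists n. Qed.

Lemma remainder_mono : {homo r : m n / (m <= n)%N >-> n <= m}.
Proof.
apply: homo_leq => // [x y z h1 h2|n]; first exact: le_trans h2 h1.
by rewrite (remainderS n) lerDr increment_ge0.
Qed.

Lemma remainder_gt0 n : 0 < r n.
Proof.
have h m : (n0 <= m)%N -> 0 < r m.
  move=> nm; rewrite remainderS; apply: ltr_wpDr; first exact: remainder_ge0.
  by rewrite /a nm invr_gt0 exprn_gt0//; apply: lt_le_trans An0 _; exact: A_mono.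
by apply: lt_le_trans (h (maxn n n0) (leq_maxr _ _)) _; apply: remainder_mono; exact: leq_maxl.
Qed.

Lemma remainder_lim (e : R) : 0 < e -> exists n, r n < e.
Proof.
move=> e0; have [_ [n _ <-] h] := sup_adherent e0 sa_has_sup.
by exists n; rewrite /r /lim_sa; lra.
Qed.

(** The slowly growing factor. The inverse square root of the tail [r] keeps the series of
    [a n * b n] convergent; the logarithm keeps [b] below [ln A] eventually. *)
Let b n := 1 + Num.min (Num.sqrt (r n))^-1 (ln (1 + A n) / 2).

Lemma b_mono : {homo b : m n / (m <= n)%N >-> m <= n}.
Proof.
move=> m n mn; rewrite lerD2l; apply: le_min2.
  by rewrite lef_pV2 ?posrE ?sqrtr_gt0 ?remainder_gt0// ler_wsqrtr// remainder_mono.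
rewrite ler_pM2r// ler_ln ?posrE ?lerD2l ?A_mono//; apply: ltr_pwDl => //; exact: A_ge0.
Qed.

Lemma b_ge1 n : 1 <= b n.
Proof.
rewrite lerDl le_min invr_ge0 sqrtr_ge0 /= mulr_ge0// ln_ge0// lerDl; exact: A_ge0.
Qed.

Lemma b_unbounded (t : R) : exists n, t <= b n.
Proof.
pose s := `|t| + 1; have s0 : 0 < s by rewrite ltr_wpDl.
have [n1 h1] := @remainder_lim (s ^-2) ltac:(by rewrite invr_gt0 exprn_gt0).
have [n2 h2] := A_unbounded (expR (2 * s)).
exists (maxn n1 n2); apply: (@le_trans _ _ (1 + s)).
  by rewrite /s; have := ler_norm t; lra.
rewrite lerD2l le_min; apply/andP; split.
  rewrite -[leLHS]invrK lef_pV2 ?posrE ?invr_gt0 ?sqrtr_gt0 ?remainder_gt0//.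
  have -> : s^-1 = Num.sqrt (s^-2) by rewrite -exprVn sqrtr_sqr ger0_norm// invr_ge0 ltW.
  rewrite ler_wsqrtr//.
  by apply: le_trans (ltW h1); apply: remainder_mono; exact: leq_maxl.
rewrite ler_pdivlMr// mulrC -[leLHS]expRK ler_ln ?posrE ?expR_gt0//; last first.
  by apply: ltr_pwDl => //; exact: A_ge0.
by apply: le_trans h2 _; apply: le_trans (A_mono (leq_maxr n1 n2)) _; rewrite lerDr.
Qed.

(* Abel-Dini: a term divided by the square root of its tail telescopes. *)
Lemma b_sum m : \sum_(i < m) a i * b i <= lim_sa + 2 * Num.sqrt (r 0%N).
Proof.
apply: (@le_trans _ _ (\sum_(i < m) (a i + 2 * (Num.sqrt (r i) - Num.sqrt (r i.+1))))).
  apply: ler_sum => i _; rewrite mulrDr mulr1 lerD2l.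
  apply: (@le_trans _ _ (a i / Num.sqrt (r i))).
    by rewrite ler_wpM2l ?increment_ge0// ge_min lexx.
  rewrite ler_pdivrMr ?sqrtr_gt0 ?remainder_gt0//.
  have -> : a i = Num.sqrt (r i) ^+ 2 - Num.sqrt (r i.+1) ^+ 2.
    by rewrite !sqr_sqrtr ?remainder_ge0// [r i]remainderS addrK.
  have h1 : Num.sqrt (r i.+1) <= Num.sqrt (r i) by rewrite ler_wsqrtr// remainder_mono.
  move: h1 (sqrtr_ge0 (r i.+1)); move: (Num.sqrt (r i)) (Num.sqrt (r i.+1)) => x y xy y0.
  rewrite -subr_ge0; have -> : 2 * (x - y) * x - (x ^+ 2 - y ^+ 2) = (x - y) ^+ 2 by ring.
  exact: sqr_ge0.
rewrite big_split/=; apply: lerD.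
  by apply: (sup_upper_bound sa_has_sup); exists m.
rewrite -mulr_sumr ler_wpM2l//.
have -> : \sum_(i < m) (Num.sqrt (r i) - Num.sqrt (r i.+1)) = Num.sqrt (r 0%N) - Num.sqrt (r m).
  by elim: m => [|m IH]; rewrite ?big_ord0 ?subrr// big_ord_recr/= IH; ring.
by rewrite gerBl sqrtr_ge0.
Qed.

(** An eighth root, obtained by three square roots: [c ^ 7] is needed for the probability of a bad
    block, and [c >= 1] gives [c ^ 7 <= c ^ 8 = b]. *)
Let cc n := Num.sqrt (Num.sqrt (Num.sqrt (b n))).

Lemma cc8 n : cc n ^+ 8 = b n.
Proof.
by rewrite /cc -[8%N]/(2 * 2 * 2)%N !exprM !sqr_sqrtr// ?sqrtr_ge0//; apply: le_trans (b_ge1 n).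
Qed.

Lemma cc_ge1 n : 1 <= cc n.
Proof. by rewrite -sqrtr1 -{1}sqrtr1 -{1}sqrtr1 !ler_wsqrtr// b_ge1. Qed.

Lemma cc_mono : {homo cc : m n / (m <= n)%N >-> m <= n}.
Proof. by move=> m n mn; rewrite !ler_wsqrtr// b_mono. Qed.

(** The summand 1 makes the variance advance even from 0. The first admissible end overshoots by at
    most one step, that is by [D ^+ 2]. *)
Let goal n m := A n + (1 + A n / cc n) <= A m.

Lemma goal_ex n : exists m, goal n m.
Proof. exact: A_unbounded. Qed.

Let next n := ex_minn (goal_ex n).

Lemma next_gt n : (n < next n)%N.
Proof.
rewrite /next; case: ex_minnP => m h _; rewrite ltnNge; apply/negP => /A_mono mn.
have : 0 <= A n / cc n by rewrite divr_ge0 ?A_ge0// (le_trans _ (cc_ge1 n)).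
by move: h; rewrite /goal; lra.
Qed.

Lemma next_before n k : (k < next n)%N -> A k < A n + (1 + A n / cc n).
Proof.
rewrite /next; case: ex_minnP => m _ h km; rewrite ltNge; apply/negP => /h.
by rewrite leqNgt km.
Qed.

Lemma next_v n : 1 + A n / cc n <= A (next n) - A n <= 1 + A n / cc n + D ^+ 2.
Proof.
apply/andP; split; first by rewrite /next; case: ex_minnP => m h _; rewrite lerBrDl.
have := next_gt n; case e : (next n) => [//|k] _.
have /next_before h : (k < next n)%N by rewrite e.
by have := A_inc k; move: (A k) (A k.+1) (A n) (A n / _) h (D ^+ 2) => *; lra.
Qed.

Lemma schedule : exists (nn : nat -> nat) (c : nat -> R),
  [/\ nn 0%N = 0%N, (forall j, (nn j < nn j.+1)%N),
      (forall j, 1 + A (nn j) / c j <= A (nn j.+1) - A (nn j) <= 1 + A (nn j) / c j + D ^+ 2),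
      [/\ (forall j, 1 <= c j), {homo c : i j / (i <= j)%N >-> i <= j},
       (forall t, \forall j \near \oo, t <= c j) &
       (\forall j \near \oo, c j ^+ 8 <= ln (A (nn j)))] &
      bounded_sums (fun j => c j ^+ 7 * (nn j.+1 - nn j)%:R / A (nn j) ^+ 2)].
Proof.
pose nn j := iter j next 0%N.
have nnS j : nn j.+1 = next (nn j) by [].
have nn_lt j : (nn j < nn j.+1)%N by exact: next_gt.
have nn_mono : {homo nn : i j / (i <= j)%N}.
  by apply: homo_leq => // [|i]; [exact: leq_trans|exact: ltnW].
have nn_ge j : (j <= nn j)%N.
  by elim: j => // j IH; exact: leq_ltn_trans IH (nn_lt j).
have c8 : forall j, cc (nn j) ^+ 8 = b (nn j) by move=> j; exact: cc8.
have A_near (t : R) : \forall j \near \oo, t <= A (nn j).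
  have [n hn] := A_unbounded t; exists n => // j /= nj; apply: le_trans hn _.
  by apply: A_mono; exact: leq_trans (nn_ge j).
exists nn, (fun j => cc (nn j)); split => //.
- by move=> j; exact: next_v.
- split.
  + by move=> j; exact: cc_ge1.
  + by move=> i j /nn_mono; exact: cc_mono.
  + move=> t; have [n hn] := b_unbounded (`|t| ^+ 8 + 1).
    exists n => // j /= nj.
    have hb : b n <= b (nn j) by apply: b_mono; exact: leq_trans (nn_ge j).
    apply: le_trans (ler_norm t) _; rewrite -(@ler_pXn2r _ 8) ?nnegrE ?normr_ge0//; last first.
      exact: le_trans (cc_ge1 _).
    by rewrite c8; lra.
  + near=> j; rewrite c8.
    have h : expR 4 <= A (nn j) by near: j; exact: A_near.
    have Aj : 1 <= A (nn j) by apply: le_trans h; have := @expR_ge1Dx R 4; lra.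
    apply: (@le_trans _ _ (1 + ln (1 + A (nn j)) / 2)); first by rewrite lerD2l ge_min lexx orbT.
    have h1 : ln (1 + A (nn j)) <= ln 2 + ln (A (nn j)).
      by rewrite -lnM ?posrE//; [rewrite ler_ln ?posrE; lra|lra].
    have h2 : ln (2 : R) <= 2 - 1 by have -> : (2 : R) = 1 + 1 by []; rewrite addrK le_ln1Dx//; lra.
    have h3 : 4 <= ln (A (nn j)) by rewrite -[leLHS]expRK ler_ln ?posrE ?expR_gt0//; lra.
    by lra.
(* Once [A >= 1], the variance before the end of a block is at most [2 * A + 1], hence at most 3
   times its value at the start, so each of the [l] terms [A ^- 2] is at most 9 times the
   corresponding term of the original series. *)
- apply: (@bounded_sums_le _ _ (fun j => 9 * \sum_(nn j <= n < nn j.+1) a n * b n)) => [|j|].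
  + near=> j.
    have h : 1 <= A (nn j) by near: j; exact: A_near.
    have h0 : (n0 <= nn j)%N by near: j; exists n0 => // j /= /leq_trans; apply.
    set x := A (nn j) in h *.
    have c1 := cc_ge1 (nn j).
    have x2 : 0 < x ^+ 2 by rewrite exprn_gt0//; lra.
    have -> : cc (nn j) ^+ 7 * (nn j.+1 - nn j)%:R / x ^+ 2 =
      9 * \sum_(nn j <= n < nn j.+1) (9 * x ^+ 2)^-1 * cc (nn j) ^+ 7.
      by rewrite sumr_const_nat -mulr_natr; field; rewrite gt_eqF//; lra.
    rewrite ler_pM2l//; apply: ler_sum_nat => n /andP[n1 n2].
    have An : x <= A n by exact: A_mono.
    have An3 : A n <= 3 * x.
      have hb : A n < x + (1 + x / cc (nn j)) := next_before n2.
      have : x / cc (nn j) <= x by rewrite ler_pdivrMr; [rewrite ler_peMr//; lra|lra].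
      by lra.
    apply: ler_pM; rewrite ?invr_ge0 ?exprn_ge0//; try lra.
    + rewrite /a (leq_trans h0 n1) lef_pV2 ?posrE ?mulr_gt0 ?exprn_gt0//; try lra.
      have -> : 9 * x ^+ 2 = (3 * x) ^+ 2 by ring.
      by rewrite ler_pXn2r ?nnegrE//; lra.
    + apply: le_trans (b_mono n1); rewrite -cc8 [leRHS]exprS ler_peMl ?exprn_ge0//; lra.
  + by rewrite mulr_ge0// sumr_ge0// => i _; rewrite mulr_ge0 ?increment_ge0// (le_trans _ (b_ge1 i)).
  + apply: bounded_sumsZ => //; exists (lim_sa + 2 * Num.sqrt (r 0%N)) => m.
    apply: le_trans (b_sum (nn m)); elim: m => [|m IH]; first by rewrite !big_ord0.
    rewrite big_ord_recr/=.
    have -> : \sum_(i < nn m.+1) a i * b i =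
        \sum_(i < nn m) a i * b i + \sum_(nn m <= i < nn m.+1) a i * b i.
      rewrite -!(big_mkord xpredT (fun i => a i * b i)).
      by rewrite (big_cat_nat _ (ltnW (nn_lt m))).
    by rewrite lerD2r.
Unshelve. all: by end_near.
Qed.

End schedule.

Lemma ln1D_ge {R : realType} (x : R) : 0 <= x -> x / (1 + x) <= ln (1 + x).
Proof.
move=> x0; have x1 : 0 < 1 + x by lra.
have h : ln (1 + - (x / (1 + x))) <= - (x / (1 + x)).
  by apply: le_ln1Dx; rewrite ltrN2 ltr_pdivrMr//; lra.
rewrite (_ : 1 + - (x / (1 + x)) = (1 + x)^-1) in h; last by field; rewrite gt_eqF.
by rewrite lnV ?posrE// in h; lra.
Qed.

(** * Growth of the variance along the blocks and accumulation of errors *)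

Section growth.
Context {R : realType}.
Variables (a c : nat -> R) (D : R).
Let v j := a j.+1 - a j.
Let y j := ln (a j).
Hypothesis D0 : 0 < D.
Hypothesis a0 : forall j, 0 <= a j.
Hypothesis vE : forall j, 1 + a j / c j <= v j <= 1 + a j / c j + D ^+ 2.
Hypothesis c1 : forall j, 1 <= c j.
Hypothesis c_lim : forall t, \forall j \near \oo, t <= c j.
Hypothesis c8 : \forall j \near \oo, c j ^+ 8 <= y j.

Lemma c_y : \forall j \near \oo, c j <= y j.
Proof.
near=> j; have h : c j ^+ 8 <= y j by near: j.
by apply: le_trans h; rewrite exprS ler_peMr ?exprn_ege1//; apply: le_trans (c1 j).
Unshelve. all: by end_near.
Qed.

Lemma y_lim t : \forall j \near \oo, t <= y j.
Proof.
near=> j; apply: (@le_trans _ _ (c j)); first by near: j; exact: c_lim.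
by near: j; exact: c_y.
Unshelve. all: by end_near.
Qed.

Lemma a_gt0 : \forall j \near \oo, 0 < a j.
Proof.
near=> j; rewrite lt_def a0 andbT; apply/negP => /eqP h.
have : 1 <= y j by near: j; exact: y_lim.
by rewrite /y h ln0// ler10.
Unshelve. all: by end_near.
Qed.

Lemma v_gt0 j : 0 < v j.
Proof.
have /andP[h _] := vE j; apply: lt_le_trans h; apply: ltr_wpDr => //.
by rewrite divr_ge0// (le_trans _ (c1 j)).
Qed.

Lemma v_large (k : R) : 0 < k -> \forall j \near \oo, k * c j ^+ 3 * y j ^+ 5 <= Num.sqrt (v j).
Proof.
move=> k0.
(* Since [v >= expR y / y] and [c <= y], the square of the left side times [y] has degree
   [2 * (3 + 5) + 1 = 17] in [y]; the bound [expR y >= (y / 18) ^ 18] leaves one power of [y] to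
   absorb [k ^+ 2 * q]. *)
have [q qE] : exists q : R, q = 18 ^+ 18 by eexists.
near=> j.
have aj : 0 < a j by near: j; exact: a_gt0.
have cy : c j <= y j by near: j; exact: c_y.
have yj : k ^+ 2 * q <= y j by near: j; exact: y_lim.
have cj := c1 j; have y1 : 1 <= y j by lra.
have /andP[h _] := vE j.
have aE : a j = expR (y j) by rewrite lnK// posrE.
have va : expR (y j) / y j <= v j.
  apply: le_trans h; rewrite -aE; apply: (@le_trans _ _ (a j / c j)); last by lra.
  by rewrite ler_pM2l// lef_pV2 ?posrE//; lra.
set Y := y j in yj cy y1 va *.
have Y0 : 0 < Y by lra.
have e1 : (Y / 18) ^+ 18 <= expR Y.
  have -> : expR Y = expR (Y / 18) ^+ 18 by rewrite -expRM_natr; congr expR; field.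
  rewrite ler_pXn2r ?nnegrE ?expR_ge0 ?divr_ge0 ?(ltW Y0)//.
  by apply: le_trans (expR_ge1Dx _); lra.
have c3 : 0 < c j ^+ 3 by apply: exprn_gt0; lra.
have Y3 : 0 < Y ^+ 3 by exact: exprn_gt0.
have Y5 : 0 < Y ^+ 5 by exact: exprn_gt0.
have w0 : 0 <= k * c j ^+ 3 * Y ^+ 5 by rewrite ltW// mulr_gt0// mulr_gt0.
have w1 : 0 <= k * Y ^+ 3 * Y ^+ 5 by rewrite ltW// mulr_gt0// mulr_gt0.
rewrite -[leLHS]ger0_norm// -sqrtr_sqr ler_wsqrtr//; apply: le_trans va.
rewrite ler_pdivlMr//; apply: le_trans e1.
apply: (@le_trans _ _ ((k * Y ^+ 3 * Y ^+ 5) ^+ 2 * Y)).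
  rewrite ler_pM2r// ler_pXn2r ?nnegrE//.
  by rewrite ler_pM2r// ler_pM2l// ler_pXn2r ?nnegrE//; lra.
rewrite expr_div_n -qE ler_pdivlMr; last by rewrite qE exprn_gt0.
have -> : (k * Y ^+ 3 * Y ^+ 5) ^+ 2 * Y * q = k ^+ 2 * q * Y ^+ 17 by ring.
by rewrite [leRHS]exprS ler_pM2r// exprn_gt0.
Unshelve. all: by end_near.
Qed.

(** The variance grows by the factor [1 + 1 / c], so [y] gains at least [1 / (c + 1)], hence at
    least [1 / (2 * y)] because [c <= y]; thus [y ^ 2] gains at least 1. Consequently [y ^- 4] is
    summable. *)
Lemma y_step : \forall j \near \oo, y j ^+ 2 + 1 <= y j.+1 ^+ 2.
Proof.
near=> j.
have aj : 0 < a j by near: j; exact: a_gt0.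
have cy : c j <= y j by near: j; exact: c_y.
have cj := c1 j; have y1 : 1 <= y j by lra.
have /andP[h _] := vE j.
have cp : 0 < c j by lra.
have h1 : a j * (1 + (c j)^-1) <= a j.+1.
  have : a j * (1 + (c j)^-1) = a j + a j / c j by ring.
  by move: h; rewrite /v; lra.
have h2 : y j + ln (1 + (c j)^-1) <= y j.+1.
  have c' : 0 < 1 + (c j)^-1 by rewrite ltr_pwDl// invr_ge0 ltW.
  rewrite -lnM ?posrE// ler_ln ?posrE ?mulr_gt0//.
  by apply: lt_le_trans h1; rewrite mulr_gt0.
have h3 : (2 * y j)^-1 <= ln (1 + (c j)^-1).
  apply: le_trans (ln1D_ge _); last by rewrite invr_ge0 ltW.
  have -> : (c j)^-1 / (1 + (c j)^-1) = (c j + 1)^-1 by field; rewrite !gt_eqF//; lra.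
  by rewrite lef_pV2 ?posrE; lra.
have h4 : y j + (2 * y j)^-1 <= y j.+1 by lra.
have yp : 0 < y j by lra.
have : (y j + (2 * y j)^-1) ^+ 2 <= y j.+1 ^+ 2.
  have i0 : 0 < (2 * y j)^-1 by rewrite invr_gt0; lra.
  by rewrite ler_pXn2r ?nnegrE//; lra.
have -> : (y j + (2 * y j)^-1) ^+ 2 = y j ^+ 2 + 1 + ((2 * y j)^-1) ^+ 2 by field; rewrite gt_eqF//; lra.
by have := sqr_ge0 (2 * y j)^-1; lra.
Unshelve. all: by end_near.
Qed.

Lemma bounded_sums_y4 : bounded_sums (fun j => (y j ^+ 4)^-1).
Proof.
have := @bounded_sums_inv_sq R (fun j => y j ^+ 2) y_step (fun j => sqr_ge0 (y j)).
by under eq_fun do rewrite -exprM.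
Qed.

Lemma a_mono : {homo a : i j / (i <= j)%N >-> i <= j}.
Proof.
apply: homo_leq => // [x z t|j]; first exact: le_trans.
by have := v_gt0 j; rewrite /v subr_gt0 => /ltW.
Qed.

Let L j := ln (y j).

Lemma L_lim t : \forall j \near \oo, t <= L j.
Proof.
near=> j; have h : expR t <= y j by near: j; exact: y_lim.
by rewrite -[t]expRK ler_ln ?posrE ?expR_gt0// (lt_le_trans _ h)// expR_gt0.
Unshelve. all: by end_near.
Qed.

Lemma a_lim t : \forall j \near \oo, t <= a j.
Proof.
near=> j; have aj : 0 < a j by near: j; exact: a_gt0.
have h : t <= y j by near: j; exact: y_lim.
apply: le_trans h _; rewrite -[leRHS]lnK ?posrE//.
by have := expR_ge1Dx (ln (a j)); rewrite /y; lra.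
Unshelve. all: by end_near.
Qed.

(** Here [x], [s], [r], [t] are the square roots of [a], [v], [c], [L], and [v'] is the next value
    of [x]. As [s] is comparable with [x / r], the mesh error is of order [x * t / r ^ 3], while
    [v' - x] is about [s ^ 2 / (2 * x)], of order [x / r ^ 2]; the factor [1 / r] gained tends to 0.
    In the same way the fluctuation [s * t] inside a block is small against [x * t]. *)
Lemma sqrt_errors (x s r t eta v' : R) : 0 < x -> 0 < s -> 0 <= t -> 1 <= r -> 0 < eta ->
  48 <= eta * r -> x <= s * r -> s * r <= 2 * x -> 0 <= v' -> v' ^+ 2 = x ^+ 2 + s ^+ 2 ->
  3 * (s * t / r ^+ 2) <= eta * (t * (v' - x)) /\ 3 * (8 * (s * t)) <= eta * (x * t).
Proof.
move=> x0 s0 t0 r1 eta0 er xs sx v'0 vE'.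
have r0 : 0 < r by lra.
split; last first.
  have h : 24 * s <= eta * x by nra.
  have -> : 3 * (8 * (s * t)) = 24 * s * t by ring.
  have -> : eta * (x * t) = eta * x * t by ring.
  by rewrite ler_wpM2r.
have s2x : s <= 2 * x by nra.
have vx : v' <= x + s by rewrite -(@ler_pXn2r _ 2) ?nnegrE//; [nra|lra].
have d1 : s ^+ 2 <= (v' - x) * (4 * x).
  have -> : s ^+ 2 = (v' - x) * (v' + x) by lra.
  have : x <= v' by rewrite -(@ler_pXn2r _ 2) ?nnegrE//; [nra|lra].
  by move=> h; rewrite ler_wpM2l; lra.
have -> : 3 * (s * t / r ^+ 2) = t * (3 * s / r ^+ 2) by field; rewrite gt_eqF.
rewrite [leRHS]mulrCA ler_wpM2l// ler_pdivrMr ?exprn_gt0//.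
have h : 12 * x <= eta * r * (s * r) by nra.
rewrite -(@ler_pM2r _ (4 * x)); last by lra.
have -> : eta * (v' - x) * r ^+ 2 * (4 * x) = (eta * r ^+ 2) * ((v' - x) * (4 * x)) by ring.
apply: (@le_trans _ _ (eta * r ^+ 2 * s ^+ 2)).
  have -> : 3 * s * (4 * x) = s * (12 * x) by ring.
  have -> : eta * r ^+ 2 * s ^+ 2 = s * (eta * r * (s * r)) by ring.
  by rewrite ler_pM2l.
by rewrite ler_pM2l// mulr_gt0// exprn_gt0.
Qed.

Lemma small_errors eta : 0 < eta -> \forall j \near \oo,
  3 * (Num.sqrt (v j * L j) / c j) <= eta * (Num.sqrt (L j) * (Num.sqrt (a j.+1) - Num.sqrt (a j))) /\
  3 * (8 * Num.sqrt (v j * L j)) <= eta * Num.sqrt (a j * L j).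
Proof.
move=> eta0; near=> j.
have aj : 0 < a j by near: j; exact: a_gt0.
have cy : c j <= y j by near: j; exact: c_y.
have L0 : 0 <= L j by near: j; exact: L_lim.
have ye : 4 * (1 + D ^+ 2) <= y j by near: j; exact: y_lim.
have ce : (48 / eta) ^+ 2 <= c j by near: j; exact: c_lim.
have cj := c1 j; have c0 : 0 < c j by lra.
have /andP[v1 v2] := vE j.
have vp := v_gt0 j.
have aE : a j = expR (y j) by rewrite lnK// posrE.
have ay : y j ^+ 2 / 4 <= a j.
  have -> : a j = expR (y j / 2) ^+ 2 by rewrite aE -expRM_natr; congr expR; field.
  have -> : y j ^+ 2 / 4 = (y j / 2) ^+ 2 by field.
  by rewrite ler_pXn2r ?nnegrE ?expR_ge0//; [have := expR_ge1Dx (y j / 2); lra|lra].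
have va : v j <= 2 * (a j / c j).
  suff : 1 + D ^+ 2 <= a j / c j by lra.
  rewrite ler_pdivlMr//; apply: le_trans ay; have := sqr_ge0 D; nra.
rewrite !(sqrtrM (L j)) ?(ltW vp)// ?(ltW aj)//.
set t := Num.sqrt (L j); set s := Num.sqrt (v j); set x := Num.sqrt (a j).
pose r := Num.sqrt (c j).
have rE : c j = r ^+ 2 by rewrite sqr_sqrtr// ltW.
have x0 : 0 < x by rewrite sqrtr_gt0.
have s0 : 0 < s by rewrite sqrtr_gt0.
have r0 : 0 < r by rewrite sqrtr_gt0.
have xE : a j = x ^+ 2 by rewrite sqr_sqrtr// ltW.
have sE : v j = s ^+ 2 by rewrite sqr_sqrtr// ltW.
rewrite [c j]rE; apply: sqrt_errors => //.
- by rewrite sqrtr_ge0.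
- by rewrite -(@ler_pXn2r _ 2) ?nnegrE// ?(ltW r0)// -rE expr1n.
- rewrite mulrC -ler_pdivrMr// -(@ler_pXn2r _ 2) ?nnegrE ?divr_ge0 ?(ltW eta0) ?(ltW r0)//.
  by rewrite -rE.
- rewrite -(@ler_pXn2r _ 2) ?nnegrE ?mulr_ge0 ?(ltW x0) ?(ltW s0) ?(ltW r0)//.
  by rewrite exprMn -sE -xE -rE -ler_pdivrMr//; lra.
- rewrite -(@ler_pXn2r _ 2) ?nnegrE ?mulr_ge0 ?(ltW x0) ?(ltW s0) ?(ltW r0)//.
  rewrite exprMn -sE -rE exprMn -xE -ler_pdivlMr//; apply: le_trans va _.
  by rewrite -mulrA ler_wpM2r ?divr_ge0 ?ltW//; lra.
- by rewrite sqr_sqrtr// -xE -sE /v addrC subrK.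
Unshelve. all: by end_near.
Qed.

(** As [L] is eventually nondecreasing, the increments [sqrt (L j) * (sqrt (a j.+1) - sqrt (a j))]
    sum up to at most the final [sqrt (a j * L j)]. Half of [eta] is spent on them, half on the
    initial value. *)
Lemma errors_add_up (Delta : nat -> R) eta : 0 < eta ->
  (\forall j \near \oo, `|Delta j.+1 - Delta j| <= 3 * (Num.sqrt (v j * L j) / c j)) ->
  \forall j \near \oo, `|Delta j| <= eta * Num.sqrt (a j * L j).
Proof.
move=> eta0 dD; have eta2 : 0 < eta / 2 by lra.
have [J _ hJ] : \forall j \near \oo, [/\ 0 < a j, 1 <= y j &
    `|Delta j.+1 - Delta j| <= eta / 2 * (Num.sqrt (L j) * (Num.sqrt (a j.+1) - Num.sqrt (a j)))].
  near=> j; split; [by near: j; exact: a_gt0|by near: j; exact: y_lim|].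
  apply: (@le_trans _ _ (3 * (Num.sqrt (v j * L j) / c j))); first by near: j.
  have [//] : 3 * (Num.sqrt (v j * L j) / c j) <= eta / 2 * (Num.sqrt (L j) * (Num.sqrt (a j.+1) - Num.sqrt (a j))) /\
    3 * (8 * Num.sqrt (v j * L j)) <= eta / 2 * Num.sqrt (a j * L j).
  by near: j; exact: small_errors.
have yS j : (J <= j)%N -> y j <= y j.+1.
  move=> /hJ[aj _ _]; rewrite ler_ln ?posrE//; first exact: a_mono.
  by apply: lt_le_trans aj _; exact: a_mono.
have LS j : (J <= j)%N -> 0 <= L j <= L j.+1.
  move=> Jj; have [_ yj _] := hJ j Jj; rewrite ln_ge0//= ler_ln ?posrE ?yS//; first by lra.
  by have := yS j Jj; lra.
have main i : `|Delta (J + i)%N| <= `|Delta J| + eta / 2 * (Num.sqrt (L (J + i)%N) * Num.sqrt (a (J + i)%N)).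
  elim: i => [|i IH]; first by rewrite addn0 lerDl !mulr_ge0// ?sqrtr_ge0//; lra.
  rewrite addnS; have [aj yj hd] := hJ (J + i)%N (leq_addr _ _).
  have /andP[L0 L1] := LS (J + i)%N (leq_addr _ _).
  move: hd IH; set j := (J + i)%N in aj yj L0 L1 *.
  have sl : Num.sqrt (L j) <= Num.sqrt (L j.+1) by rewrite ler_wsqrtr.
  have tri : `|Delta j.+1| <= `|Delta j.+1 - Delta j| + `|Delta j|.
    by rewrite -{1}[Delta j.+1](subrK (Delta j)) ler_normD.
  have q : Num.sqrt (L j) * Num.sqrt (a j.+1) <= Num.sqrt (L j.+1) * Num.sqrt (a j.+1).
    by rewrite ler_wpM2r// sqrtr_ge0.
  move: tri q; move: `|Delta j.+1| `|Delta j| `|Delta j.+1 - Delta j| `|Delta J| => d1 d0 dd dJ.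
  by move: (Num.sqrt (L j)) (Num.sqrt (a j)) (Num.sqrt (a j.+1)) (Num.sqrt (L j.+1)) => l0 x0 x1 l1; nra.
near=> j.
have Jj : (J <= j)%N by near: j; exists J.
have := main (j - J)%N; rewrite subnKC// => h; apply: le_trans h _.
have a1 : (`|Delta J| / (eta / 2)) ^+ 2 <= a j by near: j; exact: a_lim.
have L1 : 1 <= L j by near: j; exact: L_lim.
have aj : 0 <= a j by exact: a0.
rewrite sqrtrM// (mulrC (Num.sqrt (a j))).
set l := Num.sqrt (L j); set x := Num.sqrt (a j).
have l1 : 1 <= l by rewrite -sqrtr1 ler_wsqrtr.
have x1 : `|Delta J| <= x * (eta / 2).
  rewrite -ler_pdivrMr//; have q0 : 0 <= `|Delta J| / (eta / 2) by rewrite divr_ge0// ltW.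
  by rewrite -(ger0_norm q0) -sqrtr_sqr ler_wsqrtr.
have x0 : 0 <= x by exact: sqrtr_ge0.
have : x * (eta / 2) <= l * x * (eta / 2) by rewrite ler_wpM2r ?(ltW eta2)// ler_peMl.
by lra.
Unshelve. all: by end_near.
Qed.

End growth.

(** * Gaussian coupling of the blocks *)

Section uniform_value.
Context {R : realType}.
Local Notation fair := (@fair R).
Local Notation fr A := (fine (fair A)).
Variables (sg : nat -> R) (n l : nat).
Hypothesis sg0 : forall i, 0 <= sg i.
Hypothesis v0 : 0 < gvar sg n l.
Let v := gvar sg n l.
(** The probability integral transform of the Gaussian block sum: it is uniform and increasing in
    that sum, so cells in terms of [U] are intervals of values of the sum. *)
Let U w := heat v (gsum sg n l w).

Lemma gsum_heat_meas : measurable_fun setT U.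
Proof. exact: (measurableT_comp (heat_measurable v) (measurable_gsum sg n l)). Qed.

Lemma gsum_heat01 w : 0 < U w < 1.
Proof. by rewrite /U /heat gcdf_gt0 gcdf_lt1. Qed.

Let U_lt_meas t : measurable [set w | U w < t].
Proof.
have m1 : measurable_fun setT (fun w => U w < t).
  by apply: measurable_fun_ltr => //; exact: gsum_heat_meas.
by rewrite -[X in measurable X]setTI; exact: (m1 measurableT [set true]).
Qed.

Let U_le_meas t : measurable [set w | U w <= t].
Proof.
rewrite -[X in measurable X]setTI; apply: measurable_fun_le => //; exact: gsum_heat_meas.
Qed.

Let U_le t : 0 < t < 1 -> fr [set w | U w <= t] = t.
Proof.
move=> t01; have [y yt] := gcdf_surj t01.
have sv : 0 < Num.sqrt v by rewrite sqrtr_gt0.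
have -> : [set w | U w <= t] = [set w | gsum sg n l w <= y * Num.sqrt v].
  by apply/seteqP; split => w; rewrite /= /U /heat -yt gcdf_leE ler_pdivrMr.
by rewrite gsum_cdf//= /heat -/v mulfK ?gt_eqF.
Qed.

Lemma gsum_heat_unif t : 0 <= t <= 1 -> fr [set w | U w < t] = t.
Proof.
move=> /andP[t0 t1].
have h1 (s : R) : 0 < s < 1 -> s <= t -> s <= fr [set w | U w < t].
  move=> /andP[s0 s1] st; apply/ler_addgt0Pl => e e0.
  have [es|se] := leP s e; first by apply: le_trans es _; rewrite lerDl fr_ge0.
  rewrite -lerBlDl -(@U_le (s - e)); last by apply/andP; split; lra.
  by apply: fr_le => // w /= h; apply: le_lt_trans h _; lra.
have h2 (s : R) : t <= s -> 0 < s < 1 -> fr [set w | U w < t] <= s.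
  move=> ts s01; rewrite -(U_le s01); apply: fr_le => // w /= h.
  by apply: ltW; apply: lt_le_trans ts.
have [e|tn0] := eqVneq t 0.
  rewrite e (_ : [set w | _] = set0) ?measure0//.
  by apply/seteqP; split => // w /=; have /andP[h _] := gsum_heat01 w; rewrite ltNge ltW.
have [e|tn1] := eqVneq t 1.
  rewrite e (_ : [set w | _] = setT) ?[fair _](@probability_setT _ _ _ fair)//.
  by apply/seteqP; split => // w _ /=; have /andP[] := gsum_heat01 w.
have t01 : 0 < t < 1 by rewrite !lt_neqAle t0 t1 eq_sym tn0 tn1.
by apply/eqP; rewrite eq_le h1 ?h2.
Qed.

Lemma fr_leU (A B : set coins) : measurable A -> measurable B -> fr (A `|` B) <= fr A + fr B.
Proof.
move=> mA mB; rewrite -lee_fin EFinD !frE//; first exact: measureU2.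
exact: measurableU.
Qed.

Lemma gsum_heat_band (p q : R) (E : set coins) : measurable E -> 0 <= p -> p <= q ->
  (forall w, E w -> p <= U w < q) -> fr E <= q - p.
Proof.
move=> mE p0 pq h.
have [p1|p1] := leP 1 p.
  rewrite (_ : E = set0) ?measure0 /=; first by lra.
  apply/seteqP; split => // w /h /andP[h1 _]; have /andP[_] := gsum_heat01 w.
  by rewrite ltNge (le_trans p1 h1).
pose q' := Num.min q 1.
have q'1 : q' <= 1 by rewrite ge_min lexx orbT.
have q'q : q' <= q by rewrite ge_min lexx.
have pq' : p <= q' by rewrite le_min pq ltW.
have mp : measurable (E `|` [set w | U w < p]) by exact: measurableU.
have hU : fair (E `|` [set w | (U w < p)%R]) = (fair E + fair [set w | (U w < p)%R])%E.
  apply: measureU => //; apply/seteqP; split => // w [/h /andP[h1 _] /=].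
  by rewrite ltNge h1.
have : fr (E `|` [set w | U w < p]) <= fr [set w | U w < q'].
  apply: fr_le => // w [/h /andP[_ h1]|/= h1]; rewrite /q' /= lt_min.
    by rewrite h1; have /andP[_ ->] := gsum_heat01 w.
  by rewrite (lt_le_trans h1 pq) (lt_trans h1 p1).
rewrite hU fineD ?fin_num_measure// !gsum_heat_unif; try (by apply/andP; split; lra); lra.
Qed.

End uniform_value.

Section block_coupling.
Context {R : realType} {d} {S : measurableType d} (mu : probability S R).
Variable (c : reverse_chain mu).
Local Notation step := (chain_step c).
Local Notation back := (back c).
Local Notation backs := (backs c).
Local Notation fair := (@fair R).
Local Notation fr A := (fine (fair A)).
Implicit Types (x y z : S) (w : coins).
Variables (dd : nat -> S -> R) (D : R).
Hypothesis D0 : 0 < D.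
Hypothesis ddD : forall n z, `|dd n z| <= D.
Hypothesis dd_meas : forall n, measurable_fun setT (dd n).
Hypothesis dd_back : forall n x, back n (dd n) x = 0.
Variables (sg : nat -> R) (nn ll : nat -> nat).
Hypothesis sg0 : forall i, 0 <= sg i.
Hypotheses (nn0 : nn 0%N = 0%N) (nnS : forall j, nn j.+1 = (nn j + ll j)%N).
Hypothesis v0 : forall j, 0 < gvar sg (nn j) (ll j).
Variables (B e : nat -> R) (K : nat -> nat).
Hypothesis e0 : forall j, 0 < e j.

Let v j := gvar sg (nn j) (ll j).
Definition beta j z := dsums c dd (nn j) (ll j) z.
Definition grid j i : R := - B j + i%:R * e j.
(** The number of grid points not above the block sum. The values 0 and [K j] label the two
    unbounded cells. *)
Definition kap j z : nat := (\sum_(i < K j) (grid j i <= beta j z)%R)%N.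
Definition Uval j w : R := heat (v j) (gsum sg (nn j) (ll j) w).

Definition bchain := block_chain c nn0 nnS.

Lemma kapK j z : (kap j z <= K j)%N.
Proof.
rewrite -[leqRHS]card_ord -sum1_card; apply: leq_sum => i _; exact: leq_b1.
Qed.

Lemma grid_le j : {homo grid j : i k / (i <= k)%N >-> i <= k}.
Proof. by move=> i k ik; rewrite lerD2l ler_pM2r// ler_nat. Qed.

Lemma kap_lt j z k : (k < K j)%N -> (kap j z <= k)%N = (beta j z < grid j k).
Proof.
move=> kK; apply/idP/idP => h.
  rewrite ltNge; apply/negP => gk; move: h; rewrite leqNgt => /negP; apply.
  rewrite /kap -(big_mkord xpredT (fun i => nat_of_bool (grid j i <= beta j z)%R)) (big_cat_nat _ kK)//=.
  rewrite ltn_addr//.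
  have : (\sum_(0 <= i < k.+1) 1 <= \sum_(0 <= i < k.+1) (grid j i <= beta j z)%R)%N.
    rewrite !big_mkord; apply: leq_sum => i _; by rewrite (le_trans (grid_le j (ltn_ord i : (i <= k)%N)) gk).
  by rewrite sum_nat_const_nat subn0 muln1.
rewrite /kap -(big_mkord xpredT (fun i => nat_of_bool (grid j i <= beta j z)%R)) (big_cat_nat _ (ltnW kK))//=.
rewrite [X in (_ + X)%N]big_nat_cond [X in (_ + X)%N]big1 ?addn0 => [|i /andP[/andP[h1 _] _]]; last first.
  by rewrite leNgt (lt_le_trans h (grid_le j h1)).
rewrite big_mkord -[leqRHS]card_ord -sum1_card; apply: leq_sum => i _; exact: leq_b1.
Qed.

Lemma beta_meas j : measurable_fun setT (beta j).
Proof. exact: dsums_meas. Qed.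

Lemma kap_meas j k : measurable [set z | kap j z = k].
Proof.
have m : measurable_fun setT (fun z => \sum_(i < K j) (grid j i <= beta j z)%R%:R : R).
  apply: measurable_sum => i.
  rewrite (_ : (fun z => _) = \1_[set z | grid j i <= beta j z]); last first.
    by apply/funext => z; rewrite indicE; congr (nat_of_bool _)%:R; apply/idP/idP => [h|/set_mem//]; rewrite inE.
  apply: measurable_indic; rewrite -[X in measurable X]setTI; apply: measurable_fun_le => //.
  exact: beta_meas.
rewrite (_ : [set z | _] = setT `&` (fun z => \sum_(i < K j) (grid j i <= beta j z)%R%:R : R) @^-1` [set k%:R]).
  by apply: m.
rewrite setTI; apply/seteqP; split => z /=.
  by move=> <-; rewrite natr_sum.
by rewrite -natr_sum => /eqP; rewrite eqr_nat => /eqP.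
Qed.

Lemma Uval_meas j : measurable_fun setT (Uval j).
Proof. exact: gsum_heat_meas. Qed.

Lemma Uval01 j w : 0 <= Uval j w < 1.
Proof. by have /andP[h1 h2] := gsum_heat01 sg (nn j) (ll j) w; rewrite /Uval ltW. Qed.

Lemma Uval_unif j (t : R) : 0 <= t <= 1 -> fr [set w | Uval j w < t] = t.
Proof. exact: (gsum_heat_unif sg0 (v0 j)). Qed.

Lemma bchain_iter j x : iter_step (chain_step bchain) 0 j x = iter_step step 0 (nn j) x.
Proof. exact: block_iter. Qed.

Local Notation pk := (pick bchain kap Uval).
Local Notation cellpb := (cellp bchain kap).
Local Notation cellb := (cell bchain kap Uval).

(** The Gaussian leaves the observed cell by more than the shift [2 * e j] of [block_cdf]. The
    unbounded cells are left out, as sums that large are treated by the maximal inequalities. *)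
Definition mismatch j k : set coins :=
  if (0 < k < K j)%N then
    [set w | gsum sg (nn j) (ll j) w < grid j k.-1 - 2 * e j] `|`
    [set w | grid j k + 2 * e j <= gsum sg (nn j) (ll j) w]
  else set0.

Lemma mismatch_meas j k : measurable (mismatch j k).
Proof.
rewrite /mismatch; case: ifP => // _; apply: measurableU; last first.
  by rewrite -[X in measurable X]setTI; apply: measurable_fun_le => //; exact: measurable_gsum.
have m1 : measurable_fun setT (fun w => gsum sg (nn j) (ll j) w < grid j k.-1 - 2 * e j).
  by apply: measurable_fun_ltr => //; exact: measurable_gsum.
by rewrite -[X in measurable X]setTI; exact: (m1 measurableT [set true]).
Qed.

Section one_block.
Variables (j : nat) (del B1 : R).
Hypothesis del0 : 0 < del.
Hypothesis Ddel : D ^+ 2 <= del * v j.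
Hypothesis delB : del * B1 <= e j.
Hypothesis gridB : forall i, (i < K j)%N -> `|grid j i| + e j <= B1.
Hypothesis gridK : B j <= grid j (K j).-1.
Let err x := block_err c dd D (v j) del (e j) (nn j) (ll j) x.

Lemma cellp_heat k x : (k < K j)%N ->
  heat (v j) (grid j k - 2 * e j) - err x <= cellpb j k.+1 x <= heat (v j) (grid j k + 2 * e j) + err x.
Proof.
move=> kK.
have -> : cellpb j k.+1 x = backs (nn j) (ll j) (fun z => (dsums c dd (nn j) (ll j) z < grid j k)%R%:R) x.
  by rewrite /cellp /=; congr (backs _ _ _ _); apply/funext => z; rewrite ltnS kap_lt.
by apply: (block_cdf (B := B1) D0 ddD dd_back) => //; [exact: v0|exact: ltW|exact: gridB].
Qed.

Lemma block_err_ge0 x : 0 <= err x.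
Proof.
rewrite /err /block_err; apply: addr_ge0; first exact: backs_ge0.
apply: addr_ge0; last exact: expR_ge0.
apply: mulr_ge0; last by rewrite mulr_ge0 ?(ltW (v0 j))// addr_ge0// ltW.
by rewrite mulr_ge0 ?exprn_ge0 ?invr_ge0 ?sqrtr_ge0// mulr_ge0// ltW.
Qed.

(** In terms of the uniform variable, the cell is the interval between two consecutive values of
    [cellp], and [cellp_heat] places these within [err] of the Gaussian distribution function at
    shifted grid points. What lies beyond the margin is a band of width at most [err] at either
    end. *)
Lemma mismatch_cell k x : fr (mismatch j k `&` cellb j k x) <= 2 * err x.
Proof.
rewrite /mismatch; case: ifP => [/andP[k0 kK]|_]; last first.
  by rewrite set0I measure0 mulr_ge0// block_err_ge0.
case: k k0 kK => // k _ kK /=.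
have mc := cell_meas bchain kap Uval_meas j k.+1 x.
set M1 := [set w | _ < _]; set M2 := [set w | _ <= _].
have m1 : measurable M1.
  have m1 : measurable_fun setT (fun w => gsum sg (nn j) (ll j) w < grid j k - 2 * e j).
    by apply: measurable_fun_ltr => //; exact: measurable_gsum.
  by rewrite -[X in measurable X]setTI; exact: (m1 measurableT [set true]).
have m2 : measurable M2.
  by rewrite -[X in measurable X]setTI; apply: measurable_fun_le => //; exact: measurable_gsum.
have mM1 : measurable (M1 `&` cellb j k.+1 x) by exact: measurableI.
have mM2 : measurable (M2 `&` cellb j k.+1 x) by exact: measurableI.
have /andP[c1 _] := @cellp_heat k x (ltnW kK).
have /andP[_ c2] := @cellp_heat k.+1 x kK.
have er := block_err_ge0 x.
apply: (@le_trans _ _ (fr (M1 `&` cellb j k.+1 x) + fr (M2 `&` cellb j k.+1 x))).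
  by rewrite setIUl; exact: fr_leU.
set h1 := heat (v j) (grid j k - 2 * e j) in c1.
set h2 := heat (v j) (grid j k.+1 + 2 * e j) in c2.
have h10 : 0 <= h1 by exact: heat_ge0.
have h20 : 0 <= h2 by exact: heat_ge0.
rewrite mulr_natl mulr2n; apply: lerD.
  (* [gsum_heat_band] wants a nonnegative lower end; truncating at 0 does not lengthen the band. *)
  have [p0 pE] : 0 <= Num.max 0 (h1 - err x) /\ h1 - Num.max 0 (h1 - err x) <= err x.
    by split; [rewrite le_max lexx|have [?|?] := leP 0 (h1 - err x); lra].
  apply: le_trans pE.
  apply: (gsum_heat_band sg0 (v0 j)) => //; first by rewrite ge_max h10 /=; lra.
  move=> w [/= hw1 /andP[hw2 _]]; apply/andP; split.
    rewrite ge_max heat_ge0/=; exact: le_trans c1 hw2.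
  by rewrite /h1 /heat ltNge gcdf_leE ler_pM2r ?invr_gt0 ?sqrtr_gt0 -?ltNge//; exact: v0.
have -> : err x = h2 + err x - h2 by lra.
apply: (gsum_heat_band sg0 (v0 j)) => //; first by lra.
move=> w [/= hw1 /andP[_ hw2]]; apply/andP; split; first exact: heat_le.
exact: lt_le_trans hw2 c2.
Qed.

(** The bound on [beta] excludes the unbounded cells; a bounded cell has width [e j], and the margin
    [2 * e j] on either side makes [3 * e j]. *)
Lemma mismatch_sub x w : ~ mismatch j (kap j x) w -> `|beta j x| < B j -> (0 < K j)%N -> B j <= - grid j 0 ->
  `|beta j x - gsum sg (nn j) (ll j) w| <= 3 * e j.
Proof.
move=> h; rewrite ltr_norml => /andP[b1 b2] K0 _.
have kK : (kap j x < K j)%N.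
  case: (K j) K0 gridK (@kap_lt j x (K j).-1) => // k _ /= gk.
  by rewrite ltnSn => /(_ isT); rewrite ltnS => ->; exact: lt_le_trans b2 gk.
have k0 : (0 < kap j x)%N.
  by rewrite ltnNge kap_lt// -leNgt /grid mul0r addr0 ltW.
move: h; rewrite /mismatch k0 kK /= => /not_orP[/negP]; rewrite -leNgt => w1 /negP; rewrite -ltNge => w2.
have b3 : beta j x < grid j (kap j x) by rewrite -kap_lt.
have b4 : grid j (kap j x).-1 <= beta j x.
  rewrite leNgt -kap_lt; last by apply: leq_ltn_trans (leq_pred _) kK.
  by rewrite -ltnNge prednK.
have b5 : grid j (kap j x) = grid j (kap j x).-1 + e j.
  by rewrite -{1}(prednK k0) /grid -natr1; ring.
by rewrite ler_norml; apply/andP; split; lra.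
Qed.

(** The error is paid once per cell, which is why the number of cells enters as a factor and the
    mesh cannot be refined at will. The variance part of the error is integrated back to the
    probability of a bad variance. *)
Lemma law_mismatch (C : R) :
  (mu [set x | vbad c dd (v j) del (nn j) (ll j) (iter_step step 0 (nn j) x)] <= C%:E)%E ->
  ((mu \x fair) [set p | mismatch j (kap j (iter_step step 0 (nn j) p.1)) (pk j p)] <=
  (2 * (K j).+1%:R * (C + (3 * D * (Num.sqrt (del * v j))^-1 ^+ 3 * ((1 + del) * v j) +
     expR (- (e j ^+ 2 / (6 * (del * v j)))))))%:E)%E.
Proof.
move=> hV.
have hC : (\int[mu]_x (backs (nn j) (ll j) (fun z => (vbad c dd (v j) del (nn j) (ll j) z)%:R)
     (iter_step step 0 (nn j.+1) x))%:E <= C%:E)%E.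
  have mV := vbad_meas c dd_meas (v j) del (nn j) (ll j).
  rewrite (_ : (fun z => _) = \1_[set z | vbad c dd (v j) del (nn j) (ll j) z]); last first.
    apply/funext => z; rewrite indicE; congr (nat_of_bool _)%:R.
    by apply/idP/idP => [h|/set_mem//]; rewrite inE.
  rewrite nnS -(backs_int c (nn j) (ll j) (measurable_indic mV)) => [|x]; last by rewrite indicE.
  apply: le_trans hV; rewrite -[X in (_ <= mu X)%E]setIT -integral_indic//.
  by rewrite -[X in measurable X]setTI; exact: (iter_step_meas c 0 (nn j) measurableT mV).
have -> : [set p | mismatch j (kap j (iter_step step 0 (nn j) p.1)) (pk j p)] =
    [set p | mismatch j (kap j (iter_step (chain_step bchain) 0 j p.1)) (pk j p)].
  by apply/seteqP; split => p /=; rewrite bchain_iter.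
rewrite (law_pick_kap bchain kapK kap_meas Uval_meas Uval_unif j (mismatch_meas j)).
have -> : iter_step (chain_step bchain) 0 j.+1 = iter_step step 0 (nn j.+1).
  by apply/funext => x; rewrite bchain_iter.
pose b x := backs (nn j) (ll j) (fun z => (vbad c dd (v j) del (nn j) (ll j) z)%:R) x.
set k0 := (_ + expR _).
have mb : measurable_fun setT b.
  apply: backs_meas.
  rewrite (_ : (fun z => _) = \1_[set z | vbad c dd (v j) del (nn j) (ll j) z]).
    by apply: measurable_indic; exact: vbad_meas.
  apply/funext => z; rewrite indicE; congr (nat_of_bool _)%:R.
  by apply/idP/idP => [h|/set_mem//]; rewrite inE.
have mbX : measurable_fun setT (fun x => b (iter_step step 0 (nn j.+1) x)).
  exact: (measurableT_comp mb (iter_step_meas c 0 _)).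
have b0 x : 0 <= b x by exact: backs_ge0.
have errE x : err x = b x + k0 by [].
pose a : R := 2 * (K j).+1%:R.
have a0 : 0 <= a by rewrite mulr_ge0.
apply: (@le_trans _ _ (\int[mu]_x (a%:E * (b (iter_step step 0 (nn j.+1) x) + k0)%:E))%E).
  apply: ge0_le_integral => //.
  - by move=> x _; rewrite lee_fin; apply: sumr_ge0 => k _; exact: fr_ge0.
  - apply/measurable_EFinP; apply: measurable_sum => k.
    have m := @fr_cell_meas _ _ _ mu bchain kap Uval kap_meas Uval_meas j _ k (mismatch_meas j k).
    exact: (measurableT_comp m (iter_step_meas c 0 _)).
  - by apply/measurable_EFinP; apply: measurable_funM => //; exact: measurable_funD.
  move=> x _; rewrite -EFinM lee_fin -errE.
  apply: (@le_trans _ _ (\sum_(k < (K j).+1) 2 * err (iter_step step 0 (nn j.+1) x))).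
    by apply: ler_sum => k _; exact: mismatch_cell.
  by rewrite sumr_const card_ord -mulr_natl /a; lra.
have kk0 : 0 <= k0.
  rewrite /k0 addr_ge0 ?expR_ge0//.
  apply: mulr_ge0; last by rewrite mulr_ge0 ?(ltW (v0 j))// addr_ge0// ltW.
  by rewrite mulr_ge0 ?exprn_ge0 ?invr_ge0 ?sqrtr_ge0// mulr_ge0// ltW.
rewrite ge0_integralZl//; last 2 first.
- by apply/measurable_EFinP; exact: measurable_funD.
- by move=> x _; rewrite lee_fin addr_ge0.
rewrite [leRHS]EFinM; apply: lee_wpmul2l; first by rewrite lee_fin.
under eq_integral do rewrite EFinD.
rewrite ge0_integralD//; last 2 first.
- by move=> x _; rewrite lee_fin.
- exact/measurable_EFinP.
rewrite [leRHS]EFinD; apply: leeD => //; rewrite integral_cst//= -[leRHS]mule1 lee_wpmul2l ?lee_fin//.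
exact: probability_le1.
Qed.

End one_block.

(** The search range is long enough because every block is nonempty, so that [nn j >= j]. *)
Definition block_of i : nat := find (fun j => (i < nn j.+1)%N) (iota 0 i.+1).

Definition zvar i (p : S * coins) : R :=
  sg i * nth_normal (i - nn (block_of i)) (pk (block_of i) p).

Lemma ll_gt0 j : (0 < ll j)%N.
Proof. by have := v0 j; case: (ll j) => //; rewrite /gvar big_ord0 ltxx. Qed.

Lemma nn_mono : {homo nn : i j / (i <= j)%N}.
Proof. by apply: homo_leq => // [|i]; [exact: leq_trans|rewrite nnS leq_addr]. Qed.

Lemma nn_ge j : (j <= nn j)%N.
Proof. by elim: j => // j IH; rewrite nnS -addn1 leq_add// ll_gt0. Qed.

Lemma block_ofP j i : (nn j <= i < nn j.+1)%N -> block_of i = j.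
Proof.
move=> /andP[h1 h2].
have ji : (j <= i)%N by apply: leq_trans (nn_ge j) h1.
have hh : has (fun j => (i < nn j.+1)%N) (iota 0 i.+1).
  by apply/hasP; exists j => //; rewrite mem_iota add0n ltnS.
have := nth_find 0%N hh; have := hh; rewrite has_find size_iota -/(block_of i) => bi.
rewrite nth_iota// add0n => h3.
apply/eqP; rewrite eqn_leq; apply/andP; split.
  rewrite leqNgt; apply/negP => jb; have := before_find 0%N jb.
  by rewrite nth_iota ?add0n ?h2// ltnS.
rewrite leqNgt; apply/negP => bj; move: h1; rewrite leqNgt => /negP; apply.
by apply: leq_trans h3 _; exact: nn_mono.
Qed.

Lemma block_of_ex i : exists j, (nn j <= i < nn j.+1)%N.
Proof.
elim: i => [|i [j /andP[h1 h2]]].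
  by exists 0%N; rewrite nn0 leqnn /= nnS nn0 add0n ll_gt0.
have [e1|h] := eqVneq i.+1 (nn j.+1).
  by exists j.+1; rewrite -e1 leqnn e1 [nn j.+2]nnS -[X in (X < _)%N]addn0 ltn_add2l ll_gt0.
by exists j; rewrite leqW//= ltn_neqAle h.
Qed.

Lemma pk_meas j (C : set coins) : measurable C -> measurable [set p : S * coins | C (pk j p)].
Proof. by move=> mC; exact: (pick_meas bchain kapK kap_meas Uval_meas j mC). Qed.

Lemma zvar_meas i : measurable_fun setT (zvar i).
Proof.
apply: measurable_funM => //.
move=> _ C mC; rewrite setTI.
have mD : measurable (nth_normal (i - nn (block_of i)) @^-1` C : set coins).
  by rewrite -[X in measurable X]setTI; exact: (measurable_nth_normal _ measurableT).
exact: (pk_meas _ mD).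
Qed.

Lemma sum_zvar j m p : (m <= ll j)%N ->
  \sum_(nn j <= i < nn j + m) zvar i p = gsum sg (nn j) m (pk j p).
Proof.
move=> ml; rewrite -{1}[nn j]add0n (addnC _ m) big_addn addnK big_mkord; apply: eq_bigr => i _.
have e1 : block_of (i + nn j) = j.
  apply: block_ofP; rewrite leq_addl /= nnS addnC ltn_add2l; exact: leq_trans (ltn_ord i) ml.
by rewrite /zvar e1 addnK addnC.
Qed.

Definition zlaw i (A : set R) : R := fine (normal_prob (0 : R) 1 [set x | A (sg i * x)]).

Lemma zlaw_meas i A : measurable A -> measurable [set x : measurableTypeR R | A (sg i * x)].
Proof.
have m : measurable_fun setT (fun x : R => sg i * x) by exact: measurable_funM.
by move=> mA; rewrite -[X in measurable X]setTI; exact: (m measurableT _ mA).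
Qed.

Lemma joint_law M (A : nat -> set R) : (forall i, measurable (A i)) ->
  (mu \x fair)%E [set p | forall i, (i < nn M)%N -> A i (zvar i p)] =
  (\prod_(i < nn M) zlaw i (A i))%:E.
Proof.
move=> mA.
pose C j : set coins := [set w | forall i, (i < ll j)%N ->
  [set x | A (nn j + i)%N (sg (nn j + i)%N * x)] (nth_normal i w)].
have mC j : measurable (C j).
  rewrite (_ : C j = \bigcap_(i < ll j) (nth_normal i @^-1` [set x | A (nn j + i)%N (sg (nn j + i)%N * x)])).
    apply: bigcap_measurableType => i _; rewrite -[X in measurable X]setTI.
    by apply: (measurable_nth_normal i measurableT); exact: zlaw_meas.
  by apply/seteqP; split => w h i /h.
have -> : [set p | forall i, (i < nn M)%N -> A i (zvar i p)] =
    [set p | forall j, (j < M)%N -> C j (pk j p)].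
  apply/seteqP; split => p /= h.
    move=> j jM i il /=.
    have e1 : block_of (nn j + i) = j.
      by apply: block_ofP; rewrite leq_addr /= nnS ltn_add2l.
    have := h (nn j + i)%N; rewrite /zvar e1 addKn; apply.
    by apply: leq_trans (nn_mono jM); rewrite nnS ltn_add2l.
  move=> i iM; have [j /andP[h1 h2]] := block_of_ex i.
  have e1 : block_of i = j by apply: block_ofP; rewrite h1.
  have jM : (j < M)%N.
    by rewrite ltnNge; apply/negP => /nn_mono Mj; move: (leq_trans iM (leq_trans Mj h1)); rewrite ltnn.
  have := h j jM (i - nn j)%N; rewrite /zvar e1 /= subnKC//; apply.
  by rewrite ltn_subLR// -nnS.
rewrite (law_pick bchain kapK kap_meas Uval_meas Uval01 Uval_unif M mC); congr (_%:E).
elim: M => [|M IH]; first by rewrite nn0 !big_ord0.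
rewrite big_ord_recr/= IH nnS big_split_ord/=; congr (_ * _).
apply: EFin_inj; rewrite frE//.
have hB i : measurable ([set x | A (nn M + i)%N (sg (nn M + i)%N * x)] : set (measurableTypeR R)).
  exact: zlaw_meas.
have -> : fair (C M) = _ := law_nth_normals (ll M) hB.
rewrite -prodEFin; apply: eq_bigr => i _ /=.
by rewrite /zlaw fineK// fin_num_measure//; exact: zlaw_meas.
Qed.

(** An initial segment that ends inside a block is completed by imposing no condition on the
    remaining indices. *)
Lemma joint_law_lt N (A : nat -> set R) : (forall i, measurable (A i)) ->
  (mu \x fair)%E [set p | forall i, (i < N)%N -> A i (zvar i p)] =
  (\prod_(i < N) zlaw i (A i))%:E.
Proof.
move=> mA; pose A' i := if (i < N)%N then A i else setT.
have mA' i : measurable (A' i) by rewrite /A'; case: ifP.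
have := joint_law N mA'.
have -> : [set p | forall i, (i < nn N)%N -> A' i (zvar i p)] =
    [set p | forall i, (i < N)%N -> A i (zvar i p)].
  apply/seteqP; split => p h i.
    by move=> iN; have := h i (leq_trans iN (nn_ge N)); rewrite /A' iN.
  by move=> _; rewrite /A'; case: ifP => // /h.
move=> ->; congr (_%:E).
rewrite -(big_mkord xpredT (fun i => zlaw i (A' i))) (big_cat_nat _ (nn_ge N))//=.
rewrite [X in _ * X]big_nat_cond [X in _ * X]big1 => [|i /andP[/andP[h _] _]]; last first.
  rewrite /A' ltnNge h /zlaw /=.
  by rewrite (_ : normal_prob _ _ _ = 1%E)//; exact: probability_setT.
by rewrite mulr1 big_mkord; apply: eq_bigr => i _; rewrite /A' ltn_ord.
Qed.

Lemma law_pk j (C : set coins) : measurable C -> (mu \x fair)%E [set p | C (pk j p)] = fair C.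
Proof.
move=> mC; rewrite (law_pick_kap bchain kapK kap_meas Uval_meas Uval_unif j (D := fun=> C))//.
under eq_integral do rewrite (sum_cells bchain kapK Uval_meas Uval01)//.
by rewrite integral_cst//= [mu _](@probability_setT _ _ _ mu) mule1 frE.
Qed.

End block_coupling.

Lemma borel_cantelli {R : realType} {d} {Y : measurableType d} (P : probability Y R)
    (F : nat -> set Y) (q : nat -> R) : (forall j, measurable (F j)) ->
  (\forall j \near \oo, (P (F j) <= (q j)%:E)%E) -> (forall j, 0 <= q j) -> bounded_sums q ->
  {ae P, forall y, \forall j \near \oo, ~ F j y}.
Proof.
move=> mF hq q0 sq.
have [K hK] : bounded_sums (fun j => fine (P (F j))).
  apply: bounded_sums_le q0 sq; near=> j.
  by rewrite -lee_fin fineK ?fin_num_measure//; near: j.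
have h0 : P (lim_sup_set F) = 0%E.
  apply: lim_sup_set_cvg0 => //; apply: (@le_lt_trans _ _ K%:E); last exact: ltry.
  apply: lime_le; first by apply: is_cvg_nneseries => n _ _; exact: measure_ge0.
  apply: nearW => n.
  rewrite (eq_bigr (fun j => (fine (P (F j)))%:E)); last by move=> j _; rewrite fineK// fin_num_measure.
  by rewrite sumEFin lee_fin big_mkord.
exists (lim_sup_set F); split => //.
- apply: bigcap_measurableType => n _; exact: bigcup_measurable.
move=> y /= h n _; apply: contrapT => nh; apply: h; exists n => // j /= nj Fj.
by apply: nh; exists j.
Unshelve. all: by end_near.
Qed.

(* [del] is chosen so that the mesh [w / c] satisfies
   [(w / c) ^ 2 / (6 del v) = 5 t], where [t = ln y]. *)
Section parameters.
Context {R : realType}.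
Variables (D c y v t : R).
Hypotheses (D0 : 0 < D) (c1 : 1 <= c) (cy : c <= y) (t1 : 1 <= t).
Hypothesis v0 : 0 < v.
Hypothesis vL : 6 * 6 * 6 * 6 * D * c ^+ 3 * y ^+ 5 <= Num.sqrt v.
Let s := Num.sqrt v.
Let w := Num.sqrt (v * t).
Let del := (30 * c ^+ 2)^-1.

Lemma par_basic : [/\ 0 < c, 1 <= y, 0 < s, 0 < w & w ^+ 2 = v * t] /\
  [/\ 0 < D, 1 <= c, 1 <= t, 0 < t & 0 < v].
Proof.
have c0 : 0 < c := lt_le_trans ltr01 c1.
have t0 : 0 < t := lt_le_trans ltr01 t1.
have vt : 0 < v * t by rewrite mulr_gt0.
split; split => //; rewrite ?sqrtr_gt0 ?sqr_sqrtr ?(ltW vt)//.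
exact: le_trans c1 cy.
Qed.

Lemma par_del : [/\ 0 < del, del <= 1 & D ^+ 2 <= del * v].
Proof.
have [[c0 y1 s0 w0 wE] [D0' c1' t1' t0 v0']] := par_basic.
have c2 : 1 <= c ^+ 2 by rewrite exprn_ege1.
split; first by rewrite invr_gt0; lra.
  by rewrite invf_le1; lra.
have h : 6 * D * c <= s.
  apply: le_trans vL.
  have y5 : 1 <= y ^+ 5 by rewrite exprn_ege1.
  have dc : 0 < D * c by rewrite mulr_gt0.
  have -> : 6 * 6 * 6 * 6 * D * c ^+ 3 * y ^+ 5 = (D * c) * (6 * 6 * 6 * 6 * (c ^+ 2 * y ^+ 5)) by ring.
  have -> : 6 * D * c = (D * c) * 6 by ring.
  by rewrite ler_pM2l//; nra.
rewrite /del mulrC ler_pdivlMr; last by lra.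
rewrite -[v]sqr_sqrtr ?(ltW v0)// -/s.
apply: (@le_trans _ _ ((6 * D * c) ^+ 2)).
  have := sqr_ge0 (D * c); have -> : (6 * D * c) ^+ 2 = 36 * (D * c) ^+ 2 by ring.
  have -> : D ^+ 2 * (30 * c ^+ 2) = 30 * (D * c) ^+ 2 by ring.
  by lra.
by rewrite ler_pXn2r ?nnegrE ?(ltW s0)// !mulr_ge0// ltW.
Qed.

Lemma par_delB : del * (11 * w) <= w / c.
Proof.
have [[c0 y1 s0 w0 wE] [D0' c1' t1' t0 v0']] := par_basic.
have -> : del * (11 * w) = (w / c) * (11 / (30 * c)) by rewrite /del; field; rewrite gt_eqF.
rewrite ler_piMr ?divr_ge0 ?(ltW w0) ?(ltW c0)//.
by rewrite ler_pdivrMr; lra.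
Qed.

(** Since [30 <= 36], the root of [del * v] is at least [s / (6 * c)], so the Lindeberg term is at
    most [3 * 6 ^ 3 * 2 * D * c ^ 3 / s]; this is the constant [6 ^ 4] of [vL], which makes it at
    most [y ^- 5]. The Gaussian tail is exactly [expR (- 5 t) = y ^- 5] by the choice of [del]. *)
Lemma par_err : y = expR t ->
  3 * D * (Num.sqrt (del * v))^-1 ^+ 3 * ((1 + del) * v) +
    expR (- ((w / c) ^+ 2 / (6 * (del * v)))) <= 2 * (y ^+ 5)^-1.
Proof.
move=> yE; have [[c0 y1 s0 w0 wE] [D0' c1' t1' t0 v0']] := par_basic; have [d0 d1 _] := par_del.
have -> : (w / c) ^+ 2 / (6 * (del * v)) = t * 5.
  by rewrite expr_div_n wE /del; field; rewrite !gt_eqF.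
rewrite expRN expRM_natr -yE (mulr_natl _ 2) mulr2n; apply: lerD => //.
have y5 : 0 < y ^+ 5 by rewrite exprn_gt0//; lra.
have sq : s / (6 * c) <= Num.sqrt (del * v).
  rewrite sqrtrM ?(ltW d0)// -/s mulrC ler_wpM2r ?(ltW s0)//.
  have i0 : 0 <= (6 * c)^-1 by rewrite invr_ge0; lra.
  rewrite -[leLHS]ger0_norm// -sqrtr_sqr ler_wsqrtr// /del exprVn lef_pV2 ?posrE ?exprn_gt0//; try lra.
    have -> : (6 * c) ^+ 2 = 36 * c ^+ 2 by ring.
    by have := sqr_ge0 c; lra.
  by rewrite mulr_gt0 ?exprn_gt0.
have q0 : 0 < s / (6 * c) by rewrite divr_gt0//; lra.
have i3 : (Num.sqrt (del * v))^-1 ^+ 3 <= (6 * c / s) ^+ 3.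
  rewrite ler_pXn2r ?nnegrE ?invr_ge0 ?sqrtr_ge0 ?divr_ge0 ?(ltW s0)//; last by lra.
  by rewrite -[6 * c / s]invf_div lef_pV2 ?posrE// (lt_le_trans q0).
have dv : (1 + del) * v <= 2 * s ^+ 2 by rewrite sqr_sqrtr ?(ltW v0)//; nra.
apply: (@le_trans _ _ (3 * D * (6 * c / s) ^+ 3 * (2 * s ^+ 2))).
  apply: ler_pM => //.
  - by rewrite mulr_ge0 ?exprn_ge0 ?invr_ge0 ?sqrtr_ge0//; lra.
  - by rewrite mulr_ge0 ?(ltW v0)//; lra.
  - by rewrite ler_pM2l//; lra.
have -> : 3 * D * (6 * c / s) ^+ 3 * (2 * s ^+ 2) = 6 * 6 * 6 * 6 * D * c ^+ 3 / s.
  by field; rewrite gt_eqF.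
by rewrite ler_pdivrMr// [leRHS]mulrC ler_pdivlMr.
Qed.

(** The tilt of the exponential inequalities: [tt * w = 2 * t] and [tt ^ 2 * v = 4 * t], so at the
    level [8 * w] both exponents are at most [- 4 t], and [expR (- 4 t) = y ^- 4]. *)
Let tt := 2 * Num.sqrt (t / v).

Lemma par_tilt : y = expR t -> [/\ 0 <= tt, 3 * (tt * D) <= 1,
  expR (- (tt * (8 * w)) + tt ^+ 2 * ((1 + del) * v)) <= (y ^+ 4)^-1 &
  expR (tt * (0 - 8 * w) + tt ^+ 2 * v / 2) <= (y ^+ 4)^-1].
Proof.
move=> yE; have [[c0 y1 s0 w0 wE] [D0' c1' t1' t0 v0']] := par_basic; have [d0 d1 _] := par_del.
have tw : tt * w = 2 * t.
  rewrite /tt /w -mulrA -sqrtrM ?divr_ge0 ?(ltW v0) ?(ltW t0)//.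
  have -> : t / v * (v * t) = t ^+ 2 by field; rewrite gt_eqF.
  by rewrite sqrtr_sqr gtr0_norm.
have t2 : tt ^+ 2 * v = 4 * t.
  by rewrite exprMn sqr_sqrtr ?divr_ge0 ?(ltW v0) ?(ltW t0)//; field; rewrite gt_eqF.
have tt0 : 0 <= tt by rewrite mulr_ge0 ?sqrtr_ge0.
have fin x : x <= - (4 * t) -> expR x <= (y ^+ 4)^-1.
  move=> hx; apply: (@le_trans _ _ (expR (- (t * 4)))); first by rewrite ler_expR; lra.
  by rewrite expRN expRM_natr yE.
split => //.
- have ts : tt * s = 2 * Num.sqrt t.
    rewrite /tt /s -mulrA -sqrtrM ?divr_ge0 ?(ltW v0) ?(ltW t0)//.
    by congr (2 * Num.sqrt _); field; rewrite gt_eqF.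
  have st : Num.sqrt t <= t.
    rewrite -[leRHS]ger0_norm ?(ltW t0)// -sqrtr_sqr ler_wsqrtr//.
    by rewrite expr2 ler_peMl// ltW.
  have ty : t <= y by rewrite yE; have := expR_ge1Dx t; lra.
  rewrite -(@ler_pM2r _ s)// mul1r.
  have -> : 3 * (tt * D) * s = 3 * D * (tt * s) by ring.
  rewrite ts; apply: le_trans vL.
  have c3 : 1 <= c ^+ 3 by rewrite exprn_ege1.
  have y4 : 1 <= y ^+ 4 by rewrite exprn_ege1.
  have -> : 6 * 6 * 6 * 6 * D * c ^+ 3 * y ^+ 5 = D * (6 * 6 * 6 * 6 * (c ^+ 3 * y ^+ 4 * y)) by ring.
  have -> : 3 * D * (2 * Num.sqrt t) = D * (6 * Num.sqrt t) by ring.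
  rewrite ler_pM2l//; have h : 1 * 1 <= c ^+ 3 * y ^+ 4 by apply: ler_pM.
  have : y <= c ^+ 3 * y ^+ 4 * y by rewrite ler_peMl//; lra.
  by lra.
- apply: fin; have -> : tt * (8 * w) = 8 * (tt * w) by ring.
  have -> : tt ^+ 2 * ((1 + del) * v) = (1 + del) * (tt ^+ 2 * v) by ring.
  by rewrite tw t2; nra.
- apply: fin; have -> : tt * (0 - 8 * w) = - (8 * (tt * w)) by ring.
  by rewrite tw t2; lra.
Qed.

End parameters.

Lemma grid_last_le {R : realFieldType} (w c n : R) : 0 < w -> 0 < c -> 16 * c < n ->
  8 * w <= - (8 * w) + n * (w / c).
Proof.
move=> w0 c0 h; suff : 16 * w <= n * (w / c) by lra.
have -> : 16 * w = (16 * c) * (w / c) by field; rewrite gt_eqF.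
by rewrite ler_wpM2r ?(ltW h)// divr_ge0// ltW.
Qed.

Lemma grid_bound_le {R : realFieldType} (w c n : R) : 0 <= w -> 1 <= c -> 0 <= n <= 16 * c + 1 ->
  `|- (8 * w) + n * (w / c)| + w / c <= 11 * w.
Proof.
move=> w0 c1 /andP[n0 n1]; have c0 : 0 < c by lra.
have wc0 : 0 <= w / c by rewrite divr_ge0// ltW.
have wc : w / c <= w by rewrite ler_pdivrMr// ler_peMr.
have h : n * (w / c) <= (16 * c + 1) * (w / c) by rewrite ler_wpM2r.
have e1 : (16 * c + 1) * (w / c) = 16 * w + w / c by field; rewrite gt_eqF.
have h0 : 0 <= n * (w / c) by rewrite mulr_ge0.
suff : `|- (8 * w) + n * (w / c)| <= 8 * w + w / c by lra.
by rewrite ler_norml; apply/andP; split; lra.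
Qed.

Lemma total_sum {R : realFieldType} (Y q cv Cv k2 k3 p g : R) : p <= Y -> g <= Y ->
  k3 <= 76 * Y -> 39 * cv <= q -> k2 <= 38 * cv -> Cv <= cv ->
  k2 + k3 + ((Cv + 2 * p) + (g + g)) <= q + 80 * Y.
Proof. by lra. Qed.

(** As [v >= a / c], the Chebyshev term is at most [30 ^ 2 * C * c ^ 6 * l / a ^ 2]. It occurs
    [2 * k1 + 1] times with [k1 <= 19 * c], whence [c ^ 7] and the factor 39. The other errors give
    [2 * 19 * 2 = 76] times [y ^- 4], using [c <= y], plus 4 times [y ^- 4] from the maximal
    inequalities. *)
Lemma bad_total {R : realFieldType} (C l a c y v k1 err p g C' : R) :
  0 <= C -> 0 <= l -> 0 < a -> 1 <= c -> c <= y -> a / c <= v -> 0 <= k1 -> k1 <= 16 * c + 3 ->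
  0 <= err -> err <= 2 * (y ^+ 5)^-1 -> p <= (y ^+ 4)^-1 -> g <= (y ^+ 4)^-1 ->
  C' = C * l / ((30 * c ^+ 2)^-1 * v) ^+ 2 ->
  2 * k1 * (C' + err) + ((C' + 2 * p) + (g + g)) <=
  39 * (30 * 30 * C) * (c ^+ 7 * l / a ^+ 2) + 80 * (y ^+ 4)^-1.
Proof.
move=> C0 l0 a0 c1 cy va k0 kc er0 er pp gg ->.
have c0 : 0 < c by lra.
have y0 : 0 < y by lra.
have v0 : 0 < v by apply: lt_le_trans va; rewrite divr_gt0.
set Cv := C * l / _.
have Cv0 : 0 <= Cv by apply: divr_ge0; [exact: mulr_ge0|exact: sqr_ge0].
have Cv1 : c * Cv <= 30 * 30 * C * (c ^+ 7 * l / a ^+ 2).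
  have -> : c * Cv = 30 * 30 * C * l * c ^+ 5 / v ^+ 2 by rewrite /Cv; field; rewrite !gt_eqF.
  have -> : 30 * 30 * C * (c ^+ 7 * l / a ^+ 2) = 30 * 30 * C * l * c ^+ 5 * (a / c) ^- 2.
    by field; rewrite !gt_eqF.
  have kk0 : 0 <= 30 * 30 * C * l * c ^+ 5.
    apply: mulr_ge0; last by rewrite exprn_ge0 ?(ltW c0).
    by apply: mulr_ge0 => //; apply: mulr_ge0.
  apply: ler_wpM2l => //.
  by rewrite lef_pV2 ?posrE ?exprn_gt0 ?divr_gt0// ler_pXn2r ?nnegrE ?divr_ge0 ?(ltW a0) ?(ltW c0) ?(ltW v0).
have kc' : k1 <= 19 * c by lra.
have h1 : 2 * k1 * Cv <= 38 * (c * Cv).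
  have -> : 38 * (c * Cv) = 2 * (19 * c) * Cv by ring.
  by rewrite ler_wpM2r// ler_pM2l.
have h2 : 2 * k1 * err <= 76 * (y ^+ 4)^-1.
  have -> : 76 * (y ^+ 4)^-1 = 2 * (19 * y) * (2 * (y ^+ 5)^-1) by field; rewrite gt_eqF.
  by apply: ler_pM => //; [rewrite mulr_ge0|rewrite ler_pM2l//; lra].
have h3 : Cv <= c * Cv by rewrite ler_peMl.
have h4 : 39 * (c * Cv) <= 39 * (30 * 30 * C) * (c ^+ 7 * l / a ^+ 2).
  by rewrite -[leRHS]mulrA ler_pM2l.
have -> : 2 * k1 * (Cv + err) = 2 * k1 * Cv + 2 * k1 * err by ring.
exact: total_sum pp gg h2 h4 h1 h3.
Qed.

(** * Rarity of bad blocks and almost sure approximation *)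

Section asip.
Context {R : realType} {d} {S : measurableType d} (mu : probability S R).
Variable (c : reverse_chain mu).
Local Notation step := (chain_step c).
Local Notation back := (back c).
Local Notation fair := (@fair R).
Local Notation Xs j := (iter_step step 0 j).
Implicit Types (x z : S) (w : coins) (p : S * coins).
Variables (dd : nat -> S -> R) (D : R).
Hypothesis D0 : 0 < D.
Hypothesis ddD : forall n z, `|dd n z| <= D.
Hypothesis dd_meas : forall n, measurable_fun setT (dd n).
Hypothesis dd_back : forall n x, back n (dd n) x = 0.
Variables (s2 : nat -> R) (C : R) (n0 : nat) (K : R).
Hypothesis s2b : forall n, 0 <= s2 n <= D ^+ 2.
Hypothesis C0 : 0 <= C.
Hypothesis concentration : forall n l (t : R), 0 < t ->
  (mu [set x | (t <= `|\sum_(i < l) (cvar c dd (n + i) (Xs (n + i).+1 x) - s2 (n + i))|)%R] <=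
   (C * l%:R / t ^+ 2)%:E)%E.
Let A n := \sum_(i < n) s2 i.
Hypothesis An0 : 0 < A n0.
Hypothesis AK : forall m, \sum_(n0 <= n < m) (A n)^-2 <= K.
Let sg i := Num.sqrt (s2 i).

Let sgN i := - sg i.

Lemma sg_ge0 i : 0 <= sg i. Proof. exact: sqrtr_ge0. Qed.

Lemma A_split n l : A (n + l) = A n + \sum_(i < l) s2 (n + i)%N.
Proof. by rewrite /A big_split_ord. Qed.

Lemma gvar_sg n l : gvar sg n l = A (n + l) - A n.
Proof.
rewrite A_split addrAC subrr add0r; apply: eq_bigr => i _.
by rewrite sqr_sqrtr//; have /andP[] := s2b (n + i).
Qed.

Lemma A_step n : A n <= A n.+1.
Proof. by rewrite /A big_ord_recr/= lerDl; have /andP[] := s2b n. Qed.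

Lemma A_step_le n : A n.+1 <= A n + D ^+ 2.
Proof. by rewrite /A big_ord_recr/= lerD2l; have /andP[] := s2b n. Qed.

Lemma vsums_at n l x : vsums c dd n l (Xs n x) - gvar sg n l =
  \sum_(i < l) (cvar c dd (n + i) (Xs (n + i).+1 x) - s2 (n + i)).
Proof.
rewrite vsumsE gvar_sg A_split (addrC (A n)) addrK -sumrB; apply: eq_bigr => i _.
by congr (cvar _ _ _ _ - _); rewrite -addnS iter_step_add.
Qed.

Lemma law_vbad n l del : 0 < del -> 0 < gvar sg n l ->
  (mu [set x | vbad c dd (gvar sg n l) del n l (Xs n x)] <=
   (C * l%:R / (del * gvar sg n l) ^+ 2)%:E)%E.
Proof.
move=> del0 v0; apply: le_trans (concentration n l (mulr_gt0 del0 v0)).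
have mf : measurable_fun setT (fun x => \sum_(i < l) (cvar c dd (n + i) (Xs (n + i).+1 x) - s2 (n + i))).
  apply: measurable_sum => i; apply: measurable_funB => //.
  exact: (measurableT_comp (cvar_meas c dd_meas _) (iter_step_meas c 0 _)).
apply: le_measure; rewrite ?inE.
- have := vbad_meas c dd_meas (gvar sg n l) del n l.
  by rewrite -[X in _ -> measurable X]setTI => mV; exact: (iter_step_meas c 0 n measurableT mV).
- rewrite -[X in measurable X]setTI; apply: measurable_fun_le => //.
  exact: measurableT_comp.
by move=> x /=; rewrite /vbad vsums_at => /ltW.
Qed.

Lemma law_fst (B : set S) : measurable B -> (mu \x fair)%E [set p | B p.1] = mu B.
Proof.
move=> mB; have -> : [set p : S * coins | B p.1] = B `*` setT.
  by apply/seteqP; split => p /= => [|[]].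
have f1 : fair setT = 1%E by exact: probability_setT.
transitivity (mu B * fair setT)%E; first exact: product_measure1E.
by rewrite f1 mule1.
Qed.

Section schedule.
Variables (nn : nat -> nat) (cc : nat -> R).
Hypothesis nn0 : nn 0%N = 0%N.
Hypothesis nn_lt : forall j, (nn j < nn j.+1)%N.
Let ll j := (nn j.+1 - nn j)%N.
Let a j := A (nn j).
Let v j := a j.+1 - a j.
Let y j := ln (a j).
Let L j := ln (y j).
Hypothesis vE : forall j, 1 + a j / cc j <= v j <= 1 + a j / cc j + D ^+ 2.
Hypothesis cc1 : forall j, 1 <= cc j.
Hypothesis cc_lim : forall t, \forall j \near \oo, t <= cc j.
Hypothesis cc8 : \forall j \near \oo, cc j ^+ 8 <= y j.
Hypothesis cc_sum : bounded_sums (fun j => cc j ^+ 7 * (nn j.+1 - nn j)%:R / a j ^+ 2).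

Lemma nnS j : nn j.+1 = (nn j + ll j)%N.
Proof. by rewrite subnKC// ltnW. Qed.

Lemma gvar_block j : gvar sg (nn j) (ll j) = v j.
Proof. by rewrite gvar_sg -nnS. Qed.

Lemma level_ge0 j : 0 <= a j.
Proof. by apply: sumr_ge0 => i _; have /andP[] := s2b i. Qed.

Lemma v_pos j : 0 < v j.
Proof. exact: (v_gt0 level_ge0 vE cc1). Qed.

Lemma gvar_pos j : 0 < gvar sg (nn j) (ll j).
Proof. by rewrite gvar_block v_pos. Qed.

(* Equals [L j] eventually; the maximum keeps the mesh positive for all [j]. *)
Let wd j := Num.sqrt (v j * Num.max 1 (L j)).
Let B j := 8 * wd j.
Let e j := wd j / cc j.
(** Enough points for a grid of mesh [wd / cc] that starts at [- 8 * wd] to pass [8 * wd]: the last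
    index exceeds [16 * cc]. *)
Let Kn j := (Num.truncn (16 * cc j)).+2.

Lemma wd_pos j : 0 < wd j.
Proof. by rewrite sqrtr_gt0 mulr_gt0 ?v_pos// lt_max ltr01. Qed.

Lemma e_pos j : 0 < e j.
Proof. by rewrite divr_gt0 ?wd_pos// (lt_le_trans ltr01). Qed.

Local Notation kapc := (kap c dd nn ll B e Kn).
Local Notation pk := (pick (bchain c nn0 nnS) kapc (Uval sg nn ll)).
Local Notation Z := (zvar c dd sg nn0 nnS B e Kn).

Lemma grid_last j : B j <= grid B e j (Kn j).-1.
Proof.
have c0 : 0 < cc j := lt_le_trans ltr01 (cc1 j).
have h : 16 * cc j < (Num.truncn (16 * cc j)).+1%:R by exact: truncnS_gt.
have w0 := wd_pos j.
exact: (grid_last_le w0 c0 h).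
Qed.

Lemma grid_bound j i : (i < Kn j)%N -> `|grid B e j i| + e j <= 11 * wd j.
Proof.
move=> iK; apply: (grid_bound_le _ (cc1 j)); first by rewrite ltW// wd_pos.
rewrite ler0n /=; apply: (@le_trans _ _ (Num.truncn (16 * cc j)).+1%:R); first by rewrite ler_nat.
rewrite -natr1 lerD2r truncn_le// mulr_ge0// (le_trans _ (cc1 j))//.
Qed.

(** Besides a mismatch at the end of the block, a large partial sum of either process counts as bad.
    This controls the times inside the block and rules out the unbounded cells that [mismatch]
    ignores. *)
Definition bad_event j : set (S * coins) :=
  [set p | mismatch sg nn ll B e Kn j (kapc j (Xs (nn j) p.1)) (pk j p)] `|`
  ([set p | peak c dd (B j) (nn j) (ll j) (Xs (nn j) p.1)] `|`
  ([set p | exceeds sg (nn j) (ll j) 0 (B j) (pk j p)] `|`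
   [set p | exceeds sgN (nn j) (ll j) 0 (B j) (pk j p)])).

Lemma mismatch_set_meas j :
  measurable [set p : S * coins | mismatch sg nn ll B e Kn j (kapc j (Xs (nn j) p.1)) (pk j p)].
Proof.
have := @kap_pick_meas _ _ _ mu (bchain c nn0 nnS) kapc Kn (Uval sg nn ll) (@kapK _ _ _ _ _ _ _ _ _ _ _)
  (kap_meas c dd_meas nn ll B e Kn) (Uval_meas sg nn ll) j (mismatch sg nn ll B e Kn j)
  (mismatch_meas sg nn ll B e Kn j).
by under eq_set do rewrite bchain_iter.
Qed.

Lemma peak_set_meas j : measurable [set p : S * coins | peak c dd (B j) (nn j) (ll j) (Xs (nn j) p.1)].
Proof.
have mX : measurable_fun setT (fun p : S * coins => Xs (nn j) p.1).
  by apply: (measurableT_comp (iter_step_meas c 0 _)); exact: measurable_fst.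
by rewrite -[X in measurable X]setTI; exact: (mX measurableT _ (peak_meas c dd_meas _ _ _)).
Qed.

Lemma exceeds_set_meas sg' j :
  measurable [set p : S * coins | exceeds sg' (nn j) (ll j) 0 (B j) (pk j p)].
Proof. by apply: pk_meas => //; exact: measurable_exceeds. Qed.

Lemma bad_meas j : measurable (bad_event j).
Proof.
apply: measurableU; first exact: mismatch_set_meas.
apply: measurableU; first exact: peak_set_meas.
by apply: measurableU; exact: exceeds_set_meas.
Qed.

Lemma law_bad : \forall j \near \oo, ((mu \x fair) (bad_event j) <=
  (39 * (30 * 30 * C) * (cc j ^+ 7 * (nn j.+1 - nn j)%:R / a j ^+ 2) + 80 * (y j ^+ 4)^-1)%:E)%E.
Proof.
have k0 : 0 < 6 * 6 * 6 * 6 * D by rewrite !mulr_gt0.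
near=> j.
have aj : 0 < a j by near: j; exact: (a_gt0 level_ge0 cc1 cc_lim cc8).
have cy : cc j <= y j by near: j; exact: (c_y cc1 cc8).
have L1 : 1 <= L j by near: j; exact: (L_lim cc1 cc_lim cc8).
have vL : 6 * 6 * 6 * 6 * D * cc j ^+ 3 * y j ^+ 5 <= Num.sqrt (v j).
  by near: j; exact: (v_large level_ge0 vE cc1 cc_lim cc8 k0).
have wE : wd j = Num.sqrt (v j * L j) by rewrite /wd max_r.
have y0 : 0 < y j by apply: lt_le_trans cy; exact: lt_le_trans ltr01 (cc1 j).
have yE : y j = expR (L j) by rewrite lnK// posrE.
have vj := v_pos j.
pose del := (30 * cc j ^+ 2)^-1.
have [del0 _ Dd] := par_del D0 (cc1 j) cy L1 vj vL.
have db := par_delB D0 (cc1 j) cy L1 vj.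
have pe := par_err D0 (cc1 j) cy L1 vj vL yE.
have [t0 tD tp tg] := par_tilt D0 (cc1 j) cy L1 vj vL yE.
rewrite -/del -wE in del0 Dd db pe tp tg.
set tt := 2 * _ in t0 tD tp tg.
set P := (mu \x fair)%E.
pose C' := C * (ll j)%:R / (del * v j) ^+ 2.
set err := _ + expR (- ((wd j / cc j) ^+ 2 / _)) in pe.
have hV : (mu [set x | vbad c dd (v j) del (nn j) (ll j) (Xs (nn j) x)] <= C'%:E)%E.
  by have := law_vbad del0 (gvar_pos j); rewrite gvar_block.
have H1 : (P [set p | mismatch sg nn ll B e Kn j (kapc j (Xs (nn j) p.1)) (pk j p)] <=
    (2 * (Kn j).+1%:R * (C' + err))%:E)%E.
  rewrite -gvar_block in Dd hV.
  have := law_mismatch D0 ddD dd_meas dd_back sg_ge0 nn0 nnS gvar_pos e_pos del0 Dd db (@grid_bound j) hV.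
  by rewrite gvar_block.
have H2 : (P [set p | peak c dd (B j) (nn j) (ll j) (Xs (nn j) p.1)] <=
    (C' + 2 * expR (- (tt * (8 * wd j)) + tt ^+ 2 * ((1 + del) * v j)))%:E)%E.
  have mK : measurable [set x | peak c dd (B j) (nn j) (ll j) (Xs (nn j) x)].
    have := peak_meas c dd_meas (B j) (nn j) (ll j); rewrite -[X in _ -> measurable X]setTI => mV.
    exact: (iter_step_meas c 0 (nn j) measurableT mV).
  have -> : P [set p | peak c dd (B j) (nn j) (ll j) (Xs (nn j) p.1)] = _ := law_fst mK.
  have Bj : 0 < B j by rewrite mulr_gt0 ?wd_pos.
  have h := block_peak D0 ddD dd_meas dd_back (nn j) (ll j) vj del0 Bj t0 tD.
  apply: le_trans h _; rewrite EFinD; apply: leeD => //.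
have H3 sg' : (forall n l, gvar sg' n l = gvar sg n l) ->
    (P [set p | exceeds sg' (nn j) (ll j) 0 (B j) (pk j p)] <= (y j ^+ 4)^-1%:E)%E.
  move=> sgE.
  have -> : P [set p | exceeds sg' (nn j) (ll j) 0 (B j) (pk j p)] = _ :=
    law_pk c dd_meas sg_ge0 nn0 nnS gvar_pos B e Kn j (measurable_exceeds _ _ _ _ _).
  apply: le_trans (gsum_ville _ _ _ _ _ t0) _.
  by rewrite lee_fin sgE gvar_block.
have H4 := H3 sg (fun _ _ => erefl).
have H5 : (P [set p | exceeds sgN (nn j) (ll j) 0 (B j) (pk j p)] <= (y j ^+ 4)^-1%:E)%E.
  by apply: H3 => n l; apply: eq_bigr => i _; rewrite sqrrN.
have mP := bad_meas j.
have m1 := mismatch_set_meas j.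
have m2 := peak_set_meas j.
have m3 := exceeds_set_meas sg j.
have m4 := exceeds_set_meas sgN j.
apply: (@le_trans _ _ ((2 * (Kn j).+1%:R * (C' + err))%:E +
   ((C' + 2 * expR (- (tt * (8 * wd j)) + tt ^+ 2 * ((1 + del) * v j)))%:E +
    ((y j ^+ 4)^-1%:E + (y j ^+ 4)^-1%:E)))%E).
  apply: le_trans (measureU2 P m1 _) _; first by do 2 apply: measurableU => //.
  apply: leeD; [exact: H1|apply: le_trans (measureU2 P m2 _) _]; first exact: measurableU.
  apply: leeD; [exact: H2|apply: le_trans (measureU2 P m3 m4) _].
  apply: leeD; [exact: H4|exact: H5].
rewrite -!EFinD lee_fin.
have /andP[va _] := vE j.
apply: (bad_total (v := v j)) => //.
- by apply: le_trans va; rewrite lerDr.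
- have -> : ((Kn j).+1%:R : R) = (Num.truncn (16 * cc j))%:R + 3 by rewrite /Kn -addn3 natrD.
  by rewrite lerD2r truncn_le// mulr_ge0// (le_trans _ (cc1 j)).
- rewrite /err; apply: addr_ge0; last exact: expR_ge0.
  apply: mulr_ge0; last by rewrite mulr_ge0 ?(ltW vj)// addr_ge0// ltW.
  by rewrite mulr_ge0 ?exprn_ge0 ?invr_ge0 ?sqrtr_ge0// mulr_ge0// ltW.
Unshelve. all: by end_near.
Qed.

Lemma bad_rare : {ae (mu \x fair)%E, forall p, \forall j \near \oo, ~ bad_event j p}.
Proof.
have C30 : 0 <= 39 * (30 * 30 * C) by rewrite mulr_ge0// mulr_ge0.
apply: (borel_cantelli bad_meas law_bad) => [j|].
  have h1 : 0 <= cc j ^+ 7 * (nn j.+1 - nn j)%:R / a j ^+ 2.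
    by rewrite divr_ge0 ?sqr_ge0// mulr_ge0// exprn_ge0// (le_trans _ (cc1 j)).
  have h2 : 0 <= (y j ^+ 4)^-1 by rewrite invr_ge0 (exprM _ 2 2) sqr_ge0.
  by apply: addr_ge0; [exact: mulr_ge0|rewrite mulr_ge0].
apply: bounded_sumsD; first exact: bounded_sumsZ.
by apply: bounded_sumsZ => //; exact: (bounded_sums_y4 level_ge0 vE cc1 cc_lim cc8).
Qed.

Definition block_normals i p : R := Z i p.

Lemma block_normals_meas i : measurable_fun setT (block_normals i).
Proof. exact: (zvar_meas c dd_meas). Qed.

Lemma block_normals_law N (E : nat -> set R) : (forall i, measurable (E i)) ->
  (mu \x fair)%E [set p | forall i, (i < N)%N -> E i (block_normals i p)] = (\prod_(i < N) zlaw sg i (E i))%:E.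
Proof. exact: (joint_law_lt c dd_meas sg_ge0 nn0 nnS gvar_pos). Qed.

Definition partial_sum n x := \sum_(i < n) dd i (Xs i x).

Definition gap n p := partial_sum n p.1 - \sum_(i < n) Z i p.

Lemma partial_sum_block n l x : partial_sum (n + l) x - partial_sum n x = dsums c dd n l (Xs n x).
Proof.
rewrite /partial_sum big_split_ord/= addrAC subrr add0r dsumsE; apply: eq_bigr => i _.
by rewrite iter_step_add.
Qed.

Lemma gap_block j m p : (m <= ll j)%N ->
  gap (nn j + m)%N p - gap (nn j) p = dsums c dd (nn j) m (Xs (nn j) p.1) - gsum sg (nn j) m (pk j p).
Proof.
move=> ml; rewrite -partial_sum_block -(sum_zvar c dd nn0 nnS gvar_pos B e Kn p ml).
have -> : \sum_(nn j <= i < nn j + m) Z i p = \sum_(i < nn j + m) Z i p - \sum_(i < nn j) Z i p.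
  rewrite -(big_mkord xpredT (fun i => Z i p)) -(big_mkord xpredT (fun i => Z i p)).
  apply/eqP; rewrite eq_sym subr_eq addrC; apply/eqP.
  by rewrite [LHS](big_cat_nat _ (leq_addr m (nn j))).
by rewrite /gap; ring.
Qed.

(** An initial segment of the block is the difference of two sums that run to its end, hence the
    factor 2. *)
Lemma not_peak j p : ~ peak c dd (B j) (nn j) (ll j) (Xs (nn j) p.1) ->
  forall m, (m <= ll j)%N -> `|dsums c dd (nn j) m (Xs (nn j) p.1)| <= 2 * B j.
Proof.
move=> h; have H m : (m <= ll j)%N ->
    `|dsums c dd (nn j + m) (ll j - m) (iter_step step (nn j) m (Xs (nn j) p.1))| < B j.
  move=> ml; rewrite ltNge; apply/negP => hb; apply: h.
  by apply/hasP; exists m => //; rewrite mem_iota add0n ltnS.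
move=> m ml; have h0 := H 0%N isT; have hm := H m ml.
rewrite addn0 subn0 /= in h0.
have e1 : dsums c dd (nn j) (ll j) (Xs (nn j) p.1) =
   dsums c dd (nn j) m (Xs (nn j) p.1) + dsums c dd (nn j + m) (ll j - m) (iter_step step (nn j) m (Xs (nn j) p.1)).
  have -> : iter_step step (nn j) m (Xs (nn j) p.1) = Xs (nn j + m) p.1.
    exact: (esym (iter_step_add step 0 (nn j) m p.1)).
  by rewrite -!partial_sum_block -addnA subnKC//; ring.
have -> : dsums c dd (nn j) m (Xs (nn j) p.1) = dsums c dd (nn j) (ll j) (Xs (nn j) p.1) -
   dsums c dd (nn j + m) (ll j - m) (iter_step step (nn j) m (Xs (nn j) p.1)) by rewrite e1 addrK.
by apply: le_trans (ler_normB _ _) _; rewrite mulr_natl mulr2n; apply: lerD; exact: ltW.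
Qed.

Lemma not_exceeds j w : ~ exceeds sg (nn j) (ll j) 0 (B j) w -> ~ exceeds sgN (nn j) (ll j) 0 (B j) w ->
  forall m, (m <= ll j)%N -> `|gsum sg (nn j) m w| <= B j.
Proof.
move=> h1 h2 m ml; rewrite ler_norml; apply/andP; split.
  rewrite leNgt; apply/negP => h; apply: h2; exists m => //; rewrite add0r.
  have -> : gsum sgN (nn j) m w = - gsum sg (nn j) m w.
    by rewrite /gsum -sumrN; apply: eq_bigr => i _; rewrite mulNr.
  by rewrite lerNr ltW.
by rewrite leNgt; apply/negP => h; apply: h1; exists m => //; rewrite add0r ltW.
Qed.

Lemma not_bad j p : ~ bad_event j p ->
  `|gap (nn j.+1) p - gap (nn j) p| <= 3 * e j /\
  forall m, (m <= ll j)%N -> `|gap (nn j + m)%N p - gap (nn j) p| <= 3 * B j.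
Proof.
move=> /not_orP[h1 /not_orP[h2 /not_orP[h3 h4]]]; split.
  rewrite nnS gap_block//.
  have b0 : `|beta c dd nn ll j (Xs (nn j) p.1)| < B j.
    rewrite ltNge; apply/negP => hb; apply: h2; apply/hasP; exists 0%N => //.
    by rewrite addn0 subn0.
  apply: (mismatch_sub e_pos (grid_last j) h1 b0) => //.
  by rewrite /grid mul0r addr0 opprK.
move=> m ml; rewrite gap_block//.
apply: le_trans (ler_normB _ _) _.
have -> : 3 * B j = 2 * B j + B j by ring.
by apply: lerD; [exact: not_peak|exact: not_exceeds].
Qed.

(** Half of [eta] pays for the mesh errors accumulated up to the start of the current block, the
    other half for the fluctuation inside it. *)
Lemma coupling_error p (eta : R) : 0 < eta -> (\forall j \near \oo, ~ bad_event j p) ->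
  \forall n \near \oo, `|gap n p| <= eta * Num.sqrt (A n * ln (ln (A n))).
Proof.
move=> eta0 hb; have eta2 : 0 < eta / 2 by rewrite divr_gt0.
have wE : \forall j \near \oo, wd j = Num.sqrt (v j * L j).
  near=> j; rewrite /wd max_r//; near: j; exact: (L_lim cc1 cc_lim cc8).
have acc : \forall j \near \oo, `|gap (nn j) p| <= eta / 2 * Num.sqrt (a j * L j).
  apply: (errors_add_up level_ge0 vE cc1 cc_lim cc8 (Delta := fun j => gap (nn j) p) eta2).
  near=> j; have wj : wd j = Num.sqrt (v j * L j) by near: j.
  have [h _] : `|gap (nn j.+1) p - gap (nn j) p| <= 3 * e j /\
    forall m, (m <= ll j)%N -> `|gap (nn j + m)%N p - gap (nn j) p| <= 3 * B j.
    by apply: not_bad; near: j.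
  by rewrite -/(L j) -wj.
have inb : \forall j \near \oo, forall m, (m <= ll j)%N ->
    `|gap (nn j + m)%N p - gap (nn j) p| <= eta / 2 * Num.sqrt (a j * L j).
  near=> j => m ml; have wj : wd j = Num.sqrt (v j * L j) by near: j.
  have [_ h] : `|gap (nn j.+1) p - gap (nn j) p| <= 3 * e j /\
    forall m, (m <= ll j)%N -> `|gap (nn j + m)%N p - gap (nn j) p| <= 3 * B j.
    by apply: not_bad; near: j.
  apply: le_trans (h m ml) _; rewrite /B wj.
  have [_ //] : 3 * (Num.sqrt (v j * L j) / cc j) <= eta / 2 * (Num.sqrt (L j) * (Num.sqrt (a j.+1) - Num.sqrt (a j))) /\
     3 * (8 * Num.sqrt (v j * L j)) <= eta / 2 * Num.sqrt (a j * L j).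
  by near: j; exact: (small_errors level_ge0 vE cc1 cc_lim cc8 eta2).
have [J _ hJ] : \forall j \near \oo, [/\ 0 < a j, 1 <= y j, 0 <= L j,
    `|gap (nn j) p| <= eta / 2 * Num.sqrt (a j * L j) & forall m, (m <= ll j)%N ->
    `|gap (nn j + m)%N p - gap (nn j) p| <= eta / 2 * Num.sqrt (a j * L j)].
  near=> j; split; [near: j; exact: (a_gt0 level_ge0 cc1 cc_lim cc8)|near: j; exact: (y_lim cc1 cc_lim cc8)|
    near: j; exact: (L_lim cc1 cc_lim cc8)|by near: j|by near: j].
exists (nn J).+1 => // n /= nJ.
have [j /andP[j1 j2]] := block_of_ex nn0 nnS gvar_pos n.
have Jj : (J <= j)%N.
  rewrite leqNgt; apply/negP => jJ.
  have := nn_mono nnS jJ; lia.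
have [aj yj Lj h1 h2] := hJ j Jj.
have aA : a j <= A n by apply: (A_mono A_step).
have mono : Num.sqrt (a j * L j) <= Num.sqrt (A n * ln (ln (A n))).
  have An : 0 < A n by exact: lt_le_trans aA.
  have ly : y j <= ln (A n) by rewrite ler_ln ?posrE.
  have y0 : 0 < y j by exact: lt_le_trans yj.
  rewrite ler_wsqrtr// ler_pM ?(ltW aj)// ler_ln ?posrE//; exact: lt_le_trans ly.
have := h2 (n - nn j)%N; rewrite subnKC// => /(_ ltac:(rewrite leq_subLR -nnS ltnW//)) h3.
apply: le_trans (_ : eta * Num.sqrt (a j * L j) <= _); last by rewrite ler_pM2l.
have -> : gap n p = (gap n p - gap (nn j) p) + gap (nn j) p by rewrite subrK.
apply: le_trans (ler_normD _ _) _; apply: le_trans (lerD h3 h1) _.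
by rewrite -mulrDl -splitr.
Unshelve. all: by end_near.
Qed.

End schedule.

Theorem gaussian_coupling : exists Z : nat -> S * coins -> R,
  [/\ forall i, measurable_fun setT (Z i),
   forall N (B : nat -> set R), (forall i, measurable (B i)) ->
     (mu \x fair)%E [set p | forall i, (i < N)%N -> B i (Z i p)] = (\prod_(i < N) zlaw sg i (B i))%:E &
   {ae (mu \x fair)%E, forall p, forall eta : R, 0 < eta -> \forall n \near \oo,
     `|partial_sum n p.1 - \sum_(i < n) Z i p| <= eta * Num.sqrt (A n * ln (ln (A n)))}].
Proof.
have A0 : A 0 = 0 by rewrite /A big_ord0.
have [nn [cc [nn0 nn_lt vE [cc1 _ cc_lim cc8] cc_sum]]] := schedule A0 A_step A_step_le An0 AK.
exists (block_normals cc nn0 nn_lt); split; [|move=> N B mB|].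
- exact: block_normals_meas.
- exact: (block_normals_law nn0 nn_lt vE cc1).
- have := bad_rare nn0 nn_lt vE cc1 cc_lim cc8 cc_sum.
  apply: filterS => p hp eta eta0.
  exact: (coupling_error vE cc1 cc_lim cc8 eta0 hp).
Qed.

End asip.

(** * Conclusion *)

Section running_maximum.
Context {R : realType}.
Variables (A s F : nat -> R) (C D : R).
Hypothesis A_nondecr : {homo A : m n / (m <= n)%N >-> m <= n}.
Hypothesis A_unbounded : forall t, exists n, t <= A n.
Hypothesis sA : forall n, `|Num.sqrt (A n) - s n| <= C.
Hypothesis FA : forall eta, 0 < eta -> \forall n \near \oo,
  `|F n| <= eta * Num.sqrt (A n * ln (ln (A n))) + D.
Let h n := Num.sqrt (A n * ln (ln (A n))).

Let A_near t : \forall n \near \oo, t <= A n.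
Proof. by have [N hN] := A_unbounded t; exists N => // n /= Nn; exact: le_trans (A_nondecr Nn). Qed.

(** The iterated logarithm is nonnegative only from [expR 1] on, which is needed for the product
    under the root to be monotone. *)
Let h_mono m n : expR 1 <= A m -> (m <= n)%N -> h m <= h n.
Proof.
move=> e1 mn; have Am := A_nondecr mn.
have Am0 : 0 < A m by apply: lt_le_trans e1; exact: expR_gt0.
have lm : 1 <= ln (A m) by rewrite -[leLHS]expRK ler_ln ?posrE ?expR_gt0.
have lmn : ln (A m) <= ln (A n) by rewrite ler_ln ?posrE// (lt_le_trans Am0).
have l0 : 0 < ln (A m) := lt_le_trans ltr01 lm.
rewrite ler_wsqrtr// ler_pM ?(ltW Am0) ?ln_ge0// ler_ln ?posrE//; exact: lt_le_trans lmn.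
Qed.

Let h_near t : \forall n \near \oo, t <= h n.
Proof.
near=> n.
have h1 : t ^+ 2 <= A n by near: n; exact: A_near.
have h2 : expR (expR 1) <= A n by near: n; exact: A_near.
have A0 : 0 < A n by apply: lt_le_trans h2; exact: expR_gt0.
have l1 : expR 1 <= ln (A n) by rewrite -[leLHS]expRK ler_ln ?posrE ?expR_gt0.
have l2 : 1 <= ln (ln (A n)).
  by rewrite -[leLHS]expRK ler_ln ?posrE ?expR_gt0// (lt_le_trans _ l1) ?expR_gt0.
apply: le_trans (ler_norm t) _; rewrite -sqrtr_sqr ler_wsqrtr//.
by apply: le_trans h1 _; rewrite ler_peMr// ltW.
Unshelve. all: by end_near.
Qed.

Let h_s : \forall n \near \oo, h n <= 3 * Num.sqrt (s n ^+ 2 * ln (ln (s n ^+ 2))).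
Proof.
near=> n.
have C0 : 0 <= C by apply: le_trans (sA n); exact: normr_ge0.
have A1 : (expR 4 + C + C) ^+ 2 <= A n by near: n; exact: A_near.
have e4 : 5 <= expR (4 : R) by have := expR_ge1Dx (4 : R); lra.
have A0 : 0 < A n by apply: lt_le_trans A1; rewrite exprn_gt0//; lra.
have sq : expR 4 + C + C <= Num.sqrt (A n).
  by rewrite -(@ler_pXn2r _ 2) ?nnegrE ?sqrtr_ge0// ?sqr_sqrtr ?(ltW A0)//; lra.
have := sA n; rewrite ler_norml => /andP[s1 s2].
set x := Num.sqrt (A n) in sq s1 s2.
have xs : x <= 2 * s n by lra.
have es : expR 4 <= s n by lra.
have sp : 0 < s n by lra.
have AE : A n = x ^+ 2 by rewrite sqr_sqrtr// ltW.
set S := s n ^+ 2.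
have S0 : 0 < S by rewrite exprn_gt0.
have AS : A n <= 4 * S.
  rewrite AE /S; have h1 : x ^+ 2 <= (2 * s n) ^+ 2 by rewrite ler_pXn2r ?nnegrE ?sqrtr_ge0//; lra.
  by apply: le_trans h1 _; have -> : (2 * s n) ^+ 2 = 4 * s n ^+ 2 by ring.
have SE : expR 4 <= S by apply: le_trans es _; rewrite /S expr2 ler_peMl ?(ltW sp)//; lra.
have lS : 4 <= ln S by rewrite -[leLHS]expRK ler_ln ?posrE ?expR_gt0.
have lS0 : 0 < ln S by lra.
have lA : ln (A n) <= 2 * ln S.
  have h1 : ln (A n) <= ln (4 * S) by rewrite ler_ln ?posrE ?mulr_gt0.
  have h2 : ln 4 <= ln S by rewrite ler_ln ?posrE//; lra.
  by rewrite lnM ?posrE// in h1; lra.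
have A1' : 1 < A n.
  apply: lt_le_trans A1; rewrite -[ltLHS](expr1n _ 2) ltr_pXn2r ?nnegrE//; lra.
have lA0 : 0 < ln (A n) by rewrite ln_gt0.
have llS : ln 2 <= ln (ln S) by rewrite ler_ln ?posrE//; lra.
have l2 : 0 <= ln (2 : R) by rewrite ln_ge0// ler1n.
have llA : ln (ln (A n)) <= 2 * ln (ln S).
  have h1 : ln (ln (A n)) <= ln (2 * ln S) by rewrite ler_ln ?posrE// mulr_gt0.
  by rewrite lnM ?posrE// in h1; lra.
have r0 : 0 <= 3 * Num.sqrt (S * ln (ln S)) by rewrite mulr_ge0 ?sqrtr_ge0.
have q0 : 0 <= S * ln (ln S) by rewrite mulr_ge0 ?(ltW S0)//; lra.
rewrite -[leRHS]ger0_norm// -sqrtr_sqr ler_wsqrtr// exprMn sqr_sqrtr//.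
apply: (@le_trans _ _ (A n * (2 * ln (ln S)))); first by rewrite ler_wpM2l// ltW.
apply: (@le_trans _ _ (4 * S * (2 * ln (ln S)))).
  by rewrite ler_wpM2r//; lra.
(* The factor 4 comes from [A n <= 4 * S], the factor 2 from comparing the iterated logarithms; 8 is
   below the square of the constant 3. *)
have -> : 4 * S * (2 * ln (ln S)) = 8 * (S * ln (ln S)) by ring.
by move: q0; move: (S * _) => q q0; lra.
Unshelve. all: by end_near.
Qed.

Lemma running_max_littleo :
  (fun n : nat => \big[Num.max/0]_(k < n) `|F k.+1|) =o_\oo
  (fun n : nat => Num.sqrt (s n ^+ 2 * ln (ln (s n ^+ 2)))).
Proof.
apply/eqoP => eps eps0.
(* The factor 3 is lost in [h_s], and another factor 2 because the early maximum [M] is also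
   absorbed into [eta * h n]. *)
pose eta := eps / 6; have eta0 : 0 < eta by rewrite divr_gt0.
have [N _ hN] : \forall n \near \oo, expR 1 <= A n /\ `|F n| <= eta * h n + D.
  near=> n; split; first by near: n; exact: A_near.
  by near: n; exact: FA.
(* The finitely many early indices contribute a fixed amount; starting the maximum at [|D|] lets [M]
   cover the additive constant too. *)
pose M := \big[Num.max/`|D|]_(k < N) `|F k|.
have M0 : 0 <= M by apply: le_trans (bigmax_ge_id _ _ _ _); exact: normr_ge0.
near=> n.
have hM : M / eta <= h n by near: n; exact: h_near.
have hs : h n <= 3 * Num.sqrt (s n ^+ 2 * ln (ln (s n ^+ 2))) by near: n; exact: h_s.
have MD : D <= M by apply: le_trans (ler_norm D) _; exact: bigmax_ge_id.
have bound k : (k < n)%N -> `|F k.+1| <= eta * h n + M.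
  move=> kn; have h0 : 0 <= eta * h n by rewrite mulr_ge0 ?(ltW eta0)// sqrtr_ge0.
  have [kN|Nk] := ltnP k.+1 N.
    apply: le_trans (_ : M <= _); last by rewrite lerDr.
    exact: (le_bigmax _ (fun k : 'I_N => `|F k|) (Ordinal kN)).
  have [e1 hk] := hN k.+1 Nk; apply: le_trans hk _; apply: lerD => //.
  by rewrite ler_pM2l//; apply: h_mono.
have top : \big[Num.max/0]_(k < n) `|F k.+1| <= eta * h n + M.
  apply: bigmax_le => [|k _]; last exact: bound.
  by rewrite addr_ge0// mulr_ge0 ?(ltW eta0)// sqrtr_ge0.
rewrite ger0_norm; last exact: bigmax_ge_id.
rewrite ger0_norm ?sqrtr_ge0//.
apply: le_trans top _; rewrite ler_pdivrMr// in hM.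
have h1 : eta * h n <= eta * (3 * Num.sqrt (s n ^+ 2 * ln (ln (s n ^+ 2)))) by rewrite ler_pM2l.
by move: hM h1; rewrite /eta; move: (h n) (Num.sqrt _) => u v; lra.
Unshelve. all: by end_near.
Qed.

End running_maximum.

Section gaussian_laws.
Context {R : realType}.
Variable sg : nat -> R.
Hypothesis sg0 : forall i, 0 <= sg i.

Definition scale_by (k : R) : measurableTypeR R -> measurableTypeR R := fun x => k * x.

Lemma scale_by_measurable k : measurable_fun setT (scale_by k).
Proof. exact: measurable_funM. Qed.

HB.instance Definition _ k := @isMeasurableFun.Build _ _ _ _ (scale_by k) (scale_by_measurable k).

Lemma zlawE i (A : set (measurableTypeR R)) : measurable A ->
  (zlaw sg i A)%:E = distribution (normal_prob 0 1) (scale_by (sg i)) A.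
Proof. by move=> mA; have mz := zlaw_meas sg i mA; rewrite /zlaw fineK// fin_num_measure. Qed.

Lemma zlaw_gaussian i A : measurable A ->
  (zlaw sg i A)%:E = if sg i == 0 then \d_(0 : R) A else normal_prob 0 (sg i) A.
Proof.
move=> mA; case: eqVneq => [s0|s0].
  have mz := zlaw_meas sg i mA; rewrite /zlaw fineK; last by rewrite fin_num_measure.
  rewrite s0 diracE; case: (boolP (0 \in A)) => [/set_mem A0|nA0].
    rewrite (_ : [set x | _] = setT); first exact: probability_setT.
    by apply/seteqP; split => x //= _; rewrite mul0r.
  rewrite (_ : [set x | _] = set0) ?measure0//.
  by apply/seteqP; split => x //=; rewrite mul0r => A0; move/negP: nA0; apply; rewrite inE.
have sp : 0 < sg i by rewrite lt_def s0 sg0.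
rewrite (zlawE i mA).
move: A mA; apply: (@cdf_unique _ (distribution (normal_prob 0 1) (scale_by (sg i))) (normal_prob 0 (sg i))) => x.
transitivity (gcdf ((x - 0) / sg i))%:E; last exact: esym (normal_cdf 0 x sp).
rewrite subr0 gcdfE; congr (normal_prob _ _ _).
by apply/seteqP; split => y; rewrite /= /scale_by !in_itv/= ler_pdivlMr// mulrC.
Qed.

Context {d} {Y : measurableType d} (P : probability Y R).

Definition borel_valued (F : {RV P >-> R}) : Y -> measurableTypeR R := F.

HB.instance Definition _ F :=
  @isMeasurableFun.Build _ _ _ _ (borel_valued F) (measurable_funPT F).

Variable Z : nat -> {RV P >-> R}.
Hypothesis Z_law : forall N (A : nat -> set R), (forall i, measurable (A i)) ->
  P [set p | forall i, (i < N)%N -> A i (Z i p)] = (\prod_(i < N) zlaw sg i (A i))%:E.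

Lemma zlawT i : zlaw sg i setT = 1.
Proof. by apply: EFin_inj; rewrite zlawE//; exact: probability_setT. Qed.

(** A finite index set is embedded in an initial segment, with the full line imposed at the other
    indices. *)
Lemma joint_zlaw (J : {fset nat}) (A : nat -> set R) : (forall j, measurable (A j)) ->
  P (\bigcap_(j in [set` J]) (Z j @^-1` A j)) = (\prod_(j <- J) zlaw sg j (A j))%:E.
Proof.
move=> mA; pose N := (\max_(j <- J) j).+1.
have JN j : j \in J -> (j < N)%N by move=> jJ; rewrite ltnS; exact: (@leq_bigmax_seq _ _ xpredT id).
pose A' j := if j \in J then A j else setT.
have mA' j : measurable (A' j) by rewrite /A'; case: ifP.
transitivity (P [set p | forall i, (i < N)%N -> A' i (Z i p)]).
  congr (P _); apply/seteqP; split => p h i.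
    by move=> _; rewrite /A'; case: ifPn => // iJ; exact: h.
  by move=> /= iJ; have := h i (JN i iJ); rewrite /A' iJ.
rewrite Z_law//; congr (_%:E).
rewrite -(big_mkord xpredT (fun i => zlaw sg i (A' i))) (bigID (fun i => i \in J))/=.
rewrite [X in _ * X]big1 ?mulr1 => [|i /negbTE iJ]; last by rewrite /A' iJ zlawT.
rewrite -big_filter; under eq_big_seq => i do [rewrite mem_filter /A' => /andP[-> _]].
apply: perm_big; apply: uniq_perm; rewrite ?filter_uniq ?iota_uniq ?fset_uniq//.
by move=> i; rewrite mem_filter mem_index_iota /=; case: (boolP (i \in J)) => //= /JN ->.
Qed.

Lemma marginal_zlaw i A : measurable A -> distribution P (Z i) A = (zlaw sg i A)%:E.
Proof.
move=> mA; have := @joint_zlaw [fset i]%fset (fun=> A) (fun=> mA).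
rewrite big_seq_fset1 => <-; congr (P _).
by apply/seteqP; split => p /= => [h j /=|]; [rewrite inE => /eqP ->|apply; rewrite /= inE].
Qed.

Lemma zlaw_independent : independent P Z.
Proof.
move=> J A mA; rewrite joint_zlaw// -prodEFin.
by apply: eq_bigr => j _; apply: esym; exact: marginal_zlaw.
Qed.

Lemma zlaw_centred_gaussian k : centred_gaussian P (Z k).
Proof. by exists (sg k) => // A mA; rewrite marginal_zlaw// zlaw_gaussian. Qed.

Lemma zlaw_second_moment k : fine ('E_P[fun y => Z k y ^+ 2]) = sg k ^+ 2.
Proof.
rewrite unlock; apply: EFin_inj.
have mq : measurable_fun setT (fun x : measurableTypeR R => (x ^+ 2)%:E).
  by apply/measurable_EFinP; exact: measurable_funX.
have -> : (\int[P]_w (Z k w ^+ 2)%:E)%E = ((sg k ^+ 2)%:E)%E; last by [].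
have n0 (y : measurableTypeR R) : (0 <= (y ^+ 2)%:E)%E by rewrite lee_fin sqr_ge0.
transitivity (\int[distribution P (borel_valued (Z k))]_y (y ^+ 2)%:E)%E.
  exact: (esym (@ge0_integral_distribution _ _ _ (measurableTypeR R) _ P (borel_valued (Z k)) _ mq n0)).
transitivity (\int[distribution (normal_prob 0 1) (scale_by (sg k))]_y (y ^+ 2)%:E)%E.
  apply: eq_measure_integral => A mA _.
  by transitivity (zlaw sg k A)%:E; [exact: marginal_zlaw|exact: zlawE].
rewrite (@ge0_integral_distribution _ _ _ _ _ _ (scale_by (sg k)) _ mq n0) /comp.
under eq_integral do rewrite /scale_by exprMn EFinM.
rewrite ge0_integralZl ?lee_fin ?sqr_ge0//; by rewrite normal_second_moment mule1.
Qed.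

End gaussian_laws.

Lemma Rint_bounds {R : realType} {d} {S : measurableType d} (mu : probability S R) (F : S -> R) (b : R) :
  measurable_fun setT F -> (forall x, 0 <= F x <= b) -> 0 <= \int[mu]_x F x <= b.
Proof.
move=> mF Fb; have F0 x : 0 <= F x by have /andP[] := Fb x.
have Fle x : F x <= b by have /andP[] := Fb x.
apply/andP; split; first exact: Rintegral_ge0.
have b0 : 0 <= b := le_trans (F0 point) (Fle point).
rewrite -[leRHS](Rint_cst mu); apply: (@le_Rint _ _ _ mu _ _ b) => // x; first by rewrite ger0_norm.
by rewrite ger0_norm.
Qed.

Definition mfun_of {d1 d2} {T1 : measurableType d1} {T2 : measurableType d2} (g : T1 -> T2)
  of measurable_fun setT g : T1 -> T2 := g.

HB.instance Definition _ d1 d2 (T1 : measurableType d1) (T2 : measurableType d2) (g : T1 -> T2)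
    (mg : measurable_fun setT g) :=
  @isMeasurableFun.Build _ _ _ _ (mfun_of mg) mg.

Unset Implicit Arguments.

Theorem theorem2 (R : realType) (X : completeMetricType R)
  (hsep : separable_space X)
  (W : finType) (T : W -> X -> X)
  (hcont : forall i, continuous (T i))
  (hsurj : forall i y, exists x, T i x = y)
  (a lam : R) (hexp : finitely_ruelle_expanding a lam T)
  (hmix : jointly_mixing T)
  (hap : finitely_aperiodic a T)
  (alpha : R) (halpha : 0 < alpha <= 1)
  (phi : W -> X -> R)
  (hphi : forall i, holder alpha (phi i) /\ summable_potential T phi i)
  (omega : nat -> W)
  (mu : probability (borel X) R)
  (hmu : is_limit_measure alpha T phi omega mu)
  (f : X -> R) (hf : holder_space alpha f)
  (hs : (\sum_(1 <= n <oo) ((std_dev T omega mu f n ^+ 4)%:E)^-1 < +oo)%E) :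
  let s := std_dev T omega mu f in
  exists (d : measure_display) (Y : measurableType d) (P : probability Y R)
    (proj : {RV P >-> borel X}) (Z : nat -> {RV P >-> R}),
    (forall A : set (borel X), measurable A -> distribution P proj A = mu A) /\
    independent P Z /\
    (forall k, centred_gaussian P (Z k)) /\
    (exists C : R, forall n, (1 <= n)%N ->
      `| Num.sqrt (\sum_(k < n) fine ('E_P[fun y => Z k y ^+ 2])) - s n | <= C) /\
    {ae P, forall y,
      (fun n : nat => \big[Num.max/0]_(k < n)
         `| centred_sum T omega mu f k.+1 (proj y) - \sum_(i < k.+1) Z i y |)
      =o_\oo (fun n : nat => Num.sqrt (s n ^+ 2 * ln (ln (s n ^+ 2))))}.

Proof.
move=> s; have /andP[al0 _] := halpha.
have [Hp Hp0 phiH] := uniform_holder al0 (fun i => (hphi i).1).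
have [Dm _ hDm] := bounded_space hexp hsurj (omega 0%N) hap.
have [Bp phiB] := uniform_bound al0 Hp0 hDm phiH.
have [finfib [Mf cardfib]] := finite_fibres phiB (fun i => (hphi i).2).
have [Lam [N [theta [Lam0 N0 theta01 step_reg iter_reg]]]] :=
  contraction hexp hsurj hmix hap omega al0 phiB phiH finfib cardfib Hp0.
have hf' := space_hold halpha hf.
pose c := expanding_chain hcont hexp hsurj hap halpha phiH finfib Hp0 hmu.
have [D D1 [cD dD _]] :=
  uniform_bounds hcont hexp hsurj hap halpha phiH finfib Hp0 hmu Lam0 N0 theta01 step_reg iter_reg hf'.
have [C C0 conc] :=
  mvar_concentration hcont hexp hsurj hap halpha phiH finfib Hp0 hmu Lam0 N0 theta01 step_reg iter_reg hf'.
have [n0 [K [An0 AK]]] :=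
  variance_growth hcont hexp hsurj hap halpha phiH finfib Hp0 hmu Lam0 N0 theta01 step_reg iter_reg hf' hs.
have [Cs Cs0 closeS] :=
  std_dev_close hcont hexp hsurj hap halpha phiH finfib Hp0 hmu Lam0 N0 theta01 step_reg iter_reg hf'.
have D0 : 0 < D by lra.
have Xs m x : iter_step (chain_step c) 0 m x = Tword T (subword omega 0 m) x := iter_stepE T omega m x.
pose dd := mdiff T phi omega mu f.
have dd_hold n := mdiff_hold hexp hsurj hap halpha mu Lam0 N0 theta01 step_reg iter_reg hf' n.
have dd_meas n : measurable_fun setT (dd n : borel X -> R).
  exact: (hold_measurable hexp omega halpha (dd_hold n)).
have dd_back n x : back c n (dd n) x = 0 := mdiff_back hsurj phi omega finfib mu f n x.
pose s2 := sigma2 T phi omega mu f.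
have s2b n : 0 <= s2 n <= D ^+ 2.
  have mX : measurable_fun setT (fun x : borel X => dd n (Tword T (subword omega 0 n) x)).
    have -> : (fun x : borel X => dd n (Tword T (subword omega 0 n) x)) = dd n \o iter_step (chain_step c) 0 n.
      by apply/funext => x; rewrite /= -Xs.
    exact: (measurableT_comp (dd_meas n) (iter_step_meas c 0 n)).
  rewrite /s2 /sigma2.
  have h := @Rint_bounds _ _ (borel X) mu (fun x => dd n (Tword T (subword omega 0 n) x) ^+ 2) (D ^+ 2)
    (measurable_funX 2 mX).
  apply: h => x.
  by rewrite sqr_ge0 -real_normK ?num_real// lerXn2r ?nnegrE// ltW.
have conc' n l (t : R) : 0 < t -> (mu [set x | (t <= `|\sum_(i < l) (cvar c dd (n + i)
    (iter_step (chain_step c) 0 (n + i).+1 x) - s2 (n + i)%N)|)%R] <= (C * l%:R / t ^+ 2)%:E)%E.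
  move=> t0; apply: le_trans (conc n l t t0); rewrite le_eqVlt; apply/orP; left; apply/eqP.
  congr (mu _); apply/seteqP.
  have e x : \sum_(i < l) (cvar c dd (n + i) (iter_step (chain_step c) 0 (n + i).+1 x) - s2 (n + i)%N) =
    \sum_(i < l) (mvar T phi omega mu f (n + i) (Tword T (subword omega 0 (n + i).+1) x) -
      sigma2 T phi omega mu f (n + i)).
    apply: eq_bigr => i _; congr (_ - _).
    exact: (congr1 (cvar c dd (n + i)) (Xs (n + i).+1 x)).
  by split => x; rewrite /mkset e.
have [Z [Z_meas Z_law Z_ae]] :=
  @gaussian_coupling R _ (borel X) mu c dd D D0 dD dd_meas dd_back s2 C n0 K s2b C0 conc' An0 AK.
pose P : probability _ R := (mu \x @fair R)%E.
pose ZR i : {RV P >-> R} := mfun_of (Z_meas i).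
pose sg i := Num.sqrt (s2 i).
have ZR_law M (A : nat -> set R) : (forall i, measurable (A i)) ->
    P [set p | forall i, (i < M)%N -> A i (ZR i p)] = (\prod_(i < M) zlaw sg i (A i))%:E.
  exact: Z_law.
have sg0 i : 0 <= Num.sqrt (s2 i) by exact: sqrtr_ge0.
(* The enlarged space is the product of [X] with the coin space, and the original point is its first
   coordinate. *)
exists _, _, P, (mfun_of measurable_fst), ZR; split; [|split; [|split; [|split]]].
- move=> A mA; exact: (law_fst mu mA).
- exact: (zlaw_independent ZR_law).
- exact: (zlaw_centred_gaussian sg0 ZR_law).
- exists Cs => n _.
  (* The Gaussians have exactly the variances of the martingale differences, so only the bounded
     effect of the corrector separates the two standard deviations. *)
  have -> : \sum_(k < n) fine ('E_P[fun y => ZR k y ^+ 2]) = \sum_(k < n) s2 k; last exact: closeS.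
  apply: eq_bigr => k _; rewrite (zlaw_second_moment ZR_law k).
  by rewrite sqr_sqrtr//; have /andP[] := s2b k.
- apply: filterS Z_ae => p hp.
  have A_step n : \sum_(i < n) s2 i <= \sum_(i < n.+1) s2 i.
    by rewrite big_ord_recr/= lerDl; have /andP[] := s2b n.
  apply: (@running_max_littleo R (fun n => \sum_(i < n) s2 i) s
    (fun n => centred_sum T omega mu f n p.1 - \sum_(i < n) ZR i p) Cs D).
  + by apply: homo_leq => // x y z; exact: le_trans.
  + exact: (A_unbounded A_step An0 AK).
  + exact: closeS.
  + move=> eta eta0; near=> n.
    have h : `|partial_sum c dd n p.1 - \sum_(i < n) Z i p| <=
      eta * Num.sqrt ((\sum_(i < n) s2 i) * ln (ln (\sum_(i < n) s2 i))).
      by near: n; exact: hp.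
    (* The corrector is bounded by [D] and becomes the additive constant in the bound for the
       running maximum. *)
    have -> : centred_sum T omega mu f n p.1 - \sum_(i < n) ZR i p =
        (partial_sum c dd n p.1 - \sum_(i < n) Z i p) +
        corrector T phi omega mu f n (Tword T (subword omega 0 n) p.1).
      rewrite (centred_sumE T phi) addrAC; congr (_ - _ + _).
      by apply: eq_bigr => i _; rewrite -Xs.
    by apply: le_trans (ler_normD _ _) _; apply: lerD.
Unshelve. all: by end_near.
Qed.
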